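(* Let $\gamma\in\mathbb{N}_0$ and let $\Theta,\theta\in\mathbb{R}$. Then the mapping $$\mathcal{M}\colon P^\gamma_{2,\Theta,\theta}(\widetilde{\mathcal{D}})\to Y^\gamma_{2,\Theta,\theta}(\mathcal{I}),\qquad u\mapsto\mathcal{M}u,$$ with $$(\mathcal{M}u)(\lambda,\phi):=\mathcal{M}_{\theta/2}\big(r\mapsto u(r,\phi)\big)(\lambda),\qquad(\lambda,\phi)\in\Gamma_{-\theta/2}\times\mathcal{I},$$ defines an invertible, bounded, linear operator with bounded inverse $\mathcal{M}^{-1}$. In particular, $$\|\mathcal{M}u\mid Y^\gamma_{2,\Theta,\theta}(\mathcal{I})\|\sim\|u\mid P^\gamma_{2,\Theta,\theta}(\widetilde{\mathcal{D}})\|,\qquad u\in P^\gamma_{2,\Theta,\theta}(\widetilde{\mathcal{D}})$$ (two-sided estimates with finite positive constants independent of $u$).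
   Context: Fix $0<\kappa<2\pi$; $\mathcal{I}:=(0,\kappa)$, $\widetilde{\mathcal{D}}:=(0,\infty)\times\mathcal{I}$, $\mathbb{R}_+:=(0,\infty)$, $\mathbb{N}_0=\{0,1,2,\dots\}$. Derivatives $D_r$, $D_\phi$ are distributional. Weighted spaces on $\mathcal{I}$: with $\rho_{\mathcal{I}}(\phi)=\operatorname{dist}(\phi,\partial\mathcal{I})=\min\{\phi,\kappa-\phi\}$, for $k\in\mathbb{N}_0$ and $\Theta\in\mathbb{R}$ the space $H^k_{2,\Theta}(\mathcal{I})$ consists of all distributions $v$ on $\mathcal{I}$ whose derivatives up to order $k$ are functions with $\|v\mid H^k_{2,\Theta}(\mathcal{I})\|:=\big(\sum_{\alpha=0}^k\int_{\mathcal{I}}|\rho_{\mathcal{I}}^{\alpha}D^\alpha v|^2\rho_{\mathcal{I}}^{\Theta-1}\,\mathrm{d}\phi\big)^{1/2}<\infty$ (norms are considered up to equivalence); $L_{2,\Theta}(\mathcal{I}):=H^0_{2,\Theta}(\mathcal{I})$. For $\gamma\in\mathbb{N}_0$, $\Theta,\theta\in\mathbb{R}$, $P^\gamma_{2,\Theta,\theta}(\widetilde{\mathcal{D}})$ is the set of $u\in L_{1,\mathrm{loc}}(\widetilde{\mathcal{D}})$ with $$\|u\mid P^\gamma_{2,\Theta,\theta}(\widetilde{\mathcal{D}})\|:=\Big(\int_0^\infty r^{\theta-1}\sum_{j=0}^\gamma\big\|[(rD_r)^ju](r,\cdot)\mid H^{\gamma-j}_{2,\Theta-1+2j}(\mathcal{I})\big\|^2\,\mathrm{d}r\Big)^{1/2}<\infty.$$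 For $c\in\mathbb{R}$ let $\Gamma_c:=\{z\in\mathbb{C}:\operatorname{Re}z=c\}$. $Y^0_{2,\Theta,\theta}(\mathcal{I})$ is the space of all (a.e. equivalence classes of) functions $u\colon\Gamma_{-\theta/2}\times\mathcal{I}\to\mathbb{C}$ such that $(t,\phi)\mapsto u(-\theta/2+it,\phi)$ is Borel measurable and $$\|u\mid Y^0_{2,\Theta,\theta}(\mathcal{I})\|:=\Big(\frac{1}{2\pi i}\int_{-\theta/2-i\infty}^{-\theta/2+i\infty}\|u(\lambda,\cdot)\mid L_{2,\Theta-1}(\mathcal{I})\|^2\,\mathrm{d}\lambda\Big)^{1/2}<\infty.$$ For $\gamma\in\mathbb{N}$, $Y^\gamma_{2,\Theta,\theta}(\mathcal{I})$ is the set of $u$ with $\lambda^jD_\phi^\alpha u\in Y^0_{2,\Theta+2j+2\alpha,\theta}(\mathcal{I})$ for all $j\in\{0,\dots,\gamma\}$, $\alpha\in\{0,\dots,\gamma-j\}$, with norm $$\|u\mid Y^\gamma_{2,\Theta,\theta}(\mathcal{I})\|:=\Big(\frac{1}{2\pi i}\sum_{j=0}^\gamma\int_{-\theta/2-i\infty}^{-\theta/2+i\infty}|\lambda|^{2j}\|u(\lambda,\cdot)\mid H^{\gamma-j}_{2,\Theta-1+2j}(\mathcal{I})\|^2\,\mathrm{d}\lambda\Big)^{1/2}.$$ Mellin transform: for $v\in C_0^\infty(\mathbb{R}_+)$, $(\mathcal{M}v)(\lambda):=\int_0^\infty r^{-\lambda-1}v(r)\,\mathrm{d}r$, $\lambda\in\mathbb{C}$.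 For $\beta\in\mathbb{R}$, $v\mapsto(\mathcal{M}v)|_{\Gamma_{-\beta}}$ extends uniquely to an invertible linear isometry $\mathcal{M}_\beta$ from $L_2(\mathbb{R}_+,r^{2\beta-1}\mathrm{d}r)$ onto the space $Y^2_{-\beta}$ of functions $w\colon\Gamma_{-\beta}\to\mathbb{C}$ with $\|w\mid Y^2_{-\beta}\|:=\big(\frac{1}{2\pi i}\int_{-\beta-i\infty}^{-\beta+i\infty}|w(\lambda)|^2\mathrm{d}\lambda\big)^{1/2}<\infty$. *)

(* Defs.v *)
From HB Require Import structures.
From mathcomp Require Import all_boot all_order all_algebra.
From mathcomp Require Import complex.
From mathcomp Require Import all_classical all_reals all_analysis.

Set Implicit Arguments.
Unset Strict Implicit.
Unset Printing Implicit Defensive.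

Import Order.TTheory GRing.Theory Num.Theory.
Import numFieldNormedType.Exports.

Local Open Scope classical_set_scope.
Local Open Scope ring_scope.
Local Open Scope complex_scope.

Definition cmeasurable d (T : measurableType d) (R : realType) (A : set T)
    (f : T -> R[i]) : Prop :=
  measurable_fun A (fun x => complex.Re (f x)) /\
  measurable_fun A (fun x => complex.Im (f x)).

Definition cintegral d (T : measurableType d) (R : realType)
    (mu : {measure set T -> \bar R}) (A : set T) (f : T -> R[i]) : R[i] :=
  Complex (Rintegral mu A (fun x => complex.Re (f x)))
          (Rintegral mu A (fun x => complex.Im (f x))).

Definition cexp (R : realType) (z : R[i]) : R[i] :=
  Complex (expR (complex.Re z) * cos (complex.Im z))
          (expR (complex.Re z) * sin (complex.Im z)).

(* r ^ z for r > 0 *)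
Definition cpow (R : realType) (r : R) (z : R[i]) : R[i] :=
  cexp (z * (ln r)%:C).

Section Domains.
Context {R : realType}.
Local Notation C := R[i].
Implicit Types (kappa Theta theta beta : R).

Definition mu1 : {measure set (measurableTypeR R) -> \bar R} :=
  @lebesgue_measure R.

Definition mu2 : {measure set (measurableTypeR R * measurableTypeR R) -> \bar R} :=
  (@lebesgue_measure R \x @lebesgue_measure R)%E.

Definition Rpos : set R := `]0, +oo[.

Definition angles (kappa : R) : set R := `]0, kappa[.

Definition wedge (kappa : R) : set (R * R) := Rpos `*` angles kappa.

(* distance to the boundary {0, kappa} of the interval *)
Definition rho (kappa phi : R) : R := Num.min phi (kappa - phi).

Definition L1loc1 (Omega : set R) (f : R -> C) : Prop :=
  cmeasurable (Omega : set (measurableTypeR R)) f /\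
  forall K : set R, compact K -> K `<=` Omega ->
    (\int[mu1]_(x in K) (Normc.normc (f x))%:E < +oo)%E.

Definition L1loc2 (Omega : set (R * R)) (f : R * R -> C) : Prop :=
  cmeasurable (Omega : set (measurableTypeR R * measurableTypeR R)) f /\
  forall K : set (R * R), compact K -> K `<=` Omega ->
    (\int[mu2]_(x in K) (Normc.normc (f x))%:E < +oo)%E.

(* C^infinity: every iterated directional derivative is everywhere
   differentiable *)
Definition smooth (V : normedModType R) (f : V -> R) : Prop :=
  forall (s : seq V) (x : V),
    differentiable (foldr (fun v g => 'D_v g) f s) x.

Definition compact_support_in (V : normedModType R) (S : nmodType)
    (Omega : set V) (f : V -> S) : Prop :=
  exists K : set V, [/\ compact K, K `<=` Omega & forall x, ~ K x -> f x = 0].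

(* Real test functions are enough to determine (complex) distributions. *)
Definition test_function (V : normedModType R) (Omega : set V) (f : V -> R) :
    Prop :=
  smooth f /\ compact_support_in Omega f.

Definition Cc_infty_Rpos (v : R -> C) : Prop :=
  [/\ smooth (fun x : R => complex.Re (v x)),
      smooth (fun x : R => complex.Im (v x)) &
      compact_support_in (Rpos : set R) v].

(* w = D^n v on the interval, v and w being regular distributions *)
Definition is_wderiv kappa (n : nat) (v w : R -> C) : Prop :=
  [/\ L1loc1 (angles kappa) v, L1loc1 (angles kappa) w &
    forall eta : R -> R, test_function (angles kappa : set R) eta ->
      cintegral mu1 (angles kappa) (fun x => w x * (eta x)%:C) =
      (-1) ^+ n * cintegral mu1 (angles kappa) (fun x => v x * (derive1n n eta x)%:C)].

(* A representative of D^n v, meaningful when some w satisfies is_wderiv. *)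
Definition wderiv kappa (n : nat) (v : R -> C) : R -> C :=
  xget (fun=> 0) [set w | is_wderiv kappa n v w].

(* eta |-> D_r (r eta), minus the formal adjoint of r D_r *)
Definition Dr_r (eta : R * R -> R) : R * R -> R :=
  'D_((1, 0) : R * R) (fun p : R * R => p.1 * eta p).

(* w = (r D_r)^j u on the wedge, u and w being regular distributions *)
Definition is_rDr kappa (j : nat) (u w : R * R -> C) : Prop :=
  [/\ L1loc2 (wedge kappa) u, L1loc2 (wedge kappa) w &
    forall eta : R * R -> R, test_function (wedge kappa) eta ->
      cintegral mu2 (wedge kappa) (fun p => w p * (eta p)%:C) =
      (-1) ^+ j *
      cintegral mu2 (wedge kappa) (fun p => u p * (iter j Dr_r eta p)%:C)].

(* A representative of (r D_r)^j u, meaningful when some w satisfies is_rDr. *)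
Definition rDr kappa (j : nat) (u : R * R -> C) : R * R -> C :=
  xget (fun=> 0) [set w | is_rDr kappa j u w].

(* +oo when some distributional derivative up to order k is not a function *)
Definition Hnorm kappa (k : nat) Theta (v : R -> C) : \bar R :=
  if `[< forall a, (a <= k)%N -> exists w, is_wderiv kappa a v w >] then
    ((\sum_(a < k.+1) \int[mu1]_(phi in angles kappa)
       ((rho kappa phi ^+ a * Normc.normc (wderiv kappa a v phi)) ^+ 2 *
        rho kappa phi `^ (Theta - 1))%:E) `^ 2^-1)%E
  else +oo%E.

(* +oo when some (r D_r)^j u, j <= gamma, is not a function *)
Definition Pnorm kappa (gamma : nat) Theta theta (u : R * R -> C) : \bar R :=
  if `[< forall j, (j <= gamma)%N -> exists w, is_rDr kappa j u w >] then
    ((\int[mu1]_(r in Rpos)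
       ((r `^ (theta - 1))%:E *
        \sum_(j < gamma.+1)
          Hnorm kappa (gamma - j) (Theta - 1 + j.*2%:R)
            (fun phi => rDr kappa j u (r, phi)) ^+ 2)) `^ 2^-1)%E
  else +oo%E.

Definition Pspace kappa (gamma : nat) Theta theta : set (R * R -> C) :=
  [set u | L1loc2 (wedge kappa) u /\
           (Pnorm kappa gamma Theta theta u < +oo)%E].

Definition Peq kappa (u v : R * R -> C) : Prop :=
  {ae mu2, forall p, wedge kappa p -> u p = v p}.

(* Parametrization of the line Re z = c. Functions on this line are represented
   by functions on C, of which only the values on the line matter; the integral
   (1 / (2 pi i)) \int_{c - i oo}^{c + i oo} f(lambda) dlambda is
   (1 / (2 pi)) \int_R f(c + i t) dt. *)
Definition vline (c t : R) : C := Complex c t.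

Definition Y0norm kappa Theta theta (U : C * R -> C) : \bar R :=
  (((2 * pi)^-1%:E * \int[mu1]_t
     Hnorm kappa 0 (Theta - 1)
       (fun phi => U (vline (- (theta / 2)) t, phi)) ^+ 2) `^ 2^-1)%E.

Definition Y0space kappa Theta theta : set (C * R -> C) :=
  [set U |
    cmeasurable
      (setT `*` angles kappa : set (measurableTypeR R * measurableTypeR R))
      (fun p => U (vline (- (theta / 2)) p.1, p.2)) /\
    (Y0norm kappa Theta theta U < +oo)%E].

(* W = D_phi^a U *)
Definition is_Dphi kappa theta (a : nat) (U W : C * R -> C) : Prop :=
  {ae mu1, forall t,
    is_wderiv kappa a (fun phi => U (vline (- (theta / 2)) t, phi))
                      (fun phi => W (vline (- (theta / 2)) t, phi))}.

Definition Yspace kappa (gamma : nat) Theta theta : set (C * R -> C) :=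
  [set U |
    cmeasurable
      (setT `*` angles kappa : set (measurableTypeR R * measurableTypeR R))
      (fun p => U (vline (- (theta / 2)) p.1, p.2)) /\
    forall j a, (j <= gamma)%N -> (a <= gamma - j)%N ->
      exists2 W, is_Dphi kappa theta a U W &
        Y0space kappa (Theta + j.*2%:R + a.*2%:R) theta
          (fun p => p.1 ^+ j * W p)].

Definition Ynorm kappa (gamma : nat) Theta theta (U : C * R -> C) : \bar R :=
  (((2 * pi)^-1%:E * \sum_(j < gamma.+1) \int[mu1]_t
     ((Normc.normc (vline (- (theta / 2)) t) ^+ j.*2)%:E *
      Hnorm kappa (gamma - j) (Theta - 1 + j.*2%:R)
        (fun phi => U (vline (- (theta / 2)) t, phi)) ^+ 2)) `^ 2^-1)%E.

Definition Yeq kappa theta (U V : C * R -> C) : Prop :=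
  {ae mu2, forall p : R * R, angles kappa p.2 ->
    U (vline (- (theta / 2)) p.1, p.2) = V (vline (- (theta / 2)) p.1, p.2)}.

(* for v in C_c^infty(0, oo) *)
Definition mellin (v : R -> C) (lambda : C) : C :=
  cintegral mu1 Rpos (fun r => cpow r (- lambda - 1) * v r).

(* L_2(R_+, r^(2 beta - 1) dr) *)
Definition L2norm beta (v : R -> C) : \bar R :=
  ((\int[mu1]_(r in Rpos)
     (Normc.normc (v r) ^+ 2 * r `^ (2 * beta - 1))%:E) `^ 2^-1)%E.

Definition L2space beta : set (R -> C) :=
  [set v | cmeasurable (Rpos : set (measurableTypeR R)) v /\
           (L2norm beta v < +oo)%E].

(* Y^2_{-beta} *)
Definition Y2norm beta (w : C -> C) : \bar R :=
  (((2 * pi)^-1%:E *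
    \int[mu1]_t (Normc.normc (w (vline (- beta) t)) ^+ 2)%:E) `^ 2^-1)%E.

Definition Y2space beta : set (C -> C) :=
  [set w | cmeasurable (setT : set (measurableTypeR R))
             (fun t => w (vline (- beta) t)) /\
           (Y2norm beta w < +oo)%E].

(* w = M_beta v (almost everywhere on the line), where M_beta is the continuous
   extension of the Mellin transform from C_c^infty(0, oo) to
   L_2(R_+, r^(2 beta - 1) dr): w is the limit in Y^2_{-beta} of the transforms
   of smooth approximations of v. *)
Definition is_mellin_ext beta (v : R -> C) (w : C -> C) : Prop :=
  [/\ L2space beta v, Y2space beta w &
    exists f : nat -> R -> C,
      [/\ forall n, Cc_infty_Rpos (f n),
          (fun n => L2norm beta (fun r => f n r - v r)) @ \oo --> 0%E &
          (fun n => Y2norm beta (fun z => mellin (f n) z - w z)) @ \oo --> 0%E]].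

(* (M u)(lambda, phi) = M_{theta/2}(r |-> u(r, phi))(lambda) *)
Definition is_fiberwise_mellin kappa theta (u : R * R -> C) (U : C * R -> C) :
    Prop :=
  {ae mu1, forall phi, angles kappa phi ->
    is_mellin_ext (theta / 2) (fun r => u (r, phi))
                              (fun lambda => U (lambda, phi))}.

End Domains.

(* A normed space of equivalence classes, described on representatives: the
   admissible functions, the equivalence relation and the norm. *)
Record fspace (R : realType) (T : Type) := FSpace {
  fmem : set (T -> R[i]);
  feq : (T -> R[i]) -> (T -> R[i]) -> Prop;
  fnorm : (T -> R[i]) -> \bar R }.

Definition Pgamma (R : realType) (kappa : R) (gamma : nat) (Theta theta : R) :
    fspace R (R * R) :=
  FSpace (Pspace kappa gamma Theta theta) (Peq kappa)
         (Pnorm kappa gamma Theta theta).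

Definition Ygamma (R : realType) (kappa : R) (gamma : nat) (Theta theta : R) :
    fspace R (R[i] * R) :=
  FSpace (Yspace kappa gamma Theta theta) (Yeq kappa theta)
         (Ynorm kappa gamma Theta theta).

Definition bounded_linear_operator (R : realType) (S T : Type)
    (X : fspace R S) (Z : fspace R T)
    (F : (S -> R[i]) -> (T -> R[i])) : Prop :=
  [/\ forall u, fmem X u -> fmem Z (F u),
      forall u v, fmem X u -> fmem X v -> feq X u v -> feq Z (F u) (F v),
      forall (a : R[i]) u v, fmem X u -> fmem X v ->
        fmem X (fun x => a * u x + v x) /\
        feq Z (F (fun x => a * u x + v x)) (fun y => a * F u y + F v y) &
      exists2 c : R, 0 < c &
        forall u, fmem X u -> (fnorm Z (F u) <= c%:E * fnorm X u)%E].

Definition is_left_inverse (R : realType) (S T : Type) (X : fspace R S)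
    (F : (S -> R[i]) -> (T -> R[i])) (G : (T -> R[i]) -> (S -> R[i])) : Prop :=
  forall u, fmem X u -> feq X (G (F u)) u.

(* Main.v *)
From HB Require Import structures.
From mathcomp Require Import all_boot all_order all_algebra.
From mathcomp Require Import complex.
From mathcomp Require Import all_classical all_reals all_analysis.
From mathcomp Require Import measurable_realfun.
From mathcomp Require Import ring lra.
Require Import Defs.

Set Implicit Arguments.
Unset Strict Implicit.
Unset Printing Implicit Defensive.

Import Order.TTheory GRing.Theory Num.Theory.
Import numFieldNormedType.Exports.
Import HBNNSimple.

Local Open Scope classical_set_scope.
Local Open Scope ring_scope.

(** The Mellin transform in the radius is unitary between weighted spaces, and
    it commutes with everything that acts on the angle. The theorem is true,
    with constants equal to one, because both norms are sums of the same
    quantities.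

    Multiplying by square roots of the weights turns all spaces into subspaces
    of an unweighted space of pairs of real functions, the real and imaginary
    parts. In one variable the substitution [r = expR x] reduces the transform
    to the Fourier transform. Plancherel's identity is obtained by damping and
    the Poisson kernel ([fcos_fsin_plancherel]), and a system of smooth
    functions which is orthonormal and total on the half-line is carried to one
    on the line ([mb_total], [mbh_total]). This defines the extended transform
    as a relation [MP] between square integrable functions, which is a
    bijection, preserves norms ([MP_norm]), and agrees with the extension by
    continuity ([mellin_extension]).

    Derivatives in the angle. For each weight and each order [a], one countable
    system of test functions computes the norm of the weak derivative of order
    [a] as a sum of squares of coefficients of the function itself
    ([test_system], [energy_wderiv]); the sum is infinite exactly when the
    derivative is missing. For functions of two variables these coefficients
    are functions of the other variable, the transform acts on each of them
    ([REL_cpart]), and so the sums are the same on both sides ([tenergy_REL]).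

    Derivatives in the radius. The operator [r D_r] becomes multiplication by
    [lambda = - beta + 'i t]. One implication follows from integration by parts
    on smooth functions ([euler_weak]); the other inverts [lambda] up to a
    bounded perturbation and uses that the homogeneous equation has no square
    integrable solution ([euler_strong]). In two variables the first one is
    applied ray by ray to arbitrary test functions ([euler_cols]), the second
    one after pairing with test functions of the angle ([euler_rows]).

    Consequently every function of the first space has a transform in the
    second one with the same norm ([P_to_Y]) and conversely ([Y_to_P]). Since
    the relation preserves norms, it is single valued up to null sets in both
    directions ([Rel_P_unique], [Rel_Y_unique]), which yields linearity and the
    inverse. *)

(** * Real Hilbert spaces of functions *)

Section Hilbert.
Context {R : realType} {V : lmodType R}.

(** The members of the space form a predicate on a larger module, so that spaces of
    functions need no quotients: [ip u u = 0] does not imply [u = 0].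
    Completeness is required for rapidly converging sequences only, from which
    general ones are reached through subsequences. *)
Record hilbert (S : V -> Prop) (ip : V -> V -> R) : Prop := Hilbert {
  hS0 : S 0;
  hSD : forall u v, S u -> S v -> S (u + v);
  hSZ : forall a u, S u -> S (a *: u);
  hipC : forall u v, ip u v = ip v u;
  hipD : forall u v w, S u -> S v -> S w -> ip (u + v) w = ip u w + ip v w;
  hipZ : forall a u w, S u -> S w -> ip (a *: u) w = a * ip u w;
  hge0 : forall u, 0 <= ip u u;
  hcomplete : forall f : nat -> V, (forall n, S (f n)) ->
    (forall n, ip (f n.+1 - f n) (f n.+1 - f n) <= (4^-1) ^+ n) ->
    exists2 g, S g & forall e, 0 < e ->
      exists N, forall n, (N <= n)%N -> ip (f n - g) (f n - g) < e }.

Variables (S : V -> Prop) (ip : V -> V -> R).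
Hypothesis H : hilbert S ip.
Implicit Types (u v w f g : V) (a b : R) (n m : nat) (e : nat -> V).

Notation N u := (ip u u).
Notation nlim f g := (forall e : R, 0 < e -> exists N0, forall n, (N0 <= n)%N ->
  ip (f n - g) (f n - g) < e).

Lemma hSN u : S u -> S (- u).
Proof. by move=> Su; rewrite -scaleN1r; exact: (hSZ H). Qed.

Lemma hSB u v : S u -> S v -> S (u - v).
Proof. by move=> Su Sv; apply: (hSD H) => //; exact: hSN. Qed.

Lemma hSsum n (F : nat -> V) : (forall i, S (F i)) -> S (\sum_(i < n) F i).
Proof.
move=> SF; elim: n => [|n IH]; first by rewrite big_ord0; exact: (hS0 H).
by rewrite big_ord_recr /=; exact: (hSD H).
Qed.

Lemma hScomb n (c : nat -> R) (F : nat -> V) : (forall i, S (F i)) ->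
  S (\sum_(i < n) c i *: F i).
Proof. by move=> SF; apply: (hSsum n (F := fun i => c i *: F i)) => i; exact: (hSZ H). Qed.

Lemma hipDr u v w : S u -> S v -> S w -> ip w (u + v) = ip w u + ip w v.
Proof. by move=> *; rewrite (hipC H) (hipD H) // !(hipC H w). Qed.

Lemma hipZr a u w : S u -> S w -> ip w (a *: u) = a * ip w u.
Proof. by move=> *; rewrite (hipC H) (hipZ H) // (hipC H w). Qed.

Lemma hip0 u : S u -> ip 0 u = 0.
Proof. by move=> Su; rewrite -(scale0r u) (hipZ H) // mul0r. Qed.

Lemma hipN u v : S u -> S v -> ip (- u) v = - ip u v.
Proof. by move=> Su Sv; rewrite -scaleN1r (hipZ H) // mulN1r. Qed.

Lemma hipB u v w : S u -> S v -> S w -> ip (u - v) w = ip u w - ip v w.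
Proof. by move=> Su Sv Sw; rewrite (hipD H) ?hipN //; exact: hSN. Qed.

Lemma hipBr u v w : S u -> S v -> S w -> ip w (u - v) = ip w u - ip w v.
Proof. by move=> *; rewrite (hipC H) hipB // !(hipC H w). Qed.

Lemma hip_sum n (F : nat -> V) w : (forall i, S (F i)) -> S w ->
  ip (\sum_(i < n) F i) w = \sum_(i < n) ip (F i) w.
Proof.
move=> SF Sw; elim: n => [|n IH]; first by rewrite !big_ord0 hip0.
by rewrite !big_ord_recr /= (hipD H) ?IH //; exact: hSsum.
Qed.

Lemma hip_comb n (c : nat -> R) (F : nat -> V) w : (forall i, S (F i)) -> S w ->
  ip (\sum_(i < n) c i *: F i) w = \sum_(i < n) c i * ip (F i) w.
Proof.
move=> SF Sw; rewrite (hip_sum n (F := fun i => c i *: F i)) //.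
  by apply: eq_bigr => i _; rewrite (hipZ H).
by move=> i; exact: (hSZ H).
Qed.

Lemma hnB u v : S u -> S v -> N (u - v) = N u - 2 * ip u v + N v.
Proof.
move=> Su Sv; have SB := hSB Su Sv.
rewrite hipB // !hipBr // (hipC H v u); ring.
Qed.

Lemma hnD u v : S u -> S v -> N (u + v) = N u + 2 * ip u v + N v.
Proof.
move=> Su Sv; have SB := hSD H Su Sv.
rewrite (hipD H) // !hipDr // (hipC H v u); ring.
Qed.

Lemma hnD_le u v : S u -> S v -> N (u + v) <= 2 * N u + 2 * N v.
Proof.
move=> Su Sv; have := hge0 H (u - v); rewrite hnB // hnD //; lra.
Qed.

Lemma hn_swap u v : S u -> S v -> N (u - v) = N (v - u).
Proof. by move=> Su Sv; rewrite !hnB // (hipC H v u); ring. Qed.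

Lemma hn_triang u v w : S u -> S v -> S w ->
  N (u - w) <= 2 * N (u - v) + 2 * N (v - w).
Proof.
move=> Su Sv Sw; have -> : u - w = (u - v) + (v - w) by rewrite addrA subrK.
by apply: hnD_le; exact: hSB.
Qed.

Lemma hCS u v : S u -> S v -> ip u v ^+ 2 <= N u * N v.
Proof.
move=> Su Sv.
have Q t : 0 <= N u - 2 * t * ip u v + t ^+ 2 * N v.
  have := hge0 H (u - t *: v).
  rewrite hnB ?hipZr ?(hipZ H) //; try exact: (hSZ H).
  by move=> h; apply: le_trans h _; rewrite le_eqVlt; apply/orP; left; apply/eqP; ring.
have [Nv0|Nv0] := eqVneq (N v) 0.
  rewrite Nv0 mulr0.
  have [->|ne] := eqVneq (ip u v) 0; first by rewrite expr0n.
  have := Q ((N u + 1) / (2 * ip u v)); rewrite Nv0 mulr0 addr0.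
  have -> : 2 * ((N u + 1) / (2 * ip u v)) * ip u v = N u + 1 by field.
  lra.
have Nvp : 0 < N v by rewrite lt_def Nv0 (hge0 H).
have := Q (ip u v / N v) => h.
have : 0 <= (N u - 2 * (ip u v / N v) * ip u v + (ip u v / N v) ^+ 2 * N v) * N v.
  by rewrite mulr_ge0 // ltW.
have -> : (N u - 2 * (ip u v / N v) * ip u v + (ip u v / N v) ^+ 2 * N v) * N v
  = N u * N v - ip u v ^+ 2 by field.
by rewrite subr_ge0.
Qed.

Lemma hip_null u v : S u -> S v -> N u = 0 -> ip u v = 0.
Proof.
move=> Su Sv u0; have := hCS Su Sv; rewrite u0 mul0r => h.
by apply/eqP; rewrite -sqrf_eq0 eq_le h sqr_ge0.
Qed.

Lemma nlim_ip (f : nat -> V) g w : (forall n, S (f n)) -> S g -> S w ->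
  nlim f g -> forall e : R, 0 < e -> exists N0, forall n, (N0 <= n)%N ->
    (ip (f n) w - ip g w) ^+ 2 < e.
Proof.
move=> Sf Sg Sw fg e e0.
have Nw1 : 0 < N w + 1 by rewrite ltr_wpDl // (hge0 H).
have [N0 hN] := fg (e / (N w + 1)) (divr_gt0 e0 Nw1).
exists N0 => n /hN h; rewrite -hipB //.
have := hCS (hSB (Sf n) Sg) Sw => cs; apply: le_lt_trans cs _.
have : N (f n - g) * (N w + 1) < e by rewrite -ltr_pdivlMr.
by have := hge0 H (f n - g); have := hge0 H w; nra.
Qed.

(** The limit of a sequence whose pairing with [w] is constant has the same
    pairing. *)
Lemma nlim_ip_eq (f : nat -> V) g w c N1 : (forall n, S (f n)) -> S g -> S w ->
  nlim f g -> (forall n, (N1 <= n)%N -> ip (f n) w = c) -> ip g w = c.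
Proof.
move=> Sf Sg Sw fg fc; apply/eqP; rewrite eq_sym -subr_eq0 -sqrf_eq0.
apply: contraT => ne.
have e0 : 0 < (c - ip g w) ^+ 2 by rewrite lt_def ne sqr_ge0.
have [N0 /(_ _ (leq_maxl N0 N1))] := nlim_ip Sf Sg Sw fg e0.
by rewrite fc ?leq_maxr // ltxx.
Qed.

Section orthogonal_series.
Variable v : nat -> V.
Hypothesis Sv : forall n, S (v n).
Hypothesis ov : forall i j, i != j -> ip (v i) (v j) = 0.

Notation s n := (\sum_(i < n) v i).
Notation a n := (\sum_(i < n) N (v i)).

Let Ss n : S (s n). Proof. exact: hSsum. Qed.

Lemma orth_sum_ip n k : ip (s n) (v k) = if (k < n)%N then N (v k) else 0.
Proof.
rewrite hip_sum //; case: ifP => kn.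
  rewrite (bigD1 (Ordinal kn)) //= big1 ?addr0 // => i ik; apply: ov.
  by apply: contra ik => /eqP ik; apply/eqP/val_inj.
rewrite big1 // => i _; apply: ov; apply/eqP => ik.
by move: kn; rewrite -ik ltn_ord.
Qed.

Lemma orth_sum_norm n m : (n <= m)%N -> N (s m - s n) = a m - a n.
Proof.
move=> nm; rewrite hnB //.
have E k : ip (s k) (s m) = a (minn k m).
  rewrite hip_sum //; elim: k => [|k IH].
    by rewrite min0n !big_ord0.
  rewrite big_ord_recr /= IH (hipC H) orth_sum_ip.
  case: ltnP => km.
    by rewrite (minn_idPl km) big_ord_recr.
  by rewrite (minn_idPr (leqW km)) addr0.
have E2 : N (s n) = a n.
  rewrite hip_sum // (eq_bigr (fun i : 'I_n => N (v i))) // => i _.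
  by rewrite (hipC H) orth_sum_ip ltn_ord.
by rewrite E minnn (hipC H) E (minn_idPl nm) E2; ring.
Qed.

(** The squared norms of the partial sums of an orthogonal series increase and
    are bounded. A subsequence with summable increments converges by
    completeness, and monotonicity extends the convergence to all indices. *)
Lemma orth_series B : (forall n, a n <= B) ->
  exists2 g, S g & nlim (fun n => s n) g /\ (forall k, ip g (v k) = N (v k)).
Proof.
move=> aB.
have a_nd n m : (n <= m)%N -> a n <= a m.
  by move=> nm; rewrite -subr_ge0 -orth_sum_norm //; exact: (hge0 H).
pose A := sup [set a n | n in setT].
have hs : has_sup [set a n | n in setT].
  by split; [exists (a 0%N), 0%N | exists B => _ [n _ <-]; exact: aB].
have aA n : a n <= A by apply: ub_le_sup; [case: hs | exists n].
have M k : {m | A - (4^-1) ^+ k < a m}.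
  apply: cid.
  have [_ [n _ <-]] := sup_adherent (exprn_gt0 k (ltac:(by rewrite invr_gt0) : 0 < (4^-1 : R))) hs.
  by exists n.
pose NN k := \max_(i < k.+1) sval (M i).
have NNnd k : (NN k <= NN k.+1)%N by rewrite [X in (_ <= X)%N]/NN big_ord_recr /= leq_maxl.
have NNM k : A - a (NN k) <= (4^-1) ^+ k.
  have : (sval (M k) <= NN k)%N by rewrite /NN big_ord_recr /= leq_maxr.
  by move=> /a_nd; have := svalP (M k); lra.
have [g Sg gl] := hcomplete H (f := fun k => s (NN k)) (fun k => Ss _)
  (fun k => ltac:(by rewrite orth_sum_norm //; have := NNM k; have := aA (NN k.+1); lra)).
exists g => //.
have L : nlim (fun n => s n) g.
  move=> e e0.
  have [k0 hk0] := gl (e / 4) (ltac:(lra)).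
  have [k1 hk1] : exists k1, (4^-1 : R) ^+ k1 < e / 4.
    have : (4^-1 : R) ^+ n @[n --> \oo] --> (0 : R).
      by apply: cvg_expr; rewrite ger0_norm //; lra.
    move=> /cvgrPdist_lt /(_ (e / 4) (ltac:(lra))) [k1 _ /(_ k1 (leqnn _))] /=.
    rewrite sub0r normrN ger0_norm; last by rewrite exprn_ge0 // invr_ge0.
    by move=> ?; exists k1.
  pose k := maxn k0 k1.
  exists (NN k) => n kn.
  have := hn_triang (Ss n) (Ss (NN k)) Sg.
  have := hk0 k (leq_maxl _ _); rewrite orth_sum_norm //.
  have := NNM k; have := aA n.
  have : (4^-1 : R) ^+ k <= (4^-1 : R) ^+ k1.
    by apply: ler_wiXn2l; [rewrite invr_ge0|lra|exact: leq_maxr].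
  lra.
split => // k.
apply: (nlim_ip_eq (f := fun n => s n) (N1 := k.+1)) => // n kn.
by rewrite orth_sum_ip kn.
Qed.

End orthogonal_series.

(** Null vectors are tolerated in an orthonormal sequence: Gram-Schmidt then
    needs no linear independence. *)
Definition orthonormal (e : nat -> V) :=
  [/\ forall n, S (e n), forall i j, i != j -> ip (e i) (e j) = 0 &
      forall i, N (e i) = 1 \/ e i = 0].

Definition total (e : nat -> V) :=
  forall f, S f -> (forall k, ip f (e k) = 0) -> N f = 0.

Lemma onP e i : orthonormal e -> forall f, S f -> N (e i) * ip f (e i) = ip f (e i).
Proof.
case=> Se _ /(_ i) [->|->] f Sf; first by rewrite mul1r.
by rewrite (hipC H f) !hip0 ?mulr0 //; exact: (hS0 H).
Qed.

Lemma on_coef e (c : nat -> R) : orthonormal e ->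
  forall i, N (c i *: e i) = N (e i) * c i ^+ 2.
Proof.
by case=> Se _ _ i; rewrite (hipZ H) ?hipZr //; [ring|exact: (hSZ H)].
Qed.

Lemma on_orth e (c : nat -> R) : orthonormal e ->
  forall i j, i != j -> ip (c i *: e i) (c j *: e j) = 0.
Proof.
case=> Se oe _ i j ij; rewrite (hipZ H) ?hipZr ?oe ?mulr0 //; exact: (hSZ H).
Qed.

Lemma bessel e f n : orthonormal e -> S f ->
  \sum_(i < n) ip f (e i) ^+ 2 <= N f.
Proof.
move=> on Sf; have [Se oe ne] := on.
pose v i := ip f (e i) *: e i.
have Sv i : S (v i) by exact: (hSZ H).
have ov i j : i != j -> ip (v i) (v j) = 0 by exact: (on_orth (fun i => ip f (e i)) on).
have Nv i : N (v i) = ip f (e i) ^+ 2.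
  by rewrite (on_coef (fun i => ip f (e i)) on) expr2 mulrA onP.
have := hge0 H (f - \sum_(i < n) v i).
have SS : S (\sum_(i < n) v i) by exact: hSsum.
rewrite hnB // (hipC H f) hip_sum //.
have -> : \sum_(i < n) ip (v i) f = \sum_(i < n) ip f (e i) ^+ 2.
  by apply: eq_bigr => i _; rewrite (hipZ H) // (hipC H (e i)).
have := orth_sum_norm Sv ov (leq0n n).
rewrite !big_ord0 !subr0 => ->; rewrite (eq_bigr (fun i : 'I_n => ip f (e i) ^+ 2) (fun i _ => Nv i)); lra.
Qed.

(** The partial sums are Cauchy because the squared increments are the terms of a
    bounded series; [N (e i) * c i = c i] says that a null member of the system
    is given coefficient zero. *)
Lemma riesz_fischer e (c : nat -> R) B : orthonormal e ->
  (forall i, N (e i) * c i = c i) -> (forall n, \sum_(i < n) c i ^+ 2 <= B) ->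
  exists2 g, S g & nlim (fun n => \sum_(i < n) c i *: e i) g /\
    forall k, ip g (e k) = c k.
Proof.
move=> on ce cB; have [Se oe ne] := on.
have Nv i : N (c i *: e i) = c i ^+ 2 by rewrite on_coef // expr2 mulrA ce.
have [|g Sg [gl gv]] := orth_series (fun i => hSZ H (c i) (Se i)) (on_orth c on) (B := B).
  move=> n; rewrite (eq_bigr (fun i : 'I_n => c i ^+ 2) (fun i _ => Nv i)); exact: cB.
exists g => //; split => // k.
have := gv k; rewrite Nv hipZr // => h.
have [c0|c0] := eqVneq (c k) 0; last by apply: (mulfI c0); rewrite h expr2.
rewrite c0; case: (ne k) => [e1|->]; last by rewrite (hipC H) hip0.
apply: (nlim_ip_eq (f := fun n => \sum_(i < n) c i *: e i) (N1 := 0%N)) => //.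
  by move=> n; exact: (hScomb n c Se).
move=> n _; rewrite (hip_comb n c Se (Se k)) big1 // => i _.
have [->|/oe ->] := eqVneq (i : nat) k; by rewrite ?c0 ?mul0r ?mulr0.
Qed.

Lemma expansion e f : orthonormal e -> total e -> S f ->
  nlim (fun n => \sum_(i < n) ip f (e i) *: e i) f.
Proof.
move=> on tot Sf; have [Se _ _] := on.
have [g Sg [gl gc]] := riesz_fischer on (fun i => onP i on Sf)
  (fun n => bessel n on Sf).
have Nz : N (f - g) = 0.
  by apply: tot; [exact: hSB | move=> k; rewrite hipB // gc subrr].
have SS n : S (\sum_(i < n) ip f (e i) *: e i).
  exact: (hScomb n (fun i => ip f (e i)) Se).
move=> eps eps0; have [N0 hN] := gl (eps / 2) (ltac:(lra)).
exists N0 => n /hN h; have := hn_triang (SS n) Sg Sf.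
by rewrite (hn_swap Sg Sf) Nz; lra.
Qed.

Lemma expansion_norm e f n : orthonormal e -> S f ->
  N (\sum_(i < n) ip f (e i) *: e i - f) = N f - \sum_(i < n) ip f (e i) ^+ 2.
Proof.
move=> on Sf; have [Se oe ne] := on.
pose v i := ip f (e i) *: e i.
have Sv i : S (v i) by exact: (hSZ H).
have ov i j : i != j -> ip (v i) (v j) = 0 by exact: (on_orth (fun i => ip f (e i)) on).
have Nv i : N (v i) = ip f (e i) ^+ 2 by rewrite (on_coef (fun i => ip f (e i)) on) expr2 mulrA onP.
have SS : S (\sum_(i < n) v i) by exact: hSsum.
rewrite hnB // (hip_comb n (fun i => ip f (e i)) Se Sf).
have -> : \sum_(i < n) ip f (e i) * ip (e i) f = \sum_(i < n) ip f (e i) ^+ 2.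
  by apply: eq_bigr => i _; rewrite (hipC H (e i)).
have := orth_sum_norm Sv ov (leq0n n).
rewrite !big_ord0 !subr0 => ->; rewrite (eq_bigr (fun i : 'I_n => ip f (e i) ^+ 2) (fun i _ => Nv i)); ring.
Qed.

Lemma parseval e f : orthonormal e -> total e -> S f ->
  (\sum_(0 <= k <oo) (ip f (e k) ^+ 2)%:E)%E = (N f)%:E.
Proof.
move=> on tot Sf; apply/cvg_lim => //.
rewrite (_ : (fun n => _) = EFin \o (fun n => \sum_(k < n) ip f (e k) ^+ 2)); last first.
  by apply/funext => n; rewrite /= big_mkord sumEFin.
apply: cvg_EFin; first by near=> n.
apply/cvgrPdist_lt => eps eps0 /=.
have [N0 hN] := expansion on tot Sf eps0.
exists N0 => // n /= /hN; rewrite expansion_norm // => h.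
by rewrite ger0_norm // subr_ge0 bessel.
Unshelve. all: by end_near.
Qed.

(** If [f] is orthogonal to every [e k] then it is orthogonal to the partial
    sums of the expansion of [d], which converge to [d] by Parseval; hence [f]
    is orthogonal to the total family [D]. *)
Lemma total_of_parseval e (D : V -> Prop) : orthonormal e ->
  (forall d, D d -> S d) ->
  (forall f, S f -> (forall d, D d -> ip f d = 0) -> N f = 0) ->
  (forall d, D d -> (\sum_(0 <= k <oo) (ip d (e k) ^+ 2)%:E)%E = (N d)%:E) ->
  total e.
Proof.
move=> on DS Dtot Dp f Sf fe; apply: Dtot => // d Dd.
have Sd := DS _ Dd; have [Se oe ne] := on.
pose s n := \sum_(i < n) ip d (e i) *: e i.
have Ss n : S (s n) := hScomb n (fun i => ip d (e i)) Se.
rewrite (hipC H).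
apply: (nlim_ip_eq (f := s) (N1 := 0%N)) => //; last first.
  move=> n _; rewrite /s (hip_comb n (fun i => ip d (e i)) Se Sf).
  by rewrite big1 // => i _; rewrite (hipC H (e i)) fe mulr0.
move=> eps eps0.
have : (fun n => (\sum_(k < n) ip d (e k) ^+ 2)%:E) @ \oo --> (N d)%:E.
  rewrite -(Dp _ Dd).
  rewrite (_ : (fun n => _) = (fun n => \sum_(0 <= k < n) (ip d (e k) ^+ 2)%:E)%E).
    by apply: is_cvg_nneseries => n _ _; rewrite lee_fin sqr_ge0.
  by apply/funext => n; rewrite big_mkord sumEFin.
move=> /fine_cvgP[_] /cvgrPdist_lt /(_ _ eps0)[N0 _ hN].
exists N0 => n nN; rewrite expansion_norm //.
by apply: le_lt_trans (hN n nN); exact: ler_norm.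
Qed.

(** Each vector is reduced by its projections on the previous ones and
    normalised; a dependent vector contributes the null vector. *)
Section gram_schmidt.
Variable d : nat -> V.
Hypothesis Sd : forall n, S (d n).

Definition gs_residual (l : seq V) u : V := u - \sum_(x <- l) ip u x *: x.

Definition gs_normalize u : V :=
  if N u == 0 then 0 else (Num.sqrt (N u))^-1 *: u.

Fixpoint gs_list n : seq V :=
  if n is m.+1 then rcons (gs_list m) (gs_normalize (gs_residual (gs_list m) (d m)))
  else [::].

Definition gram_schmidt n := gs_normalize (gs_residual (gs_list n) (d n)).

Let e := gram_schmidt.

Lemma gs_listE n : gs_list n = [seq e i | i <- iota 0 n].
Proof. by elim: n => // n IH; rewrite -addn1 iotaD map_cat -IH addn1 /= cats1. Qed.

Lemma gs_residualE n : gs_residual (gs_list n) (d n) =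
  d n - \sum_(i < n) ip (d n) (e i) *: e i.
Proof.
rewrite /gs_residual gs_listE big_map; congr (_ - _).
by rewrite -(big_mkord xpredT (fun i => ip (d n) (e i) *: e i)) /index_iota subn0.
Qed.

Lemma gs_closed (P : V -> Prop) : P 0 -> (forall u v, P u -> P v -> P (u + v)) ->
  (forall a u, P u -> P (a *: u)) -> (forall n, P (d n)) ->
  forall n, P (e n) /\ P (gs_residual (gs_list n) (d n)).
Proof.
move=> P0 PD PZ Pd; suff I n : forall k, (k < n)%N -> P (e k) /\ P (gs_residual (gs_list k) (d k)).
  by move=> n; exact: (I n.+1).
elim: n => // n IH k; rewrite ltnS leq_eqVlt => /predU1P[->|]; last exact: IH.
have Pr : P (gs_residual (gs_list n) (d n)).
  rewrite gs_residualE; apply: (PD _ _ (Pd n)); rewrite -scaleN1r; apply: (PZ (-1)).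
  suff : forall m, (m <= n)%N -> P (\sum_(i < m) ip (d n) (e i) *: e i) by exact.
  elim=> [|m IHm] mn; first by rewrite big_ord0.
  rewrite big_ord_recr /=; apply: (PD _ _); first exact/IHm/ltnW.
  by apply: (PZ _); case: (IH m).
by split => //; rewrite /e /gram_schmidt /gs_normalize; case: ifP => // _; exact: PZ.
Qed.

Let SeR n : S (e n) /\ S (gs_residual (gs_list n) (d n)).
Proof. by apply: gs_closed => //; [exact: (hS0 H)|exact: (hSD H)|exact: (hSZ H)]. Qed.

Lemma gs_orthonormal : orthonormal e.
Proof.
have Se n : S (e n) by case: (SeR n).
have nor i : N (e i) = 1 \/ e i = 0.
  rewrite /e /gram_schmidt /gs_normalize; case: ifPn => n0; [by right|left].
  have Sr : S (gs_residual (gs_list i) (d i)) by case: (SeR i).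
  rewrite (hipZ H) ?hipZr //; last exact: (hSZ H).
  set r := N _ in n0 *; have r0 : 0 <= r by exact: (hge0 H).
  rewrite mulrA -invfM -expr2 sqr_sqrtr // mulVf //.
have nors i f : S f -> N (e i) * ip f (e i) = ip f (e i).
  case: (nor i) => ->; first by rewrite mul1r.
  by move=> Sf; rewrite (hipC H f) !hip0 ?mulr0 //; exact: (hS0 H).
have or n : forall i j, (i < n)%N -> (j < n)%N -> i != j -> ip (e i) (e j) = 0.
  elim: n => // n IH.
  have step i : (i < n)%N -> ip (e n) (e i) = 0.
    move=> ni; rewrite {1}/e /gram_schmidt /gs_normalize; case: ifP => _; first by rewrite hip0.
    have Sr : S (gs_residual (gs_list n) (d n)) by case: (SeR n).
    have SZ k : S (ip (d n) (e k) *: e k) by exact: (hSZ H).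
    rewrite (hipZ H) //; set c := _^-1; rewrite gs_residualE hipB //; last first.
      exact: (hScomb n (fun i => ip (d n) (e i)) Se).
    rewrite (hip_comb n (fun i => ip (d n) (e i)) Se (Se i)).
    rewrite (bigD1 (Ordinal ni)) //= big1 => [|j ji].
      have E : ip (d n) (e i) * ip (e i) (e i) = ip (d n) (e i).
        by rewrite mulrC; exact: nors.
      by rewrite addr0 E subrr mulr0.
    rewrite IH ?mulr0 //.
  move=> i j; rewrite !ltnS (leq_eqVlt i) (leq_eqVlt j) => /predU1P[->|ni] /predU1P[->|nj].
  - by rewrite eqxx.
  - by move=> _; exact: step.
  - by move=> _; rewrite (hipC H); exact: step.
  - exact: IH.
by split => // i j; exact: (or (maxn i j).+1 _ _ (leq_maxl _ _) (leq_maxr _ _)).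
Qed.

Lemma gs_span n : exists c : nat -> R,
  let z := d n - \sum_(i < n.+1) c i *: e i in
  z = (if N (gs_residual (gs_list n) (d n)) == 0
       then gs_residual (gs_list n) (d n) else 0).
Proof.
set r := gs_residual _ _.
exists (fun i => if i == n then Num.sqrt (N r) else ip (d n) (e i)) => /=.
rewrite big_ord_recr /= eqxx.
rewrite (eq_bigr (fun i : 'I_n => ip (d n) (e i) *: e i)); last first.
  by move=> i _; rewrite ltn_eqF.
rewrite opprD addrA -gs_residualE -/r {1}/e /gram_schmidt -/r /gs_normalize.
case: ifPn => n0; first by rewrite scaler0 subr0.
rewrite scalerA divff ?scale1r ?subrr // sqrtr_eq0 -ltNge lt_def n0.
exact: (hge0 H).
Qed.

Lemma gs_total f : S f -> (forall k, ip f (e k) = 0) -> forall n, ip f (d n) = 0.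
Proof.
move=> Sf fe n; have [c /= E] := gs_span n.
have [Se _ _] := gs_orthonormal.
have Sr : S (gs_residual (gs_list n) (d n)) by case: (SeR n).
have SZ k : S (c k *: e k) by exact: (hSZ H).
have -> : d n = (d n - \sum_(i < n.+1) c i *: e i) + \sum_(i < n.+1) c i *: e i.
  by rewrite subrK.
rewrite E (hipC H) (hipD H) //; last 2 first.
- by case: ifP => // _; exact: (hS0 H).
- exact: (hSsum _ SZ).
rewrite (hip_sum _ SZ) // big1 => [|i _].
  by rewrite addr0; case: ifP => [/eqP r0|_]; [exact: hip_null|exact: hip0].
by rewrite (hipZ H) // (hipC H) fe mulr0.
Qed.

End gram_schmidt.

(** A subset of a separable space is separable; here the subset is the graph
    of [B] over [A], for the product norm. *)
Lemma separable_graph e (X : choiceType) (D : X -> Prop) (A B : X -> V) (x0 : X) :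
  orthonormal e -> total e -> D x0 ->
  (forall x, D x -> S (A x)) -> (forall x, D x -> S (B x)) ->
  exists2 x : nat -> X, forall n, D (x n) &
    forall y, D y -> forall eps : R, 0 < eps -> exists n,
      N (A y - A (x n)) < eps /\ N (B y - B (x n)) < eps.
Proof.
move=> on tot Dx0 SA SB; have [Se oe ne] := on.
pose Q (s : seq rat) := \sum_(i < size s) (ratr (nth 0 s i) : R) *: e i.
have SQ s : S (Q s).
  by apply: (hSsum (size s) (F := fun i => (ratr (nth 0 s i) : R) *: e i)) => i; exact: (hSZ H).
have Ne i : N (e i) <= 1 by case: (ne i) => ->; rewrite ?hip0 //; exact: (hS0 H).
have appr f (eps : R) : S f -> 0 < eps -> exists s, N (f - Q s) < eps.
  move=> Sf eps0.
  have [n /(_ n (leqnn _)) hn] := expansion on tot Sf (ltac:(lra) : 0 < eps / 4).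
  pose del := Num.sqrt (eps / 4 / n.+1%:R).
  have d0 : 0 < del by rewrite sqrtr_gt0 !divr_gt0.
  have q i : {q : rat | (ip f (e i) - ratr q) ^+ 2 <= eps / 4 / n.+1%:R}.
    apply: cid.
    have : ip f (e i) - del < ip f (e i) + del by lra.
    move=> /rat_in_itvoo[q]; rewrite in_itv /= => /andP[q1 q2]; exists q.
    rewrite -[leRHS]sqr_sqrtr; last by rewrite !divr_ge0 // ltW.
    rewrite -/del -real_normK ?num_real // ler_pXn2r ?nnegrE ?normr_ge0 ?(ltW d0) //.
    by rewrite ler_norml; apply/andP; split; lra.
  exists [seq sval (q i) | i <- iota 0 n].
  set s := [seq _ | _ <- _].
  have sz : size s = n by rewrite size_map size_iota.
  pose g i := ip f (e i) *: e i; pose h i := (ratr (nth 0 s i) : R) *: e i.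
  have Sg i : S (g i) by exact: (hSZ H).
  have Sh i : S (h i) by exact: (hSZ H).
  have QE : Q s = \sum_(i < n) h i by rewrite /Q sz.
  have -> : f - Q s = f - \sum_(i < n) g i + \sum_(i < n) (g i - h i).
    by rewrite sumrB addrA subrK QE.
  have Sgh i : S (g i - h i) by exact: hSB.
  apply: le_lt_trans (hnD_le (hSB Sf (hSsum n Sg)) (hSsum n Sgh)) _.
  rewrite (hn_swap Sf (hSsum n Sg)).
  suff : N (\sum_(i < n) (g i - h i)) <= eps / 4 by move: hn; rewrite -/(g _); lra.
  have gh i : g i - h i = (ip f (e i) - ratr (nth 0 s i)) *: e i by rewrite scalerBl.
  have ogh i j : i != j -> ip (g i - h i) (g j - h j) = 0.
    by move=> ij; rewrite !gh; apply: (on_orth (fun i => ip f (e i) - ratr (nth 0 s i)) on).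
  have := orth_sum_norm Sgh ogh (leq0n n); rewrite !big_ord0 !subr0 => ->.
  apply: (@le_trans _ _ (\sum_(i < n) (eps / 4 / n.+1%:R))).
    apply: ler_sum => i _; rewrite gh.
    rewrite (on_coef (fun i => ip f (e i) - ratr (nth 0 s i)) on).
    have -> : nth 0 s i = sval (q i).
      by rewrite (nth_map 0%N) ?size_iota // nth_iota // add0n.
    apply: le_trans (svalP (q i)).
    by rewrite ler_piMl // sqr_ge0.
  rewrite sumr_const card_ord -[leLHS]mulr_natr -[leLHS]mulrA ler_piMr //; first by lra.
  by rewrite mulrC ler_pdivrMr // mul1r ler_nat.
pose T := (seq rat * seq rat * nat)%type.
pose G (t : T) x := [/\ D x, N (A x - Q t.1.1) < t.2.+1%:R^-1 & N (B x - Q t.1.2) < t.2.+1%:R^-1].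
pose x n := if unpickle n is Some t then xget x0 [set x | G t x] else x0.
exists x.
  move=> n; rewrite /x; case: unpickle => // t.
  have [/(xgetPex x0)[]//|/forallNP nG] := pselect (exists x, [set x | G t x] x).
  by rewrite xgetPN.
move=> y Dy eps eps0.
have [m hm] : exists m, (m.+1%:R^-1 : R) < eps / 4.
  have [m _ /(_ m (leqnn _)) h] := near_infty_natSinv_lt (PosNum (ltac:(lra) : 0 < eps / 4)).
  by exists m.
have [s1 h1] := appr _ _ (SA _ Dy) (ltac:(by rewrite invr_gt0) : 0 < m.+1%:R^-1).
have [s2 h2] := appr _ _ (SB _ Dy) (ltac:(by rewrite invr_gt0) : 0 < m.+1%:R^-1).
exists (pickle ((s1, s2, m) : T)); rewrite /x pickleK.
have [Dz z1 z2] : [set x | G (s1, s2, m) x] (xget x0 [set x | G (s1, s2, m) x]).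
  by apply: xgetPex; exists y.
set z := xget _ _ in Dz z1 z2 *.
have := hn_triang (SA _ Dy) (SQ s1) (SA _ Dz).
have := hn_triang (SB _ Dy) (SQ s2) (SB _ Dz).
rewrite (hn_swap (SQ s1) (SA _ Dz)) (hn_swap (SQ s2) (SB _ Dz)).
move=> tB tA.
have fin (k a b c : R) : a < k -> b < k -> k < eps / 4 -> c <= 2 * a + 2 * b -> c < eps.
  by lra.
by split; [exact: (fin _ _ _ _ h1 z1 hm tA)|exact: (fin _ _ _ _ h2 z2 hm tB)].
Qed.

End Hilbert.

(** * Square integrable functions *)

Section lower_integral.
Local Open Scope ereal_scope.
Context d (T : measurableType d) (R : realType).
Variable mu : {measure set T -> \bar R}.

(** The integral of a nonnegative function is a supremum over simple functions,
    so it is monotone, and blind to negligible sets, even for functions that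
    are not measurable. *)
Lemma ae_le_integral (D : set T) (f g : T -> \bar R) :
  (forall x, D x -> 0 <= f x) -> (forall x, D x -> 0 <= g x) ->
  {ae mu, forall x, D x -> f x <= g x} ->
  \int[mu]_(x in D) f x <= \int[mu]_(x in D) g x.
Proof.
move=> f0 g0 [N [mN N0 fgN]].
rewrite integral_mkcond [leRHS]integral_mkcond.
have p0 (h : T -> \bar R) : (forall x, D x -> 0 <= h x) -> forall x, 0 <= (h \_ D) x.
  by move=> h0 x; rewrite patchE; case: ifPn => // /set_mem /h0.
rewrite !ge0_integralTE; [|exact: p0..].
apply: ge_ereal_sup => _ [h hf <-].
pose k := proj_nnsfun h (measurableC mN).
rewrite -integralT_nnsfun.
have -> : \int[mu]_x (h x)%:E = \int[mu]_x (k x)%:E.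
  have mE (u : {nnsfun T >-> R}) : measurable_fun setT (EFin \o u).
    exact/measurable_EFinP/measurable_funPT.
  apply: ge0_ae_eq_integral => //; try exact: mE.
  - by move=> x _; rewrite lee_fin.
  - by move=> x _; rewrite lee_fin.
  exists N; split => // x /= nh; apply: contrapT => xN; apply: nh => _.
  by rewrite /= mindicE mem_set ?mulr1.
rewrite integralT_nnsfun; apply: ereal_sup_ubound; exists k => // x /=.
rewrite mindicE; have [xN|xN] := boolP (x \in ~` N).
  rewrite mulr1; apply: le_trans (hf x) _; rewrite !patchE.
  case: ifPn => // /set_mem Dx.
  by apply: contrapT => nfg; move/set_mem: xN; apply; apply: fgN => /(_ Dx).
by rewrite mulr0; exact: p0.
Qed.

Lemma ae_eq_ge0_integral (D : set T) (f g : T -> \bar R) :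
  (forall x, D x -> 0 <= f x) -> (forall x, D x -> 0 <= g x) ->
  {ae mu, forall x, D x -> f x = g x} ->
  \int[mu]_(x in D) f x = \int[mu]_(x in D) g x.
Proof.
move=> f0 g0 fg; apply/eqP; rewrite eq_le; apply/andP; split;
  apply: ae_le_integral => //; apply: filterS fg => x h Dx; rewrite h //.
Qed.

Lemma le_ge0_integral (D : set T) (f g : T -> \bar R) :
  (forall x, D x -> 0 <= f x) -> (forall x, D x -> f x <= g x) ->
  \int[mu]_(x in D) f x <= \int[mu]_(x in D) g x.
Proof.
move=> f0 fg; apply: ae_le_integral => //; last exact: aeW.
by move=> x Dx; apply: le_trans (f0 _ Dx) (fg _ Dx).
Qed.

Lemma integral_lty_ae (D : set T) (f : T -> \bar R) : measurable D ->
  measurable_fun D f -> (forall x, D x -> 0 <= f x) ->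
  \int[mu]_(x in D) f x < +oo -> {ae mu, forall x, D x -> f x < +oo}.
Proof.
move=> mD mf f0 foo.
have : mu.-integrable D f.
  apply/integrableP; split => //.
  by rewrite (eq_integral f) // => x /set_mem Dx; rewrite gee0_abs // f0.
move=> /(integrable_ae mD); apply: filterS => x h Dx.
by move: (h Dx); rewrite fin_numE lt_neqAle leey andbT => /andP[].
Qed.

End lower_integral.

Lemma ge0_integrable d (T : measurableType d) (R : realType)
  (mu : {measure set T -> \bar R}) (D : set T) (f : T -> R) : measurable D ->
  measurable_fun D f -> (forall x, 0 <= f x) ->
  (\int[mu]_(x in D) (f x)%:E < +oo)%E -> mu.-integrable D (EFin \o f).
Proof.
move=> mD mf f0 foo; apply/integrableP; split; first exact/measurable_EFinP.
by under eq_integral do rewrite /= ger0_norm //.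
Qed.

Lemma integrable_measurable d (T : measurableType d) (R : realType)
  (mu : {measure set T -> \bar R}) (D : set T) (f : T -> R) :
  mu.-integrable D (EFin \o f) -> measurable_fun D f.
Proof. by move=> /measurable_int /measurable_EFinP. Qed.

Lemma integrable_normR d (T : measurableType d) (R : realType)
  (mu : {measure set T -> \bar R}) (D : set T) (f : T -> R) :
  mu.-integrable D (EFin \o f) -> mu.-integrable D (EFin \o (fun x => `|f x|)).
Proof. by move=> /integrable_abse. Qed.

Section L2.
Context d (T : measurableType d) (R : realType).
Variable mu : {measure set T -> \bar R}.
Implicit Types f g : T -> R.

Definition L2 f := measurable_fun setT f /\ (\int[mu]_x (f x ^+ 2)%:E < +oo)%E.
Definition ip f g : R := \int[mu]_x (f x * g x).

Lemma L2_sq_integrable f : L2 f -> mu.-integrable setT (EFin \o (fun x => f x ^+ 2)).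
Proof.
move=> [mf f2]; apply/integrableP; split.
  by apply/measurable_EFinP; exact: measurable_funX.
by rewrite (eq_integral (fun x => (f x ^+ 2)%:E)) // => x _; rewrite /= ger0_norm ?sqr_ge0.
Qed.

Lemma L2_mul_integrable f g : L2 f -> L2 g ->
  mu.-integrable setT (EFin \o (fun x => f x * g x)).
Proof.
move=> Lf Lg; have [mf _] := Lf; have [mg _] := Lg.
have hD := integrableD measurableT (L2_sq_integrable Lf) (L2_sq_integrable Lg).
apply: (le_integrable measurableT _ _ hD).
  by apply/measurable_EFinP; exact: measurable_funM.
move=> x _ /=; rewrite lee_fin [leRHS]ger0_norm; last first.
  by rewrite addr_ge0 ?sqr_ge0.
rewrite ler_norml; have := sqr_ge0 (f x + g x); have := sqr_ge0 (f x - g x).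
by have := sqr_ge0 (f x); have := sqr_ge0 (g x); move=> *; apply/andP; split; nra.
Qed.

Lemma L2_ipE f : L2 f -> (\int[mu]_x (f x ^+ 2)%:E)%E = (ip f f)%:E.
Proof.
move=> Lf; rewrite /ip /Rintegral fineK.
  by apply: eq_integral => x _; rewrite expr2.
exact: (integrable_fin_num measurableT (L2_mul_integrable Lf Lf)).
Qed.

Lemma L2_0 : L2 (cst 0).
Proof.
split; first exact: measurable_cst.
by rewrite integral0_eq // => x _; rewrite expr0n.
Qed.

Lemma L2_D f g : L2 f -> L2 g -> L2 (f + g).
Proof.
move=> Lf Lg; have [mf f2] := Lf; have [mg g2] := Lg.
split; first exact: measurable_funD.
have mE (h : T -> R) : measurable_fun setT h -> measurable_fun setT (fun x => (2 * h x ^+ 2)%:E).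
  by move=> mh; apply/measurable_EFinP; apply: measurable_funM => //; exact: measurable_funX.
have s0 (h : T -> R) x : (0 <= (2 * h x ^+ 2)%:E)%E.
  by rewrite lee_fin mulr_ge0 ?sqr_ge0.
apply: (@le_lt_trans _ _ (\int[mu]_x ((2 * f x ^+ 2)%:E + (2 * g x ^+ 2)%:E))%E).
  apply: le_ge0_integral => x _; first by rewrite lee_fin sqr_ge0.
  by rewrite -EFinD lee_fin fctE; have := sqr_ge0 (f x - g x); nra.
rewrite ge0_integralD //; [|exact: mE..].
have fin h : L2 h -> (\int[mu]_x (2 * h x ^+ 2)%:E < +oo)%E.
  move=> Lh; under eq_integral do rewrite EFinM.
  by rewrite integralZl ?L2_sq_integrable // L2_ipE // -EFinM ltry.
by rewrite lte_add_pinfty // fin.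
Qed.

Lemma L2_Z a f : L2 f -> L2 (a *: f).
Proof.
move=> Lf; have [mf f2] := Lf; split.
  by apply: measurable_funM => //; exact: measurable_cst.
under eq_integral do rewrite fctE exprMn EFinM.
by rewrite integralZl ?L2_sq_integrable // L2_ipE // -EFinM ltry.
Qed.

Lemma ipC f g : ip f g = ip g f.
Proof. by apply: eq_Rintegral => x _; rewrite mulrC. Qed.

Lemma ip_ge0 f : 0 <= ip f f.
Proof. by apply: Rintegral_ge0 => x _; rewrite -expr2 sqr_ge0. Qed.

Lemma ipD f g h : L2 f -> L2 g -> L2 h -> ip (f + g) h = ip f h + ip g h.
Proof.
move=> Lf Lg Lh; rewrite /ip -RintegralD //; [|exact: L2_mul_integrable..].
by apply: eq_Rintegral => x _; rewrite fctE mulrDl.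
Qed.

Lemma ipZ a f h : L2 f -> L2 h -> ip (a *: f) h = a * ip f h.
Proof.
move=> Lf Lh; rewrite /ip -RintegralZl //; [|exact: L2_mul_integrable..].
by apply: eq_Rintegral => x _; rewrite fctE mulrA.
Qed.

Lemma L2_le f g : measurable_fun setT f -> L2 g -> (forall x, `|f x| <= `|g x|) -> L2 f.
Proof.
move=> mf [mg g2] fg; split => //; apply: le_lt_trans g2.
apply: le_ge0_integral => x _; first by rewrite lee_fin sqr_ge0.
by rewrite lee_fin -real_normK ?num_real // -[leRHS]real_normK ?num_real // ler_sqr ?nnegrE.
Qed.

Lemma L2_norm0_ae f : L2 f -> ip f f = 0 -> {ae mu, forall x, f x = 0}.
Proof.
move=> Lf f0; have [mf _] := Lf.
have : (\int[mu]_x `|(f x ^+ 2)%:E| = 0)%E.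
  rewrite (eq_integral (fun x => (f x ^+ 2)%:E)); first by rewrite L2_ipE // f0.
  by move=> x _; rewrite gee0_abs // lee_fin sqr_ge0.
move=> /(ae_eq_integral_abs mu measurableT) h.
have {}h : ae_eq mu setT (fun x => (f x ^+ 2)%:E) (cst 0%E).
  by apply: h; apply/measurable_EFinP; exact: measurable_funX.
by apply: filterS h => x /(_ I) [/eqP]; rewrite sqrf_eq0 => /eqP.
Qed.

Lemma ip_ae f1 f2 g1 g2 : L2 f1 -> L2 f2 -> L2 g1 -> L2 g2 ->
  {ae mu, forall x, f1 x = f2 x} -> {ae mu, forall x, g1 x = g2 x} ->
  ip f1 g1 = ip f2 g2.
Proof.
move=> L1 L2' L3 L4 f12 g12; rewrite /ip /Rintegral; congr fine.
apply: ae_eq_integral => //.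
- by apply/measurable_EFinP; apply: measurable_funM; [case: L1|case: L3].
- by apply/measurable_EFinP; apply: measurable_funM; [case: L2'|case: L4].
by apply: filterS2 f12 g12 => x -> ->.
Qed.

(** Pointwise, a sequence with increments [d] satisfies
    [|f (n + p) - f n|^2 <= 2^(1 - n) \sum_k 2^k |d k|^2]; this weighted
    Cauchy--Schwarz inequality replaces Minkowski's inequality in the
    completeness of L2. *)
Lemma increments_bound (u : nat -> R) n p :
  (u (n + p)%N - u n) ^+ 2 <=
  2 * (2^-1) ^+ n * \sum_(n <= k < n + p) 2 ^+ k * (u k.+1 - u k) ^+ 2.
Proof.
elim: p n => [|p IH] n.
  by rewrite addn0 subrr expr0n /= big_geq // mulr0.
rewrite addnS -addSn big_ltn ?addSn ?ltnS ?leq_addr //.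
have := IH n.+1; rewrite addSn; set s := \sum_(_ <= _ < _) _; set a := u _; set b := u n.+1.
move=> h; have E : (2^-1 : R) ^+ n.+1 = 2^-1 * 2^-1 ^+ n by rewrite exprS.
have E2 : 2 * 2^-1 ^+ n * (2 ^+ n * (b - u n) ^+ 2) = 2 * (b - u n) ^+ 2.
  by rewrite -mulrA [2^-1 ^+ n * _]mulrA -exprMn mulVf // expr1n mul1r.
rewrite mulrDr E2; apply: (@le_trans _ _ (2 * (b - u n) ^+ 2 + 2 * (a - b) ^+ 2)).
  by have := sqr_ge0 ((b - u n) - (a - b)); nra.
rewrite lerD2l; move: h; rewrite E => h.
have -> : 2 * 2^-1 ^+ n * s = 2 * (2 * (2^-1 * 2^-1 ^+ n) * s) by field.
by rewrite ler_pM2l.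
Qed.

(** Fast Cauchy sequences converge pointwise off the null set where the weighted
    sum of squared increments diverges; the limit in mean follows from the same
    bound. *)
Lemma L2_complete (f : nat -> T -> R) : (forall n, L2 (f n)) ->
  (forall n, ip (f n.+1 - f n) (f n.+1 - f n) <= (4^-1) ^+ n) ->
  exists2 g, L2 g & forall e, 0 < e ->
    exists N, forall n, (N <= n)%N -> ip (f n - g) (f n - g) < e.
Proof.
move=> Lf df.
have mf n : measurable_fun setT (f n) by case: (Lf n).
have Ld n : L2 (f n.+1 - f n).
  by apply: L2_D => //; rewrite -scaleN1r; exact: L2_Z.
pose w k x := (2 ^+ k * (f k.+1 x - f k x) ^+ 2)%:E.
have w0 k x : (0 <= w k x)%E.
  by rewrite lee_fin mulr_ge0 ?sqr_ge0 ?exprn_ge0.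
have mw k : measurable_fun setT (w k).
  apply/measurable_EFinP/measurable_funM => //; apply: measurable_funX.
  exact: measurable_funB.
pose S (x : T) : \bar R := (\sum_(0 <= k <oo) w k x)%E.
have S0 x : (0 <= S x)%E by exact: nneseries_ge0.
have mS : measurable_fun setT S by exact: ge0_emeasurable_sum.
have iS : (\int[mu]_x S x <= 2%:E)%E.
  rewrite integral_nneseries //.
  apply: (@le_trans _ _ (\sum_(0 <= k <oo) (((1 / 2) ^+ k : R)%:E))%E).
    apply: lee_nneseries => [k _ _|k _]; first exact: integral_ge0.
    under eq_integral do rewrite /w EFinM.
    have -> : (\int[mu]_x ((2 ^+ k)%:E * ((f k.+1 x - f k x) ^+ 2)%:E))%E =
        ((2 ^+ k)%:E * (ip (f k.+1 - f k) (f k.+1 - f k))%:E)%E.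
      by rewrite integralZl ?(L2_sq_integrable (Ld k)) // -L2_ipE.
    rewrite -EFinM lee_fin; apply: (@le_trans _ _ (2 ^+ k * (4^-1) ^+ k)).
      by rewrite ler_pM2l ?exprn_gt0.
    by rewrite -exprMn; have -> : 2 * 4^-1 = 1 / 2 :> R by field.
  have : series (geometric 1 (1 / 2 : R)) @ \oo --> (2 : R).
    rewrite [X in _ --> X](_ : 2 = 1 * (1 - 1 / 2)^-1 :> R); last by field.
    by apply: cvg_geometric_series; rewrite ger0_norm; lra.
  move=> h; rewrite (_ : (\sum_(0 <= k <oo) _)%E = 2%:E) //; apply/cvg_lim => //.
  rewrite (_ : (fun n => _) = EFin \o series (geometric 1 (1 / 2 : R))).
    by apply: cvg_EFin; [near=> n|exact: h].
  apply/funext => n; rewrite /= /series /= -sumEFin; apply: eq_bigr => i _.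
  by rewrite [in RHS]mul1r.
pose A := [set x | (S x < +oo)%E].
have mA : measurable A.
  rewrite /A -[X in measurable X]setTI; exact: (emeasurable_fun_infty_o measurableT mS).
pose g_ n x := f n x * \1_A x.
have mg n : measurable_fun setT (g_ n).
  by apply: measurable_funM => //; exact: measurable_indic.
have bd x n m : A x -> (n <= m)%N -> (f m x - f n x) ^+ 2 <= 2 * 2^-1 ^+ n * fine (S x).
  move=> Ax nm; have := increments_bound (fun n => f n x) n (m - n); rewrite subnKC //.
  move=> h; apply: le_trans h _; apply: ler_wpM2l.
    by rewrite mulr_ge0 ?exprn_ge0 // invr_ge0.
  rewrite -lee_fin fineK; last by rewrite ge0_fin_numE.
  rewrite -sumEFin; apply: le_trans (nneseries_lim_ge m _); last by move=> *; exact: w0.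
  by rewrite (big_cat_nat (leq0n n) nm) /= leeDr // sume_ge0.
have ed (e s : R) : 0 < e -> exists N, forall n, (N <= n)%N -> 2 * 2^-1 ^+ n * s < e :> R.
  move=> e0.
  have : (fun n => 2 * 2^-1 ^+ n * s) @ \oo --> (2 * 0 * s : R).
    apply: cvgMl; apply: cvgMr; apply: cvg_expr; rewrite ger0_norm; lra.
  rewrite mulr0 mul0r => /cvgrPdist_lt /(_ e e0)[N _ hN]; exists N => k /hN /=.
  by rewrite sub0r normrN => /(le_lt_trans (ler_norm _)).
have cg x : cvgn (fun n => g_ n x).
  have [Ax|nAx] := pselect (A x); last first.
    by rewrite /g_ indicE memNset //; under eq_fun do rewrite mulr0; exact: is_cvg_cst.
  rewrite /g_ indicE mem_set //; under eq_fun do rewrite mulr1.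
  apply/cauchy_cvgP/cauchy_exP => e e0.
  have [N hN] := ed (e ^+ 2) (fine (S x)) (exprn_gt0 2 e0).
  exists (f N x); exists N => // n /= Nn; rewrite /ball /=.
  rewrite -ltr_sqr ?nnegrE ?(ltW e0) // real_normK ?num_real // -sqrrN opprB.
  by apply: le_lt_trans (bd x _ _ Ax Nn) (hN N (leqnn _)).
pose g x := limn (fun n => g_ n x).
have mg' : measurable_fun setT g.
  by apply: (measurable_fun_cvg mg) => x _; exact: cg.
have gb n x : A x -> (f n x - g x) ^+ 2 <= 2 * 2^-1 ^+ n * fine (S x).
  move=> Ax.
  have h : (fun m => (f n x - g_ m x) ^+ 2) @ \oo --> (f n x - g x) ^+ 2.
    under eq_fun do rewrite expr2; rewrite expr2.
    by apply: cvgM; (apply: cvgB; [exact: cvg_cst|exact: cg]).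
  apply: (cvgr_to_le h).
  exists n => // m /= nm; rewrite /g_ indicE mem_set // mulr1 -sqrrN opprB.
  exact: bd.
have aeA : {ae mu, forall x, A x}.
  have /(_ (le_lt_trans iS (ltry _))) := @integral_lty_ae _ _ _ mu setT S measurableT mS (fun x _ => S0 x).
  by apply: filterS => x; apply.
have nb n : (\int[mu]_x ((f n x - g x) ^+ 2)%:E <= (2 * 2^-1 ^+ n * 2)%:E)%E.
  have c0 : (0 <= (2 * 2^-1 ^+ n)%:E :> \bar R)%E.
    by rewrite lee_fin mulr_ge0 // exprn_ge0 // invr_ge0.
  have h2 : (\int[mu]_x ((2 * 2^-1 ^+ n)%:E * S x) <= (2 * 2^-1 ^+ n * 2)%:E)%E.
    by rewrite ge0_integralZl // [leRHS]EFinM; exact: lee_wpmul2l.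
  apply: (le_trans _ h2); apply: ae_le_integral.
  - by move=> x _; rewrite lee_fin sqr_ge0.
  - by move=> x _; rewrite mule_ge0.
  apply: filterS aeA => x Ax _; rewrite -[S x]fineK; last by rewrite ge0_fin_numE.
  by rewrite -EFinM lee_fin gb.
have Lfg n : L2 (f n - g).
  split; first exact: measurable_funB.
  by apply: le_lt_trans (nb n) _; rewrite ltry.
have Lg : L2 g.
  have -> : g = f 0%N - (f 0%N - g) by rewrite opprB addrC subrK.
  by apply: L2_D => //; rewrite -scaleN1r; exact: L2_Z.
exists g => // e e0; have [N hN] := ed e 2 e0; exists N => n /hN; apply: le_lt_trans.
by rewrite -lee_fin -L2_ipE //; exact: nb.
Unshelve. all: by end_near.
Qed.

Lemma L2_hilbert : hilbert L2 ip.
Proof.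
split; [exact: L2_0|exact: L2_D|exact: L2_Z|exact: ipC|exact: ipD|exact: ipZ|exact: ip_ge0|].
exact: L2_complete.
Qed.

End L2.

Section product.
Context d1 d2 (T1 : measurableType d1) (T2 : measurableType d2) (R : realType).
Variables (m1 : {sigma_finite_measure set T1 -> \bar R})
          (m2 : {sigma_finite_measure set T2 -> \bar R}).
Implicit Types (F : T1 * T2 -> R) (p : T1 -> R) (q : T2 -> R).

Lemma measurable_sqE d (T : measurableType d) (f : T -> R) :
  measurable_fun setT f -> measurable_fun setT (fun x => (f x ^+ 2)%:E).
Proof. by move=> mf; apply/measurable_EFinP; exact: measurable_funX. Qed.

Lemma L2_tonelli F : measurable_fun setT F ->
  (\int[m1 \x m2]_z (F z ^+ 2)%:E = \int[m1]_x \int[m2]_y (F (x, y) ^+ 2)%:E)%E.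
Proof.
move=> mF; rewrite (fubini_tonelli1 (fun z => (F z ^+ 2)%:E)) //.
  exact: measurable_sqE.
by move=> x; rewrite lee_fin sqr_ge0.
Qed.

Lemma L2_tonelli2 F : measurable_fun setT F ->
  (\int[m1 \x m2]_z (F z ^+ 2)%:E = \int[m2]_y \int[m1]_x (F (x, y) ^+ 2)%:E)%E.
Proof.
move=> mF; rewrite L2_tonelli // (fubini_tonelli (fun z => (F z ^+ 2)%:E)) //.
  exact: measurable_sqE.
by move=> x; rewrite lee_fin sqr_ge0.
Qed.

Lemma L2_slice F : L2 (m1 \x m2)%E F -> {ae m1, forall x, L2 m2 (fun y => F (x, y))}.
Proof.
move=> [mF]; rewrite L2_tonelli // => h.
have sq0 (z : T1 * T2) : (0 <= (F z ^+ 2)%:E)%E by rewrite lee_fin sqr_ge0.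
have mI := measurable_fun_fubini_tonelli_F (m2 := m2) _ (measurable_sqE mF) sq0.
have := integral_lty_ae measurableT mI _ h.
have I0 x : setT x -> (0 <= fubini_F m2 (fun z => (F z ^+ 2)%:E) x)%E.
  by move=> _; apply: integral_ge0 => y _; exact: sq0.
move=> /(_ I0); apply: filterS => x /(_ I) fin; split => //; exact: measurable_fun_pair2.
Qed.

Lemma L2_slice2 F : L2 (m1 \x m2)%E F -> {ae m2, forall y, L2 m1 (fun x => F (x, y))}.
Proof.
move=> [mF]; rewrite L2_tonelli2 // => h.
have sq0 (z : T1 * T2) : (0 <= (F z ^+ 2)%:E)%E by rewrite lee_fin sqr_ge0.
have mI := measurable_fun_fubini_tonelli_G (m1 := m1) _ (measurable_sqE mF) sq0.
have := integral_lty_ae measurableT mI _ h.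
have I0 x : setT x -> (0 <= fubini_G m1 (fun z => (F z ^+ 2)%:E) x)%E.
  by move=> _; apply: integral_ge0 => y _; exact: sq0.
move=> /(_ I0); apply: filterS => x /(_ I) fin; split => //; exact: measurable_fun_pair1.
Qed.

Lemma measurable_tensor p q : measurable_fun setT p -> measurable_fun setT q ->
  measurable_fun setT (fun z : T1 * T2 => p z.1 * q z.2).
Proof.
move=> mp mq; apply: measurable_funM.
- exact: (measurableT_comp mp measurable_fst).
- exact: (measurableT_comp mq measurable_snd).
Qed.

Lemma L2_tensor p q : L2 m1 p -> L2 m2 q ->
  L2 (m1 \x m2)%E (fun z => p z.1 * q z.2).
Proof.
move=> Lp Lq; have [mp _] := Lp; have [mq _] := Lq.
split; first exact: measurable_tensor.
rewrite L2_tonelli /=; last exact: measurable_tensor.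
have E x : (\int[m2]_y ((p x * q y) ^+ 2)%:E = (p x ^+ 2)%:E * (ip m2 q q)%:E)%E.
  under eq_integral do rewrite exprMn EFinM.
  by rewrite integralZl ?(L2_sq_integrable Lq) // L2_ipE.
under eq_integral do rewrite E muleC.
by rewrite integralZl ?(L2_sq_integrable Lp) // L2_ipE // -EFinM ltry.
Qed.

Definition part F q x := ip m2 (fun y => F (x, y)) q.
Definition part2 F p y := ip m1 (fun x => F (x, y)) p.

Lemma measurable_part F q : measurable_fun setT F -> measurable_fun setT q ->
  measurable_fun setT (part F q).
Proof.
move=> mF mq.
pose f z := (F z * q z.2)%:E.
have mf : measurable_fun setT f.
  apply/measurable_EFinP/measurable_funM => //.
  exact: (measurableT_comp mq measurable_snd).
apply: (measurableT_comp (fine_measurable measurableT)).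
rewrite [X in measurable_fun _ X](_ : _ = fun x =>
    (\int[m2]_y f^\+ (x, y) - \int[m2]_y f^\- (x, y))%E); last first.
  by apply/funext => x; rewrite integralE; congr (_ - _)%E; apply: eq_integral => y _; rewrite ?funeposE ?funenegE.
apply: emeasurable_funB.
- apply: (measurable_fun_fubini_tonelli_F f^\+%E) => //.
  exact: measurable_funepos.
- apply: (measurable_fun_fubini_tonelli_F f^\-%E) => //.
  exact: measurable_funeneg.
Qed.

Lemma L2_part F q : L2 (m1 \x m2)%E F -> L2 m2 q -> L2 m1 (part F q).
Proof.
move=> LF Lq; have [mF fF] := LF; have [mq _] := Lq.
split; first exact: measurable_part.
apply: (@le_lt_trans _ _ (\int[m1]_x ((ip m2 q q)%:E * \int[m2]_y (F (x, y) ^+ 2)%:E))%E).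
  apply: ae_le_integral.
  - by move=> x _; rewrite lee_fin sqr_ge0.
  - move=> x _; apply: mule_ge0; first by rewrite lee_fin ip_ge0.
    by apply: integral_ge0 => y _; rewrite lee_fin sqr_ge0.
  apply: filterS (L2_slice LF) => x Lx _.
  by rewrite L2_ipE // -EFinM lee_fin mulrC; exact: (hCS (L2_hilbert m2)).
rewrite ge0_integralZl //.
- by rewrite -L2_tonelli // lte_mul_pinfty // lee_fin ip_ge0.
- apply: (measurable_fun_fubini_tonelli_F (fun z => (F z ^+ 2)%:E)).
    exact: measurable_sqE.
  by move=> z; rewrite lee_fin sqr_ge0.
- by move=> x _; apply: integral_ge0 => y _; rewrite lee_fin sqr_ge0.
- by rewrite lee_fin ip_ge0.
Qed.

Lemma measurable_part2 F p : measurable_fun setT F -> measurable_fun setT p ->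
  measurable_fun setT (part2 F p).
Proof.
move=> mF mp.
pose f z := (F z * p z.1)%:E.
have mf : measurable_fun setT f.
  apply/measurable_EFinP/measurable_funM => //.
  exact: (measurableT_comp mp measurable_fst).
apply: (measurableT_comp (fine_measurable measurableT)).
rewrite [X in measurable_fun _ X](_ : _ = fun y =>
    (\int[m1]_x f^\+ (x, y) - \int[m1]_x f^\- (x, y))%E); last first.
  by apply/funext => x; rewrite integralE; congr (_ - _)%E; apply: eq_integral => y _; rewrite ?funeposE ?funenegE.
apply: emeasurable_funB.
- apply: (measurable_fun_fubini_tonelli_G f^\+%E) => //.
  exact: measurable_funepos.
- apply: (measurable_fun_fubini_tonelli_G f^\-%E) => //.
  exact: measurable_funeneg.
Qed.

Lemma L2_part2 F p : L2 (m1 \x m2)%E F -> L2 m1 p -> L2 m2 (part2 F p).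
Proof.
move=> LF Lp; have [mF fF] := LF; have [mp _] := Lp.
split; first exact: measurable_part2.
apply: (@le_lt_trans _ _ (\int[m2]_y ((ip m1 p p)%:E * \int[m1]_x (F (x, y) ^+ 2)%:E))%E).
  apply: ae_le_integral.
  - by move=> x _; rewrite lee_fin sqr_ge0.
  - move=> x _; apply: mule_ge0; first by rewrite lee_fin ip_ge0.
    by apply: integral_ge0 => y _; rewrite lee_fin sqr_ge0.
  apply: filterS (L2_slice2 LF) => x Lx _.
  by rewrite L2_ipE // -EFinM lee_fin mulrC; exact: (hCS (L2_hilbert m1)).
rewrite ge0_integralZl //.
- by rewrite -L2_tonelli2 // lte_mul_pinfty // lee_fin ip_ge0.
- apply: (measurable_fun_fubini_tonelli_G (fun z => (F z ^+ 2)%:E)).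
    exact: measurable_sqE.
  by move=> z; rewrite lee_fin sqr_ge0.
- by move=> x _; apply: integral_ge0 => y _; rewrite lee_fin sqr_ge0.
- by rewrite lee_fin ip_ge0.
Qed.

Lemma ip_part F p q : L2 (m1 \x m2)%E F -> L2 m1 p -> L2 m2 q ->
  ip m1 (part F q) p = ip (m1 \x m2)%E F (fun z => p z.1 * q z.2).
Proof.
move=> LF Lp Lq; have Lpq := L2_tensor Lp Lq.
have iF := L2_mul_integrable LF Lpq.
rewrite /ip /Rintegral -(integral12_prod_meas1 iF); congr fine.
have [mP _] := L2_part LF Lq.
apply: ae_eq_integral => //.
- by apply/measurable_EFinP/measurable_funM => //; case: Lp.
- exact: measurable_fubini_F iF.
apply: filterS (L2_slice LF) => x Lx _.
rewrite /fubini_F /= mulrC EFinM.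
have fn := integrable_fin_num measurableT (L2_mul_integrable Lx Lq).
under [RHS]eq_integral do rewrite mulrCA EFinM.
by rewrite integralZl ?(L2_mul_integrable Lx Lq) // /part /ip /Rintegral fineK.
Qed.

Lemma ip_part2 F p q : L2 (m1 \x m2)%E F -> L2 m1 p -> L2 m2 q ->
  ip m2 (part2 F p) q = ip (m1 \x m2)%E F (fun z => p z.1 * q z.2).
Proof.
move=> LF Lp Lq; have Lpq := L2_tensor Lp Lq.
have iF := L2_mul_integrable LF Lpq.
rewrite /ip /Rintegral -(integral21_prod_meas1 iF); congr fine.
have [mP _] := L2_part2 LF Lp.
apply: ae_eq_integral => //.
- by apply/measurable_EFinP/measurable_funM => //; case: Lq.
- exact: measurable_fubini_G iF.
apply: filterS (L2_slice2 LF) => y Ly _.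
rewrite /fubini_G /= mulrC EFinM.
have fn := integrable_fin_num measurableT (L2_mul_integrable Ly Lp).
under [RHS]eq_integral do rewrite mulrA mulrC EFinM.
by rewrite integralZl ?(L2_mul_integrable Ly Lp) // /part2 /ip /Rintegral fineK.
Qed.

Lemma ip_tensor p p' q q' : L2 m1 p -> L2 m1 p' -> L2 m2 q -> L2 m2 q' ->
  ip (m1 \x m2)%E (fun z => p z.1 * q z.2) (fun z => p' z.1 * q' z.2) =
  ip m1 p p' * ip m2 q q'.
Proof.
move=> Lp Lp' Lq Lq'; rewrite -ip_part //; last exact: L2_tensor.
have -> : part (fun z => p z.1 * q z.2) q' = ip m2 q q' *: p.
  apply/funext => x; rewrite /part /= fctE /GRing.scale /= mulrC -(ipZ (p x) Lq Lq').
  by [].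
by rewrite ipZ // mulrC.
Qed.

End product.

Section pair_hilbert.
Context {R : realType} {V : lmodType R} (S : V -> Prop) (i : V -> V -> R).

Definition pairS (u : V * V) := S u.1 /\ S u.2.
Definition pairip (u v : V * V) := i u.1 v.1 + i u.2 v.2.

Lemma pair_hilbert : hilbert S i -> hilbert pairS pairip.
Proof.
move=> H; split.
- by split; exact: (hS0 H).
- by move=> u v [? ?] [? ?]; split; exact: (hSD H).
- by move=> a u [? ?]; split; exact: (hSZ H).
- by move=> u v; rewrite /pairip (hipC H u.1) (hipC H u.2).
- by move=> u v w [? ?] [? ?] [? ?]; rewrite /pairip !(hipD H) //; ring.
- by move=> a u w [? ?] [? ?]; rewrite /pairip !(hipZ H) // mulrDr.
- by move=> u; rewrite addr_ge0 // (hge0 H).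
move=> f Sf df.
have b1 n : i ((f n.+1).1 - (f n).1) ((f n.+1).1 - (f n).1) <= (4^-1) ^+ n.
  by apply: le_trans (df n); rewrite /pairip lerDl (hge0 H).
have b2 n : i ((f n.+1).2 - (f n).2) ((f n.+1).2 - (f n).2) <= (4^-1) ^+ n.
  by apply: le_trans (df n); rewrite /pairip lerDr (hge0 H).
have [g1 S1 h1] := hcomplete H (f := fun n => (f n).1) (fun n => (Sf n).1) b1.
have [g2 S2 h2] := hcomplete H (f := fun n => (f n).2) (fun n => (Sf n).2) b2.
exists (g1, g2) => // e e0.
have e20 : 0 < e / 2 by lra.
have [N1 k1] := h1 _ e20; have [N2 k2] := h2 _ e20.
exists (maxn N1 N2) => n; rewrite geq_max => /andP[/k1 a1 /k2 a2].
by rewrite /pairip /=; lra.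
Qed.

End pair_hilbert.

Notation L2c mu := (pairS (L2 mu)).
Notation ipc mu := (pairip (ip mu)).

Definition slice1 {T1 T2 R : Type} (G : (T1 * T2 -> R) * (T1 * T2 -> R)) x :
  (T2 -> R) * (T2 -> R) := (fun y => G.1 (x, y), fun y => G.2 (x, y)).

(** The coefficient functions [c k] are square integrable in the parameter, so
    the series of the products [c k x * e k y] converges in the plane by
    the parameterless theorem; almost every slice of the limit has the
    prescribed coefficients. Choosing slices one by one would lose joint
    measurability. *)
Lemma riesz_fischer_param d1 d2 (T1 : measurableType d1) (T2 : measurableType d2)
  (R : realType) (m1 : {sigma_finite_measure set T1 -> \bar R})
  (m2 : {sigma_finite_measure set T2 -> \bar R})
  (e : nat -> (T2 -> R) * (T2 -> R)) (c : nat -> T1 -> R) B :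
  orthonormal (L2c m2) (ipc m2) e -> (forall k, L2 m1 (c k)) ->
  (forall k x, ipc m2 (e k) (e k) * c k x = c k x) ->
  (forall n, \sum_(k < n) ip m1 (c k) (c k) <= B) ->
  exists2 G, L2c (m1 \x m2)%E G &
    {ae m1, forall x, L2c m2 (slice1 G x) /\
       forall k, ipc m2 (slice1 G x) (e k) = c k x}.
Proof.
move=> [Se oe ne] Lc ce cB.
have H2 := pair_hilbert (L2_hilbert (m1 \x m2)%E).
have H1 := L2_hilbert m1.
pose ten (p : T1 -> R) k : (T1 * T2 -> R) * (T1 * T2 -> R) :=
  (fun z => p z.1 * (e k).1 z.2, fun z => p z.1 * (e k).2 z.2).
have Lten p k : L2 m1 p -> L2c (m1 \x m2)%E (ten p k).
  by move=> Lp; have [S1 S2] := Se k; split; exact: L2_tensor.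
have iten p p' k l : L2 m1 p -> L2 m1 p' ->
    ipc (m1 \x m2)%E (ten p k) (ten p' l) = ip m1 p p' * ipc m2 (e k) (e l).
  move=> Lp Lp'; have [S1 S2] := Se k; have [S3 S4] := Se l.
  by rewrite /pairip /= !ip_tensor // -mulrDr.
pose v k := ten (c k) k.
have Sv k : L2c (m1 \x m2)%E (v k) by exact: Lten.
have cN k (p : T1 -> R) : L2 m1 p -> ip m1 (c k) p * ipc m2 (e k) (e k) = ip m1 (c k) p.
  move=> Lp; rewrite mulrC -(ipZ _ (Lc k) Lp); congr (ip m1 _ p).
  by apply/funext => x; rewrite fctE /GRing.scale /= ce.
have ov i j : i != j -> ipc (m1 \x m2)%E (v i) (v j) = 0.
  by move=> ij; rewrite /v iten // oe // mulr0.
have vB n : \sum_(i < n) ipc (m1 \x m2)%E (v i) (v i) <= B.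
  apply: le_trans (cB n); rewrite le_eqVlt; apply/orP; left; apply/eqP.
  by apply: eq_bigr => k _; rewrite /v iten // cN.
have [G SG [Gl _]] := orth_series H2 Sv ov vB.
exists G => //; have [SG1 SG2] := SG.
pose P k := part m2 G.1 (e k).1 + part m2 G.2 (e k).2.
have LP k : L2 m1 (P k).
  by have [S1 S2] := Se k; apply: L2_D; exact: L2_part.
have PE k p : L2 m1 p -> ip m1 (P k) p = ip m1 (c k) p.
  move=> Lp; have [S1 S2] := Se k.
  rewrite /P ipD ?(ip_part SG1) ?(ip_part SG2) //; [|exact: L2_part..].
  have -> : ip (m1 \x m2)%E G.1 (fun z => p z.1 * (e k).1 z.2) +
     ip (m1 \x m2)%E G.2 (fun z => p z.1 * (e k).2 z.2) = ipc (m1 \x m2)%E G (ten p k) by [].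
  apply: (nlim_ip_eq H2 (f := fun n => \sum_(i < n) v i) (N1 := k.+1)) => //.
  - by move=> n; exact: (hSsum H2).
  - exact: Lten.
  move=> n kn; rewrite (hip_sum H2) //; last exact: Lten.
  rewrite (bigD1 (Ordinal kn)) //= big1 ?addr0; first by rewrite /v iten // cN.
  move=> i ik; rewrite /v iten // (oe i k) ?mulr0 //.
have Pc k : {ae m1, forall x, P k x = c k x}.
  have LB : L2 m1 (P k - c k) by exact: (hSB H1).
  have := L2_norm0_ae LB.
  rewrite {1}(hipB H1) // PE // subrr => /(_ erefl).
  by apply: filterS => x; rewrite fctE => /subr0_eq.
have a1 := L2_slice SG1; have a2 := L2_slice SG2.
apply: filterS3 a1 a2 (ae_foralln Pc) => x h1 h2 h3; split; first by split.
by move=> k; rewrite -h3.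
Qed.

(** * Test functions *)

Section smooth_functions.
Context {R : realType}.
Implicit Types (V : normedModType R).

(** Finitely many derivatives at a time, which makes induction possible. *)
Fixpoint smooth_upto V n (f : V -> R) : Prop :=
  if n is m.+1 then (forall x, differentiable f x) /\
    forall v, smooth_upto m ('D_v f) else True.

Lemma smoothP V (f : V -> R) : smooth f <-> forall n, smooth_upto n f.
Proof.
split=> [sf n|sf s x].
  elim: n f sf => //= n IH f sf; split; first by move=> x; exact: (sf [::]).
  by move=> v; apply: IH => s x; have := sf (rcons s v) x; rewrite foldr_rcons.
suff h n : forall g, smooth_upto (n + size s) g ->
    smooth_upto n (foldr (fun v g => 'D_v g) g s).
  by have [] := h 1%N f (sf _).
elim: s n => [|v s IH] n g; first by rewrite addn0.
by rewrite addnS -addSn => /IH [_]; exact.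
Qed.

Lemma smooth_uptoS V n (f : V -> R) : smooth_upto n.+1 f -> smooth_upto n f.
Proof.
elim: n f => // n IH f [df sf]; split => // v; exact: IH (sf v).
Qed.

Lemma smooth_upto_cst V n (k : R) : smooth_upto n (cst k : V -> R).
Proof.
elim: n k => // n IH k; split => [x|v]; first exact: differentiable_cst.
have -> : 'D_v (cst k : V -> R) = cst 0 by apply/funext => x; rewrite derive_cst.
exact: IH.
Qed.

Lemma diff_derivable_fun V (f : V -> R) : (forall x, differentiable f x) ->
  forall x v, derivable f x v.
Proof. by move=> df x v; exact: diff_derivable. Qed.

Lemma smooth_uptoD V n (f g : V -> R) : smooth_upto n f -> smooth_upto n g ->
  smooth_upto n (f + g).
Proof.
elim: n f g => // n IH f g [df sf] [dg sg]; split => [x|v].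
  exact: differentiableD.
have -> : 'D_v (f + g) = 'D_v f + 'D_v g.
  by apply/funext => x; rewrite deriveD //; exact: diff_derivable.
exact: IH _ _ (sf v) (sg v).
Qed.

Lemma smooth_uptoM V n (f g : V -> R) : smooth_upto n f -> smooth_upto n g ->
  smooth_upto n (f * g).
Proof.
elim: n f g => // n IH f g sf sg.
have sf' := smooth_uptoS sf; have sg' := smooth_uptoS sg.
case: sf sg => df sf [dg sg]; split => [x|v]; first exact: differentiableM.
have -> : 'D_v (f * g) = f * 'D_v g + g * 'D_v f.
  by apply/funext => x; rewrite deriveM //; exact: diff_derivable.
by apply: smooth_uptoD; [exact: (IH _ _ sf' (sg v))|exact: (IH _ _ sg' (sf v))].
Qed.

Lemma derive_real (f : R -> R) x v : differentiable f x ->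
  'D_v f x = v * f^`()%classic x.
Proof.
move=> df; rewrite deriveE // deriv1E //; exact/derivable1_diffP.
Qed.

Lemma smooth_upto_comp V n (f : R -> R) (g : V -> R) : smooth_upto n f ->
  smooth_upto n g -> smooth_upto n (f \o g).
Proof.
elim: n f g => // n IH f g sf sg; have sg' := smooth_uptoS sg.
case: sf sg => df sf [dg sg]; split => [x|v]; first exact: differentiable_comp.
have -> : 'D_v (f \o g) = (('D_1 f) \o g) * 'D_v g.
  apply/funext => x; rewrite deriveE; last exact: differentiable_comp.
  rewrite diff_comp //= deriv1E; last exact/derivable1_diffP.
  by rewrite fctE /= (deriveE _ (dg x)) -derive1E mulrC.
apply: smooth_uptoM; last exact: sg.
  apply: IH; [exact: sf|exact: sg'].
Qed.

Lemma smooth_upto_linear V n (L : {linear V -> R}) : continuous L -> smooth_upto n L.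
Proof.
case: n => // n cL; split => [x|v]; first exact: linear_differentiable.
have -> : 'D_v L = cst (L v).
  apply/funext => x; rewrite deriveE; last exact: linear_differentiable.
  by rewrite diff_lin.
exact: smooth_upto_cst.
Qed.

Lemma smooth_cst V (k : R) : smooth (cst k : V -> R).
Proof. by apply/smoothP => n; exact: smooth_upto_cst. Qed.

Lemma smoothD V (f g : V -> R) : smooth f -> smooth g -> smooth (f + g).
Proof. by move=> /smoothP sf /smoothP sg; apply/smoothP => n; exact: smooth_uptoD. Qed.

Lemma smoothM V (f g : V -> R) : smooth f -> smooth g -> smooth (f * g).
Proof. by move=> /smoothP sf /smoothP sg; apply/smoothP => n; exact: smooth_uptoM. Qed.

Lemma smoothZ V a (f : V -> R) : smooth f -> smooth (a *: f).
Proof. by move=> sf; exact: (@smoothM V (cst a) f (smooth_cst a) sf). Qed.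

Lemma smooth_comp V (f : R -> R) (g : V -> R) : smooth f -> smooth g -> smooth (f \o g).
Proof. by move=> /smoothP sf /smoothP sg; apply/smoothP => n; exact: smooth_upto_comp. Qed.

Lemma smooth_derive V (f : V -> R) v : smooth f -> smooth ('D_v f).
Proof. by move=> /smoothP sf; apply/smoothP => n; have [_] := sf n.+1; exact. Qed.

Lemma smooth_differentiable V (f : V -> R) x : smooth f -> differentiable f x.
Proof. by move=> /smoothP /(_ 1%N) []. Qed.

Lemma smooth_continuous V (f : V -> R) : smooth f -> continuous f.
Proof. by move=> sf x; apply: differentiable_continuous; exact: smooth_differentiable. Qed.

Lemma smooth_id : smooth (id : R -> R).
Proof.
apply/smoothP => n.
exact: (@smooth_upto_linear _ n (idfun : {linear R -> R}) (fun x => @cvg_id _ _)).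
Qed.

Lemma smooth_fst : smooth (fst : R * R -> R).
Proof.
apply/smoothP => n.
have c : continuous (fst : R * R -> R) by move=> x; exact: cvg_fst.
have := @smooth_upto_linear (R * R)%type n fst c; exact.
Qed.

Lemma smooth_snd : smooth (snd : R * R -> R).
Proof.
apply/smoothP => n.
have c : continuous (snd : R * R -> R) by move=> x; exact: cvg_snd.
have := @smooth_upto_linear (R * R)%type n snd c; exact.
Qed.

Lemma smooth_derive1 (f : R -> R) : smooth f -> smooth (f^`()%classic).
Proof.
move=> sf; have -> : f^`()%classic = 'D_1 f by apply/funext => x; rewrite derive1E.
exact: smooth_derive.
Qed.

Lemma smooth_derive1n n (f : R -> R) : smooth f -> smooth (derive1n n f).
Proof. by move=> sf; elim: n => //= n IH; exact: smooth_derive1. Qed.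

(** The functions [x^-k exp (- 1 / x)] on the positive axis, extended by zero;
    their span is closed under differentiation. *)
Definition hexp k (x : R) : R := if 0 < x then x^-1 ^+ k * expR (- x^-1) else 0.

Lemma hexp_bound k x : `|hexp k x| <= (k.+2)`!%:R * x ^+ 2.
Proof.
rewrite /hexp; case: ifPn => x0; last by rewrite normr0 mulr_ge0 ?sqr_ge0.
have y0 : 0 < x^-1 by rewrite invr_gt0.
rewrite ger0_norm; last by rewrite mulr_ge0 ?exprn_ge0 ?expR_ge0 // ltW.
have := expR_ge1Dxn k.+1 (ltW y0); rewrite expRN.
set y := x^-1 in y0 *; have -> : x = y^-1 by rewrite /y invrK.
set c : R := (k.+2)`!%:R; have c0 : 0 < c by rewrite ltr0n fact_gt0.
move=> h; have E0 := expR_gt0 y.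
rewrite ler_pdivrMr // [y^-1 ^+ 2]exprVn; apply: (@le_trans _ _ (c * y ^- 2 * (y ^+ k.+2 / c))).
  rewrite le_eqVlt; apply/orP; left; apply/eqP.
  rewrite -(addn2 k) exprD; set z := y ^+ k.
  have yn : y != 0 by rewrite gt_eqF.
  have cn : c != 0 by rewrite gt_eqF.
  by field; rewrite yn cn.
rewrite ler_pM2l; first by apply: le_trans h; rewrite lerDr.
by rewrite mulr_gt0 // invr_gt0 exprn_gt0.
Qed.

Lemma is_derive_hexp k (x : R) :
  is_derive x 1 (hexp k) (- k%:R * hexp k.+1 x + hexp k.+2 x).
Proof.
have [x0|x0|->] := ltgtP x 0.
- rewrite /hexp ltNge (ltW x0) /= mulr0 addr0.
  apply: (@near_eq_is_derive _ _ _ (cst 0)).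
  near=> y; rewrite /hexp ltNge; suff -> : y <= 0 by [].
  by near: y; apply: filterS (lt_nbhsl x0) => z /ltW.
- rewrite /hexp x0.
  apply: (@near_eq_is_derive _ _ _ ((fun z => z ^+ k * expR (- z)) \o (fun y : R => y^-1))).
    near=> y; suff -> : 0 < y by [].
    by near: y; exact: lt_nbhsr.
  have xn0 : x != 0 by rewrite gt_eqF.
  have d1 : is_derive x 1 (fun y : R => y^-1) (- x ^- 2).
    have := @is_deriveV R id x 1 1 xn0 (is_derive_id _ _).
    by rewrite /GRing.scale /= mulr1.
  have d2 : is_derive (x^-1) 1 (fun z : R => z ^+ k * expR (- z))
     (x^-1 ^+ k * - expR (- x^-1) + expR (- x^-1) * (k%:R * x^-1 ^+ k.-1)).
    have dz : is_derive (x^-1) 1 (fun z : R => z ^+ k) (k%:R * x^-1 ^+ k.-1).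
      have := @is_deriveX R R id k (x^-1) 1 1 (is_derive_id _ _).
      rewrite exprfctE => H; exact: (is_derive_eq H (mulr1 _)).
    have de : is_derive (x^-1) 1 (fun z : R => expR (- z)) (- expR (- x^-1)).
      have dn : is_derive (x^-1) 1 (fun z : R => - z) (- 1).
        exact: (@is_deriveN R R R id (x^-1) 1 1 (is_derive_id _ _)).
      by have := is_derive1_comp (is_derive_expR _) dn; rewrite mulrN1.
    exact: (is_deriveM dz de).
  apply: (is_derive_eq (is_derive1_comp d2 d1)).
  case: k d2 => [|k] _ /=; first by rewrite expr0 exprS expr1; field.
  rewrite !exprS; by field.
- rewrite [hexp k.+1 _]/hexp [hexp k.+2 _]/hexp ltxx mulr0 addr0.
  have L : h^-1 *: ((hexp k \o shift (0 : R)) (h *: 1) - hexp k 0) @[h --> (0 : R)^'] --> (0 : R).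
    pose c : R := (k.+2)`!%:R; have c0 : 0 < c by rewrite ltr0n fact_gt0.
    apply/cvgr0Pnorm_lt => e e0; near=> h.
    have h0 : h != 0 by near: h; exact: nbhs_dnbhs_neq.
    rewrite /= addr0 /GRing.scale /= mulr1 [hexp k 0]/hexp ltxx subr0 normrM normfV.
    apply: (@le_lt_trans _ _ (c * `|h|)).
      rewrite mulrC ler_pdivrMr ?normr_gt0 // -mulrA -expr2 real_normK ?num_real //.
      exact: hexp_bound.
    rewrite mulrC -ltr_pdivlMr //; near: h; apply: dnbhs0_lt; exact: divr_gt0.
  by apply: DeriveDef; [apply/cvg_ex; exists 0|apply/cvg_lim].
Unshelve. all: by end_near.
Qed.

Lemma smooth_hexp k : smooth (hexp k).
Proof.
apply/smoothP => n; elim: n k => // n IH k.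
have dh x : differentiable (hexp k) x.
  by apply/derivable1_diffP; have [] := is_derive_hexp k x.
split => // v.
have -> : 'D_v (hexp k) = cst v * (cst (- k%:R) * hexp k.+1 + hexp k.+2).
  apply/funext => x; rewrite derive_real // derive1E.
  by have /@derive_val -> := is_derive_hexp k x.
apply: smooth_uptoM; first exact: smooth_upto_cst.
apply: smooth_uptoD => //; apply: smooth_uptoM => //; exact: smooth_upto_cst.
Qed.

(** Smooth bumps on [[a, b]] increasing to the indicator of [(a, b)] with [n]. *)
Definition bump n (a b x : R) : R :=
  hexp 0 (n.+1%:R * (x - a)) * hexp 0 (n.+1%:R * (b - x)).

Lemma smooth_bump n a b : smooth (bump n a b).
Proof.
have affine (u v w : R) : smooth (fun x : R => u * (v * x + w)).
  have -> : (fun x : R => u * (v * x + w)) = cst u * (cst v * id + cst w) by [].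
  apply: smoothM; first exact: smooth_cst.
  by apply: smoothD; [apply: smoothM; [exact: smooth_cst|exact: smooth_id]|exact: smooth_cst].
have -> : bump n a b = ((hexp 0) \o (fun x => n.+1%:R * (1 * x + (- a)))) *
    ((hexp 0) \o (fun x => n.+1%:R * (-1 * x + b))).
  by apply/funext => x; rewrite /bump fctE /= mul1r mulN1r (addrC (- x)).
by apply: smoothM; apply: smooth_comp => //; exact: smooth_hexp.
Qed.

Lemma hexp0_ge0 x : 0 <= hexp 0 x.
Proof. by rewrite /hexp; case: ifP => // _; rewrite expr0 mul1r expR_ge0. Qed.

Lemma hexp0_le1 x : hexp 0 x <= 1.
Proof.
rewrite /hexp; case: ifPn => // x0; rewrite expr0 mul1r.
by rewrite expR_le1 oppr_le0 invr_ge0 ltW.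
Qed.

Lemma bump_ge0 n a b x : 0 <= bump n a b x.
Proof. by rewrite mulr_ge0 ?hexp0_ge0. Qed.

Lemma bump_le1 n a b x : bump n a b x <= 1.
Proof. by rewrite mulr_ile1 ?hexp0_ge0 ?hexp0_le1. Qed.

Lemma bump_out n a b x : ~ `]a, b[%classic x -> bump n a b x = 0.
Proof.
move=> /= nx; rewrite /bump /hexp !pmulr_rgt0 ?ltr0n // !subr_gt0.
by case: ifPn => ax; case: ifPn => xb; rewrite ?mul0r ?mulr0 //; case: nx; rewrite in_itv /= ax.
Qed.

Lemma bump_cvg a b x : `]a, b[%classic x -> bump n a b x @[n --> \oo] --> (1 : R).
Proof.
rewrite /= in_itv /= => /andP[ax xb].
have h (y : R) : 0 < y -> hexp 0 (n.+1%:R * y) @[n --> \oo] --> (1 : R).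
  move=> y0.
  have -> : (fun n => hexp 0 (n.+1%:R * y)) = (fun n => expR (- (y^-1 * n.+1%:R^-1))).
    apply/funext => n; rewrite /hexp pmulr_rgt0 ?ltr0n // y0 expr0 mul1r invfM.
    by rewrite mulrC.
  rewrite -[X in _ --> X]expR0 -[X in expR X]oppr0 -[X in - X](mulr0 y^-1).
  apply: (cvg_comp _ expR _ (@continuous_expR R _)).
  by apply: cvgN; apply: cvgMr; exact: cvg_harmonic.
rewrite -[X in _ --> X]mulr1; apply: cvgM; apply: h; by rewrite subr_gt0.
Qed.

Lemma bump_test (J : set R) n a b : `[a, b] `<=` J -> test_function J (bump n a b).
Proof.
move=> abJ; split; first exact: smooth_bump.
exists `[a, b]%classic; split => //; first exact: segment_compact.
move=> x nx; apply: bump_out => xab; apply: nx; move: xab; rewrite /= !in_itv /=.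
by move=> /andP[/ltW -> /ltW ->].
Qed.

Lemma test0 V (J : set V) : J !=set0 -> test_function J (cst 0 : V -> R).
Proof.
move=> [x Jx]; split; first exact: smooth_cst.
exists [set x]; split => //; first exact: compact_set1.
by move=> _ ->.
Qed.

Definition bump_seq (J : set R) k : R -> R :=
  if unpickle k is Some ((p, q), n) then
    if `[< `[ratr p, ratr q]%classic `<=` J >] then bump n (ratr p) (ratr q)
    else cst 0
  else cst 0.

Lemma bump_seq_test J k : J !=set0 -> test_function J (bump_seq J k).
Proof.
move=> J0; rewrite /bump_seq; case: unpickle => [[[p q] n]|]; last exact: test0.
by case: asboolP => [h|_]; [exact: bump_test|exact: test0].
Qed.

Notation mu := (@lebesgue_measure R).

#[local] Instance ae_mu : Filter (almost_everywhere mu) := ae_filter_ringOfSetsType mu.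

Definition locally_integrable_on (J : set R) (f : R -> R) :=
  forall a b, `[a, b]%classic `<=` J ->
  mu.-integrable (`[a, b]%classic : set (measurableTypeR R)) (EFin \o f).

Lemma Rintegral_supported (J K : set R) (f : R -> R) : K `<=` J ->
  (forall x, ~ K x -> f x = 0) -> \int[mu]_(x in J) f x = \int[mu]_(x in K) f x.
Proof.
move=> KJ f0; rewrite Rintegral_mkcond [RHS]Rintegral_mkcond.
apply: eq_Rintegral => x _; rewrite !patchE; case: ifPn => xJ; case: ifPn => xK //.
- by rewrite f0 //; move: xK; rewrite notin_setE.
- by move: xJ; rewrite notin_setE => /(_ (KJ _ (set_mem xK))).
Qed.

Lemma continuous_measurable (f : R -> R) : continuous f -> measurable_fun setT f.
Proof. by move=> cf; apply: continuous_measurable_fun. Qed.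

Lemma bump_integral0 (J : set R) f p q : locally_integrable_on J f ->
  (forall k, \int[mu]_(x in J) (f x * bump_seq J k x) = 0) ->
  `[ratr p, ratr q]%classic `<=` J -> \int[mu]_(x in `]ratr p, ratr q[) f x = 0.
Proof.
move=> locf f0 pqJ.
have pq : `]ratr p, ratr q[%classic `<=` `[ratr p : R, ratr q]%classic.
  by move=> x; rewrite /= !in_itv /= => /andP[/ltW -> /ltW ->].
have fi : mu.-integrable (`]ratr p, ratr q[%classic : set (measurableTypeR R)) (EFin \o f).
  by apply: (@integrableS _ _ _ mu `[ratr p, ratr q] _ (EFin \o f)) => //; exact: locf.
have mf := measurable_int _ fi.
pose b n := bump n (ratr p : R) (ratr q).
have mb n D : measurable_fun D (b n).
  apply: measurable_funTS; apply: continuous_measurable.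
  exact/smooth_continuous/smooth_bump.
have bi n : \int[mu]_(x in `]ratr p, ratr q[) (f x * b n x) = 0.
  have := f0 (pickle ((p, q), n)); rewrite /bump_seq pickleK asboolT // => h.
  rewrite -[RHS]h; symmetry; apply: Rintegral_supported; first exact: subset_trans pq pqJ.
  by move=> x /bump_out ->; rewrite mulr0.
have mfb n : measurable_fun (`]ratr p, ratr q[%classic : set R) (fun x => (f x * b n x)%:E).
  by apply/measurable_EFinP/measurable_funM => //; exact/measurable_EFinP.
have bd n x : (`|(f x * b n x)%:E| <= `|(f x)%:E|)%E.
  by rewrite lee_fin normrM ler_piMr // ger0_norm ?bump_ge0 ?bump_le1.
have ibn n : mu.-integrable `]ratr p, ratr q[ (fun x => (f x * b n x)%:E).
  apply: (@le_integrable _ _ _ mu _ _ _ (EFin \o f)) => //; first exact: mfb.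
have := @dominated_cvg _ _ _ mu `]ratr p, ratr q[ _ (fun n x => (f x * b n x)%:E)
  (EFin \o f) (fun x => `|(f x)%:E|)%E mfb.
move=> /(_ (ltac:(by [])))h.
have {}h : (\int[mu]_(x in `]ratr p, ratr q[) (f x * b n x)%:E)%E @[n --> \oo] -->
    (\int[mu]_(x in `]ratr p, ratr q[) (EFin \o f) x)%E.
  apply: h => //.
  - move=> x xpq; apply: cvg_EFin; first by near=> n.
    rewrite -[X in _ --> X]mulr1; apply: cvgMr; exact: bump_cvg.
  - exact: integrable_abse.
have E n : (\int[mu]_(x in `]ratr p, ratr q[) (f x * b n x)%:E)%E = 0%E.
  rewrite -(fineK (integrable_fin_num _ (ibn n))) //.
  by have := bi n; rewrite /Rintegral => ->.
move: h; under eq_fun do rewrite E.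
move=> /cvg_lim => /(_ (@ereal_hausdorff R)); rewrite lim_cst //.
by rewrite /Rintegral => <-.
Unshelve. all: by end_near.
Qed.

Lemma bump_separates_itv (J : set R) f p q : locally_integrable_on J f ->
  (forall k, \int[mu]_(x in J) (f x * bump_seq J k x) = 0) ->
  `[ratr p, ratr q]%classic `<=` J ->
  {ae mu, forall x, `]ratr p, ratr q[%classic x -> f x = 0}.
Proof.
move=> locf f0 pqJ.
have [pq|qp] := ltP p q; last first.
  apply: aeW => x /=; rewrite in_itv /= => /andP[px xq].
  by have := lt_trans px xq; rewrite ltr_rat ltNge qp.
have pqR : (ratr p : R) < ratr q by rewrite ltr_rat.
have fi := locf _ _ pqJ.
pose F (x : R) := \int[mu]_(t in `[ratr p, x]) f t.
have F0r r : ratr p < (ratr r : R) < ratr q -> F (ratr r) = 0.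
  move=> /andP[pr rq]; rewrite /F.
  have sub : `[ratr p, ratr r]%classic `<=` `[ratr p : R, ratr q]%classic.
    by move=> y; rewrite /= !in_itv /= => /andP[-> yr] /=; exact: (ltW (le_lt_trans yr rq)).
  rewrite -(bump_integral0 (p := p) (q := r) locf f0 (subset_trans sub pqJ)).
  have mf : measurable_fun (`]ratr p, ratr r[%classic : set R) (EFin \o f).
    apply: measurable_funS (measurable_int _ fi) => //.
    by move=> x; rewrite /= !in_itv /= => /andP[/ltW -> xr] /=; exact: (ltW (lt_trans xr rq)).
  by rewrite /Rintegral integral_itv_bndoo.
have cF : {within `[ratr p, ratr q], continuous F}.
  by apply: parameterized_integral_continuous => //; exact: ltW.
have F0 x : ratr p < x < ratr q -> F x = 0.
  move=> xpq; have [px xq] := andP xpq; apply: contrapT => Fx.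
  have cx : {for x, continuous F}.
    by have [cI _ _] := (continuous_within_itvP F pqR).1 cF; apply: cI; rewrite in_itv.
  have nF : \forall y \near x, F y != 0.
    have e0 : 0 < `|F x| by rewrite normr_gt0; exact/eqP.
    have := cx; move=> /cvgrPdist_lt /(_ _ e0); apply: filterS => y h.
    by apply/eqP => Fy; move: h; rewrite Fy subr0 ltxx.
  have nI : \forall y \near x, ratr p < y < ratr q by exact: near_in_itvoo.
  have [e /= e0 he] : exists2 e : R, 0 < e & forall y, `|x - y| < e -> F y != 0 /\ ratr p < y < ratr q.
    have [e /= e0 he] := filterI nF nI; exists e => // y xy; exact: he.
  have /rat_in_itvoo[r] : x < x + e by rewrite ltrDl.
  rewrite in_itv /= => /andP[r1 r2].
  have [] := he (ratr r); first by rewrite ltr0_norm ?subr_lt0 //; lra.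
  by move=> + hr; rewrite F0r ?eqxx.
pose g := f \_ `[ratr p : R, ratr q].
have gi : mu.-integrable setT (EFin \o g).
  have mD : measurable (`[ratr p, ratr q]%classic : set (measurableTypeR R)) by [].
  by have := (@integrable_mkcond _ (measurableTypeR R) R mu _ (EFin \o f) mD).1 fi; rewrite restrict_EFin.
have gi' y : mu.-integrable [set` Interval (BLeft (ratr p)) (BRight y)] (EFin \o g).
  exact: integrableS gi.
have gl : locally_integrable [set: R] g.
  by apply: open_integrable_locally => //; exact: openT.
have := FTC1 gi' gl.
apply: filterS => x h /=; rewrite in_itv /= => /andP[px xq].
have [|_] := h; first by rewrite ?bnd_simp ?lte_fin ?(ltW px).
have Gx : \near x, (fun x => \int[mu]_(t in [set` Interval (BLeft (ratr p)) (BRight x)]) g t) x = cst 0 x.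
  have : \forall y \near x, ratr p < y < ratr q by apply: near_in_itvoo; rewrite in_itv /= px.
  apply: filterS => y ypq; rewrite -(F0 y ypq) /F; apply: eq_Rintegral => t.
  rewrite inE /= in_itv /= => /andP[pt ty].
  by rewrite /g patchE mem_set //= in_itv /= pt (le_trans ty) // ltW //; case/andP: ypq.
rewrite derive1E (near_eq_derive _ Gx) derive_cst.
by rewrite /g patchE mem_set //= in_itv /= !ltW.
Qed.

(** Bumps increase to the indicator of a rational interval, so dominated
    convergence makes the integral of [f] over every such interval vanish. *)
Lemma bump_separates (J : set R) f : open J -> locally_integrable_on J f ->
  (forall k, \int[mu]_(x in J) (f x * bump_seq J k x) = 0) ->
  {ae mu, forall x, J x -> f x = 0}.
Proof.
move=> oJ locf f0.
pose P k x := forall p q : rat, unpickle k = Some (p, q) ->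
  `[ratr p, ratr q]%classic `<=` J -> `]ratr p, ratr q[%classic x -> f x = 0.
have : {ae mu, forall x, forall k, P k x}.
  apply: ae_foralln => k; rewrite /P.
  case: (unpickle k) => [[p q]|]; last by apply: aeW.
  have [pqJ|npqJ] := pselect (`[ratr p, ratr q]%classic `<=` J); last first.
    by apply: aeW => x p' q' [<- <-] /npqJ.
  by apply: filterS (bump_separates_itv locf f0 pqJ) => x h p' q' [<- <-].
apply: filterS => x h Jx.
have [e /= e0 he] : exists2 e : R, 0 < e & forall y, `|x - y| < e -> J y.
  by have [e /= e0 he] := open_nbhs_nbhs (conj oJ Jx); exists e.
have /rat_in_itvoo[p] : x - e < x by lra.
have /rat_in_itvoo[q] : x < x + e by lra.
rewrite !in_itv /= => /andP[q1 q2] /andP[p1 p2].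
apply: (h (pickle (p, q)) p q); rewrite ?pickleK //= ?in_itv /= ?q1 ?p2 //.
move=> y; rewrite /= in_itv /= => /andP[y1 y2]; apply: he.
by rewrite ltr_norml; apply/andP; split; lra.
Qed.

End smooth_functions.

(** * Plancherel's identity *)

Section plancherel.
Context {R : realType}.
Notation mu := (@lebesgue_measure R).
Implicit Types (f g G : R -> R) (e t x y u M : R).

#[local] Instance ae_mu_plancherel : Filter (almost_everywhere mu) :=
  ae_filter_ringOfSetsType mu.

Notation pos := (`[0, +oo[%classic : set (measurableTypeR R)).

Lemma integral_halves f : measurable_fun setT f -> (forall t, 0 <= f t) ->
  (\int[mu]_t (f t)%:E = \int[mu]_(t in pos) (f (- t))%:E + \int[mu]_(t in pos) (f t)%:E)%E.
Proof.
move=> mf f0.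
have -> : (setT : set (measurableTypeR R)) = `]-oo, 0]%classic `|` `]0, +oo[%classic.
  by apply/seteqP; split=> // t _ /=; rewrite !in_itv /= andbT; case: (leP t 0) => h; [left|right].
rewrite ge0_integral_setU //=; last 2 first.
- by move=> t _; rewrite lee_fin.
- by apply/disj_setPS => t [] /=; rewrite !in_itv /= andbT => t0 /lt_le_trans /(_ t0); rewrite ltxx.
  rewrite integral_itv_obnd_cbnd; last by apply/measurable_EFinP; exact: measurable_funTS.
  congr (_ + _)%E.
  have mfN : measurable_fun setT (fun t => (f (- t))%:E).
    by apply/measurable_EFinP; apply: (measurableT_comp mf); exact: oppr_measurable.
  rewrite (ge0_integration_by_substitution0 mfN) //.
    by apply: eq_integral => t _; rewrite opprK.
  by move=> t; rewrite lee_fin.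
by apply/measurable_EFinP; exact: measurable_funTS.
Qed.

Lemma integral_even f : measurable_fun setT f -> (forall t, 0 <= f t) ->
  (forall t, f (- t) = f t) ->
  (\int[mu]_t (f t)%:E = 2%:E * \int[mu]_(t in pos) (f t)%:E)%E.
Proof.
move=> mf f0 fe; rewrite integral_halves //.
by under [X in (X + _)%E = _]eq_integral do rewrite fe; rewrite -mule2n mule_natl.
Qed.

Lemma ip_even_odd f g : L2 mu f -> L2 mu g ->
  (forall t, f (- t) = f t) -> (forall t, g (- t) = - g t) -> ip mu f g = 0.
Proof.
move=> Lf Lg fe go.
have H := L2_hilbert mu.
have LD : L2 mu (f + g) := hSD H Lf Lg.
have LB : L2 mu (f - g) := hSB H Lf Lg.
have : ip mu (f + g) (f + g) = ip mu (f - g) (f - g).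
  suff h : (\int[mu]_x ((f + g) x ^+ 2)%:E = \int[mu]_x ((f - g) x ^+ 2)%:E)%E.
    by move: h; rewrite !L2_ipE // => -[].
  have ms h : L2 mu h -> measurable_fun setT (fun x => h x ^+ 2).
    by move=> [mh _]; exact: measurable_funX.
  rewrite (integral_halves (ms _ LD)); last by move=> t; exact: sqr_ge0.
  rewrite (integral_halves (ms _ LB)); last by move=> t; exact: sqr_ge0.
  rewrite addeC; congr (_ + _)%E; apply: eq_integral => t _; rewrite !fctE ?fe ?go //.
  by rewrite opprK.
rewrite (hnD H Lf Lg) (hnB H Lf Lg); lra.
Qed.

Lemma is_derive_expN e t : is_derive t 1 (fun t => expR (- (e * t))) (- e * expR (- (e * t))).
Proof.
have d : is_derive t 1 (fun t => - (e * t)) (- e).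
  have -> : (fun t => - (e * t)) = (- e) *: (id : R -> R).
    by apply/funext => s; rewrite fctE /GRing.scale /= mulNr.
  by apply: is_derive_eq; rewrite /GRing.scale /= mulr1.
by apply: (is_derive_eq (is_derive1_comp (is_derive_expR _) d)); rewrite mulrC.
Qed.

Lemma is_derive_trig (z t : R) :
  is_derive t 1 (fun t => sin (t * z)) (z * cos (t * z)) /\
  is_derive t 1 (fun t => cos (t * z)) (- z * sin (t * z)).
Proof.
have d : is_derive t 1 (fun t => t * z) z.
  have -> : (fun t => t * z) = z *: (id : R -> R).
    by apply/funext => s; rewrite fctE /GRing.scale /= mulrC.
  by apply: is_derive_eq; rewrite /GRing.scale /= mulr1.
split.
- by apply: (is_derive_eq (is_derive1_comp (is_derive_sin _) d)); rewrite mulrC.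
- by apply: (is_derive_eq (is_derive1_comp (is_derive_cos _) d)); rewrite mulNr mulrC mulNr.
Qed.

Lemma cvg_expN e : 0 < e -> expR (- (e * t)) @[t --> +oo] --> (0 : R).
Proof.
move=> e0; apply: (@cvg_comp _ _ _ (fun t => e * t) (fun s => expR (- s))); last exact: cvgr_expR.
by apply: gt0_cvgMry => //; exact: cvg_id.
Qed.

Lemma exp_trig_integral e (z : R) : 0 < e ->
  [/\ mu.-integrable pos (fun t => (expR (- (e * t)))%:E),
      (\int[mu]_(t in pos) (expR (- (e * t)))%:E = (e^-1)%:E)%E &
      \int[mu]_(t in pos) (expR (- (e * t)) * cos (t * z)) = e / (e ^+ 2 + z ^+ 2)].
Proof.
move=> e0; have en0 : e != 0 by rewrite gt_eqF.
have D0 : 0 < e ^+ 2 + z ^+ 2 by rewrite ltr_pwDl ?exprn_gt0 ?sqr_ge0.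
have Dn0 : e ^+ 2 + z ^+ 2 != 0 by rewrite gt_eqF.
pose E t := expR (- (e * t)).
have dE t : is_derive t 1 E (- e * E t) := is_derive_expN e t.
have cE : continuous E by move=> t; apply/differentiable_continuous/derivable1_diffP; have [] := dE t.
have cc : continuous (fun t => cos (t * z)).
  by move=> t; apply/differentiable_continuous/derivable1_diffP; have [_ []] := is_derive_trig z t.
pose F0 t := - e^-1 * E t.
have dF0 t : is_derive t 1 F0 (E t).
  have := @is_deriveZ R R R E (- e^-1) t 1 _ (dE t).
  move=> h; apply: (is_derive_eq h); rewrite /GRing.scale /=; by field.
pose F1 t := E t * (z * sin (t * z) - e * cos (t * z)) / (e ^+ 2 + z ^+ 2).
have dF1 t : is_derive t 1 F1 (E t * cos (t * z)).
  have [ds dc] := is_derive_trig z t.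
  have d1 := is_deriveB (@is_deriveZ R R R _ z t 1 _ ds) (@is_deriveZ R R R _ e t 1 _ dc).
  have d2 := @is_deriveZ R R R _ (e ^+ 2 + z ^+ 2)^-1 t 1 _ (is_deriveM (dE t) d1).
  have -> : F1 = (e ^+ 2 + z ^+ 2)^-1 *: (E * (z *: (fun t => sin (t * z)) - e *: (fun t => cos (t * z)))).
    by apply/funext => s; rewrite /F1 !fctE /GRing.scale /= mulrC.
  apply: (is_derive_eq d2); rewrite !fctE /GRing.scale /= /GRing.scale /=.
  by field.
have l0 : F0 t @[t --> +oo] --> (0 : R).
  by rewrite -[X in _ --> X](mulr0 (- e^-1)); apply: cvgMr; exact: cvg_expN.
have l1 : F1 t @[t --> +oo] --> (0 : R).
  pose K := (`|z| + e) / (e ^+ 2 + z ^+ 2).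
  have K0 : 0 <= K by rewrite divr_ge0 ?(ltW D0) ?addr_ge0 ?normr_ge0 ?(ltW e0).
  have lk : K * E t @[t --> +oo] --> (0 : R).
    by rewrite -[X in _ --> X](mulr0 K); apply: cvgMr; exact: cvg_expN.
  have lk' : - (K * E t) @[t --> +oo] --> (0 : R) by rewrite -oppr0; exact: cvgN.
  apply: (squeeze_cvgr _ lk' lk); near=> t.
  have b : `|F1 t| <= K * E t.
    rewrite /F1 /K !normrM normfV (gtr0_norm D0) (ger0_norm (expR_ge0 _)).
    rewrite [leRHS]mulrC mulrA; apply: ler_wpM2r; first by rewrite invr_ge0 ltW.
    apply: ler_wpM2l; first exact: expR_ge0.
    apply: le_trans (ler_normB _ _) _; rewrite !normrM (gtr0_norm e0).
    have s1 : `|sin (t * z)| <= 1 by rewrite ler_norml sin_geN1 sin_le1.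
    have c1 : `|cos (t * z)| <= 1 by rewrite ler_norml cos_geN1 cos_le1.
    by apply: lerD; rewrite ler_piMr // ltW.
  by move: b; rewrite ler_norml.
have cont_at (F g : R -> R) t : is_derive t 1 F (g t) -> F x @[x --> t] --> F t.
  by move=> [dF _]; apply: differentiable_continuous; exact/derivable1_diffP.
have ftc (F g : R -> R) : continuous g -> (forall t, 0 <= t -> 0 <= g t) ->
   (forall t, is_derive t 1 F (g t)) -> F t @[t --> +oo] --> (0 : R) ->
   (\int[mu]_(t in pos) (g t)%:E = (- F 0)%:E)%E.
  move=> cg g0 dF lF.
  have := @ge0_continuous_FTC2y R g F 0 0 g0.
  rewrite -EFinB sub0r; apply => //.
  - exact: continuous_subspaceT.
  - by apply: cvg_at_right_filter; exact: (cont_at F g 0 (dF 0)).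
  - by move=> t _; rewrite derive1E; have [_] := dF t.
have I0 : (\int[mu]_(t in pos) (E t)%:E = (e^-1)%:E)%E.
  rewrite (ftc F0) //; last by move=> t _; exact: expR_ge0.
  by rewrite /F0 /E mulr0 oppr0 expR0 mulr1 opprK.
have mE (D : set (measurableTypeR R)) (h : R -> R) : continuous h -> measurable_fun D (EFin \o h).
  by move=> ch; apply/measurable_EFinP/measurable_funTS; exact: continuous_measurable.
have iE : mu.-integrable pos (fun t => (E t)%:E).
  apply: (@ge0_integrable _ _ _ mu) => //; last by rewrite I0 ltry.
  - by apply: measurable_funTS; exact: continuous_measurable.
  - by move=> t; exact: expR_ge0.
have cEc : continuous (fun t => E t * cos (t * z)) by move=> t; apply: cvgM; [exact: cE|exact: cc].
have I1 : (\int[mu]_(t in pos) (E t * (1 + cos (t * z)))%:E = (e^-1 + e / (e ^+ 2 + z ^+ 2))%:E)%E.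
  have c1 : continuous (fun t => E t * (1 + cos (t * z))).
    by move=> t; apply: cvgM; [exact: cE|apply: cvgD; [exact: cvg_cst|exact: cc]].
  have c2 t : 0 <= t -> 0 <= E t * (1 + cos (t * z)).
    by move=> _; rewrite mulr_ge0 ?expR_ge0 //; have := cos_geN1 (t * z); lra.
  have d t : is_derive t 1 (fun t => F0 t + F1 t) (E t * (1 + cos (t * z))).
    by apply: (is_derive_eq (is_deriveD (dF0 t) (dF1 t))); ring.
  have l : F0 t + F1 t @[t --> +oo] --> (0 : R).
    by rewrite -[X in _ --> X](addr0 0); exact: cvgD.
  rewrite (ftc _ _ c1 c2 d l) /F0 /F1 /E mulr0 oppr0 expR0 mul0r sin0 cos0.
  by congr (_%:E); field; rewrite en0 Dn0.
have iEc : mu.-integrable pos (EFin \o (fun t => E t * cos (t * z))).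
  apply: (@le_integrable _ _ _ mu _ _ _ _ _ _ iE) => //; first exact: mE.
  move=> t _ /=; rewrite lee_fin normrM ler_piMr //.
  by rewrite ler_norml cos_geN1 cos_le1.
split => //.
have := I1; under eq_integral do rewrite mulrDr mulr1 EFinD.
rewrite integralD // I0 -(fineK (integrable_fin_num _ iEc)) // -EFinD => -[].
by move=> /addrI.
Unshelve. all: by end_near.
Qed.

Lemma poisson_mass : (\int[mu]_u ((1 + u ^+ 2)^-1)%:E = pi%:E)%E.
Proof.
have D u : 0 < 1 + u ^+ 2 :> R by rewrite ltr_pwDl ?sqr_ge0.
have c : continuous (fun u : R => (1 + u ^+ 2)^-1).
  move=> u; apply: cvgV; first by rewrite gt_eqF.
  by apply: cvgD; [exact: cvg_cst|exact: (@exprn_continuous R 2 u)].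
rewrite integral_even.
- have := @ge0_continuous_FTC2y R (fun u => (1 + u ^+ 2)^-1) (@atan R) 0 (pi / 2).
  move=> ->.
  + by rewrite atan0 sube0 -EFinM; congr (_%:E); field.
  + by move=> x _; rewrite invr_ge0 ltW.
  + exact: continuous_subspaceT.
  + exact: cvgy_atan.
  + by move=> x _; have [] := is_derive1_atan x.
  + by apply: cvg_at_right_filter; exact: continuous_atan.
  + by move=> x _; rewrite derive1E; have [_] := is_derive1_atan x.
- exact: continuous_measurable.
- by move=> t; rewrite invr_ge0 ltW.
- by move=> t; rewrite sqrrN.
Qed.

Lemma poisson_subst f e x M : 0 < e -> continuous f -> (forall y, `|f y| <= M) ->
  \int[mu]_y (f y * (e / (e ^+ 2 + (x - y) ^+ 2))) =
  \int[mu]_u (f (x + e * u) * (1 + u ^+ 2)^-1).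
Proof.
move=> e0 cf fM.
have D u : 0 < 1 + u ^+ 2 :> R by rewrite ltr_pwDl ?sqr_ge0.
have De u : 0 < e ^+ 2 + (x - u) ^+ 2 :> R by rewrite ltr_pwDl ?exprn_gt0 ?sqr_ge0.
have cP : continuous (fun u : R => (1 + u ^+ 2)^-1).
  move=> u; apply: cvgV; first by rewrite gt_eqF.
  by apply: cvgD; [exact: cvg_cst|exact: (@exprn_continuous R 2 u)].
have ck : continuous (fun y => e / (e ^+ 2 + (x - y) ^+ 2)).
  move=> y; apply: cvgMr; apply: cvgV; first by rewrite gt_eqF.
  apply: cvgD; first exact: cvg_cst.
  apply: (@cvg_comp _ _ _ (fun y => x - y) (fun z => z ^+ 2)); last exact: exprn_continuous.
  by apply: cvgB; [exact: cvg_cst|exact: cvg_id].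
have cx : continuous (fun u : R => x + e * u).
  by move=> u; apply: cvgD; [exact: cvg_cst|apply: cvgMr; exact: cvg_id].
have cfx : continuous (fun u : R => f (x + e * u)).
  by move=> u; apply: (@cvg_comp _ _ _ (fun u => x + e * u) f); [exact: cx|exact: cf].
have dA (u : R) : is_derive u 1 (fun u : R => x + e * u) e.
  have dZ : is_derive u 1 (e *: (id : R -> R)) e.
    by apply: is_derive_eq; rewrite /GRing.scale /= mulr1.
  by have := is_deriveD (is_derive_cst x u 1) dZ; rewrite add0r.
have dA' : ((fun u : R => x + e * u)^`())%classic = cst e.
  by apply/funext => u; rewrite derive1E; have [_] := dA u.
have sub G : continuous G -> (forall y, 0 <= G y) ->
   (\int[mu]_y (G y)%:E = \int[mu]_u (G (x + e * u) * e)%:E)%E.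
  move=> cG G0.
  have h1 : {homo (fun u => x + e * u) : a b / a < b}.
    by move=> a b ab; rewrite ltrD2l ltr_pM2l.
  have h2 : continuous ((fun u => x + e * u)^`())%classic.
    by rewrite dA' => u; exact: cvg_cst.
  have h3 : cvg (((fun u => x + e * u)^`())%classic u @[u --> -oo]).
    by rewrite dA'; exact: is_cvg_cst.
  have h4 : cvg (((fun u => x + e * u)^`())%classic u @[u --> +oo]).
    by rewrite dA'; exact: is_cvg_cst.
  have h5 u : derivable (fun u => x + e * u) u 1 by have [] := dA u.
  have h6 : x + e * u @[u --> -oo] --> -oo.
    apply/cvgrNyPle => A; exists ((A - x) / e); split; first exact: num_real.
    by move=> u /=; rewrite ltr_pdivlMr // mulrC => h; lra.
  have h7 : x + e * u @[u --> +oo] --> +oo.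
    apply/cvgryPge => A; exists ((A - x) / e); split; first exact: num_real.
    by move=> u /=; rewrite ltr_pdivrMr // mulrC => h; lra.
  rewrite (increasing_ge0_integration_by_substitutionT h1 h2 h3 h4 h5 h6 h7 cG G0).
  by rewrite dA'.
have kE u : e / (e ^+ 2 + (x - (x + e * u)) ^+ 2) * e = (1 + u ^+ 2)^-1.
  have en0 : e != 0 by rewrite gt_eqF.
  have := D u; have -> : e ^+ 2 + (x - (x + e * u)) ^+ 2 = e ^+ 2 * (1 + u ^+ 2) by ring.
  by move=> Du; field; rewrite en0 gt_eqF.
pose k y := e / (e ^+ 2 + (x - y) ^+ 2).
have k0 y : 0 <= k y by rewrite divr_ge0 ?ltW.
have M0 : 0 <= M by apply: le_trans (fM 0).
have mE (h : R -> R) : continuous h -> measurable_fun setT (EFin \o h).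
  by move=> ch; apply/measurable_EFinP; exact: continuous_measurable.
have ik : mu.-integrable setT (EFin \o k).
  apply: (@ge0_integrable _ _ _ mu) => //; first exact: continuous_measurable.
  by rewrite (sub k) //; under eq_integral do rewrite kE; rewrite poisson_mass ltry.
have iP : mu.-integrable setT (EFin \o (fun u : R => (1 + u ^+ 2)^-1)).
  apply: (@ge0_integrable _ _ _ mu) => //; first exact: continuous_measurable.
  - by move=> y; rewrite invr_ge0 ltW.
  - by rewrite poisson_mass ltry.
have bnd (h p : R -> R) : continuous h -> continuous p -> (forall y, `|h y| <= M) ->
    mu.-integrable setT (EFin \o p) -> mu.-integrable setT (EFin \o (fun y => h y * p y)).
  move=> ch cp hM ip0.
  have iMp := integrableZl measurableT M ip0.
  apply: (@le_integrable _ _ _ mu _ _ _ _ _ _ iMp) => //.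
    by apply: mE => y; apply: cvgM; [exact: ch|exact: cp].
  by move=> y _ /=; rewrite lee_fin !normrM (ger0_norm M0); apply: ler_wpM2r.
have ifk := bnd f k cf ck fM ik.
have ifP := bnd (fun u => f (x + e * u)) (fun u => (1 + u ^+ 2)^-1) cfx cP (fun u => fM _) iP.
have split_int (h p : R -> R) : mu.-integrable setT (EFin \o (fun y => h y * p y)) ->
    mu.-integrable setT (EFin \o p) ->
    \int[mu]_y ((h y + M) * p y) = \int[mu]_y (h y * p y) + M * \int[mu]_y p y.
  move=> i1 i2; rewrite -RintegralZl // -RintegralD //.
    by apply: eq_Rintegral => y _; rewrite mulrDl.
  exact: (integrableZl measurableT M i2).
have E0 : \int[mu]_y k y = \int[mu]_u (1 + u ^+ 2)^-1.
  rewrite /Rintegral (sub k) //; congr fine; apply: eq_integral => u _; by rewrite kE.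
have : \int[mu]_y ((f y + M) * k y) = \int[mu]_u ((f (x + e * u) + M) * (1 + u ^+ 2)^-1).
  rewrite /Rintegral (sub (fun y => (f y + M) * k y)).
  - by congr fine; apply: eq_integral => u _; rewrite -mulrA kE.
  - by move=> y; apply: cvgM; [apply: cvgD; [exact: cf|exact: cvg_cst]|exact: ck].
  - move=> y; rewrite mulr_ge0 //; have := fM y; rewrite ler_norml; lra.
by rewrite !split_int // E0 => /addIr.
Qed.

(** The kernel is an approximate identity of mass [pi]; after the substitution
    this is dominated convergence. *)
Lemma poisson_limit f x M : continuous f -> (forall y, `|f y| <= M) ->
  \int[mu]_y (f y * (n.+1%:R^-1 / (n.+1%:R^-1 ^+ 2 + (x - y) ^+ 2)))
    @[n --> \oo] --> pi * f x.
Proof.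
move=> cf fM; under eq_fun do rewrite (poisson_subst _ _ cf fM) //.
have D u : 0 < 1 + u ^+ 2 :> R by rewrite ltr_pwDl ?sqr_ge0.
have cP : continuous (fun u : R => (1 + u ^+ 2)^-1).
  move=> u; apply: cvgV; first by rewrite gt_eqF.
  by apply: cvgD; [exact: cvg_cst|exact: (@exprn_continuous R 2 u)].
have M0 : 0 <= M by apply: le_trans (fM 0).
have mE (h : R -> R) : continuous h -> measurable_fun setT (EFin \o h).
  by move=> ch; apply/measurable_EFinP; exact: continuous_measurable.
have iP : mu.-integrable setT (EFin \o (fun u : R => (1 + u ^+ 2)^-1)).
  apply: (@ge0_integrable _ _ _ mu) => //; first exact: continuous_measurable.
  - by move=> y; rewrite invr_ge0 ltW.
  - by rewrite poisson_mass ltry.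
have iMP := integrableZl measurableT M iP.
have cn n : continuous (fun u => f (x + n.+1%:R^-1 * u) * (1 + u ^+ 2)^-1).
  move=> u; apply: cvgM; last exact: cP.
  apply: (@cvg_comp _ _ _ (fun u => x + n.+1%:R^-1 * u) f); last exact: cf.
  by apply: cvgD; [exact: cvg_cst|apply: cvgMr; exact: cvg_id].
have bd n u : (`|(f (x + n.+1%:R^-1 * u) * (1 + u ^+ 2)^-1)%:E| <= (M * (1 + u ^+ 2)^-1)%:E)%E.
  have i0 : 0 <= (1 + u ^+ 2)^-1 by rewrite invr_ge0 ltW.
  by rewrite lee_fin normrM (ger0_norm i0); exact: ler_wpM2r.
have h := @dominated_cvg _ _ _ mu setT measurableT
  (fun n u => (f (x + n.+1%:R^-1 * u) * (1 + u ^+ 2)^-1)%:E)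
  (fun u => (f x * (1 + u ^+ 2)^-1)%:E) (fun u => (M * (1 + u ^+ 2)^-1)%:E)
  (fun n => mE _ (cn n)).
have {}h : (\int[mu]_u (f (x + n.+1%:R^-1 * u) * (1 + u ^+ 2)^-1)%:E)%E @[n --> \oo] -->
   (\int[mu]_u (f x * (1 + u ^+ 2)^-1)%:E)%E.
  apply: h => //.
  move=> u _; apply: cvg_EFin; first by near=> n.
  have lu : x + n.+1%:R^-1 * u @[n --> \oo] --> x.
    rewrite -[X in _ --> X](addr0 x); apply: cvgD; first exact: cvg_cst.
    by rewrite -[X in _ --> X](mul0r u); apply: cvgMl; exact: cvg_harmonic.
  have lf : f (x + n.+1%:R^-1 * u) @[n --> \oo] --> f x.
    by apply: (@cvg_comp _ _ _ (fun n => x + n.+1%:R^-1 * u) f); [exact: lu|exact: cf].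
  have lf2 : f (x + n.+1%:R^-1 * u) * (1 + u ^+ 2)^-1 @[n --> \oo] --> f x * (1 + u ^+ 2)^-1.
    exact: cvgMl.
  exact: lf2.
have E : (\int[mu]_u (f x * (1 + u ^+ 2)^-1)%:E)%E = (pi * f x)%:E.
  under eq_integral do rewrite EFinM.
  by rewrite integralZl // poisson_mass -EFinM mulrC.
by move: h; rewrite E; exact: fine_cvg.
Unshelve. all: by end_near.
Qed.

Lemma poisson_bound f e x M : 0 < e -> continuous f -> (forall y, `|f y| <= M) ->
  `|\int[mu]_y (f y * (e / (e ^+ 2 + (x - y) ^+ 2)))| <= M * pi.
Proof.
move=> e0 cf fM; rewrite (poisson_subst _ e0 cf fM).
have D u : 0 < 1 + u ^+ 2 :> R by rewrite ltr_pwDl ?sqr_ge0.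
have cP : continuous (fun u : R => (1 + u ^+ 2)^-1).
  move=> u; apply: cvgV; first by rewrite gt_eqF.
  by apply: cvgD; [exact: cvg_cst|exact: (@exprn_continuous R 2 u)].
have P0 u : 0 <= (1 + u ^+ 2)^-1 by rewrite invr_ge0 ltW.
have iP : mu.-integrable setT (EFin \o (fun u : R => (1 + u ^+ 2)^-1)).
  apply: (@ge0_integrable _ _ _ mu) => //; first exact: continuous_measurable.
  by rewrite poisson_mass ltry.
have iMP := integrableZl measurableT M iP.
have M0 : 0 <= M by apply: le_trans (fM 0).
have bd u : `|f (x + e * u) * (1 + u ^+ 2)^-1| <= M * (1 + u ^+ 2)^-1.
  by rewrite normrM (ger0_norm (P0 u)); exact: ler_wpM2r.
have iF : mu.-integrable setT (EFin \o (fun u => f (x + e * u) * (1 + u ^+ 2)^-1)).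
  apply: (@le_integrable _ _ _ mu _ _ _ _ _ _ iMP) => //.
    apply/measurable_EFinP; apply: continuous_measurable => u; apply: cvgM; last exact: cP.
    apply: (@cvg_comp _ _ _ (fun u => x + e * u) f); last exact: cf.
    by apply: cvgD; [exact: cvg_cst|apply: cvgMr; exact: cvg_id].
  by move=> u _; rewrite /= lee_fin (le_trans (bd u)) // ler_norm.
apply: le_trans (le_normr_Rintegral measurableT iF) _.
have -> : M * pi = \int[mu]_u (M * (1 + u ^+ 2)^-1).
  by rewrite RintegralZl // /Rintegral poisson_mass.
by apply: le_Rintegral => //; exact: integrable_normR.
Qed.

Lemma fubini_kernel (K : R * R -> R) f g :
  mu.-integrable setT (EFin \o f) -> mu.-integrable setT (EFin \o g) ->
  measurable_fun (setT : set (measurableTypeR R * measurableTypeR R)) K ->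
  (forall z, `|K z| <= 1) ->
  \int[mu]_t (g t * \int[mu]_x (K (t, x) * f x)) =
  \int[mu]_x (f x * \int[mu]_t (K (t, x) * g t)).
Proof.
move=> fi gi mK K1.
have mf : measurable_fun setT f by exact: integrable_measurable fi.
have mg : measurable_fun setT g by exact: integrable_measurable gi.
pose H (z : measurableTypeR R * measurableTypeR R) := (g z.1 * (K z * f z.2))%:E.
have mH : measurable_fun setT H.
  apply/measurable_EFinP; apply: measurable_funM.
    exact: (measurableT_comp mg measurable_fst).
  apply: measurable_funM => //; exact: (measurableT_comp mf measurable_snd).
have iKf t : mu.-integrable setT (EFin \o (fun x => K (t, x) * f x)).
  apply: (@le_integrable _ _ _ mu _ _ _ _ _ _ fi) => //.
    by apply/measurable_EFinP/measurable_funM => //; exact: measurable_fun_pair2.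
  by move=> x _; rewrite /= lee_fin normrM ler_piMl.
have iKg x : mu.-integrable setT (EFin \o (fun t => K (t, x) * g t)).
  apply: (@le_integrable _ _ _ mu _ _ _ _ _ _ gi) => //.
    by apply/measurable_EFinP/measurable_funM => //; exact: measurable_fun_pair1.
  by move=> t _; rewrite /= lee_fin normrM ler_piMl.
have iH : (mu \x mu)%E.-integrable setT H.
  apply/(integrable12ltyP mu mu mH).
  have Hf : (\int[mu]_x `|(f x)%:E| < +oo)%E by case/integrableP : fi.
  have Hg : (\int[mu]_x `|(g x)%:E| < +oo)%E by case/integrableP : gi.
  apply: (@le_lt_trans _ _ (\int[mu]_t (`|(g t)%:E| * \int[mu]_x `|(f x)%:E|))%E).
    apply: le_ge0_integral => t _; first exact: integral_ge0.
    rewrite -ge0_integralZl //; last by apply/measurable_EFinP/measurableT_comp.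
    apply: le_ge0_integral => x _ //.
    by rewrite /H /= -EFinM lee_fin !normrM ler_wpM2l // ler_piMl.
  rewrite ge0_integralZr //; [|by apply/measurable_EFinP/measurableT_comp|exact: integral_ge0].
  by rewrite lte_mul_pinfty // ?integral_ge0 // ge0_fin_numE ?integral_ge0.
have := Fubini iH.
have EL t : (\int[mu]_y H (t, y) = (g t * \int[mu]_x (K (t, x) * f x))%:E)%E.
  rewrite EFinM /Rintegral fineK; last exact: (integrable_fin_num measurableT (iKf t)).
  by rewrite -(integralZl measurableT (iKf t)).
have ER x : (\int[mu]_t H (t, x) = (f x * \int[mu]_t (K (t, x) * g t))%:E)%E.
  rewrite EFinM /Rintegral fineK; last exact: (integrable_fin_num measurableT (iKg x)).
  rewrite -(integralZl measurableT (iKg x)); apply: eq_integral => t _.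
  by rewrite /H -EFinM; congr (_%:E); rewrite /=; ring.
under eq_integral do rewrite EL; under [RHS]eq_integral do rewrite ER.
by move=> h; rewrite /Rintegral h.
Qed.

Definition fcos f t := \int[mu]_x (cos (t * x) * f x).
Definition fsin f t := \int[mu]_x (sin (t * x) * f x).

Lemma measurable_phase (h : R -> R) : continuous h ->
  measurable_fun (setT : set (measurableTypeR R * measurableTypeR R)) (fun z => h (z.1 * z.2)).
Proof.
move=> ch; apply: (measurableT_comp (continuous_measurable ch)).
by apply: measurable_funM; [exact: measurable_fst|exact: measurable_snd].
Qed.

Lemma norm_cos_le1 x : `|cos x| <= 1. Proof. by rewrite ler_norml cos_geN1 cos_le1. Qed.
Lemma norm_sin_le1 x : `|sin x| <= 1. Proof. by rewrite ler_norml sin_geN1 sin_le1. Qed.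

Lemma Rintegral_opp d (T : measurableType d) (K : realType) (m : {measure set T -> \bar K}) (f : T -> K) :
  \int[m]_p (- f p) = - \int[m]_p f p.
Proof.
rewrite /Rintegral integralE [X in _ = - fine X]integralE.
have -> : (\int[m]_p (fun p => (- f p)%:E)^\+ p = \int[m]_p (fun p => (f p)%:E)^\- p)%E.
  by apply: eq_integral => p _; rewrite funeposE funenegE EFinN.
have -> : (\int[m]_p (fun p => (- f p)%:E)^\- p = \int[m]_p (fun p => (f p)%:E)^\+ p)%E.
  by apply: eq_integral => p _; rewrite funeposE funenegE EFinN oppeK.
set a := (\int[m]_p _)%E; set b := (\int[m]_p _)%E; clearbody a b.
by case: a b => [a||] [b||] //=; rewrite ?oppr0 ?opprB.
Qed.

Lemma fcosN f t : fcos f (- t) = fcos f t.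
Proof. by apply: eq_Rintegral => x _; rewrite mulNr cosN. Qed.

Lemma fsinN f t : fsin f (- t) = - fsin f t.
Proof.
rewrite /fsin; under eq_Rintegral do rewrite mulNr sinN mulNr.
exact: Rintegral_opp.
Qed.
Section one_function.
Variables (f : R -> R) (M : R).
Hypotheses (cf : continuous f) (fM : forall y, `|f y| <= M)
  (fi : mu.-integrable setT (EFin \o f)).

Let K (h : R -> R) : R * R -> R := fun z => h (z.1 * z.2).

Lemma one_measurable : measurable_fun setT f. Proof. exact: continuous_measurable. Qed.

Lemma measurable_fK (h : R -> R) : continuous h ->
  measurable_fun setT (fun t => \int[mu]_x (h (t * x) * f x)).
Proof.
move=> ch.
have := @measurable_part _ _ _ _ R mu (K h) f (measurable_phase ch) one_measurable.
by [].
Qed.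

Lemma bounded_fK (h : R -> R) t : continuous h -> (forall x, `|h x| <= 1) ->
  `|\int[mu]_x (h (t * x) * f x)| <= \int[mu]_x `|f x|.
Proof.
move=> ch h1.
have mh : measurable_fun setT (fun x => h (t * x)).
  exact: (measurable_fun_pair2 t (measurable_phase ch)).
have i1 : mu.-integrable setT (EFin \o (fun x => h (t * x) * f x)).
  apply: (@le_integrable _ _ _ mu _ _ _ _ _ _ fi) => //.
    by apply/measurable_EFinP/measurable_funM => //; exact: one_measurable.
  by move=> x _; rewrite /= lee_fin normrM ler_piMl.
apply: le_trans (le_normr_Rintegral measurableT i1) _.
apply: le_Rintegral => //; [exact: integrable_normR|exact: integrable_normR|].
by move=> x _; rewrite normrM ler_piMl.
Qed.

Let C := fcos f.
Let S := fsin f.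

Lemma measurable_fcos : measurable_fun setT C.
Proof. exact: (measurable_fK (@continuous_cos R)). Qed.

Lemma measurable_fsin : measurable_fun setT S.
Proof. exact: (measurable_fK (@continuous_sin R)). Qed.

Let w n t : R := if 0 <= t then expR (- (n.+1%:R^-1 * t)) else 0.

Lemma wi n : mu.-integrable setT (EFin \o w n).
Proof.
have en : 0 < n.+1%:R^-1 :> R by rewrite invr_gt0.
have [i0 _ _] := exp_trig_integral 0 en.
have mD : measurable pos by [].
have := (@integrable_mkcond _ (measurableTypeR R) R mu _ _ mD).1 i0.
apply: eq_integrable => // t _; rewrite patchE /w /= (_ : (t \in pos) = (0 <= t)); last by rewrite mem_setE in_itv /= andbT.
by case: ifP.
Qed.

Lemma wbi n (g : R -> R) B : measurable_fun setT g -> (forall t, `|g t| <= B) ->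
  mu.-integrable setT (EFin \o (fun t => g t * w n t)).
Proof.
move=> mg gB; have B0 : 0 <= B by apply: le_trans (gB 0).
apply: (@le_integrable _ _ _ mu _ _ _ _ _ _ (integrableZl measurableT B (wi n))) => //.
  apply/measurable_EFinP/measurable_funM => //.
  exact: (integrable_measurable (wi n)).
move=> t _ /=; rewrite lee_fin !normrM (ger0_norm B0); exact: ler_wpM2r.
Qed.

Lemma kernel_integral n x y :
  \int[mu]_t ((cos (t * y) * cos (t * x) + sin (t * y) * sin (t * x)) * w n t) =
  n.+1%:R^-1 / (n.+1%:R^-1 ^+ 2 + (x - y) ^+ 2).
Proof.
have en : 0 < n.+1%:R^-1 :> R by rewrite invr_gt0.
have [_ _ <-] := exp_trig_integral (x - y) en.
rewrite [RHS]Rintegral_mkcond; apply: eq_Rintegral => t _; rewrite patchE /w.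
rewrite (_ : (t \in _) = (0 <= t)); last by rewrite mem_setE in_itv /= andbT.
case: ifP => _; last by rewrite mulr0.
by rewrite mulrBr cosB mulrC [cos _ * cos _]mulrC [sin _ * sin _]mulrC.
Qed.

Let P n x := \int[mu]_y (f y * (n.+1%:R^-1 / (n.+1%:R^-1 ^+ 2 + (x - y) ^+ 2))).

(** With the damping factor [w n] Fubini's theorem applies to the triple
    integral, and the integral over the frequency is the Poisson kernel. *)
Lemma regularized_plancherel n : \int[mu]_t ((C t ^+ 2 + S t ^+ 2) * w n t) = \int[mu]_x (f x * P n x).
Proof.
have cC := @continuous_cos R; have cS := @continuous_sin R.
pose A0 := \int[mu]_x `|f x|.
have bC t : `|C t| <= A0 by exact: (bounded_fK t cC norm_cos_le1).
have bS t : `|S t| <= A0 by exact: (bounded_fK t cS norm_sin_le1).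
have iC := wbi n measurable_fcos bC; have iS := wbi n measurable_fsin bS.
have mh (h : R -> R) x : continuous h -> measurable_fun setT (fun t => h (t * x)).
  by move=> ch; exact: (measurable_fun_pair1 x (measurable_phase ch)).
have iK (h g : R -> R) x : continuous h -> (forall s, `|h s| <= 1) ->
    mu.-integrable setT (EFin \o g) -> mu.-integrable setT (EFin \o (fun t => h (t * x) * g t)).
  move=> ch h1 gi; apply: (@le_integrable _ _ _ mu _ _ _ _ _ _ gi) => //.
    by apply/measurable_EFinP/measurable_funM; [exact: mh|exact: integrable_measurable gi].
  by move=> t _; rewrite /= lee_fin normrM ler_piMl.
have A0' : 0 <= A0 by apply: le_trans (bC 0).
have i2 (g : R -> R) : measurable_fun setT g -> (forall t, `|g t| <= A0) ->
    mu.-integrable setT (EFin \o (fun t => g t * w n t * g t)).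
  move=> mg gA.
  have -> : (fun t => g t * w n t * g t) = (fun t => g t ^+ 2 * w n t).
    by apply/funext => t; rewrite expr2 mulrAC.
  apply: (wbi n (B := A0 ^+ 2)); first exact: measurable_funX.
  by move=> t; rewrite normrX ler_pXn2r ?nnegrE.
have -> : \int[mu]_t ((C t ^+ 2 + S t ^+ 2) * w n t) =
   \int[mu]_t (C t * w n t * C t) + \int[mu]_t (S t * w n t * S t).
  rewrite -RintegralD //; [|exact: (i2 _ measurable_fcos bC)|exact: (i2 _ measurable_fsin bS)].
  by apply: eq_Rintegral => t _; ring.
have EC := fubini_kernel fi iC (measurable_phase cC) (fun z => norm_cos_le1 _).
have ES := fubini_kernel fi iS (measurable_phase cS) (fun z => norm_sin_le1 _).
rewrite /= in EC ES; rewrite [X in X + _]EC [X in _ + X]ES {EC ES}.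
have Q (h : R -> R) x : continuous h -> (forall s, `|h s| <= 1) ->
   \int[mu]_t (h (t * x) * ((\int[mu]_y (h (t * y) * f y)) * w n t)) =
   \int[mu]_y (f y * \int[mu]_t (h (t * y) * (h (t * x) * w n t))).
  move=> ch h1.
  have F := fubini_kernel fi (iK h _ x ch h1 (wi n)) (measurable_phase ch) (fun z => h1 _).
  rewrite /= in F; rewrite -F.
  by apply: eq_Rintegral => t _; ring.
have bQ (h : R -> R) x : continuous h -> (forall s, `|h s| <= 1) ->
    `|\int[mu]_t (h (t * x) * ((\int[mu]_y (h (t * y) * f y)) * w n t))| <= A0 * \int[mu]_t `|w n t|.
  move=> ch h1.
  have ig : mu.-integrable setT (EFin \o (fun t => (\int[mu]_y (h (t * y) * f y)) * w n t)).
    by apply: (wbi n (measurable_fK ch)) => t; exact: bounded_fK.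
  have i1 := iK h _ x ch h1 ig.
  apply: le_trans (le_normr_Rintegral measurableT i1) _.
  rewrite -RintegralZl //; last exact: (integrable_normR (wi n)).
  apply: le_Rintegral => //; first exact: (integrable_normR i1).
    exact: (integrableZl measurableT A0 (integrable_normR (wi n))).
  move=> t _; rewrite !normrM; apply: le_trans (_ : 1 * (A0 * `|w n t|) <= _); last by rewrite mul1r.
  by apply: ler_pM => //; apply: ler_wpM2r => //; exact: bounded_fK.
have iQ (h : R -> R) : continuous h -> (forall s, `|h s| <= 1) ->
    mu.-integrable setT (EFin \o (fun x => f x * \int[mu]_t (h (t * x) * ((\int[mu]_y (h (t * y) * f y)) * w n t)))).
  move=> ch h1.
  apply: (@le_integrable _ _ _ mu _ _ _ _ _ _ (integrableZl measurableT (A0 * \int[mu]_t `|w n t|) fi)) => //.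
    apply/measurable_EFinP/measurable_funM; first exact: one_measurable.
    have mg : measurable_fun setT (fun t => (\int[mu]_y (h (t * y) * f y)) * w n t).
      apply: measurable_funM; first exact: measurable_fK.
      exact: (integrable_measurable (wi n)).
    exact: (measurable_part2 mu (measurable_phase ch) mg).
  move=> x _ /=; rewrite lee_fin !normrM mulrC; apply: ler_wpM2r => //.
  by apply: le_trans (bQ h x ch h1) _; rewrite -normrM ler_norm.
rewrite -RintegralD //; [|exact: (iQ _ cC norm_cos_le1)|exact: (iQ _ cS norm_sin_le1)].
apply: eq_Rintegral => x _; rewrite -mulrDr; congr (_ * _).
rewrite (Q _ x cC norm_cos_le1) (Q _ x cS norm_sin_le1) /P.
have bw (h : R -> R) y : continuous h -> (forall s, `|h s| <= 1) ->
   `|\int[mu]_t (h (t * y) * (h (t * x) * w n t))| <= \int[mu]_t `|w n t|.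
  move=> ch h1; have i1 := iK h _ y ch h1 (iK h _ x ch h1 (wi n)).
  apply: le_trans (le_normr_Rintegral measurableT i1) _.
  apply: le_Rintegral => //; [exact: (integrable_normR i1)|exact: (integrable_normR (wi n))|].
  by move=> t _; rewrite !normrM mulrA ler_piMl // mulr_ile1.
have iW (h : R -> R) : continuous h -> (forall s, `|h s| <= 1) ->
    mu.-integrable setT (EFin \o (fun y => f y * \int[mu]_t (h (t * y) * (h (t * x) * w n t)))).
  move=> ch h1.
  apply: (@le_integrable _ _ _ mu _ _ _ _ _ _ (integrableZl measurableT (\int[mu]_t `|w n t|) fi)) => //.
    apply/measurable_EFinP/measurable_funM; first exact: one_measurable.
    have mg : measurable_fun setT (fun t => h (t * x) * w n t).
      apply: measurable_funM; first exact: mh.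
      exact: (integrable_measurable (wi n)).
    exact: (measurable_part2 mu (measurable_phase ch) mg).
  move=> y _ /=; rewrite lee_fin !normrM mulrC; apply: ler_wpM2r => //.
  by apply: le_trans (bw h y ch h1) _; rewrite ler_norm.
rewrite -RintegralD //; [|exact: (iW _ cC norm_cos_le1)|exact: (iW _ cS norm_sin_le1)].
apply: eq_Rintegral => y _; rewrite -mulrDr -kernel_integral; congr (_ * _).
rewrite -RintegralD //; last 2 first.
- exact: (iK _ _ _ cC norm_cos_le1 (iK _ _ _ cC norm_cos_le1 (wi n))).
- exact: (iK _ _ _ cS norm_sin_le1 (iK _ _ _ cS norm_sin_le1 (wi n))).
by apply: eq_Rintegral => t _; ring.
Qed.

Lemma L2_bounded_integrable : L2 mu f.
Proof.
split; first exact: one_measurable.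
have M0 : 0 <= M by apply: le_trans (fM 0).
have [_ fin] := integrableP _ _ _ fi.
apply: (@le_lt_trans _ _ (\int[mu]_x (M%:E * `|(f x)%:E|))%E).
  apply: le_ge0_integral => x _; first by rewrite lee_fin sqr_ge0.
  by rewrite -EFinM lee_fin -real_normK ?num_real // expr2 ler_wpM2r.
have mf := one_measurable.
rewrite ge0_integralZl //; first by rewrite lte_mul_pinfty.
by apply/measurable_EFinP/measurableT_comp.
Qed.

(** The weights [w n] increase to the indicator of [pos], so that monotone
    convergence applies. *)
Lemma regularized_limit :
  (\int[mu]_t ((C t ^+ 2 + S t ^+ 2) * w n t)%:E)%E @[n --> \oo] -->
  (\int[mu]_(t in pos) (C t ^+ 2 + S t ^+ 2)%:E)%E.
Proof.
have mC := measurable_fcos; have mS := measurable_fsin.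
have mG : measurable_fun setT (fun t => C t ^+ 2 + S t ^+ 2).
  by apply: measurable_funD; exact: measurable_funX.
have G0 t : 0 <= C t ^+ 2 + S t ^+ 2 by rewrite addr_ge0 ?sqr_ge0.
have w0 n t : 0 <= w n t by rewrite /w; case: ifP => // _; exact: expR_ge0.
pose g n t := ((C t ^+ 2 + S t ^+ 2) * w n t)%:E.
have mg n : measurable_fun setT (g n).
  by apply/measurable_EFinP/measurable_funM => //; exact: integrable_measurable (wi n).
have := @cvg_monotone_convergence _ _ _ mu setT measurableT g mg.
have g0 n t : setT t -> (0 <= g n t)%E by move=> _; rewrite lee_fin mulr_ge0.
have nd t : setT t -> {homo g^~ t : n m / (n <= m)%N >-> (n <= m)%E}.
  move=> _ n m nm; rewrite lee_fin ler_wpM2l // /w; case: ifP => // t0.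
  by rewrite ler_expR lerN2 ler_wpM2r // lef_pV2 ?posrE // ler_nat.
move=> /(_ g0 nd).
suff -> : (\int[mu]_t (fun t => limn (g^~ t)) t = \int[mu]_(t in pos) (C t ^+ 2 + S t ^+ 2)%:E)%E by [].
rewrite [RHS]integral_mkcond; apply: eq_integral => t _; rewrite patchE.
rewrite (_ : (t \in _) = (0 <= t)); last by rewrite mem_setE in_itv /= andbT.
apply: cvg_lim => //; rewrite /g /w; case: ifP => t0; last first.
  by under eq_fun do rewrite mulr0; exact: cvg_cst.
apply: cvg_EFin; first by near=> n.
rewrite -[X in _ --> X]mulr1; apply: cvgMr.
have lt : - (n.+1%:R^-1 * t) @[n --> \oo] --> - (0 * t).
  by apply: cvgN; apply: cvgMl; exact: cvg_harmonic.
rewrite mul0r oppr0 in lt; rewrite -[X in _ --> X]expR0.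
by apply: (cvg_comp _ _ lt); exact: continuous_expR.
Unshelve. all: by end_near.
Qed.

(** Both sides of the damped identity have limits when the damping disappears:
    monotone convergence on the frequency side, the Poisson limit and dominated
    convergence on the other. The transforms [C] and [S] have definite parity, so
    the half-line [pos] carries half of the norm. *)
Lemma fcos_fsin_plancherel :
  [/\ L2 mu C, L2 mu S & ip mu C C + ip mu S S = 2 * pi * ip mu f f].
Proof.
have mC := measurable_fcos; have mS := measurable_fsin.
have mf := one_measurable.
have M0 : 0 <= M by apply: le_trans (fM 0).
have mG : measurable_fun setT (fun t => C t ^+ 2 + S t ^+ 2).
  by apply: measurable_funD; exact: measurable_funX.
have G0 t : 0 <= C t ^+ 2 + S t ^+ 2 by rewrite addr_ge0 ?sqr_ge0.
have iG n : mu.-integrable setT (EFin \o (fun t => (C t ^+ 2 + S t ^+ 2) * w n t)).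
  pose A := \int[mu]_x `|f x|.
  have A0 : 0 <= A by apply: Rintegral_ge0.
  have bC t : `|C t| <= A by exact: (bounded_fK t (@continuous_cos R) norm_cos_le1).
  have bS t : `|S t| <= A by exact: (bounded_fK t (@continuous_sin R) norm_sin_le1).
  apply: (wbi n (B := A ^+ 2 + A ^+ 2) mG) => t; rewrite (ger0_norm (G0 t)).
  by apply: lerD; rewrite -(real_normK (num_real _)) ler_pXn2r ?nnegrE.
have iMf := integrableZl measurableT (M * pi) (integrable_normR fi).
have mP n : measurable_fun setT (P n).
  pose k (z : measurableTypeR R * measurableTypeR R) := n.+1%:R^-1 / (n.+1%:R^-1 ^+ 2 + (z.2 - z.1) ^+ 2).
  have mk : measurable_fun setT k.
    have ck : continuous (fun s : R => n.+1%:R^-1 / (n.+1%:R^-1 ^+ 2 + s ^+ 2)).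
      move=> s; apply: cvgMr; apply: cvgV.
        by rewrite gt_eqF // ltr_pwDl ?sqr_ge0 ?exprn_gt0 ?invr_gt0.
      by apply: cvgD; [exact: cvg_cst|exact: exprn_continuous].
    apply: (measurableT_comp (continuous_measurable ck)).
    by apply: measurable_funB; [exact: measurable_snd|exact: measurable_fst].
  have := measurable_part2 mu mk mf.
  by rewrite /part2 /ip; under eq_fun do under eq_Rintegral do rewrite mulrC.
have bP n x : `|P n x| <= M * pi by apply: poisson_bound => //; rewrite invr_gt0.
have mfP n : measurable_fun setT (EFin \o (fun x => f x * P n x)).
  by apply/measurable_EFinP/measurable_funM.
have bfP n x : `|f x * P n x| <= M * pi * `|f x| by rewrite normrM mulrC ler_wpM2r.
have iR n : mu.-integrable setT (EFin \o (fun x => f x * P n x)).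
  apply: (@le_integrable _ _ _ mu _ _ _ _ _ _ iMf) => //; first exact: mfP.
  move=> x _.
  by rewrite /= lee_fin (le_trans (bfP n x)) // ler_norm.
have right : (\int[mu]_x (f x * P n x)%:E)%E @[n --> \oo] --> (pi * ip mu f f)%:E.
  have := @dominated_cvg _ _ _ mu setT measurableT (fun n x => (f x * P n x)%:E)
    (fun x => (pi * (f x * f x))%:E) (fun x => (M * pi * `|f x|)%:E).
  have -> : (\int[mu]_x (pi * (f x * f x))%:E = (pi * ip mu f f)%:E)%E.
    have L := L2_bounded_integrable; have iff := L2_mul_integrable L L.
    by under eq_integral do rewrite EFinM; rewrite integralZl // EFinM /ip /Rintegral fineK // integrable_fin_num.
  apply => //.
  - move=> x _; apply: cvg_EFin; first by near=> n.
    rewrite (_ : pi * (f x * f x) = f x * (pi * f x)); last by rewrite mulrCA.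
    by apply: cvgMr; exact: (@poisson_limit f x M cf fM).
  - by move=> n x _ /=; rewrite lee_fin.
have E : (\int[mu]_(t in pos) (C t ^+ 2 + S t ^+ 2)%:E = (pi * ip mu f f)%:E)%E.
  rewrite -(cvg_lim _ regularized_limit) //; apply: cvg_lim => //.
  rewrite (_ : (fun n => _) = fun n => \int[mu]_x (f x * P n x)%:E)%E //.
  apply/funext => n.
  rewrite -(fineK (integrable_fin_num measurableT (iG n))) -(fineK (integrable_fin_num measurableT (iR n))).
  congr (_%:E); exact: regularized_plancherel.
have T : (\int[mu]_t (C t ^+ 2 + S t ^+ 2)%:E = (2 * pi * ip mu f f)%:E)%E.
  rewrite integral_even ?E -?EFinM ?mulrA // => t.
  by rewrite /C /S fcosN fsinN sqrrN.
have LC : L2 mu C.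
  split => //; apply: (@le_lt_trans _ _ (2 * pi * ip mu f f)%:E); last exact: ltry.
  by rewrite -T; apply: le_ge0_integral => t _; rewrite lee_fin ?sqr_ge0 // lerDl sqr_ge0.
have LS : L2 mu S.
  split => //; apply: (@le_lt_trans _ _ (2 * pi * ip mu f f)%:E); last exact: ltry.
  by rewrite -T; apply: le_ge0_integral => t _; rewrite lee_fin ?sqr_ge0 // lerDr sqr_ge0.
split => //; apply: EFin_inj; rewrite -T; under eq_integral do rewrite EFinD.
rewrite ge0_integralD // ?L2_ipE //.
- by move=> t _; rewrite lee_fin sqr_ge0.
- by apply/measurable_EFinP/measurable_funX.
- by move=> t _; rewrite lee_fin sqr_ge0.
- by apply/measurable_EFinP/measurable_funX.
Unshelve. all: by end_near.
Qed.

End one_function.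

End plancherel.

(** * The Fourier transform of pairs and the exponential substitution *)

Section hilbert_identities.
Context {R : realType} {V : lmodType R} (S : V -> Prop) (ip : V -> V -> R).
Hypothesis H : hilbert S ip.
Implicit Types (c d s t u v : V) (p : R).

Lemma hip_phase_norm p c1 s1 c2 s2 : S c1 -> S s1 -> S c2 -> S s2 -> p ^+ 2 = 1 ->
  ip c1 s2 = 0 -> ip c2 s1 = 0 ->
  ip (c1 - p *: s2) (c1 - p *: s2) + ip (c2 + p *: s1) (c2 + p *: s1) =
  (ip c1 c1 + ip s1 s1) + (ip c2 c2 + ip s2 s2).
Proof.
move=> C1 S1 C2 S2 ss z1 z2.
have Z1 : S (p *: s1) by exact: (hSZ H).
have Z2 : S (p *: s2) by exact: (hSZ H).
rewrite (hnB H) // (hnD H) // !(hipZ H) // !(hipZr H) // z1 z2.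
by rewrite !mulr0 subr0 addr0 !mulrA -expr2 ss; ring.
Qed.

Lemma hip_phase_adjoint p c1 s1 c2 s2 d1 t1 d2 t2 u1 u2 v1 v2 :
  [/\ S c1, S s1, S c2 & S s2] -> [/\ S d1, S t1, S d2 & S t2] ->
  [/\ S u1, S u2, S v1 & S v2] ->
  ip v1 c1 = ip d1 u1 -> ip v1 s2 = ip t1 u2 -> ip v2 c2 = ip d2 u2 -> ip v2 s1 = ip t2 u1 ->
  ip v1 (c1 - p *: s2) + ip v2 (c2 + p *: s1) =
  ip (d1 - - p *: t2) u1 + ip (d2 + - p *: t1) u2.
Proof.
move=> [C1 S1 C2 S2] [D1 T1 D2 T2] [U1 U2 V1 V2] e1 e2 e3 e4.
have Z w a : S w -> S (a *: w) by exact: (hSZ H).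
rewrite (hipBr H) ?(hipDr H) ?(hipB H) ?(hipD H) ?(hipZ H) ?(hipZr H) //; try exact: Z.
by rewrite e1 e2 e3 e4; ring.
Qed.
End hilbert_identities.

Section fourier_pair.
Context {R : realType}.
Notation mu := (@lebesgue_measure R).
Implicit Types (f g h : R -> R) (s t x : R).

Definition nice f := [/\ continuous f, exists M, forall y, `|f y| <= M &
  mu.-integrable setT (EFin \o f)].

Lemma niceD f g : nice f -> nice g -> nice (f + g).
Proof.
move=> [cf [M fM] fi] [cg [N gN] gi]; split.
- by move=> x; apply: cvgD; [exact: cf|exact: cg].
- by exists (M + N) => y; rewrite fctE (le_trans (ler_normD _ _)) // lerD.
- exact: (integrableD measurableT fi gi).
Qed.

Lemma niceZ a f : nice f -> nice (a *: f).
Proof.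
move=> [cf [M fM] fi]; split.
- by move=> x; apply: cvgMr; exact: cf.
- by exists (`|a| * M) => y; rewrite fctE /GRing.scale /= normrM ler_wpM2l.
- exact: (integrableZl measurableT a fi).
Qed.

Lemma nice_L2 f : nice f -> L2 mu f.
Proof. by move=> [cf [M fM] fi]; exact: L2_bounded_integrable cf fM fi. Qed.

Lemma phase_integrable (k : R -> R) f t : continuous k -> (forall x, `|k x| <= 1) ->
  nice f -> mu.-integrable setT (EFin \o (fun x => k (t * x) * f x)).
Proof.
move=> ck k1 [cf _ fi].
apply: (@le_integrable _ _ _ mu _ _ _ _ _ _ fi) => //; last first.
  by move=> x _; rewrite /= lee_fin normrM ler_piMl.
apply/measurable_EFinP/measurable_funM; last exact: continuous_measurable.
exact: (measurable_fun_pair2 t (measurable_phase ck)).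
Qed.

Lemma fcosD f g : nice f -> nice g -> fcos (f + g) = fcos f + fcos g.
Proof.
move=> nf ng; apply/funext => t; have -> : (fcos f + fcos g) t = fcos f t + fcos g t by [].
rewrite /fcos -RintegralD //.
- by apply: eq_Rintegral => x _; rewrite fctE mulrDr.
- exact: (phase_integrable t (@continuous_cos R) (@norm_cos_le1 R)).
- exact: (phase_integrable t (@continuous_cos R) (@norm_cos_le1 R)).
Qed.

Lemma fsinD f g : nice f -> nice g -> fsin (f + g) = fsin f + fsin g.
Proof.
move=> nf ng; apply/funext => t; have -> : (fsin f + fsin g) t = fsin f t + fsin g t by [].
rewrite /fsin -RintegralD //.
- by apply: eq_Rintegral => x _; rewrite fctE mulrDr.
- exact: (phase_integrable t (@continuous_sin R) (@norm_sin_le1 R)).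
- exact: (phase_integrable t (@continuous_sin R) (@norm_sin_le1 R)).
Qed.

Lemma fcosZ a f : nice f -> fcos (a *: f) = a *: fcos f.
Proof.
move=> nf; apply/funext => t; have -> : (a *: fcos f) t = a * fcos f t by [].
rewrite /fcos -RintegralZl //.
- by apply: eq_Rintegral => x _; rewrite fctE /GRing.scale /= mulrCA.
- exact: (phase_integrable t (@continuous_cos R) (@norm_cos_le1 R)).
Qed.

Lemma fsinZ a f : nice f -> fsin (a *: f) = a *: fsin f.
Proof.
move=> nf; apply/funext => t; have -> : (a *: fsin f) t = a * fsin f t by [].
rewrite /fsin -RintegralZl //.
- by apply: eq_Rintegral => x _; rewrite fctE /GRing.scale /= mulrCA.
- exact: (phase_integrable t (@continuous_sin R) (@norm_sin_le1 R)).
Qed.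

Lemma ip_fcos f g : nice f -> nice g -> ip mu g (fcos f) = ip mu (fcos g) f.
Proof.
move=> [cf _ fi] [cg _ gi].
have := fubini_kernel fi gi (measurable_phase (@continuous_cos R)) (fun z => norm_cos_le1 _).
rewrite /= /ip => ->; apply: eq_Rintegral => x _; rewrite mulrC; congr (_ * _).
by apply: eq_Rintegral => t _; rewrite [t * x]mulrC.
Qed.

Lemma ip_fsin f g : nice f -> nice g -> ip mu g (fsin f) = ip mu (fsin g) f.
Proof.
move=> [cf _ fi] [cg _ gi].
have := fubini_kernel fi gi (measurable_phase (@continuous_sin R)) (fun z => norm_sin_le1 _).
rewrite /= /ip => ->; apply: eq_Rintegral => x _; rewrite mulrC; congr (_ * _).
by apply: eq_Rintegral => t _; rewrite [t * x]mulrC.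
Qed.

Implicit Types u v : (R -> R) * (R -> R).

Lemma fcosE f t : fcos f t = \int[mu]_x (cos (t * x) * f x). Proof. by []. Qed.

Lemma fsinE f t : fsin f t = \int[mu]_x (sin (t * x) * f x). Proof. by []. Qed.

#[local] Opaque fcos fsin.

(** Real and imaginary parts of the integral of [expR ('i * s * t * x) * f x]
    for a complex function [f] given by its two components. *)
Definition fhat s u : (R -> R) * (R -> R) :=
  (fcos u.1 - s *: fsin u.2, fcos u.2 + s *: fsin u.1).

Definition nicec := pairS nice.

Lemma fhatD s u v : nicec u -> nicec v -> fhat s (u + v) = fhat s u + fhat s v.
Proof.
move=> [u1 u2] [v1 v2]; rewrite /fhat /= !fcosD ?fsinD //.
congr (_, _); rewrite !scalerDr ?opprD; first by rewrite addrACA.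
by rewrite addrACA.
Qed.

Lemma fhatZ s a u : nicec u -> fhat s (a *: u) = a *: fhat s u.
Proof.
move=> [u1 u2]; rewrite /fhat /= !fcosZ ?fsinZ //.
congr (_, _); first by rewrite scalerBr !scalerA mulrC.
by rewrite scalerDr !scalerA mulrC.
Qed.

Lemma fhat_plancherel s u : s ^+ 2 = 1 -> nicec u ->
  L2c mu (fhat s u) /\ ipc mu (fhat s u) (fhat s u) = 2 * pi * ipc mu u u.
Proof.
move=> s2 [u1 u2].
have [c1 [M1 b1] i1] := u1; have [c2 [M2 b2] i2] := u2.
have [LC1 LS1 E1] := fcos_fsin_plancherel c1 b1 i1.
have [LC2 LS2 E2] := fcos_fsin_plancherel c2 b2 i2.
have H := L2_hilbert mu.
have Z1 : L2 mu (s *: fsin u.1) := hSZ H _ LS1.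
have Z2 : L2 mu (s *: fsin u.2) := hSZ H _ LS2.
split; first exact: (conj (hSB H LC1 Z2) (hSD H LC2 Z1)).
have o1 : ip mu (fcos u.1) (fsin u.2) = 0 := ip_even_odd LC1 LS2 (fcosN _) (fsinN _).
have o2 : ip mu (fcos u.2) (fsin u.1) = 0 := ip_even_odd LC2 LS1 (fcosN _) (fsinN _).
by rewrite [RHS]mulrDr -E1 -E2; exact: (hip_phase_norm H LC1 LS1 LC2 LS2 s2 o1 o2).
Qed.

Lemma fhat_ip s u v : s ^+ 2 = 1 -> nicec u -> nicec v ->
  ipc mu (fhat s u) (fhat s v) = 2 * pi * ipc mu u v.
Proof.
move=> s2 nu nv; have H := pair_hilbert (L2_hilbert mu).
have [u1 u2] := nu; have [v1 v2] := nv.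
have nuv : nicec (u + v) := conj (niceD u1 v1) (niceD u2 v2).
have Lu : L2c mu u := conj (nice_L2 u1) (nice_L2 u2).
have Lv : L2c mu v := conj (nice_L2 v1) (nice_L2 v2).
have [Fu Eu] := fhat_plancherel s2 nu; have [Fv Ev] := fhat_plancherel s2 nv.
have [_] := fhat_plancherel s2 nuv.
rewrite (fhatD s nu nv) (hnD H Fu Fv) (hnD H Lu Lv) Eu Ev.
have cancel (x y a b p : R) : p * a + 2 * x + p * b = p * (a + 2 * y + b) -> x = p * y by lra.
exact: cancel.
Qed.

Lemma fhat_adjoint s u v : nicec u -> nicec v ->
  ipc mu v (fhat s u) = ipc mu (fhat (- s) v) u.
Proof.
move=> [u1 u2] [v1 v2]; have H := L2_hilbert mu.
have L f : nice f -> [/\ L2 mu f, L2 mu (fcos f) & L2 mu (fsin f)].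
  by move=> nf; have [c [M b] i] := nf; have [Cf Sf _] := fcos_fsin_plancherel c b i; exact: (And3 (nice_L2 nf) Cf Sf).
have [Lu1 Cu1 Su1] := L _ u1; have [Lu2 Cu2 Su2] := L _ u2.
have [Lv1 Cv1 Sv1] := L _ v1; have [Lv2 Cv2 Sv2] := L _ v2.
have E := (hip_phase_adjoint H s (And4 Cu1 Su1 Cu2 Su2) (And4 Cv1 Sv1 Cv2 Sv2)
  (And4 Lu1 Lu2 Lv1 Lv2) (ip_fcos u1 v1) (ip_fsin u2 v1) (ip_fcos u2 v2) (ip_fsin u1 v2)).
by rewrite /pairip /=; exact: E.
Qed.

End fourier_pair.

Section exp_substitution.
Context {R : realType}.
Notation mu := (@lebesgue_measure R).
Notation Rp := (Rpos : set (measurableTypeR R)).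

(** Change of variables on the compact intervals [[- n, n]], then monotone
    convergence. *)
Lemma exp_substitution (G : R -> R) : (forall r, 0 < r -> {for r, continuous G}) ->
  (forall r, 0 < r -> 0 <= G r) ->
  (\int[mu]_(r in Rp) (G r)%:E = \int[mu]_x (G (expR x) * expR x)%:E)%E.
Proof.
move=> cG G0.
have d1 : (@expR R)^`()%classic = @expR R by apply/funext => x; rewrite derive1E; have [_] := is_derive_expR x.
pose a n : R := n%:R.
pose I n : set (measurableTypeR R) := `[expR (- a n), expR (a n)]%classic.
pose J n : set (measurableTypeR R) := `[- a n, a n]%classic.
have nI : nondecreasing_seq I.
  move=> n m nm; apply/subsetPset => r; rewrite /I /= !in_itv /= => /andP[h1 h2].
  have h : a n <= a m by rewrite ler_nat.
  by rewrite (le_trans _ h1) ?(le_trans h2) // ler_expR ?lerN2.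
have nJ : nondecreasing_seq J.
  move=> n m nm; apply/subsetPset => r; rewrite /J /= !in_itv /= => /andP[h1 h2].
  have h : a n <= a m by rewrite ler_nat.
  by rewrite (le_trans _ h1) ?(le_trans h2) // ?lerN2.
have bnd (x : R) : exists n, - a n <= x <= a n.
  exists (Num.Def.truncn `|x|).+1; rewrite -ler_norml; apply: ltW; exact: truncnS_gt.
have UJ : \bigcup_n J n = setT.
  apply/seteqP; split=> // x _; have [n h] := bnd x; exists n => //=; by rewrite in_itv.
have UI : \bigcup_n I n = Rp.
  apply/seteqP; split=> r.
    move=> [n _]; rewrite /I /Rpos /= !in_itv /= andbT => /andP[h _].
    by apply: lt_le_trans h; exact: expR_gt0.
  rewrite /Rpos /= in_itv /= andbT => r0; have [n /andP[h1 h2]] := bnd (ln r).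
  by exists n => //; rewrite /I /= in_itv /= -[r]lnK ?posrE // !ler_expR h1 h2.
have cE x : {for x, continuous (fun x => G (expR x) * expR x)}.
  apply: cvgM; last exact: continuous_expR.
  by apply: continuous_comp; [exact: continuous_expR|exact: (cG _ (expR_gt0 x))].
have mGE : measurable_fun setT (fun x => G (expR x) * expR x).
  exact: (continuous_measurable cE).
have oR : open (Rpos : set R) by exact: interval_open.
have mG : measurable_fun Rp G.
  apply: (@open_continuous_measurable_fun R _ G) => // r; rewrite inE /Rpos /= in_itv /= andbT; exact: cG.
have c1 := @ge0_nondecreasing_set_cvg_integral _ _ _ I (EFin \o G) mu nI.
rewrite UI in c1.
have c2 := @ge0_nondecreasing_set_cvg_integral _ _ _ J (fun x => (G (expR x) * expR x)%:E) mu nJ.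
rewrite UJ in c2.
have E n : (\int[mu]_(r in I n) (G r)%:E = \int[mu]_(x in J n) (G (expR x) * expR x)%:E)%E.
  rewrite (@integration_by_substitution_increasing R expR G (- a n) (a n)).
  - by apply: eq_integral => x _; rewrite d1.
  - by rewrite ge0_cp.
  - by move=> x y _ _; rewrite ltr_expR.
  - by rewrite d1 => x _; exact: continuous_expR.
  - by rewrite d1; apply/cvg_ex; exists (expR (- a n)); apply: cvg_at_right_filter; exact: continuous_expR.
  - by rewrite d1; apply/cvg_ex; exists (expR (a n)); apply: cvg_at_left_filter; exact: continuous_expR.
  - split.
    + by move=> x _; exact: derivable_expR.
    + by apply: cvg_at_right_filter; exact: continuous_expR.
    + by apply: cvg_at_left_filter; exact: continuous_expR.
  - apply: continuous_in_subspaceT => r; rewrite inE /= in_itv /= => /andP[h _].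
    by apply: cG; apply: lt_le_trans h; exact: expR_gt0.
have I0 n r : I n r -> 0 < r.
  by rewrite /I /= in_itv /= => /andP[h _]; apply: lt_le_trans h; exact: expR_gt0.
have l1 : (\int[mu]_(r in I n) (G r)%:E)%E @[n --> \oo] --> (\int[mu]_(r in Rp) (G r)%:E)%E.
  apply: c1 => [n|n|n r /I0 r0]; first exact: measurable_itv.
  - apply/measurable_EFinP; apply: (measurable_funS (measurable_itv _) _ mG) => r /I0.
    by rewrite /Rpos /= in_itv /= andbT.
  - by rewrite lee_fin G0.
have l2 : (\int[mu]_(r in I n) (G r)%:E)%E @[n --> \oo] --> (\int[mu]_x (G (expR x) * expR x)%:E)%E.
  under eq_fun do rewrite E.
  apply: c2 => [n|n|n r _]; first exact: measurable_itv.
  - by apply/measurable_EFinP; exact: measurable_funTS.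
  - by rewrite lee_fin mulr_ge0 ?expR_ge0 ?G0 ?expR_gt0.
by rewrite -(cvg_lim _ l1) // -(cvg_lim _ l2).
Qed.

Lemma exp_substitution_R (G : R -> R) : (forall r, 0 < r -> {for r, continuous G}) ->
  \int[mu]_(r in Rp) G r = \int[mu]_x (G (expR x) * expR x).
Proof.
move=> cG; rewrite /Rintegral integralE [X in _ = fine X]integralE.
have p0 r : 0 < r -> {for r, continuous (fun r => Num.max (G r) 0)}.
  by move=> r0; apply: continuous_max; [exact: cG|exact: cst_continuous].
have n0 r : 0 < r -> {for r, continuous (fun r => Num.max (- G r) 0)}.
  by move=> r0; apply: continuous_max; [apply: cvgN; exact: cG|exact: cst_continuous].
have Ep D (h : R -> R) : (\int[mu]_(r in D) (fun r => (h r)%:E)^\+ r = \int[mu]_(r in D) (Num.max (h r) 0)%:E)%E.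
  by apply: eq_integral => r _; rewrite funeposE EFin_max.
have En D (h : R -> R) : (\int[mu]_(r in D) (fun r => (h r)%:E)^\- r = \int[mu]_(r in D) (Num.max (- h r) 0)%:E)%E.
  by apply: eq_integral => r _; rewrite funenegE EFin_max.
rewrite !Ep !En !exp_substitution //; last 2 first.
- by move=> r _; rewrite le_max lexx orbT.
- by move=> r _; rewrite le_max lexx orbT.
congr (fine (_ - _)); apply: eq_integral => x _; congr (_%:E).
- by rewrite maxr_pMl ?expR_ge0 // mul0r.
- by rewrite maxr_pMl ?expR_ge0 // mul0r mulNr.
Qed.

End exp_substitution.

(** * Weighted spaces as subspaces of the unweighted space *)

Section supported.
Context d (T : measurableType d) (R : realType).
Variables (mu : {measure set T -> \bar R}) (D : set T).
Hypothesis mD : measurable D.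
Implicit Types (f g : T -> R).

Definition L2on f := L2 mu f /\ forall x, ~ D x -> f x = 0.

Definition cut f x := if x \in D then f x else 0.

Lemma measurable_cut f : measurable_fun D f -> measurable_fun setT (cut f).
Proof.
move=> mf; have := (measurable_restrictT f mD).1 mf.
by apply: eq_measurable_fun => x _; rewrite patchE /cut.
Qed.

Lemma L2_cut f : L2 mu f -> L2on (cut f).
Proof.
move=> Lf; have [mf _] := Lf.
split; last by move=> x nD; rewrite /cut memNset.
apply: (L2_le _ Lf); first by apply: measurable_cut; exact: measurable_funTS.
by move=> x; rewrite /cut; case: ifP => // _; rewrite normr0.
Qed.

Lemma L2on_hilbert : hilbert L2on (ip mu).
Proof.
have H := L2_hilbert mu; split.
- by split; [exact: (hS0 H)|].
- move=> u v [Lu u0] [Lv v0]; split; first exact: (hSD H Lu Lv).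
  by move=> x nD; rewrite fctE u0 // v0 // addr0.
- move=> a u [Lu u0]; split; first exact: (hSZ H a Lu).
  by move=> x nD; rewrite fctE /GRing.scale /= u0 // mulr0.
- exact: (hipC H).
- by move=> u v w [Lu _] [Lv _] [Lw _]; exact: (hipD H Lu Lv Lw).
- by move=> a u w [Lu _] [Lw _]; exact: (hipZ H a Lu Lw).
- exact: (hge0 H).
move=> f Sf df.
have [g Lg lg] := hcomplete H (fun n => (Sf n).1) df.
exists (cut g); first exact: L2_cut.
move=> e e0; have [N hN] := lg e e0; exists N => n Nn.
apply: le_lt_trans (hN n Nn).
have L1 : L2 mu (f n - cut g) := hSB H (Sf n).1 (L2_cut Lg).1.
have L2' : L2 mu (f n - g) := hSB H (Sf n).1 Lg.
apply: le_Rintegral => //; [exact: (L2_mul_integrable L1 L1)|exact: (L2_mul_integrable L2' L2')|].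
move=> x _; rewrite !fctE /cut -!expr2; case: ifPn => // xD.
by rewrite (Sf n).2 ?subrr ?expr0n ?sqr_ge0 //; move: xD; rewrite notin_setE.
Qed.

Variable W : T -> R.
Hypotheses (mW : measurable_fun D W) (W0 : forall x, D x -> 0 < W x).

Implicit Types v : T -> R[i].

(** Multiplication by the square root [W] of a weight carries the weighted
    space on [D] onto the functions in the unweighted space that vanish
    outside [D]. *)
Definition tld v : (T -> R) * (T -> R) :=
  (cut (fun x => W x * complex.Re (v x)), cut (fun x => W x * complex.Im (v x))).

Definition untld (c : (T -> R) * (T -> R)) x : R[i] := Complex (c.1 x / W x) (c.2 x / W x).

Lemma normc_sq (z : R[i]) : Normc.normc z ^+ 2 = complex.Re z ^+ 2 + complex.Im z ^+ 2.
Proof. by case: z => a b /=; rewrite sqr_sqrtr // addr_ge0 ?sqr_ge0. Qed.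

Lemma tld_measurable v : cmeasurable D v ->
  measurable_fun setT (tld v).1 /\ measurable_fun setT (tld v).2.
Proof. by move=> [m1 m2]; split; apply: measurable_cut; exact: measurable_funM. Qed.

Lemma tld_norm v : cmeasurable D v ->
  (\int[mu]_(x in D) (Normc.normc (v x) ^+ 2 * W x ^+ 2)%:E =
   \int[mu]_x ((tld v).1 x ^+ 2)%:E + \int[mu]_x ((tld v).2 x ^+ 2)%:E)%E.
Proof.
move=> /tld_measurable[m1 m2]; rewrite integral_mkcond -ge0_integralD //.
- apply: eq_integral => x _; rewrite patchE /tld /cut /= -EFinD.
  case: ifP => _; last by rewrite expr0n addr0.
  by rewrite normc_sq; congr (_%:E); ring.
- by move=> x _; rewrite lee_fin sqr_ge0.
- by apply/measurable_EFinP/measurable_funX.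
- by move=> x _; rewrite lee_fin sqr_ge0.
- by apply/measurable_EFinP/measurable_funX.
Qed.

Lemma tld_on v : cmeasurable D v ->
  (\int[mu]_(x in D) (Normc.normc (v x) ^+ 2 * W x ^+ 2)%:E < +oo)%E ->
  pairS L2on (tld v).
Proof.
move=> mv; have [m1 m2] := tld_measurable mv; rewrite tld_norm // => fin.
have out f x : ~ D x -> cut f x = 0 by move=> nD; rewrite /cut memNset.
split; (split; last exact: out); split => //; apply: le_lt_trans fin.
- by rewrite leeDl // integral_ge0 // => x _; rewrite lee_fin sqr_ge0.
- by rewrite leeDr // integral_ge0 // => x _; rewrite lee_fin sqr_ge0.
Qed.

Lemma tld_ipE v : cmeasurable D v -> pairS L2on (tld v) ->
  (\int[mu]_(x in D) (Normc.normc (v x) ^+ 2 * W x ^+ 2)%:E = (ipc mu (tld v) (tld v))%:E)%E.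
Proof. by move=> mv [[L1 _] [L2' _]]; rewrite tld_norm // !L2_ipE. Qed.

Lemma untldK c : (forall x, ~ D x -> c.1 x = 0) -> (forall x, ~ D x -> c.2 x = 0) ->
  tld (untld c) = c.
Proof.
case: c => c1 c2 /= o1 o2; congr (_, _); apply/funext => x; rewrite /cut /=.
- case: ifPn => [/set_mem xD|]; last by rewrite notin_setE => /o1.
  by rewrite mulrC divfK // gt_eqF // W0.
- case: ifPn => [/set_mem xD|]; last by rewrite notin_setE => /o2.
  by rewrite mulrC divfK // gt_eqF // W0.
Qed.

Lemma untld_measurable c : measurable_fun D (fun x => (W x)^-1) -> measurable_fun setT c.1 -> measurable_fun setT c.2 ->
  cmeasurable D (untld c).
Proof.
move=> mV m1 m2; split; rewrite /untld /=.
- by apply: measurable_funM; [exact: measurable_funTS|exact: mV].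
- by apply: measurable_funM; [exact: measurable_funTS|exact: mV].
Qed.

Lemma tldD v w : tld (fun x => v x + w x) = tld v + tld w.
Proof.
rewrite /tld; congr (_, _); apply/funext => x; rewrite fctE /cut /=.
- by case: ifP => _; rewrite ?addr0 // raddfD mulrDr.
- by case: ifP => _; rewrite ?addr0 // raddfD mulrDr.
Qed.

Lemma tldZ (z : R[i]) v : tld (fun x => z * v x) =
  (complex.Re z *: (tld v).1 - complex.Im z *: (tld v).2,
   complex.Im z *: (tld v).1 + complex.Re z *: (tld v).2).
Proof.
rewrite /tld; congr (_, _); apply/funext => x; rewrite !fctE /GRing.scale /cut /=.
- by case: ifP => _; rewrite ?mulr0 ?subr0 //; case: z (v x) => [a b] [c e] /=; ring.
- by case: ifP => _; rewrite ?mulr0 ?addr0 //; case: z (v x) => [a b] [c e] /=; ring.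
Qed.

End supported.

Section compactly_supported.
Context {R : realType}.
Notation mu := (@lebesgue_measure R).
Implicit Types (D : set R) (g h : R -> R).

Definition cc D h := continuous h /\
  exists K, [/\ compact K, K `<=` D & forall x, ~ K x -> h x = 0].

Lemma cc_weight D (W h : R -> R) : open D -> (forall x, D x -> {for x, continuous W}) ->
  cc D h -> cc D (fun x => W x * h x).
Proof.
move=> oD cW [ch [K [cK KD h0]]]; split; last first.
  by exists K; split => // x /h0 ->; rewrite mulr0.
move=> x; have [xD|nD] := pselect (D x).
  by apply: cvgM; [exact: cW|exact: ch].
have nK : ~ K x by move=> /KD.
rewrite /continuous_at h0 // mulr0.
have oK : open (~` K) by rewrite openC; apply: compact_closed => //; exact: Rhausdorff.
apply: cvg_near_cst; have : nbhs x (~` K) by exact: open_nbhs_nbhs.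
by apply: filterS => y nKy; rewrite h0 ?mulr0.
Qed.

Lemma cc_integrable D h : cc D h -> mu.-integrable setT (EFin \o h).
Proof.
move=> [ch [K [cK KD h0]]].
have mK : measurable (K : set (measurableTypeR R)).
  by apply: closed_measurable; apply: compact_closed => //; exact: Rhausdorff.
have iK : mu.-integrable (K : set (measurableTypeR R)) (EFin \o h).
  by apply: continuous_compact_integrable => //; exact: continuous_subspaceT.
have := (@integrable_mkcond _ (measurableTypeR R) R mu _ _ mK).1 iK.
apply: eq_integrable => // x _; rewrite patchE; case: ifPn => //.
by rewrite notin_setE => /h0 /= ->.
Qed.

Lemma cc_bounded D h : cc D h -> exists M, forall x, `|h x| <= M.
Proof.
move=> [ch [K [cK KD h0]]].
have cI : compact (h @` K) by apply: continuous_compact => //; exact: continuous_subspaceT.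
have [M [_ hM]] := compact_bounded cI.
exists (`|M| + 1) => x; have [xK|nK] := pselect (K x); last by rewrite h0 // normr0 addr_ge0.
have MM : M < `|M| + 1 by rewrite (le_lt_trans (ler_norm M)) // ltrDl.
by apply: (hM _ MM); exists x.
Qed.

Lemma cc_nice D h : cc D h -> nice h.
Proof. by move=> ch; split; [case: ch|exact: cc_bounded ch|exact: cc_integrable ch]. Qed.

Lemma ccD D g h : cc D g -> cc D h -> cc D (g + h).
Proof.
move=> [cg [K [cK KD g0]]] [ch [K' [cK' KD' h0]]]; split.
  by move=> x; apply: cvgD; [exact: cg|exact: ch].
exists (K `|` K'); split; [exact: compactU|by move=> x [/KD|/KD']|].
by move=> x nK; rewrite fctE g0 ?h0 ?addr0 // => ?; apply: nK; [right|left].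
Qed.

Lemma ccZ D a h : cc D h -> cc D (a *: h).
Proof.
move=> [ch [K [cK KD h0]]]; split.
  by move=> x; apply: cvgMr; exact: ch.
by exists K; split => // x /h0 hx; rewrite fctE /GRing.scale /= hx mulr0.
Qed.

Lemma cc_L2on D h : cc D h -> L2on mu D h.
Proof.
move=> hc; split; first exact: nice_L2 (cc_nice hc).
by have [_ [K [_ KD h0]]] := hc => x nD; apply: h0 => /KD.
Qed.

(** The unitary substitution [r = expR x]. *)
Definition lift h x := Num.sqrt (expR x) * h (expR x).

Lemma RposE (r : R) : Rpos r = (0 < r).
Proof. by rewrite /Rpos /= in_itv /= andbT. Qed.

Lemma lift_nice h : cc Rpos h -> nice (lift h).
Proof.
move=> hc; have [ch _] := hc.
have oR : open (Rpos : set R) by exact: interval_open.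
have c1 : cc Rpos (fun r => Num.sqrt r * h r).
  by apply: cc_weight => // x _; exact: sqrt_continuous.
have c2 : cc Rpos (fun r => (Num.sqrt r)^-1 * h r).
  apply: cc_weight => // x; rewrite RposE => x0; apply: cvgV; last exact: sqrt_continuous.
  by rewrite gt_eqF // sqrtr_gt0.
have cl : continuous (lift h).
  move=> x; apply: cvgM.
    by apply: continuous_comp; [exact: continuous_expR|exact: sqrt_continuous].
  by apply: continuous_comp; [exact: continuous_expR|exact: ch].
split => //; first by have [M hM] := cc_bounded c1; exists M => x; exact: hM.
apply/integrableP; split; first by apply/measurable_EFinP; exact: continuous_measurable.
have [_ fin] := integrableP _ _ _ (cc_integrable c2).
apply: le_lt_trans fin.
have -> : (\int[mu]_x `|(EFin \o lift h) x| = \int[mu]_x (`|(Num.sqrt (expR x))^-1 * h (expR x)| * expR x)%:E)%E.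
  apply: eq_integral => x _ /=; congr (_%:E).
  have s0 : 0 < Num.sqrt (expR x) by rewrite sqrtr_gt0 expR_gt0.
  rewrite /lift !normrM normfV (gtr0_norm s0).
  rewrite -[X in _ = _ * X](sqr_sqrtr (expR_ge0 x)).
  by field; rewrite gt_eqF.
rewrite -(exp_substitution (G := fun r => `|(Num.sqrt r)^-1 * h r|)) //.
  apply: ge0_subset_integral => //; first exact: measurable_itv.
  have mm : measurable_fun setT (EFin \o (fun r => (Num.sqrt r)^-1 * h r)).
    by apply/measurable_EFinP; exact: (continuous_measurable c2.1).
  exact: (measurableT_comp (@abse_measurable R setT) mm).
by move=> r _; apply: (@cvg_norm _ _ _ _ _ _ _); exact: c2.1.
Qed.

Lemma lift_ip g h : cc Rpos g -> cc Rpos h -> ip mu (lift g) (lift h) = ip mu g h.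
Proof.
move=> [cg _] [ch [K [cK KD h0]]].
have -> : ip mu g h = \int[mu]_(r in Rpos) (g r * h r).
  rewrite /ip; apply: (@Rintegral_supported _ setT Rpos) => // r nr.
  by rewrite h0 ?mulr0 // => /KD.
rewrite exp_substitution_R; last by move=> r _; apply: cvgM; [exact: cg|exact: ch].
apply: eq_Rintegral => x _; rewrite /lift.
have s2 := sqr_sqrtr (expR_ge0 x).
by rewrite mulrACA -expr2 s2 mulrC.
Qed.

Lemma liftD g h : lift (g + h) = lift g + lift h.
Proof. by apply/funext => x; rewrite /lift !fctE mulrDr. Qed.

Lemma liftZ a h : lift (a *: h) = a *: lift h.
Proof. by apply/funext => x; rewrite /lift !fctE /GRing.scale /= mulrCA. Qed.

End compactly_supported.

(** * The Mellin transform in one dimension *)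

Section mellin_test.
Context {R : realType}.
Notation mu := (@lebesgue_measure R).
Notation V := ((R -> R) * (R -> R))%type.
Implicit Types (a b c : V) (s t x : R).

Definition liftc c : V := (lift c.1, lift c.2).
Definition ccc := pairS (cc (Rpos : set R)).

Lemma liftc_nice c : ccc c -> nicec (liftc c).
Proof. by move=> [c1 c2]; exact: (conj (lift_nice c1) (lift_nice c2)). Qed.

Lemma cccD a b : ccc a -> ccc b -> ccc (a + b).
Proof. by move=> [a1 a2] [b1 b2]; exact: (conj (ccD a1 b1) (ccD a2 b2)). Qed.

Lemma cccZ s a : ccc a -> ccc (s *: a).
Proof. by move=> [a1 a2]; exact: (conj (ccZ s a1) (ccZ s a2)). Qed.

Lemma ccc_L2on a : ccc a -> pairS (L2on mu Rpos) a.
Proof. by move=> [a1 a2]; exact: (conj (cc_L2on a1) (cc_L2on a2)). Qed.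

Lemma L2on_L2c d (T : measurableType d) (m : {measure set T -> \bar R}) D (a : (T -> R) * (T -> R)) :
  pairS (L2on m D) a -> L2c m a.
Proof. by move=> [[? _] [? _]]. Qed.

(** The unitary Mellin transform of a test function, in the coordinates in
    which both weighted spaces become unweighted. *)
Definition Mt a : V := (Num.sqrt (2 * pi))^-1 *: fhat (-1) (liftc a).

Lemma sqrt2pi_gt0 : 0 < Num.sqrt (2 * pi) :> R.
Proof. by rewrite sqrtr_gt0 mulr_gt0 // pi_gt0. Qed.

Lemma sqrt2pi_sq : Num.sqrt (2 * pi) ^+ 2 = 2 * pi :> R.
Proof. by rewrite sqr_sqrtr // mulr_ge0 // pi_ge0. Qed.

Lemma sqrt2pi_cancel x : (Num.sqrt (2 * pi))^-1 * ((Num.sqrt (2 * pi))^-1 * (2 * pi * x)) = x.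
Proof.
have e : (Num.sqrt (2 * pi))^-1 ^+ 2 * (2 * pi) = 1 :> R.
  by rewrite exprVn sqrt2pi_sq mulVf // gt_eqF // mulr_gt0 // pi_gt0.
by rewrite mulrA mulrA -expr2 e mul1r.
Qed.

Lemma MtD a b : ccc a -> ccc b -> Mt (a + b) = Mt a + Mt b.
Proof.
move=> ca cb; rewrite /Mt -scalerDr -(fhatD _ (liftc_nice ca) (liftc_nice cb)).
by rewrite /liftc /= !liftD.
Qed.

Lemma MtZ s a : ccc a -> Mt (s *: a) = s *: Mt a.
Proof.
move=> ca; have E : liftc (s *: a) = s *: liftc a by congr (_, _); exact: liftZ.
rewrite /Mt E (fhatZ _ s (liftc_nice ca)).
set k := (Num.sqrt _)^-1; set F := fhat _ _; clearbody F k.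
by rewrite !scalerA mulrC.
Qed.

Lemma Mt_L2c a : ccc a -> L2c mu (Mt a).
Proof.
move=> ca; have H := pair_hilbert (L2_hilbert mu).
have s1 : (-1 : R) ^+ 2 = 1 by rewrite sqrrN expr1n.
exact: (hSZ H _ (fhat_plancherel s1 (liftc_nice ca)).1).
Qed.

Lemma Mt_ip a b : ccc a -> ccc b -> ipc mu (Mt a) (Mt b) = ipc mu a b.
Proof.
move=> ca cb; have H := pair_hilbert (L2_hilbert mu).
have s1 : (-1 : R) ^+ 2 = 1 by rewrite sqrrN expr1n.
have Fa := (fhat_plancherel s1 (liftc_nice ca)).1.
have Fb := (fhat_plancherel s1 (liftc_nice cb)).1.
have E := fhat_ip s1 (liftc_nice ca) (liftc_nice cb).
have El : ipc mu (liftc a) (liftc b) = ipc mu a b.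
  by rewrite /pairip /= (lift_ip ca.1 cb.1) (lift_ip ca.2 cb.2).
rewrite /Mt (hipZ H _ Fa (hSZ H _ Fb)) (hipZr H _ Fb Fa) E El.
exact: sqrt2pi_cancel.
Qed.

(** The inverse Fourier transform followed by the inverse substitution. It is
    only needed on nice functions, where Plancherel's identity applies to it. *)
Definition Ms a : V :=
  let F := (Num.sqrt (2 * pi))^-1 *: fhat 1 a in
  (cut Rpos (fun r => (Num.sqrt r)^-1 * F.1 (ln r)),
   cut Rpos (fun r => (Num.sqrt r)^-1 * F.2 (ln r))).

Lemma continuous_phase_integral (k f : R -> R) : continuous k -> (forall x, `|k x| <= 1) ->
  nice f -> continuous (fun t => \int[mu]_x (k (t * x) * f x)).
Proof.
move=> ck k1 nf t; have [cf _ fi] := nf.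
have h := @continuity_under_integral R _ _ mu (fun t x => k (t * x) * f x) setT measurableT
  (t - 1) (t + 1) (fun u _ => phase_integrable u ck k1 nf).
apply: (h _ (fun x => `|f x|)).
- apply: aeW => x _ u _; apply: cvgMl.
  apply: (@continuous_comp _ _ _ (fun t => t * x) k); last exact: ck.
  by apply: cvgMl; exact: cvg_id.
- exact: integrable_normR fi.
- by move=> u _; apply: aeW => x _; rewrite normrM ler_piMl.
- by rewrite inE /= in_itv /=; apply/andP; split; lra.
Qed.

Lemma continuous_fcos (f : R -> R) : nice f -> continuous (fcos f).
Proof. exact: (continuous_phase_integral (@continuous_cos R) (@norm_cos_le1 R)). Qed.

Lemma continuous_fsin (f : R -> R) : nice f -> continuous (fsin f).
Proof. exact: (continuous_phase_integral (@continuous_sin R) (@norm_sin_le1 R)). Qed.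

Lemma continuous_fhat s a : nicec a -> continuous (fhat s a).1 /\ continuous (fhat s a).2.
Proof.
move=> [n1 n2]; split=> x /=.
- apply: cvgB; first exact: (continuous_fcos n1).
  by apply: cvgMr; exact: (continuous_fsin n2).
- apply: cvgD; first exact: (continuous_fcos n2).
  by apply: cvgMr; exact: (continuous_fsin n1).
Qed.

Lemma unlift_L2on (f : R -> R) : continuous f -> L2 mu f ->
  let g := cut Rpos (fun r => (Num.sqrt r)^-1 * f (ln r)) in
  L2on mu Rpos g /\ ip mu g g = ip mu f f.
Proof.
move=> cf Lf g; have mR : measurable (Rpos : set (measurableTypeR R)) := measurable_itv _.
have cg r : 0 < r -> {for r, continuous (fun r => (Num.sqrt r)^-1 * f (ln r))}.
  move=> r0; apply: cvgM.
    by apply: cvgV; [rewrite gt_eqF // sqrtr_gt0|exact: sqrt_continuous].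
  by apply: continuous_comp; [exact: continuous_ln|exact: cf].
have mg : measurable_fun setT g.
  apply: measurable_cut => //; apply: open_continuous_measurable_fun.
    exact: interval_open.
  by move=> r; rewrite inE RposE; exact: cg.
have E : (\int[mu]_r (g r ^+ 2)%:E = \int[mu]_x (f x ^+ 2)%:E)%E.
  transitivity (\int[mu]_(r in (Rpos : set (measurableTypeR R))) (((Num.sqrt r)^-1 * f (ln r)) ^+ 2)%:E)%E.
    rewrite [RHS]integral_mkcond; apply: eq_integral => r _; rewrite patchE /g /cut.
    by case: ifP => // _; rewrite expr0n.
  rewrite (exp_substitution (G := fun r => ((Num.sqrt r)^-1 * f (ln r)) ^+ 2)).
  - apply: eq_integral => x _; congr (_%:E).
    rewrite expRK exprMn exprVn (sqr_sqrtr (expR_ge0 x)) mulrC mulrA divff ?mul1r //.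
    by rewrite gt_eqF // expR_gt0.
  - move=> r r0; exact: (cvgM (cg r r0) (cg r r0)).
  - by move=> r _; exact: sqr_ge0.
have Lg : L2 mu g by split => //; rewrite E; case: Lf.
split; last by apply: EFin_inj; rewrite -!L2_ipE.
by split => // r nr; rewrite /g /cut memNset.
Qed.

Lemma Ms_L2on a : nicec a -> pairS (L2on mu Rpos) (Ms a) /\ ipc mu (Ms a) (Ms a) = ipc mu a a.
Proof.
move=> na; have H := pair_hilbert (L2_hilbert mu).
have s1 : (1 : R) ^+ 2 = 1 by rewrite expr1n.
have [LF EF] := fhat_plancherel s1 na.
have [c1 c2] := continuous_fhat 1 na.
pose k : R := (Num.sqrt (2 * pi))^-1.
have c1' : continuous (k *: fhat 1 a).1 by move=> x; apply: cvgMr; exact: c1.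
have c2' : continuous (k *: fhat 1 a).2 by move=> x; apply: cvgMr; exact: c2.
have [L1 L2'] := hSZ H k LF.
have [h1 e1] := unlift_L2on c1' L1; have [h2 e2] := unlift_L2on c2' L2'.
split; first exact: (conj h1 h2).
rewrite [LHS](_ : _ = ipc mu (k *: fhat 1 a) (k *: fhat 1 a)); last by rewrite /pairip -e1 -e2.
rewrite (hipZ H _ LF (hSZ H _ LF)) (hipZr H _ LF LF) EF.
exact: sqrt2pi_cancel.
Qed.

Lemma Ms_ip a c : nicec a -> ccc c -> ipc mu (Ms a) c = ipc mu a (Mt c).
Proof.
move=> na cc; have H := pair_hilbert (L2_hilbert mu).
have nl := liftc_nice cc; have [c1 c2] := continuous_fhat 1 na.
have s1 : (1 : R) ^+ 2 = 1 by rewrite expr1n.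
have s1' : (-1 : R) ^+ 2 = 1 by rewrite sqrrN expr1n.
have LF := (fhat_plancherel s1 na).1; have LM := (fhat_plancherel s1' nl).1.
have La : L2c mu a := conj (nice_L2 na.1) (nice_L2 na.2).
have Lc : L2c mu (liftc c) := conj (nice_L2 nl.1) (nice_L2 nl.2).
rewrite /Mt (hipZr H _ LM La) (fhat_adjoint _ nl na) opprK.
rewrite -(hipZ H _ LF Lc); set F := _ *: fhat 1 a.
have cF1 : continuous F.1 by move=> x; apply: cvgMr; exact: c1.
have cF2 : continuous F.2 by move=> x; apply: cvgMr; exact: c2.
have key (f h : R -> R) : continuous f -> Defs.compact_support_in Rpos h -> continuous h ->
   ip mu (cut Rpos (fun r => (Num.sqrt r)^-1 * f (ln r))) h = ip mu f (lift h).
  move=> cf [K [cK KR h0]] ch.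
  transitivity (\int[mu]_(r in (Rpos : set R)) ((Num.sqrt r)^-1 * f (ln r) * h r)).
    rewrite /ip [RHS]Rintegral_mkcond; apply: eq_Rintegral => r _; rewrite patchE /cut.
    by case: ifP => // _; rewrite mul0r.
  rewrite exp_substitution_R.
    apply: eq_Rintegral => x _; rewrite /lift expRK.
    have s0 : 0 < Num.sqrt (expR x) by rewrite sqrtr_gt0 expR_gt0.
    rewrite -[X in _ * X = _](sqr_sqrtr (expR_ge0 x)).
    by field; rewrite gt_eqF.
  move=> r r0; apply: cvgM; last exact: ch.
  apply: cvgM.
    by apply: cvgV; [rewrite gt_eqF // sqrtr_gt0|exact: sqrt_continuous].
  by apply: continuous_comp; [exact: continuous_ln|exact: cf].
have [[cc1 k1] [cc2 k2]] := cc.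
by rewrite /pairip /= (key _ _ cF1 k1 cc1) (key _ _ cF2 k2 cc2).
Qed.

End mellin_test.

Section mellin_basis.
Context {R : realType}.
Notation mu := (@lebesgue_measure R).
Notation V := ((R -> R) * (R -> R))%type.
Notation Rp := (Rpos : set (measurableTypeR R)).

#[local] Instance ae_mu_mellin : Filter (almost_everywhere mu) :=
  ae_filter_ringOfSetsType mu.

Lemma locally_integrable_weight (D : set R) (a W : R -> R) : L2 mu a ->
  (forall x, D x -> {for x, continuous W}) -> locally_integrable_on D (fun x => a x * W x).
Proof.
move=> La cW p q pqD; set I : set (measurableTypeR R) := `[p, q]%classic.
have mI : measurable I := measurable_itv _.
have cI : {within (I : set R), continuous W}.
  by apply: continuous_in_subspaceT => x /set_mem xI; apply: cW; exact: pqD.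
have cI2 : {within (I : set R), continuous (fun x => W x ^+ 2)}.
  apply: continuous_in_subspaceT => x /set_mem xI.
  exact: (cvgM (cW _ (pqD _ xI)) (cW _ (pqD _ xI))).
have cpt := @segment_compact R p q.
have i1 : mu.-integrable I (EFin \o W) := continuous_compact_integrable cpt cI.
have i2 : mu.-integrable I (EFin \o (fun x => W x ^+ 2)) := continuous_compact_integrable cpt cI2.
have i3 : mu.-integrable I (EFin \o (fun x => a x ^+ 2)).
  by apply: (integrableS measurableT) => //; exact: L2_sq_integrable.
apply: (@le_integrable _ _ _ mu _ _ _ _ _ _ (integrableD mI i3 i2)) => //.
  apply/measurable_EFinP/measurable_funM.
    by apply: measurable_funTS; case: La.
  by apply/measurable_EFinP; exact: measurable_int i1.
move=> x _ /=; rewrite lee_fin [leRHS]ger0_norm; last by rewrite addr_ge0 ?sqr_ge0.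
rewrite ler_norml; have := sqr_ge0 (a x + W x); have := sqr_ge0 (a x - W x).
by have := sqr_ge0 (a x); have := sqr_ge0 (W x); move=> *; apply/andP; split; nra.
Qed.

(** Dividing by a positive continuous weight preserves local integrability, so
    the separation property of bumps transfers to weighted spaces. *)
Lemma bump_null (D : set R) (a W : R -> R) : open D -> L2on mu D a ->
  (forall x, D x -> {for x, continuous W}) -> (forall x, D x -> 0 < W x) ->
  (forall k, ip mu a (cut D (fun x => W x * bump_seq D k x)) = 0) -> ip mu a a = 0.
Proof.
move=> oD [La a0] cW W0 h.
have li := locally_integrable_weight La cW.
have z : {ae mu, forall x, D x -> a x * W x = 0}.
  apply: bump_separates => // k; rewrite -[RHS](h k) /ip Rintegral_mkcond.
  apply: eq_Rintegral => x _; rewrite patchE /cut; case: ifP => _; last by rewrite mulr0.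
  by rewrite mulrA.
have L0 := L2_0 mu.
have az : {ae mu, forall x, a x = 0}.
  apply: filterS z => x hx; have [xD|/a0 //] := pselect (D x).
  by have /eqP := hx xD; rewrite mulf_eq0 (gt_eqF (W0 _ xD)) orbF => /eqP.
rewrite (ip_ae La L0 La L0 az az) /ip; under eq_Rintegral do rewrite mul0r.
by rewrite Rintegral_cst // mul0r.
Qed.

Variable beta : R.
Implicit Types (a b c : V) (v f : R -> R[i]).

Definition Wr (r : R) : R := r `^ (beta - 2^-1).
Definition tr v : V := tld Rpos Wr v.

Lemma powR_continuous s (r : R) : 0 < r -> {for r, continuous (fun r => r `^ s)}.
Proof.
move=> r0; apply: differentiable_continuous; apply/derivable1_diffP.
by have [] := is_derive1_powR s r0.
Qed.

Lemma open_Rpos : open (Rpos : set R).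
Proof. exact: interval_open. Qed.

Lemma Wr_gt0 r : Rpos r -> 0 < Wr r.
Proof. by rewrite RposE => r0; rewrite powR_gt0. Qed.

Lemma Wr_continuous r : Rpos r -> {for r, continuous Wr}.
Proof. by rewrite RposE; exact: powR_continuous. Qed.

Lemma measurable_Rp : measurable Rp. Proof. exact: measurable_itv. Qed.

Lemma measurable_powR_Rp s : measurable_fun Rp (fun r => r `^ s).
Proof.
apply: open_continuous_measurable_fun; first exact: open_Rpos.
by move=> r; rewrite inE RposE; exact: powR_continuous.
Qed.

Lemma tr_ccc f : Cc_infty_Rpos f -> ccc (tr f).
Proof.
move=> [s1 s2 [K [cK KR f0]]].
have E (g : R -> R) : (forall x, ~ K x -> g x = 0) -> cut Rpos g = g.
  move=> g0; apply/funext => x; rewrite /cut; case: ifPn => //.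
  by rewrite notin_setE => nx; rewrite g0 // => /KR.
split; rewrite /tr /tld /= E; try by move=> x /f0 ->; rewrite mulr0.
- apply: (cc_weight open_Rpos Wr_continuous); split; first exact: smooth_continuous.
  by exists K; split => // x /f0 ->.
- apply: (cc_weight open_Rpos Wr_continuous); split; first exact: smooth_continuous.
  by exists K; split => // x /f0 ->.
Qed.

Lemma Cc0 : Cc_infty_Rpos (cst 0 : R -> R[i]).
Proof.
split; [exact: smooth_cst|exact: smooth_cst|].
by exists set0; split => //; exact: compact0.
Qed.

Lemma CcD f g : Cc_infty_Rpos f -> Cc_infty_Rpos g -> Cc_infty_Rpos (fun r => f r + g r).
Proof.
move=> [s1 s2 [K [cK KR f0]]] [t1 t2 [K' [cK' KR' g0]]]; split.
- have -> : (fun x => complex.Re (f x + g x)) = (fun x => complex.Re (f x)) + (fun x => complex.Re (g x)).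
    by apply/funext => x; rewrite fctE raddfD.
  exact: smoothD.
- have -> : (fun x => complex.Im (f x + g x)) = (fun x => complex.Im (f x)) + (fun x => complex.Im (g x)).
    by apply/funext => x; rewrite fctE raddfD.
  exact: smoothD.
exists (K `|` K'); split; [exact: compactU|by move=> x [/KR|/KR']|].
by move=> x nK; rewrite f0 ?g0 ?addr0 // => ?; apply: nK; [right|left].
Qed.

Lemma CcZ (z : R[i]) f : Cc_infty_Rpos f -> Cc_infty_Rpos (fun r => z * f r).
Proof.
move=> [s1 s2 [K [cK KR f0]]]; split.
- have -> : (fun x => complex.Re (z * f x)) =
     complex.Re z *: (fun x => complex.Re (f x)) + (- complex.Im z) *: (fun x => complex.Im (f x)).
    by apply/funext => x; rewrite !fctE /GRing.scale /=; case: z (f x) => p q [u w] /=; ring.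
  by apply: smoothD; exact: smoothZ.
- have -> : (fun x => complex.Im (z * f x)) =
     complex.Im z *: (fun x => complex.Re (f x)) + complex.Re z *: (fun x => complex.Im (f x)).
    by apply/funext => x; rewrite !fctE /GRing.scale /=; case: z (f x) => p q [u w] /=; ring.
  by apply: smoothD; exact: smoothZ.
by exists K; split => // x /f0 ->; rewrite mulr0.
Qed.

Lemma Cc_real (b : R -> R) : test_function (Rpos : set R) b -> Cc_infty_Rpos (fun r => (b r)%:C%C).
Proof.
move=> [sb [K [cK KR b0]]]; split => //; first exact: smooth_cst.
by exists K; split => // x /b0 ->.
Qed.

Lemma trD f g : tr (fun r => f r + g r) = tr f + tr g.
Proof. exact: tldD. Qed.

Lemma trZ (z : R[i]) f : tr (fun r => z * f r) =
  (complex.Re z *: (tr f).1 - complex.Im z *: (tr f).2,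
   complex.Im z *: (tr f).1 + complex.Re z *: (tr f).2).
Proof. exact: tldZ. Qed.

Lemma trZr (s : R) f : tr (fun r => s%:C%C * f r) = s *: tr f.
Proof. by rewrite trZ /=; congr (_, _); rewrite scale0r ?subr0 ?add0r. Qed.

(** Bumps and their multiples by ['i]: an enumeration that spans the space
    over the real numbers. *)
Definition bumpc n : R -> R[i] := fun r =>
  (if odd n then 'i%C else 1) * (bump_seq Rpos n./2 r)%:C%C.

Lemma bumpc_Cc n : Cc_infty_Rpos (bumpc n).
Proof.
apply: CcZ; apply: Cc_real; apply: bump_seq_test.
by exists 1; rewrite RposE.
Qed.

Definition mb : nat -> V := gram_schmidt (ipc mu) (fun n => tr (bumpc n)).
Definition mbh k : V := Mt (mb k).

Let HL := pair_hilbert (L2_hilbert mu).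
Let HR := pair_hilbert (L2on_hilbert mu measurable_Rp).

Lemma tr_L2on f : Cc_infty_Rpos f -> pairS (L2on mu Rpos) (tr f).
Proof. by move=> /tr_ccc/ccc_L2on. Qed.

Lemma mb_tr k : exists2 f, Cc_infty_Rpos f & mb k = tr f.
Proof.
have := gs_closed (P := fun u => exists2 f, Cc_infty_Rpos f & u = tr f) (ipc mu) (d := fun n => tr (bumpc n)).
move=> /(_ _ _ _ _ k) [].
- exists (cst 0); first exact: Cc0.
  by rewrite /tr /tld /cut; congr (_, _); apply/funext => x; rewrite mulr0 if_same.
- move=> u w [f Cf ->] [g Cg ->]; exists (fun r => f r + g r); first exact: CcD.
  by rewrite trD.
- move=> s u [f Cf ->]; exists (fun r => s%:C%C * f r); first exact: CcZ.
  by rewrite trZr.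
- by move=> n; exists (bumpc n) => //; exact: bumpc_Cc.
- by [].
Qed.

Lemma mb_ccc k : ccc (mb k).
Proof. by have [f Cf ->] := mb_tr k; exact: tr_ccc. Qed.

Lemma mb_on : orthonormal (pairS (L2on mu Rpos)) (ipc mu) mb.
Proof. apply: (gs_orthonormal HR) => n; exact: (tr_L2on (bumpc_Cc n)). Qed.

Lemma mb_total : total (pairS (L2on mu Rpos)) (ipc mu) mb.
Proof.
move=> a Sa ae; have := gs_total HR (fun n => tr_L2on (bumpc_Cc n)) Sa ae.
move=> h; have [[La _] [Lb _]] := Sa.
have z0 : ip mu a.2 (cst 0) = 0.
  by rewrite /ip; under eq_Rintegral do rewrite mulr0; rewrite Rintegral_cst // mul0r.
have z1 : ip mu a.1 (cst 0) = 0.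
  by rewrite /ip; under eq_Rintegral do rewrite mulr0; rewrite Rintegral_cst // mul0r.
have d0 k : tr (bumpc k.*2) = (cut Rpos (fun r => Wr r * bump_seq Rpos k r), cst 0).
  congr (_, _); apply/funext => r; rewrite /cut /bumpc odd_double doubleK /=.
  - by case: ifP => // _; congr (_ * _); ring.
  - by case: ifP => // _; ring.
have d1 k : tr (bumpc k.*2.+1) = (cst 0, cut Rpos (fun r => Wr r * bump_seq Rpos k r)).
  congr (_, _); apply/funext => r; rewrite /cut /bumpc /= odd_double /= uphalf_double.
  - by case: ifP => // _; ring.
  - by case: ifP => // _; congr (_ * _); ring.
rewrite /pairip (bump_null open_Rpos Sa.1 Wr_continuous Wr_gt0); last first.
  by move=> k; have := h k.*2; rewrite /pairip d0 /= z0 addr0.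
rewrite add0r (bump_null open_Rpos Sa.2 Wr_continuous Wr_gt0) //.
by move=> k; have := h k.*2.+1; rewrite /pairip d1 /= z1 add0r.
Qed.

Lemma mbh_on : orthonormal (L2c mu) (ipc mu) mbh.
Proof.
have [_ oe ne] := mb_on; split.
- by move=> n; exact: Mt_L2c (mb_ccc n).
- by move=> i j ij; rewrite /mbh (Mt_ip (mb_ccc i) (mb_ccc j)); exact: oe.
- move=> i; rewrite /mbh (Mt_ip (mb_ccc i) (mb_ccc i)); have [n1|z] := ne i; [by left|right; rewrite z].
  have := MtZ 0 (mb_ccc i); rewrite !scale0r.
  by [].
Qed.

(** Surjectivity of the transform. Bumps [d] on the line are total, and Parseval's
    identity for [d] in the system [mbh] is Parseval's identity for [Ms d] in
    the total system [mb], because [Ms] is an isometry adjoint to [Mt]. *)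
Lemma mbh_total : total (L2c mu) (ipc mu) mbh.
Proof.
pose I : set R := setT.
pose D (a : V) := exists k, a = (bump_seq I k, cst 0) \/ a = (cst 0, bump_seq I k).
have I0 : I !=set0 by exists 0.
have nb k : nice (bump_seq I k).
  have [sb [K [cK KI b0]]] := bump_seq_test k I0.
  by apply: (cc_nice (D := I)); split; [exact: smooth_continuous|exists K].
have n0 : nice (cst 0 : R -> R).
  apply: (cc_nice (D := I)); split; first by move=> x; exact: cvg_cst.
  by exists set0; split => //; exact: compact0.
have nD a : D a -> nicec a by move=> [k [->|->]]; [exact: (conj (nb k) n0)|exact: (conj n0 (nb k))].
have ND a : D a -> L2c mu a by move=> /nD[n1 n2]; exact: (conj (nice_L2 n1) (nice_L2 n2)).
apply: (total_of_parseval HL (D := D) mbh_on ND).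
- move=> a [La1 La2] h.
  have z (g : R -> R) : ip mu g (cst 0) = 0.
    by rewrite /ip; under eq_Rintegral do rewrite mulr0; rewrite Rintegral_cst // mul0r.
  have c1 x : I x -> {for x, continuous (cst 1 : R -> R)} by move=> _; exact: cvg_cst.
  have w1 x : I x -> 0 < (cst 1 : R -> R) x by [].
  have cE k : cut I (fun x => cst 1 x * bump_seq I k x) = bump_seq I k.
    by apply/funext => x; rewrite /cut mem_set // mul1r.
  have on g : L2 mu g -> L2on mu I g by move=> Lg; split => // x nI; case: nI.
  rewrite /pairip (bump_null openT (on _ La1) c1 w1); last first.
    move=> k; have := h (bump_seq I k, cst 0) (ex_intro _ k (or_introl erefl)).
    by rewrite /pairip /= z addr0 cE.
  rewrite (bump_null openT (on _ La2) c1 w1) ?addr0 //.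
  move=> k; have := h (cst 0, bump_seq I k) (ex_intro _ k (or_intror erefl)).
  by rewrite /pairip /= z add0r cE.
- move=> a Da; have na := nD _ Da; have [SM EM] := Ms_L2on na.
  rewrite -EM -(parseval HR mb_on mb_total SM); apply: eq_eseriesr => k _.
  by rewrite (Ms_ip na (mb_ccc k)).
Qed.

End mellin_basis.

(** * Weak solutions of first-order equations on the half-line *)

Section half_line.
Context {R : realType}.
Notation mu := (@lebesgue_measure R).
Notation Rp := (Rpos : set (measurableTypeR R)).
Implicit Types (f g h F chi : R -> R) (s x y r : R).

#[local] Instance ae_mu_half : Filter (almost_everywhere mu) :=
  ae_filter_ringOfSetsType mu.

Lemma is_derive_continuous F g : (forall x, is_derive x 1 F (g x)) -> continuous F.
Proof.
by move=> dF x; apply: differentiable_continuous; apply/derivable1_diffP; have [] := dF x.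
Qed.

Lemma is_derive_derive1 F g : (forall x, is_derive x 1 F (g x)) -> F^`()%classic = g.
Proof. by move=> dF; apply/funext => x; rewrite derive1E; have [_] := dF x. Qed.

Lemma smooth_is_derive F : smooth F -> forall x, is_derive x 1 F (F^`()%classic x).
Proof.
move=> sF x; rewrite derive1E; apply: DeriveDef => //.
by apply/derivable1_diffP; exact: smooth_differentiable.
Qed.

Lemma smooth_of_derive F g : (forall x, is_derive x 1 F (g x)) -> smooth g -> smooth F.
Proof.
move=> dF sg; apply/smoothP; case=> // n.
have dif x : differentiable F x by apply/derivable1_diffP; have [] := dF x.
split => // v; have -> : 'D_v F = v *: g.
  by apply/funext => x; rewrite derive_real // (is_derive_derive1 dF).
by have /smoothP := smoothZ v sg; exact.
Qed.

Lemma integral_derive0 F g K : continuous g -> (forall x, is_derive x 1 F (g x)) ->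
  (forall x, K <= `|x| -> F x = 0) -> (forall x, K <= `|x| -> g x = 0) ->
  \int[mu]_x g x = 0.
Proof.
move=> cg dF F0 g0; pose M := Num.max K 1.
have KM : K <= M by rewrite le_max lexx.
have M0 : 0 < M by rewrite lt_max ltr01 orbT.
have MM : - M < M by lra.
have E : \int[mu]_x g x = \int[mu]_(x in `[- M, M]) g x.
  apply: (@Rintegral_supported _ setT) => // x /=; rewrite in_itv /= => /negP.
  by rewrite -ler_norml -ltNge => /ltW h; apply: g0; exact: le_trans h.
rewrite E /Rintegral (continuous_FTC2 (F := F) MM).
- have -> : F M = 0 by apply: F0; rewrite (ger0_norm (ltW M0)).
  have -> : F (- M) = 0 by apply: F0; rewrite normrN (ger0_norm (ltW M0)).
  by rewrite -EFinB subrr.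
- exact: continuous_subspaceT.
- have cF := is_derive_continuous dF; split.
  + by move=> x _; have [] := dF x.
  + by apply: cvg_at_right_filter; exact: cF.
  + by apply: cvg_at_left_filter; exact: cF.
- by move=> x _; rewrite (is_derive_derive1 dF).
Qed.

Lemma fcos_derive F g K : continuous g -> (forall x, is_derive x 1 F (g x)) ->
  (forall x, K <= `|x| -> F x = 0) -> (forall x, K <= `|x| -> g x = 0) ->
  nice F -> nice g ->
  (forall t, fcos g t = t * fsin F t) /\ (forall t, fsin g t = - (t * fcos F t)).
Proof.
move=> cg dF F0 g0 nF ng; have cF := is_derive_continuous dF.
have trig t x : is_derive x 1 (fun x => sin (t * x)) (t * cos (t * x)) /\
                is_derive x 1 (fun x => cos (t * x)) (- t * sin (t * x)).
  have [ds dc] := is_derive_trig t x.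
  have E1 : (fun x => sin (t * x)) = (fun x => sin (x * t)) by apply/funext => u; rewrite mulrC.
  have E2 : (fun x => cos (t * x)) = (fun x => cos (x * t)) by apply/funext => u; rewrite mulrC.
  by rewrite E1 E2 [t * x]mulrC.
have csin t : continuous (fun x => sin (t * x)).
  exact: (is_derive_continuous (fun x => (trig t x).1)).
have ccos t : continuous (fun x => cos (t * x)).
  exact: (is_derive_continuous (fun x => (trig t x).2)).
have pc t := phase_integrable t (@continuous_cos R) (@norm_cos_le1 R).
have ps t := phase_integrable t (@continuous_sin R) (@norm_sin_le1 R).
split=> t.
- have dP x : is_derive x 1 (fun x => cos (t * x) * F x) (cos (t * x) * g x - t * (sin (t * x) * F x)).
    by apply: (is_derive_eq (is_deriveM (trig t x).2 (dF x))); rewrite /GRing.scale /=; ring.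
  have cP : continuous (fun x => cos (t * x) * g x - t * (sin (t * x) * F x)).
    move=> x; apply: cvgB; first by apply: cvgM; [exact: ccos|exact: cg].
    by apply: cvgMr; apply: cvgM; [exact: csin|exact: cF].
  have := integral_derive0 (K := K) cP dP _ _.
  rewrite (RintegralB measurableT (pc _ t ng) (integrableZl measurableT t (ps _ t nF))).
  rewrite (RintegralZl t measurableT (ps _ t nF)).
  move=> h; apply/eqP; rewrite -subr_eq0; apply/eqP; apply: h.
  + by move=> x /F0 ->; rewrite mulr0.
  + by move=> x Kx; rewrite g0 // F0 // !mulr0 subr0.
- have dP x : is_derive x 1 (fun x => sin (t * x) * F x) (sin (t * x) * g x + t * (cos (t * x) * F x)).
    by apply: (is_derive_eq (is_deriveM (trig t x).1 (dF x))); rewrite /GRing.scale /=; ring.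
  have cP : continuous (fun x => sin (t * x) * g x + t * (cos (t * x) * F x)).
    move=> x; apply: cvgD; first by apply: cvgM; [exact: csin|exact: cg].
    by apply: cvgMr; apply: cvgM; [exact: ccos|exact: cF].
  have := integral_derive0 (K := K) cP dP _ _.
  rewrite (RintegralD measurableT (ps _ t ng) (integrableZl measurableT t (pc _ t nF))).
  rewrite (RintegralZl t measurableT (pc _ t nF)).
  move=> h; apply/eqP; rewrite -addr_eq0; apply/eqP; apply: h.
  + by move=> x /F0 ->; rewrite mulr0.
  + by move=> x Kx; rewrite g0 // F0 // !mulr0 addr0.
Qed.

Lemma compact_bounded_Rpos (K : set R) : compact K -> K `<=` Rpos ->
  exists B, forall r, K r -> `|ln r| <= B.
Proof.
move=> cK KR; have cI : compact ((@ln R) @` K).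
  apply: continuous_compact => //; apply: continuous_in_subspaceT => r /set_mem /KR.
  by rewrite RposE; exact: continuous_ln.
have [M [_ hM]] := compact_bounded cI.
have MM : M < `|M| + 1 by rewrite (le_lt_trans (ler_norm M)) // ltrDl.
by exists (`|M| + 1) => r Kr; apply: (hM _ MM); exists r.
Qed.

Lemma test_powR s h : test_function (Rpos : set R) h ->
  test_function (Rpos : set R) (fun r => r `^ s * h r).
Proof.
move=> [sh [K [cK KR h0]]]; split; last first.
  by exists K; split => // r /h0 ->; rewrite mulr0.
apply/smoothP => n; elim: n s h sh h0 => // n IH s h sh h0.
have d x : is_derive x 1 (fun r => r `^ s * h r)
    (x `^ (s - 1) * (s * h x + x * h^`()%classic x)).
  have [xR|xR] := pselect (Rpos x).
    move: xR; rewrite RposE => x0.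
    have := is_deriveM (is_derive1_powR s x0) (smooth_is_derive sh x).
    move=> dd; apply: (is_derive_eq dd); rewrite /GRing.scale /= powRB ?(gt_eqF x0) ?implybT //.
    by rewrite powRr1 ?ltW //; field; rewrite gt_eqF.
  have nK : ~ K x by move=> /KR.
  have oK : open (~` K) by rewrite openC; apply: compact_closed => //; exact: Rhausdorff.
  have nb : \forall y \near x, (cst 0 : R -> R) y = y `^ s * h y.
    have : nbhs x (~` K) by exact: open_nbhs_nbhs.
    by apply: filterS => y nKy; rewrite h0 ?mulr0.
  have -> : x `^ (s - 1) * (s * h x + x * h^`()%classic x) = 0.
    have -> : h^`()%classic x = 0.
      rewrite derive1E; have nb' : \forall y \near x, h y = (cst 0 : R -> R) y.
        have : nbhs x (~` K) by exact: open_nbhs_nbhs.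
        by apply: filterS => y nKy; rewrite h0.
      by rewrite (near_eq_derive _ nb') derive_cst.
    by rewrite h0 // !mulr0 addr0 mulr0.
  apply: (near_eq_is_derive nb).
have dif x : differentiable (fun r => r `^ s * h r) x.
  by apply/derivable1_diffP; have [] := d x.
split => // v.
have -> : 'D_v (fun r => r `^ s * h r) =
    (fun r => r `^ (s - 1) * (v * (s * h r + r * h^`()%classic r))).
  by apply/funext => x; rewrite derive_real // (is_derive_derive1 d); ring.
apply: IH; last first.
  move=> x nK; rewrite h0 // mulr0 add0r.
  have oK : open (~` K) by rewrite openC; apply: compact_closed => //; exact: Rhausdorff.
  rewrite derive1E; have nb' : \forall y \near x, h y = (cst 0 : R -> R) y.
    have : nbhs x (~` K) by exact: open_nbhs_nbhs.
    by apply: filterS => y nKy; rewrite h0.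
  by rewrite (near_eq_derive _ nb') derive_cst !mulr0.
have -> : (fun r => v * (s * h r + r * h^`()%classic r)) =
    v *: (s *: h + (id : R -> R) * h^`()%classic) by [].
apply: smoothZ; apply: smoothD; first exact: smoothZ.
exact: (smoothM (@smooth_id R) (smooth_derive1 sh)).
Qed.

Lemma test_cc (D : set R) h : test_function D h -> cc D h.
Proof. by move=> [sh [K [cK KD h0]]]; split; [exact: smooth_continuous|exists K]. Qed.

(** The primitive that vanishes at the left of the support also vanishes at its
    right, because the integral is zero. *)
Lemma primitive_test psi : test_function (Rpos : set R) psi -> \int[mu]_x psi x = 0 ->
  exists2 chi, test_function (Rpos : set R) chi & forall x, is_derive x 1 chi (psi x).
Proof.
move=> tp z; have [sp [K [cK KR p0]]] := tp.
have [B hB] := compact_bounded_Rpos cK KR.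
have cp := smooth_continuous sp.
have ip := cc_integrable (test_cc tp).
have out x : ~ `[expR (- B), expR B]%classic x -> psi x = 0.
  move=> nx; apply: p0 => Kx; apply: nx; rewrite /= in_itv /=.
  have := KR _ Kx; rewrite RposE => x0.
  have := hB _ Kx; rewrite ler_norml => /andP[b1 b2].
  by apply/andP; split; rewrite -[x]lnK ?posrE // ler_expR.
pose chi x := \int[mu]_(t in `]-oo, x]) psi t.
have dchi x : is_derive x 1 chi (psi x).
  have xx : x < x + 1 by rewrite ltrDl.
  have ix : mu.-integrable [set` Interval (BInfty R true) (BRight (x + 1))] (EFin \o psi).
    by apply: (integrableS measurableT) => //; exact: measurable_itv.
  have [|d e] := continuous_FTC1 xx ix _ (cp x).
    exact: ltNyr.

  by rewrite -e derive1E; apply: DeriveDef.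
exists chi => //; split; first exact: (smooth_of_derive dchi).
exists `[expR (- B), expR B]%classic; split.
- exact: segment_compact.
- move=> x /=; rewrite RposE in_itv /= => /andP[h _].
  by apply: lt_le_trans h; exact: expR_gt0.
- move=> x nx; rewrite /chi; have [xs|xl] := ltP x (expR (- B)).
    rewrite Rintegral_mkcond; under eq_Rintegral => t _.
      rewrite patchE; have -> : (if t \in `]-oo, x]%classic then psi t else 0) = 0.
        case: ifPn => // /set_mem; rewrite /= in_itv /= => tx; apply: out.
        rewrite /= in_itv /= => /andP[h _]; have := le_lt_trans tx xs.
        by rewrite ltNge h.
      over.
    by rewrite Rintegral_cst // mul0r.
  rewrite -z; symmetry; apply: (@Rintegral_supported _ setT) => // t /= nt.
  apply: out => /=; rewrite in_itv /= => /andP[h1 h2]; apply: nt.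
  rewrite /= in_itv /=; apply: (le_trans h2); rewrite leNgt; apply/negP => xB.
  by apply: nx; rewrite /= in_itv /= xl ltW.
Qed.

Lemma test_mul_integrable f h : locally_integrable_on (Rpos : set R) f ->
  test_function (Rpos : set R) h -> mu.-integrable Rp (EFin \o (fun r => f r * h r)).
Proof.
move=> lf th; have [sh [K [cK KR h0]]] := th.
have [B hB] := compact_bounded_Rpos cK KR.
pose J : set (measurableTypeR R) := `[expR (- B), expR B]%classic.
have JR : J `<=` Rpos.
  move=> x; rewrite /J /= RposE in_itv /= => /andP[h1 _].
  by apply: lt_le_trans h1; exact: expR_gt0.
have out x : ~ J x -> h x = 0.
  move=> nx; apply: h0 => Kx; apply: nx; rewrite /J /= in_itv /=.
  have := KR _ Kx; rewrite RposE => x0.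
  have := hB _ Kx; rewrite ler_norml => /andP[b1 b2].
  by apply/andP; split; rewrite -[x]lnK ?posrE // ler_expR.
have mJ : measurable J := measurable_itv _.
have [M hM] := cc_bounded (test_cc th).
have iJ : mu.-integrable J (EFin \o f) by exact: lf.
have i1 : mu.-integrable J (EFin \o (fun r => f r * h r)).
  apply: (@le_integrable _ _ _ mu _ _ _ _ _ _ (integrableZl mJ M iJ)) => //.
    apply/measurable_EFinP/measurable_funM; first exact: integrable_measurable iJ.
    by apply: measurable_funTS; apply: continuous_measurable; exact: smooth_continuous.
  move=> x _; rewrite /= lee_fin !normrM mulrC; apply: ler_wpM2r => //.
  by apply: le_trans (hM x) _; exact: ler_norm.
have mR : measurable Rp := measurable_itv _.
apply: (integrable_mkcond _ mR).2.
have := (integrable_mkcond _ mJ).1 i1; apply: eq_integrable => // x _.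
rewrite !patchE; case: ifPn => xJ; case: ifPn => xR //.
- by move: xR; rewrite notin_setE => /(_ (JR _ (set_mem xJ))).
- by rewrite /= out ?mulr0 //; move: xJ; rewrite notin_setE.
Qed.

Lemma mu_Rp_neq0 : mu Rp <> 0%E.
Proof. by rewrite /Rpos lebesgue_measure_itv /= ltry. Qed.

Lemma not_ae_Rpos (P : Prop) : {ae mu, forall r, Rpos r -> P} -> P.
Proof.
move=> [N [mN N0 sN]]; apply: contrapT => nP; apply: mu_Rp_neq0.
apply: (subset_measure0 _ mN _ N0); first exact: measurable_itv.
by move=> r rR; apply: sN => /= /(_ rR).
Qed.

(** Test functions of mean zero are derivatives, so subtracting the mean of [f]
    against a fixed bump leaves a function annihilated by all test functions. *)
Lemma du_bois_reymond f : locally_integrable_on (Rpos : set R) f ->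
  (forall chi, test_function (Rpos : set R) chi ->
     \int[mu]_(r in Rp) (f r * chi^`()%classic r) = 0) ->
  exists C, {ae mu, forall r, Rpos r -> f r = C}.
Proof.
move=> lf hf.
have mR : measurable Rp := measurable_itv _.
have tb k : test_function (Rpos : set R) (bump_seq Rpos k).
  by apply: bump_seq_test; exists 1; rewrite RposE.
pose I h := \int[mu]_(x in Rp) h x.
have l1 : locally_integrable_on (Rpos : set R) (cst 1).
  move=> p q _; apply: continuous_compact_integrable; first exact: segment_compact.
  by apply: continuous_subspaceT => x; exact: cvg_cst.
have iT h : test_function (Rpos : set R) h -> mu.-integrable Rp (EFin \o h).
  move=> th; have := test_mul_integrable l1 th.
  by apply: eq_integrable => // x _; rewrite /= mul1r.
have [k0 Ik0] : exists k, I (bump_seq Rpos k) != 0.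
  apply: contrapT => nk; suff : (1 : R) = 0 by apply/eqP; rewrite oner_eq0.
  apply: not_ae_Rpos; apply: (bump_separates open_Rpos l1) => k.
  under eq_Rintegral do rewrite mul1r.
  by apply/eqP/negPn/negP => h; apply: nk; exists k.
pose psi0 := (I (bump_seq Rpos k0))^-1 *: bump_seq Rpos k0.
have tZ a h : test_function (Rpos : set R) h -> test_function (Rpos : set R) (a *: h).
  move=> [sh [K [cK KR h0]]]; split; first exact: smoothZ.
  by exists K; split => // x /h0 hx; rewrite fctE /GRing.scale /= hx mulr0.
have tD h g : test_function (Rpos : set R) h -> test_function (Rpos : set R) g ->
    test_function (Rpos : set R) (h + g).
  move=> [sh [K [cK KR h0]]] [sg [K' [cK' KR' g0]]]; split; first exact: smoothD.
  exists (K `|` K'); split; [exact: compactU|by move=> x [/KR|/KR']|].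
  by move=> x nK; rewrite fctE h0 ?g0 ?addr0 // => ?; apply: nK; [right|left].
have t0 : test_function (Rpos : set R) psi0 by exact: tZ.
have I1 : I psi0 = 1.
  rewrite /I /psi0; under eq_Rintegral do rewrite fctE /GRing.scale /=.
  by rewrite (RintegralZl _ mR (iT _ (tb k0))) mulVf.
pose C := \int[mu]_(r in Rp) (f r * psi0 r).
exists C.
suff : {ae mu, forall r, Rpos r -> f r - C = 0}.
  by apply: filterS => r h /h /eqP; rewrite subr_eq0 => /eqP.
apply: (bump_separates open_Rpos).
  move=> p q pq; have mI : measurable (`[p, q]%classic : set (measurableTypeR R)) := measurable_itv _.
  have i2 := integrableZl mI C (l1 _ _ pq).
  have := integrableB mI (lf _ _ pq) i2; apply: eq_integrable => // x _.
  by change ((f x)%:E - C%:E * 1%:E = (f x - C)%:E)%E; rewrite mule1 EFinB.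
move=> k; set b := bump_seq Rpos k.
pose psi x := b x - I b * psi0 x.
have tp : test_function (Rpos : set R) psi.
  have -> : psi = b + (- I b) *: psi0.
    by apply/funext => x; rewrite /psi -mulNr.
  exact: (tD _ _ (tb k) (tZ _ _ t0)).
have psiE (g : R -> R) : (forall h, test_function (Rpos : set R) h ->
      mu.-integrable Rp (EFin \o (fun r => g r * h r))) ->
    \int[mu]_(r in Rp) (g r * psi r) =
    \int[mu]_(r in Rp) (g r * b r) - I b * \int[mu]_(r in Rp) (g r * psi0 r).
  move=> ig; rewrite -(RintegralZl _ mR (ig _ t0)).
  rewrite -(RintegralB mR (ig _ (tb k)) (integrableZl mR _ (ig _ t0))).
  by apply: eq_Rintegral => r _; rewrite /psi mulrBr mulrCA.
have z : \int[mu]_x psi x = 0.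
  have [_ [K [_ KR p0]]] := tp.
  have -> : \int[mu]_x psi x = \int[mu]_(x in Rp) (cst 1 x * psi x).
    rewrite (@Rintegral_supported _ setT Rpos) //; last by move=> x nx; apply: p0 => /KR.
    by apply: eq_Rintegral => x _; rewrite mul1r.
  rewrite psiE; last by move=> h; exact: test_mul_integrable.
  have -> : \int[mu]_(r in Rp) (cst 1 r * psi0 r) = 1.
    by rewrite -[RHS]I1; apply: eq_Rintegral => r _; rewrite mul1r.
  have -> : \int[mu]_(r in Rp) (cst 1 r * b r) = I b.
    by apply: eq_Rintegral => r _; rewrite mul1r.
  by rewrite mulr1 subrr.
have [chi tchi dchi] := primitive_test tp z.
have := hf _ tchi; rewrite (is_derive_derive1 dchi) psiE; last by move=> h; exact: test_mul_integrable.
rewrite -/C => E; have ib := test_mul_integrable lf (tb k).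
under eq_Rintegral do rewrite mulrBl.
rewrite (RintegralB mR ib (integrableZl mR C (iT _ (tb k)))) (RintegralZl _ mR (iT _ (tb k))).
by rewrite -/(I b) [C * _]mulrC; exact: E.
Qed.

(** The power [r ^ 1/2] does not belong to the space, so that a homogeneous
    solution that does vanishes. *)
Lemma sqrt_not_L2 (a : R -> R) C : L2on mu Rpos a ->
  {ae mu, forall r, Rpos r -> a r * r `^ (- 2^-1) = C} -> ip mu a a = 0.
Proof.
move=> [La a0] h; have [C0|nC] := eqVneq C 0.
  have L0 := L2_0 mu.
  have az : {ae mu, forall x, a x = 0}.
    apply: filterS h => x hx; have [xD|/a0 //] := pselect (Rpos x).
    have := hx xD; rewrite C0 => /eqP; rewrite mulf_eq0 => /orP[/eqP//|].
    by rewrite gt_eqF // powR_gt0; move: xD; rewrite RposE.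
  rewrite (ip_ae La L0 La L0 az az) /ip; under eq_Rintegral do rewrite mul0r.
  by rewrite Rintegral_cst // mul0r.
exfalso; have [ma fin] := La.
pose J : set (measurableTypeR R) := `]1, +oo[%classic.
have mJ : measurable J := measurable_itv _.
have muJ : mu J = +oo%E by rewrite /J lebesgue_measure_itv /= ltry.
have : (\int[mu]_(x in J) (C ^+ 2)%:E <= \int[mu]_x (a x ^+ 2)%:E)%E.
  rewrite [leLHS]integral_mkcond; apply: ae_le_integral.
  - by move=> x _; rewrite patchE; case: ifP => // _; rewrite lee_fin sqr_ge0.
  - by move=> x _; rewrite lee_fin sqr_ge0.
  apply: filterS h => x hx _; rewrite patchE; case: ifPn => [/set_mem|_]; last by rewrite lee_fin sqr_ge0.
  rewrite /J /= in_itv /= andbT => x1.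
  have x0 : 0 < x by exact: lt_trans x1.
  have := hx; rewrite RposE => /(_ x0) <-.
  rewrite lee_fin exprMn ler_piMr ?sqr_ge0 // -powR_mulrn ?powR_ge0 // -powRrM.
  rewrite mulNr mulVf // powRN powRr1 ?ltW //.
  by rewrite invf_lt1.
have -> : (\int[mu]_(x in J) (C ^+ 2)%:E = (C ^+ 2)%:E * mu J)%E by rewrite integral_cst.
rewrite muJ gt0_muley; last by rewrite lte_fin exprn_even_gt0.
by rewrite leye_eq => /eqP E; move: fin; rewrite E ltxx.
Qed.

End half_line.

(** * Mellin pairs *)

Section mellin_pair.
Context {R : realType}.
Notation mu := (@lebesgue_measure R).
Notation V := ((R -> R) * (R -> R))%type.
Notation Rp := (Rpos : set (measurableTypeR R)).
Variable beta : R.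
Implicit Types (a b c : V) (f : R -> R[i]).

#[local] Instance ae_mu_pair : Filter (almost_everywhere mu) :=
  ae_filter_ringOfSetsType mu.

Let HL := pair_hilbert (L2_hilbert mu).
Let HR := pair_hilbert (L2on_hilbert mu (@measurable_Rp R)).

Notation tr := (tr beta).

Lemma cccN c : ccc c -> ccc (- c).
Proof. by move=> h; rewrite -scaleN1r; exact: cccZ. Qed.

Lemma MtB c c' : ccc c -> ccc c' -> Mt (c - c') = Mt c - Mt c'.
Proof.
move=> h h'; rewrite (MtD h (cccN h')); congr (_ + _).
by rewrite -[- c']scaleN1r (MtZ _ h') scaleN1r.
Qed.

(** The extension by continuity of the transform is encoded through its adjoint
    relation with smooth functions: this determines [b] from [a] and conversely,
    and is stable under linear combinations without taking limits. *)
Definition MP a b := [/\ pairS (L2on mu Rpos) a, L2c mu b &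
  forall f, Cc_infty_Rpos f -> ipc mu a (tr f) = ipc mu b (Mt (tr f))].

(** The coefficients in [mb] and [mbh] determine [a] and [b], and the expansion
    of a smooth function in [mb] is carried by [Mt] to its expansion in [mbh]. *)
Lemma MP_of_basis a b : pairS (L2on mu Rpos) a -> L2c mu b ->
  (forall k, ipc mu a (mb beta k) = ipc mu b (mbh beta k)) -> MP a b.
Proof.
move=> Sa Sb ab; split => // f Cf.
have Sc := tr_L2on beta Cf; have cc0 := tr_ccc beta Cf; set c := tr f in Sc cc0 *.
have [Se oe ne] := mb_on beta.
pose s n := \sum_(i < n) ipc mu c (mb beta i) *: mb beta i.
have cs n : ccc (s n).
  rewrite /s; elim: n => [|n IH]; last first.
    by rewrite big_ord_recr /=; exact: (cccD IH (cccZ _ (mb_ccc beta n))).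
  rewrite big_ord0; have := cccZ 0 cc0; by rewrite scale0r.
have Ms n : Mt (s n) = \sum_(i < n) ipc mu c (mb beta i) *: mbh beta i.
  rewrite /s; elim: n => [|n IH].
    by rewrite !big_ord0; have := MtZ 0 cc0; rewrite !scale0r.
  rewrite !big_ord_recr /= -IH (MtD (cs n) (cccZ _ (mb_ccc beta n))).
  by rewrite (MtZ _ (mb_ccc beta n)).
have Sa' := L2on_L2c Sa; have Sc' := L2on_L2c Sc.
have eq n : ipc mu (s n) a = ipc mu (Mt (s n)) b.
  rewrite Ms (hip_comb HL n (fun i => ipc mu c (mb beta i)) (fun i => L2on_L2c (Se i)) Sa').
  have [Seh _ _] := mbh_on beta.
  rewrite (hip_comb HL n (fun i => ipc mu c (mb beta i)) Seh Sb).
  by apply: eq_bigr => i _; rewrite (hipC HL _ a) (hipC HL _ b) ab.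
have lim1 := expansion HR (mb_on beta) (@mb_total R beta) Sc.
have lim2 e : 0 < e -> exists N0 : nat, forall n, (N0 <= n)%N ->
    ipc mu (Mt (s n) - Mt c) (Mt (s n) - Mt c) < e.
  move=> /lim1[N0 hN]; exists N0 => n /hN.
  have cB : ccc (s n - c) := cccD (cs n) (cccN cc0).
  by rewrite -(MtB (cs n) cc0) (Mt_ip cB cB).
have l1 := nlim_ip HL (f := s) (w := a) (fun n => L2on_L2c (ccc_L2on (cs n))) Sc' Sa' lim1.
have l2 := nlim_ip HL (f := fun n => Mt (s n)) (w := b) (fun n => Mt_L2c (cs n)) (Mt_L2c cc0) Sb lim2.
have [//|ne0] := eqVneq (ipc mu a c) (ipc mu b (Mt c)).
pose e0 := (ipc mu c a - ipc mu (Mt c) b) ^+ 2 / 4.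
have e00 : 0 < e0.
  by rewrite divr_gt0 // lt_def sqr_ge0 sqrf_eq0 subr_eq0 (hipC HL c) (hipC HL (Mt c)) ne0.
have [N1 h1] := l1 _ e00; have [N2 h2] := l2 _ e00.
have {}h1 := h1 _ (leq_maxl N1 N2); have {}h2 := h2 _ (leq_maxr N1 N2).
move: h1 h2; rewrite -eq /e0.
move: (ipc mu (s (maxn N1 N2)) a) (ipc mu c a) (ipc mu (Mt c) b) => y p q h1 h2.
have : (p - q) ^+ 2 <= 2 * (y - p) ^+ 2 + 2 * (y - q) ^+ 2.
  by have := sqr_ge0 (p - y + q - y); rewrite !expr2; lra.
by lra.
Qed.

Lemma MP_basis a b k : MP a b -> ipc mu a (mb beta k) = ipc mu b (mbh beta k).
Proof. by move=> [_ _ h]; rewrite /mbh; have [f Cf ->] := mb_tr beta k; exact: h. Qed.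

Lemma MP_norm a b : MP a b -> ipc mu a a = ipc mu b b.
Proof.
move=> h; have [Sa Sb _] := h; apply: EFin_inj.
rewrite -(parseval HR (mb_on beta) (@mb_total R beta) Sa).
rewrite -(parseval HL (mbh_on beta) (@mbh_total R beta) Sb).
by apply: eq_eseriesr => k _; rewrite (MP_basis k h).
Qed.

Lemma MPD a a' b b' : MP a b -> MP a' b' -> MP (a + a') (b + b').
Proof.
move=> [Sa Sb h] [Sa' Sb' h']; split; [exact: (hSD HR)|exact: (hSD HL)|].
move=> f Cf; have Sc := tr_L2on beta Cf; have SM := Mt_L2c (tr_ccc beta Cf).
by rewrite (hipD HR Sa Sa' Sc) (hipD HL Sb Sb' SM) (h _ Cf) (h' _ Cf).
Qed.

Lemma MPZ (s : R) a b : MP a b -> MP (s *: a) (s *: b).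
Proof.
move=> [Sa Sb h]; split; [exact: (hSZ HR)|exact: (hSZ HL)|].
move=> f Cf; have Sc := tr_L2on beta Cf; have SM := Mt_L2c (tr_ccc beta Cf).
by rewrite (hipZ HR s Sa Sc) (hipZ HL s Sb SM) (h _ Cf).
Qed.

Definition Jc c : V := (- c.2, c.1).

Lemma Jc_L2on a : pairS (L2on mu Rpos) a -> pairS (L2on mu Rpos) (Jc a).
Proof. by move=> [S1 S2]; exact: (conj (hSN (L2on_hilbert mu (@measurable_Rp R)) S2) S1). Qed.

Lemma Jc_L2c a : L2c mu a -> L2c mu (Jc a).
Proof. by move=> [S1 S2]; exact: (conj (hSN (L2_hilbert mu) S2) S1). Qed.

Lemma ipc_Jc a c : L2c mu a -> L2c mu c -> ipc mu (Jc a) c = ipc mu a (- Jc c).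
Proof.
move=> [S1 S2] [T1 T2]; have H := L2_hilbert mu.
rewrite /pairip /= opprK (hipN H S2 T1) addrC; congr (_ + _).
by rewrite [RHS](hipC H) (hipN H T1 S2) [in RHS](hipC H).
Qed.

Lemma Mt_Jc c : ccc c -> Mt (Jc c) = Jc (Mt c).
Proof.
move=> cc0; have [n1 n2] := liftc_nice cc0; rewrite /Mt.
have -> : liftc (Jc c) = ((-1) *: (liftc c).2, (liftc c).1).
  by congr (_, _); rewrite /= -scaleN1r liftZ.
rewrite /fhat /= (fcosZ _ n2) (fsinZ _ n2) /Jc /=.
have lin (k p q : R) : k * (-1 * p - -1 * q) = - (k * (p + -1 * q)) by ring.
have lin' (k p q : R) : k * (p + -1 * (-1 * q)) = k * (p - -1 * q) by ring.
congr (_, _); apply/funext => t; rewrite !fctE /GRing.scale /=; [exact: lin|exact: lin'].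
Qed.

Lemma tr_i f : tr (fun r => 'i%C * f r) = Jc (tr f).
Proof. by rewrite trZ /= !scale0r sub0r addr0 !scale1r. Qed.

Lemma MP_Jc a b : MP a b -> MP (Jc a) (Jc b).
Proof.
move=> [Sa Sb h]; split; [exact: Jc_L2on|exact: Jc_L2c|].
move=> f Cf; have Sc := tr_L2on beta Cf; have cc0 := tr_ccc beta Cf.
have Sc' := L2on_L2c Sc; have SM := Mt_L2c cc0; have Sa' := L2on_L2c Sa.
have e1 := ipc_Jc Sa' Sc'; have e2 := ipc_Jc Sb SM.
rewrite e1 e2 (hipC HL a) (hipC HL b) (hipN HL (Jc_L2c Sc') Sa') (hipN HL (Jc_L2c SM) Sb).
by rewrite -(Mt_Jc cc0) -tr_i -(hipC HL a) -(hipC HL b) (h _ (CcZ _ Cf)).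
Qed.

Lemma MP_inv b : L2c mu b -> exists a, MP a b.
Proof.
move=> Sb; have oh := mbh_on beta; have [Seh _ ne] := oh.
have nm i : ipc mu (mb beta i) (mb beta i) = ipc mu (mbh beta i) (mbh beta i).
  by rewrite /mbh (Mt_ip (mb_ccc _ i) (mb_ccc _ i)).
have N i : ipc mu (mb beta i) (mb beta i) * ipc mu b (mbh beta i) = ipc mu b (mbh beta i).
  by rewrite nm; exact: (onP HL i oh Sb).
have [a Sa [_ ha]] := riesz_fischer HR (mb_on beta) N (fun n => bessel HL n oh Sb).
by exists a; exact: MP_of_basis.
Qed.

End mellin_pair.

(** * The Mellin transform and the Euler operator *)

Section mellin_euler.
Context {R : realType}.
Notation mu := (@lebesgue_measure R).
Notation V := ((R -> R) * (R -> R))%type.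
Notation Rp := (Rpos : set (measurableTypeR R)).
Variable beta : R.
Implicit Types (a b c v w : V) (f : R -> R[i]) (h : R -> R) (r t x y : R).

#[local] Instance ae_mu_euler : Filter (almost_everywhere mu) :=
  ae_filter_ringOfSetsType mu.

Let HL := pair_hilbert (L2_hilbert mu).
Let HR := pair_hilbert (L2on_hilbert mu (@measurable_Rp R)).

Notation tr := (tr beta).
Notation Wr := (Wr beta).
Notation MP := (MP beta).

Lemma lift_weight h x : lift (cut Rpos (fun r => Wr r * h r)) x = expR (beta * x) * h (expR x).
Proof.
rewrite /lift /cut mem_set; last by rewrite RposE expR_gt0.
rewrite mulrA; congr (_ * _); rewrite /Wr -powR12_sqrt ?expR_ge0 //.
rewrite -powRD; last by rewrite (gt_eqF (expR_gt0 _)) implybT.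
by rewrite addrC subrK -expRM mulrC.
Qed.

Definition euler h r := r * h^`()%classic r.

Lemma test_euler h : test_function (Rpos : set R) h -> test_function (Rpos : set R) (euler h).
Proof.
move=> [sh [K [cK KR h0]]]; split.
  exact: (smoothM (@smooth_id R) (smooth_derive1 sh)).
exists K; split => // x nK; rewrite /euler.
have oK : open (~` K) by rewrite openC; apply: compact_closed => //; exact: Rhausdorff.
rewrite derive1E; have nb' : \forall y \near x, h y = (cst 0 : R -> R) y.
  have : nbhs x (~` K) by exact: open_nbhs_nbhs.
  by apply: filterS => y nKy; rewrite h0.
by rewrite (near_eq_derive _ nb') derive_cst mulr0.
Qed.

Lemma test_weight_cc h : test_function (Rpos : set R) h ->
  cc (Rpos : set R) (cut Rpos (fun r => Wr r * h r)).
Proof. by move=> th; have [] := tr_ccc beta (Cc_real th). Qed.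

Lemma fourier_euler h : test_function (Rpos : set R) h ->
  let F := lift (cut Rpos (fun r => Wr r * h r)) in
  let G := lift (cut Rpos (fun r => Wr r * euler h r)) in
  (forall t, fcos G t = t * fsin F t - beta * fcos F t) /\
  (forall t, fsin G t = - (t * fcos F t) - beta * fsin F t).
Proof.
move=> th F G; have te := test_euler th.
have nF : nice F := lift_nice (test_weight_cc th).
have nG : nice G := lift_nice (test_weight_cc te).
have [sh [K [cK KR h0]]] := th.
have [B hB] := compact_bounded_Rpos cK KR.
have dexp x : is_derive x 1 (fun x => expR (beta * x)) (beta * expR (beta * x)).
  have d : is_derive x 1 (fun t => beta * t) beta.
    have -> : (fun t => beta * t) = beta *: (id : R -> R) by [].
    by apply: is_derive_eq; rewrite /GRing.scale /= mulr1.
  by apply: (is_derive_eq (is_derive1_comp (is_derive_expR _) d)); rewrite mulrC.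
have dF x : is_derive x 1 F ((beta *: F + G) x).
  have -> : F = fun x => expR (beta * x) * h (expR x).
    by apply/funext => y; rewrite /F lift_weight.
  have d1 := is_derive1_comp (smooth_is_derive sh (expR x)) (is_derive_expR x).
  apply: (is_derive_eq (is_deriveM (dexp x) d1)).
  rewrite !fctE /GRing.scale /= /G lift_weight /euler; ring.
have nFG : nice (beta *: F + G) := niceD (niceZ beta nF) nG.
have out x (g : R -> R) : B + 1 <= `|x| -> (forall r, ~ K r -> g r = 0) ->
    lift (cut Rpos (fun r => Wr r * g r)) x = 0.
  move=> Bx g0; rewrite lift_weight g0 ?mulr0 // => /hB; rewrite expRK => xB.
  by have := le_trans Bx xB; rewrite gerDl ler10.
have e0 r : ~ K r -> euler h r = 0.
  move=> nK; rewrite /euler.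
  have oK : open (~` K) by rewrite openC; apply: compact_closed => //; exact: Rhausdorff.
  rewrite derive1E; have nb' : \forall y \near r, h y = (cst 0 : R -> R) y.
    have : nbhs r (~` K) by exact: open_nbhs_nbhs.
    by apply: filterS => y nKy; rewrite h0.
  by rewrite (near_eq_derive _ nb') derive_cst mulr0.
have [cFG _ _] := nFG.
have g0 x : B + 1 <= `|x| -> (beta *: F + G) x = 0.
  move=> Bx; have F0 : F x = 0 := out x h Bx h0; have G0 : G x = 0 := out x _ Bx e0.
  have -> : (beta *: F + G) x = beta * F x + G x by [].
  by rewrite F0 G0 mulr0 addr0.
have [k1 k2] := fcos_derive (K := B + 1) cFG dF (fun x Bx => out x h Bx h0) g0 nF nFG.
have E1 : fcos (beta *: F + G) = beta *: fcos F + fcos G by rewrite (fcosD (niceZ beta nF) nG) (fcosZ _ nF).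
have E2 : fsin (beta *: F + G) = beta *: fsin F + fsin G by rewrite (fsinD (niceZ beta nF) nG) (fsinZ _ nF).
split=> t.
- by rewrite -k1 E1 fctE /GRing.scale /= addrAC subrr add0r.
- by rewrite -k2 E2 fctE /GRing.scale /= addrAC subrr add0r.
Qed.

Definition eulerc f r : R[i] :=
  Complex (euler (fun r => complex.Re (f r)) r) (euler (fun r => complex.Im (f r)) r).

Lemma Cc_test f : Cc_infty_Rpos f ->
  test_function (Rpos : set R) (fun r => complex.Re (f r)) /\
  test_function (Rpos : set R) (fun r => complex.Im (f r)).
Proof.
by move=> [s1 s2 [K [cK KR f0]]]; split; (split => //; exists K; split => // x /f0 ->).
Qed.

Lemma Cc_of_test (p q : R -> R) : test_function (Rpos : set R) p -> test_function (Rpos : set R) q ->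
  Cc_infty_Rpos (fun r => Complex (p r) (q r)).
Proof.
move=> [sp [K [cK KR p0]]] [sq [K' [cK' KR' q0]]]; split => //.
exists (K `|` K'); split; [exact: compactU|by move=> x [/KR|/KR']|].
by move=> x nK; rewrite p0 ?q0 // => ?; apply: nK; [right|left].
Qed.

Lemma Cc_eulerc f : Cc_infty_Rpos f -> Cc_infty_Rpos (eulerc f).
Proof. by move=> /Cc_test[t1 t2]; exact: Cc_of_test (test_euler t1) (test_euler t2). Qed.

(** Multiplication by [lambda = - beta + 'i t] and by its conjugate, on pairs of
    real functions. *)
Definition lamc b : V := (fun t => - beta * b.1 t - t * b.2 t, fun t => t * b.1 t - beta * b.2 t).
Definition lamb b : V := (fun t => - beta * b.1 t + t * b.2 t, fun t => - t * b.1 t - beta * b.2 t).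

Lemma Mt_euler f : Cc_infty_Rpos f -> Mt (tr (eulerc f)) = lamc (Mt (tr f)).
Proof.
move=> /Cc_test[t1 t2].
have [c1 s1] := fourier_euler t1; have [c2 s2] := fourier_euler t2.
have alg1 (k t p1 q1 p2 q2 : R) :
  k * (t * q1 - beta * p1 - -1 * (- (t * p2) - beta * q2)) =
  - beta * (k * (p1 - -1 * q2)) - t * (k * (p2 + -1 * q1)) by ring.
have alg2 (k t p1 q1 p2 q2 : R) :
  k * (t * q2 - beta * p2 + -1 * (- (t * p1) - beta * q1)) =
  t * (k * (p1 - -1 * q2)) - beta * (k * (p2 + -1 * q1)) by ring.
pose u := liftc (tr f); pose u' := liftc (tr (eulerc f)).
have C1 t : fcos u'.1 t = t * fsin u.1 t - beta * fcos u.1 t := c1 t.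
have C2 t : fcos u'.2 t = t * fsin u.2 t - beta * fcos u.2 t := c2 t.
have S1 t : fsin u'.1 t = - (t * fcos u.1 t) - beta * fsin u.1 t := s1 t.
have S2 t : fsin u'.2 t = - (t * fcos u.2 t) - beta * fsin u.2 t := s2 t.
rewrite /Mt -/u -/u'; clearbody u u'.
rewrite /fhat /lamc /=; congr (_, _); apply/funext => t; rewrite !fctE /GRing.scale /=.
- by rewrite C1 S2; exact: alg1.
- by rewrite C2 S1; exact: alg2.
Qed.

(** The adjoint of the Euler operator for the weight [r ^ (2 beta - 1)]. *)
Definition Lop f r : R[i] := (- (2 * beta))%:C%C * f r + (-1)%:C%C * eulerc f r.

Lemma Cc_Lop f : Cc_infty_Rpos f -> Cc_infty_Rpos (Lop f).
Proof. by move=> Cf; apply: CcD; [exact: CcZ|apply: CcZ; exact: Cc_eulerc]. Qed.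

Lemma Mt_Lop f : Cc_infty_Rpos f -> Mt (tr (Lop f)) = lamb (Mt (tr f)).
Proof.
move=> Cf; have c0 := tr_ccc beta Cf; have c1 := tr_ccc beta (Cc_eulerc Cf).
rewrite /Lop trD !trZr (MtD (cccZ _ c0) (cccZ _ c1)) (MtZ _ c0) (MtZ _ c1) (Mt_euler Cf).
case: (Mt (tr f)) => p q; rewrite /lamc /lamb /=.
have alg1 (t x y : R) : - (2 * beta) * x + -1 * (- beta * x - t * y) = - beta * x + t * y by ring.
have alg2 (t x y : R) : - (2 * beta) * y + -1 * (t * x - beta * y) = - t * x - beta * y by ring.
by congr (_, _); apply/funext => t; [exact: alg1|exact: alg2].
Qed.

Lemma ipc_cdot a b c d : L2c mu a -> L2c mu b -> L2c mu c -> L2c mu d ->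
  {ae mu, forall t, a.1 t * c.1 t + a.2 t * c.2 t = b.1 t * d.1 t + b.2 t * d.2 t} ->
  ipc mu a c = ipc mu b d.
Proof.
move=> [a1 a2] [b1 b2] [c1 c2] [d1 d2] h.
have i1 := L2_mul_integrable a1 c1; have i2 := L2_mul_integrable a2 c2.
have j1 := L2_mul_integrable b1 d1; have j2 := L2_mul_integrable b2 d2.
rewrite /pairip /ip -(RintegralD measurableT i1 i2) -(RintegralD measurableT j1 j2).
rewrite /Rintegral; congr fine; apply: ae_eq_integral => //.
- apply/measurable_EFinP.
  exact: (measurable_funD (integrable_measurable i1) (integrable_measurable i2)).
- apply/measurable_EFinP.
  exact: (measurable_funD (integrable_measurable j1) (integrable_measurable j2)).
- by apply: filterS h => t ht _; rewrite ht.
Qed.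

(** On smooth functions the Euler operator becomes multiplication by [lambda], so
    its adjoint becomes multiplication by the conjugate. *)
Lemma euler_weak v w v' w' : MP v v' -> MP w w' ->
  {ae mu, forall t, w'.1 t = (lamc v').1 t /\ w'.2 t = (lamc v').2 t} ->
  forall f, Cc_infty_Rpos f -> ipc mu w (tr f) = ipc mu v (tr (Lop f)).
Proof.
move=> [Sv Sv' hv] [Sw Sw' hw] e f Cf; rewrite (hw _ Cf) (hv _ (Cc_Lop Cf)).
have LM := Mt_L2c (tr_ccc beta (Cc_Lop Cf)); rewrite (Mt_Lop Cf) in LM *.
apply: (ipc_cdot Sw' Sv' (Mt_L2c (tr_ccc beta Cf)) LM).
apply: filterS e => t [-> ->]; rewrite /lamc /lamb /=; ring.
Qed.

Lemma L2_bounded_mul (k g : R -> R) : measurable_fun setT k -> (forall t, `|k t| <= 1) ->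
  L2 mu g -> L2 mu (fun t => k t * g t).
Proof.
move=> mk k1 Lg; have [mg _] := Lg; apply: (L2_le _ Lg); first exact: measurable_funM.
by move=> t; rewrite normrM ler_piMl.
Qed.

(** The hypothesis is a first-order equation in the sense of distributions, whose
    solutions are the multiples of [r ^ 1/2] in unweighted coordinates; none
    but zero is square integrable. *)
Lemma euler_kernel a : pairS (L2on mu Rpos) a ->
  (forall f, Cc_infty_Rpos f -> ipc mu a (tr (fun r => Lop f r + (- (1 - beta))%:C%C * f r)) = 0) ->
  ipc mu a a = 0.
Proof.
move=> [S1 S2] h.
have z (g : R -> R) : ip mu g (cut (Rpos : set R) (fun r => Wr r * 0)) = 0.
  rewrite /ip; under eq_Rintegral do rewrite /cut mulr0 if_same mulr0.
  by rewrite Rintegral_cst // mul0r.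
have comp (g : R -> R) : L2on mu Rpos g ->
   (forall p, test_function (Rpos : set R) p ->
      ip mu g (cut Rpos (fun r => Wr r * (- (1 + beta) * p r - euler p r))) = 0) ->
   ip mu g g = 0.
  move=> Lg hg.
  have lg : locally_integrable_on (Rpos : set R) (fun r => g r * r `^ (- 2^-1)).
    apply: locally_integrable_weight; first by case: Lg.
    by move=> r; rewrite RposE; exact: powR_continuous.
  have [C hC] : exists C, {ae mu, forall r, Rpos r -> g r * r `^ (- 2^-1) = C}.
    apply: (du_bois_reymond lg) => chi tchi.
    have tp := test_powR (- (1 + beta)) tchi.
    have := hg _ tp; rewrite /ip.
    move=> E0; apply/eqP; rewrite -oppr_eq0; apply/eqP; rewrite -[RHS]E0.
    rewrite Rintegral_mkcond -Rintegral_opp; apply: eq_Rintegral => r _.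
    rewrite patchE /cut; case: ifPn => [/set_mem rR|_]; last by rewrite oppr0 mulr0.
    have r0 : 0 < r by move: rR; rewrite RposE.
    have [stc _] := tchi.
    have dp := is_deriveM (is_derive1_powR (- (1 + beta)) r0) (smooth_is_derive stc r).
    have -> : euler (fun r0 => r0 `^ (- (1 + beta)) * chi r0) r =
        r * (r `^ (- (1 + beta)) * chi^`()%classic r +
        chi r * (- (1 + beta) * r `^ (- (1 + beta) - 1))).
      by rewrite /euler derive1E; have [_ ->] := dp.
    have rn : r != 0 by rewrite gt_eqF.
    have P1 : r * r `^ (- (1 + beta) - 1) = r `^ (- (1 + beta)).
      by rewrite powRB ?rn ?implybT // powRr1 ?ltW // mulrC divfK.
    have P2 : Wr r * (r * r `^ (- (1 + beta))) = r `^ (- 2^-1).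
      rewrite /Wr -[X in _ * (X * _)]powRr1 ?ltW // -!powRD ?rn ?implybT //.
      by congr (_ `^ _); ring.
    rewrite -P2 -P1; ring.
  exact: (sqrt_not_L2 Lg hC).
have t0 : test_function (Rpos : set R) (cst 0 : R -> R) by apply: test0; exists 1; rewrite RposE.
have eu0 r : euler (fun=> 0) r = 0 by rewrite /euler derive1_cst mulr0.
rewrite /pairip (comp _ S1) ?(comp _ S2) ?addr0 // => p tp.
- rewrite -[RHS](h (fun r => Complex 0 (p r)) (Cc_of_test t0 tp)) /pairip.
  rewrite (_ : (tr _).1 = cut (Rpos : set R) (fun r => Wr r * 0)) ?z ?add0r; last first.
    by congr (cut _ _); apply/funext => r /=; rewrite /Lop /eulerc /= eu0; ring.
  by congr (ip _ _ (cut _ _)); apply/funext => r /=; rewrite /Lop /eulerc /=; ring.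
- rewrite -[RHS](h (fun r => Complex (p r) 0) (Cc_of_test tp t0)) /pairip.
  rewrite (_ : (tr _).2 = cut (Rpos : set R) (fun r => Wr r * 0)) ?z ?addr0; last first.
    by congr (cut _ _); apply/funext => r /=; rewrite /Lop /eulerc /= eu0; ring.
  by congr (ip _ _ (cut _ _)); apply/funext => r /=; rewrite /Lop /eulerc /=; ring.
Qed.

(** The inverse of [- 1 + 'i t] is [k1 - 'i k2]. *)
Let k1 t : R := - (1 + t ^+ 2)^-1.
Let k2 t : R := t * (1 + t ^+ 2)^-1.

Lemma resolvent_adjoint t (p q r s : R) :
  (k1 t * p + k2 t * q) * (- beta * r + t * s - (1 - beta) * r) +
  (k1 t * q - k2 t * p) * (- t * r - beta * s - (1 - beta) * s) = p * r + q * s.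
Proof.
have Dn : 1 + t ^+ 2 != 0 by rewrite gt_eqF // ltr_pwDl ?sqr_ge0.
by rewrite /k1 /k2; field.
Qed.

Lemma resolvent_inverse t (p q r s : R) :
  k1 t * p + k2 t * q = r -> k1 t * q - k2 t * p = s -> p = - r - t * s /\ q = t * r - s.
Proof.
have Dn : 1 + t ^+ 2 != 0 by rewrite gt_eqF // ltr_pwDl ?sqr_ge0.
by move=> <- <-; rewrite /k1 /k2; split; field.
Qed.

(** Multiplication by [lambda] is unbounded, so the relation cannot be read off
    by testing against the transforms of smooth functions, whose
    density for the graph norm is not available. Shifting by the real number [1 - beta] turns
    it into [- 1 + 'i t], whose inverse is bounded by one. Applying this inverse
    gives a square integrable function whose preimage solves the homogeneous
    equation of [euler_kernel], hence vanishes. *)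
Lemma euler_strong v w v' w' : MP v v' -> MP w w' ->
  (forall f, Cc_infty_Rpos f -> ipc mu w (tr f) = ipc mu v (tr (Lop f))) ->
  {ae mu, forall t, w'.1 t = (lamc v').1 t /\ w'.2 t = (lamc v').2 t}.
Proof.
move=> hv hw e; have [Sv [v1 v2] ev] := hv; have [Sw [w1 w2] ew] := hw.
pose D t := 1 + t ^+ 2.
have D0 t : 0 < D t by rewrite /D ltr_pwDl ?sqr_ge0.
have cD : continuous D by move=> t; apply: cvgD; [exact: cvg_cst|exact: exprn_continuous].
have cDV : continuous (fun t => (D t)^-1).
  by move=> t; apply: cvgV; [rewrite gt_eqF|exact: cD].
have m1 : measurable_fun setT k1.
  by apply: continuous_measurable => t; apply: cvgN; exact: cDV.
have m2 : measurable_fun setT k2.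
  by apply: continuous_measurable => t; apply: cvgM; [exact: cvg_id|exact: cDV].
have b1 t : `|k1 t| <= 1.
  by rewrite /k1 normrN normfV (gtr0_norm (D0 t)) invf_le1 // /D lerDl sqr_ge0.
have b2 t : `|k2 t| <= 1.
  rewrite /k2 normrM normfV (gtr0_norm (D0 t)) ler_pdivrMr // mul1r /D.
  by have := sqr_ge0 (`|t| - 1); rewrite -[t ^+ 2]real_normK ?num_real //; nra.
pose c := 1 - beta.
pose x1 := w'.1 - c *: v'.1; pose x2 := w'.2 - c *: v'.2.
have H := L2_hilbert mu.
have X1 : L2 mu x1 := hSB H w1 (hSZ H c v1).
have X2 : L2 mu x2 := hSB H w2 (hSZ H c v2).
pose g1 : R -> R := (fun t => k1 t * x1 t) + (fun t => k2 t * x2 t) - v'.1.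
pose g2 : R -> R := (fun t => k1 t * x2 t) - (fun t => k2 t * x1 t) - v'.2.
have G1 : L2 mu g1.
  exact: (hSB H (hSD H (L2_bounded_mul m1 b1 X1) (L2_bounded_mul m2 b2 X2)) v1).
have G2 : L2 mu g2.
  exact: (hSB H (hSB H (L2_bounded_mul m1 b1 X2) (L2_bounded_mul m2 b2 X1)) v2).
have Lg : L2c mu (g1, g2) := conj G1 G2.
(* [g] is the resolvent applied to [w' - (1 - beta) v'], minus [v'] *)
have [a ha] := MP_inv beta Lg; have [Sa _ ea] := ha.
have z : ipc mu a a = 0.
  apply: (euler_kernel Sa) => f Cf.
  have Cg : Cc_infty_Rpos (fun r => Lop f r + (- (1 - beta))%:C%C * f r).
    by apply: CcD; [exact: Cc_Lop|exact: CcZ].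
  rewrite (ea _ Cg).
  have c0 := tr_ccc beta Cf; have c1 := tr_ccc beta (Cc_Lop Cf).
  have LM := Mt_L2c (tr_ccc beta Cg); have LM0 := Mt_L2c c0; have LM1 := Mt_L2c c1.
  have e1 := e _ Cf; rewrite (ew _ Cf) (ev _ (Cc_Lop Cf)) in e1.
  have E : ipc mu (g1, g2) (Mt (tr (fun r => Lop f r + (- (1 - beta))%:C%C * f r))) =
    ipc mu w' (Mt (tr f)) - ipc mu v' (Mt (tr (Lop f))).
    pose m := Mt (tr f); pose m' := lamb m - c *: m.
    have Em : Mt (tr (fun r => Lop f r + (- (1 - beta))%:C%C * f r)) = m'.
      rewrite trD trZr (MtD c1 (cccZ _ c0)) (MtZ _ c0) (Mt_Lop Cf) /m' -/m.
      by rewrite scaleNr.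
    have Lm' : L2c mu m' := eq_ind _ (L2c mu) LM _ Em.
    rewrite Em; rewrite (Mt_Lop Cf) -/m in LM1 *; rewrite -/m in LM0 *.
    clear Em LM; clearbody m; move: Lm' => LM.
    have Lv : L2c mu v' := conj v1 v2.
    have Lw : L2c mu w' := conj w1 w2.
    have Lx : L2c mu (x1, x2) := conj X1 X2.
    have Lgv : L2c mu ((g1, g2) + v') := hSD HL Lg Lv.
    have E0 : ipc mu ((g1, g2) + v') m' = ipc mu (x1, x2) m.
      apply: (ipc_cdot Lgv Lx LM LM0); apply: aeW => t.
      rewrite /m' /lamb /=.
      have -> : (g1 + v'.1) t = k1 t * x1 t + k2 t * x2 t by rewrite /g1 !fctE subrK.
      have -> : (g2 + v'.2) t = k1 t * x2 t - k2 t * x1 t by rewrite /g2 !fctE subrK.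
      exact: resolvent_adjoint.
    have -> : ipc mu (g1, g2) m' = ipc mu (x1, x2) m - ipc mu v' m'.
      by rewrite -E0 (hipD HL Lg Lv LM) addrK.
    have -> : (x1, x2) = w' - c *: v' by [].
    rewrite (hipB HL Lw (hSZ HL c Lv) LM0) (hipZ HL c Lv LM0).
    rewrite /m' (hipBr HL LM1 (hSZ HL c LM0) Lv) (hipZr HL c LM0 Lv).
    move: (ipc mu w' m) (ipc mu v' m) (ipc mu v' (lamb m)) => p q r; ring.
  by rewrite E e1 subrr.
have zg : ipc mu (g1, g2) (g1, g2) = 0 := etrans (esym (MP_norm ha)) z.
have z1 : ip mu g1 g1 = 0.
  by apply/eqP; have := zg; rewrite /pairip /= => /eqP; rewrite paddr_eq0 ?(hge0 H) // => /andP[].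
have z2 : ip mu g2 g2 = 0.
  by apply/eqP; have := zg; rewrite /pairip /= => /eqP; rewrite paddr_eq0 ?(hge0 H) // => /andP[].
have a1 := L2_norm0_ae G1 z1; have a2 := L2_norm0_ae G2 z2.
apply: filterS2 a1 a2 => t.
have -> : g1 t = k1 t * x1 t + k2 t * x2 t - v'.1 t by [].
have -> : g2 t = k1 t * x2 t - k2 t * x1 t - v'.2 t by [].
move=> /subr0_eq E1 /subr0_eq E2.
have [F1 F2] := resolvent_inverse E1 E2.
have {F1}-> : w'.1 t = - v'.1 t - t * v'.2 t + c * v'.1 t by rewrite -F1 /x1 fctE subrK.
have {F2}-> : w'.2 t = t * v'.1 t - v'.2 t + c * v'.2 t by rewrite -F2 /x2 fctE subrK.
rewrite /lamc /c /=; move: (v'.1 t) (v'.2 t) => p q; split; ring.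
Qed.

End mellin_euler.

(** * From Mellin pairs to the extended Mellin transform *)

Section mellin_extension.
Context {R : realType}.
Notation mu := (@lebesgue_measure R).
Notation V := ((R -> R) * (R -> R))%type.
Notation Rp := (Rpos : set (measurableTypeR R)).
Variable beta : R.
Implicit Types (a b c : V) (f v : R -> R[i]) (w : R[i] -> R[i]) (r t x y : R).

Let HL := pair_hilbert (L2_hilbert mu).
Let HR := pair_hilbert (L2on_hilbert mu (@measurable_Rp R)).

Notation tr := (tr beta).
Notation Wr := (Wr beta).
Notation MP := (MP beta).

Lemma mellinE f t : Cc_infty_Rpos f -> mellin f (vline (- beta) t) =
  Complex (Num.sqrt (2 * pi) * (Mt (tr f)).1 t) (Num.sqrt (2 * pi) * (Mt (tr f)).2 t).
Proof.
move=> Cf; have [s1 s2 _] := Cf.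
have c1 := smooth_continuous s1; have c2 := smooth_continuous s2.
have [n1 n2] := liftc_nice (tr_ccc beta Cf).
pose f1 r := complex.Re (f r); pose f2 r := complex.Im (f r).
pose E r := expR ((beta - 1) * ln r).
have pE r : 0 < r -> cpow r (- vline (- beta) t - 1) * f r =
    Complex (E r * (cos (t * ln r) * f1 r + sin (t * ln r) * f2 r))
            (E r * (cos (t * ln r) * f2 r - sin (t * ln r) * f1 r)).
  move=> r0; rewrite /cpow /cexp /vline /=.
  have -> : (- - beta - 1) * ln r - (- t - 0) * 0 = (beta - 1) * ln r by ring.
  have -> : (- - beta - 1) * 0 + (- t - 0) * ln r = - (t * ln r) by ring.
  rewrite cosN sinN -/(E r) /f1 /f2; case: (f r) => p q /=.
  by apply/eqP; rewrite eq_complex /=; apply/andP; split; apply/eqP; ring.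
have cl : forall r, 0 < r -> {for r, continuous (fun r => t * ln r)}.
  by move=> r r0; apply: cvgMr; exact: continuous_ln.
have cE r : 0 < r -> {for r, continuous E}.
  move=> r0; apply: (@continuous_comp _ _ _ (fun r => (beta - 1) * ln r) expR).
    by apply: cvgMr; exact: continuous_ln.
  exact: continuous_expR.
have cc0 r : 0 < r -> {for r, continuous (fun r => cos (t * ln r))}.
  move=> r0; apply: (@continuous_comp _ _ _ (fun r => t * ln r) cos); first exact: cl.
  exact: continuous_cos.
have cs0 r : 0 < r -> {for r, continuous (fun r => sin (t * ln r))}.
  move=> r0; apply: (@continuous_comp _ _ _ (fun r => t * ln r) sin); first exact: cl.
  exact: continuous_sin.
have L1 x : (liftc (tr f)).1 x = expR (beta * x) * f1 (expR x) by exact: lift_weight.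
have L2' x : (liftc (tr f)).2 x = expR (beta * x) * f2 (expR x) by exact: lift_weight.
have EE x : E (expR x) * expR x = expR (beta * x).
  by rewrite /E expRK -expRD; congr expR; ring.
have M1 : (Mt (tr f)).1 t = (Num.sqrt (2 * pi))^-1 *
    (fcos (liftc (tr f)).1 t - -1 * fsin (liftc (tr f)).2 t) by [].
have M2 : (Mt (tr f)).2 t = (Num.sqrt (2 * pi))^-1 *
    (fcos (liftc (tr f)).2 t + -1 * fsin (liftc (tr f)).1 t) by [].
have k0 : Num.sqrt (2 * pi) != 0 :> R by rewrite gt_eqF // sqrt2pi_gt0.
have cosi := phase_integrable t (@continuous_cos R) (@norm_cos_le1 R).
have sini := phase_integrable t (@continuous_sin R) (@norm_sin_le1 R).
rewrite /mellin /cintegral; congr Complex.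
- have -> : Rintegral mu1 Rp (fun r => complex.Re (cpow r (- vline (- beta) t - 1) * f r)) =
     \int[mu]_(r in Rp) (E r * (cos (t * ln r) * f1 r + sin (t * ln r) * f2 r)).
    by apply: eq_Rintegral => r /set_mem; rewrite RposE => r0; rewrite pE.
  rewrite exp_substitution_R; last first.
    move=> r r0; apply: cvgM; first exact: cE.
    by apply: cvgD; apply: cvgM; [exact: cc0|exact: c1|exact: cs0|exact: c2].
  rewrite M1 mulrA divff // mul1r mulN1r opprK.
  rewrite fcosE fsinE -(RintegralD measurableT (cosi _ n1) (sini _ n2)).
  by apply: eq_Rintegral => x _; rewrite L1 L2' expRK -EE; ring.
- have -> : Rintegral mu1 Rp (fun r => complex.Im (cpow r (- vline (- beta) t - 1) * f r)) =
     \int[mu]_(r in Rp) (E r * (cos (t * ln r) * f2 r - sin (t * ln r) * f1 r)).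
    by apply: eq_Rintegral => r /set_mem; rewrite RposE => r0; rewrite pE.
  rewrite exp_substitution_R; last first.
    move=> r r0; apply: cvgM; first exact: cE.
    by apply: cvgB; apply: cvgM; [exact: cc0|exact: c2|exact: cs0|exact: c1].
  rewrite M2 mulrA divff // mul1r mulN1r.
  rewrite fcosE fsinE -(RintegralB measurableT (cosi _ n2) (sini _ n1)).
  by apply: eq_Rintegral => x _; rewrite L1 L2' expRK -EE; ring.
Qed.

(** Coordinates on the vertical line, normalised so that [Y2norm] becomes the
    unweighted norm. *)
Definition tw w : V :=
  (fun t => (Num.sqrt (2 * pi))^-1 * complex.Re (w (vline (- beta) t)),
   fun t => (Num.sqrt (2 * pi))^-1 * complex.Im (w (vline (- beta) t))).

Lemma Wr_sq r : 0 < r -> Wr r ^+ 2 = r `^ (2 * beta - 1).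
Proof.
move=> r0; rewrite /Wr -powR_mulrn ?powR_ge0 // -powRrM; congr (_ `^ _).
by rewrite mulrBl mulVf // mulrC.
Qed.

Lemma measurable_Wr : measurable_fun Rp Wr.
Proof. exact: measurable_powR_Rp. Qed.

Lemma L2norm_tr v : cmeasurable Rp v -> pairS (L2on mu Rpos) (tr v) ->
  L2norm beta v = (Num.sqrt (ipc mu (tr v) (tr v)))%:E.
Proof.
move=> mv Sv; rewrite /L2norm.
have := tld_ipE (@measurable_Rp R) measurable_Wr mv Sv => E.
have -> : (\int[mu1]_(r in Rpos) (Normc.normc (v r) ^+ 2 * r `^ (2 * beta - 1))%:E =
   (ipc mu (tr v) (tr v))%:E)%E.
  rewrite -E; apply: eq_integral => r /set_mem; rewrite RposE => r0.
  by rewrite Wr_sq.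
by rewrite poweR_EFin powR12_sqrt // (hge0 HL).
Qed.

Lemma tw_measurable w : L2c mu (tw w) ->
  cmeasurable (setT : set (measurableTypeR R)) (fun t => w (vline (- beta) t)).
Proof.
move=> [[m1 _] [m2 _]]; have n0 : Num.sqrt (2 * pi) != 0 :> R by rewrite gt_eqF // sqrt2pi_gt0.
have mk (g : R -> R) : measurable_fun setT (fun t => (Num.sqrt (2 * pi))^-1 * g t) -> measurable_fun setT g.
  move=> mg; have -> : g = (fun t => Num.sqrt (2 * pi) * ((Num.sqrt (2 * pi))^-1 * g t)).
    by apply/funext => t; rewrite mulrA divff // mul1r.
  by apply: measurable_funM.
by split; apply: mk.
Qed.

Lemma Y2norm_tw w : L2c mu (tw w) ->
  Y2norm beta w = (Num.sqrt (ipc mu (tw w) (tw w)))%:E.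
Proof.
move=> Sw; have [S1 S2] := Sw; have [m1 m2] := tw_measurable Sw; rewrite /Y2norm.
have k0 : 0 < 2 * pi :> R by rewrite mulr_gt0 // pi_gt0.
have -> : ((2 * pi)^-1%:E * \int[mu1]_t (Normc.normc (w (vline (- beta) t)) ^+ 2)%:E =
   (ipc mu (tw w) (tw w))%:E)%E.
  rewrite /pairip EFinD -(L2_ipE S1) -(L2_ipE S2) -ge0_integralD //; last 4 first.
  - by move=> t _; rewrite lee_fin sqr_ge0.
  - by apply: measurable_sqE; case: S1.
  - by move=> t _; rewrite lee_fin sqr_ge0.
  - by apply: measurable_sqE; case: S2.
  rewrite -ge0_integralZl //; last 3 first.
  - apply/measurable_EFinP.
    apply: (eq_measurable_fun (fun t => complex.Re (w (vline (- beta) t)) ^+ 2 + complex.Im (w (vline (- beta) t)) ^+ 2)).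
      by move=> t _; rewrite normc_sq.
    by apply: measurable_funD; exact: measurable_funX.
  - by move=> t _; rewrite lee_fin sqr_ge0.
  - by rewrite lee_fin invr_ge0 ltW.
  apply: eq_integral => t _; rewrite -EFinM -EFinD normc_sq /=; congr (_%:E).
  by rewrite !exprMn exprVn sqrt2pi_sq mulrDr.
by rewrite poweR_EFin powR12_sqrt // (hge0 HL).
Qed.

Lemma sqrt_cvg0 (x : nat -> R) : (forall n, 0 <= x n) ->
  (forall e : R, 0 < e -> exists N, forall n, (N <= n)%N -> x n < e) ->
  (fun n => (Num.sqrt (x n))%:E) @ \oo --> 0%E.
Proof.
move=> x0 h; apply: cvg_EFin; first by near=> n.
have l : x n @[n --> \oo] --> (0 : R).
  apply/cvgrPdist_lt => e e0; have [N hN] := h e e0; exists N => // n /= Nn.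
  by rewrite sub0r normrN ger0_norm // hN.
rewrite -[X in _ --> X]sqrtr0.
by apply: (cvg_comp _ _ l); exact: sqrt_continuous.
Unshelve. all: by end_near.
Qed.

(** The partial sums of the expansion in [mb] are transforms of smooth functions
    and converge on both sides. *)
Lemma mellin_extension v w : cmeasurable Rp v ->
  MP (tr v) (tw w) -> is_mellin_ext beta v w.
Proof.
move=> mv h; have [Sv Sw _] := h.
have n0 : Num.sqrt (2 * pi) != 0 :> R by rewrite gt_eqF // sqrt2pi_gt0.
split.
- by split => //; rewrite (L2norm_tr mv Sv) ltry.
- split; last by rewrite (Y2norm_tw Sw) ltry.
  exact: tw_measurable.
have ex k : exists f, Cc_infty_Rpos f /\ mb beta k = tr f.
  by have [f Cf E] := mb_tr beta k; exists f.
pose g k := projT1 (cid (ex k)).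
have Cg k : Cc_infty_Rpos (g k) by have [] := projT2 (cid (ex k)).
have Eg k : mb beta k = tr (g k) by have [] := projT2 (cid (ex k)).
pose c k := ipc mu (tr v) (mb beta k).
pose f n r := \sum_(i < n) (c i)%:C%C * g i r.
have fS n : f n.+1 = fun r => f n r + (c n)%:C%C * g n r.
  by apply/funext => r; rewrite /f big_ord_recr.
have f0 : f 0%N = cst 0 by apply/funext => r; rewrite /f big_ord0.
have Cf n : Cc_infty_Rpos (f n).
  elim: n => [|n IH]; first by rewrite f0; exact: Cc0.
  by rewrite fS; apply: CcD => //; exact: CcZ.
have Tf n : tr (f n) = \sum_(i < n) c i *: mb beta i.
  elim: n => [|n IH].
    rewrite big_ord0 f0 /tr /tld /cut; congr (_, _); apply/funext => x; by rewrite mulr0 if_same.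
  by rewrite fS trD trZr IH big_ord_recr /= Eg.
have Mf n : Mt (tr (f n)) = \sum_(i < n) c i *: mbh beta i.
  elim: n => [|n IH].
    by rewrite Tf !big_ord0; have := MtZ 0 (mb_ccc beta 0); rewrite !scale0r.
  rewrite Tf !big_ord_recr /= -Tf (MtD (tr_ccc beta (Cf n)) (cccZ _ (mb_ccc beta n))) IH.
  by rewrite (MtZ _ (mb_ccc beta n)).
exists f; split=> //.
- have -> : (fun n => L2norm beta (fun r => f n r - v r)) =
     (fun n => (Num.sqrt (ipc mu (\sum_(i < n) c i *: mb beta i - tr v) (\sum_(i < n) c i *: mb beta i - tr v)))%:E).
    apply/funext => n.
    have E : tr (fun r => f n r - v r) = \sum_(i < n) c i *: mb beta i - tr v.
      have -> : (fun r => f n r - v r) = (fun r => f n r + (-1)%:C%C * v r).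
        by apply/funext => r; rewrite rmorphN mulN1r.
      by rewrite trD trZr scaleN1r Tf.
    have S' : pairS (L2on mu Rpos) (tr (fun r => f n r - v r)).
      by rewrite E -Tf; exact: (hSB HR (tr_L2on beta (Cf n)) Sv).
    have mv' : cmeasurable Rp (fun r => f n r - v r).
      have [s1 s2 _] := Cf n; have [m1 m2] := mv.
      have ms h0 : smooth h0 -> measurable_fun Rp h0.
        by move=> sh; apply: measurable_funTS; apply: continuous_measurable; exact: smooth_continuous.
      split.
      + apply: (eq_measurable_fun (fun r => complex.Re (f n r) - complex.Re (v r))).
          by move=> r _; rewrite raddfB.
        by apply: measurable_funB => //; exact: ms.
      + apply: (eq_measurable_fun (fun r => complex.Im (f n r) - complex.Im (v r))).
          by move=> r _; rewrite raddfB.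
        by apply: measurable_funB => //; exact: ms.
    by rewrite (L2norm_tr mv' S') E.
  apply: sqrt_cvg0; first by move=> n; exact: (hge0 HL).
  exact: (expansion HR (mb_on beta) (@mb_total R beta) Sv).
- have E n : tw (fun z => mellin (f n) z - w z) = \sum_(i < n) ipc mu (tw w) (mbh beta i) *: mbh beta i - tw w.
    have -> : \sum_(i < n) ipc mu (tw w) (mbh beta i) *: mbh beta i = Mt (tr (f n)).
      by rewrite Mf; apply: eq_bigr => i _; rewrite /c (MP_basis i h).
    rewrite /tw; congr (_, _); apply/funext => t; rewrite (mellinE t (Cf n)) raddfB /= mulrBr.
    - by rewrite mulrA mulVf // mul1r.
    - by rewrite mulrA mulVf // mul1r.
  have -> : (fun n => Y2norm beta (fun z => mellin (f n) z - w z)) =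
     (fun n => (Num.sqrt (ipc mu (\sum_(i < n) ipc mu (tw w) (mbh beta i) *: mbh beta i - tw w)
       (\sum_(i < n) ipc mu (tw w) (mbh beta i) *: mbh beta i - tw w)))%:E).
    apply/funext => n; rewrite Y2norm_tw E //.
    have [Seh _ _] := mbh_on beta.
    exact: (hSB HL (hScomb HL n (fun i => ipc mu (tw w) (mbh beta i)) Seh) Sw).
  apply: sqrt_cvg0; first by move=> n; exact: (hge0 HL).
  exact: (expansion HL (mbh_on beta) (@mbh_total R beta) Sw).
Qed.

End mellin_extension.

(** * Weak derivatives on the interval *)

Section weak_derivative.
Context {R : realType}.
Notation mu := (@lebesgue_measure R).
Variable kappa : R.
Hypothesis kappa_gt0 : 0 < kappa.
Notation An := (angles kappa : set (measurableTypeR R)).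
Implicit Types (f g h eta : R -> R) (s x y t : R) (a n m : nat).

#[local] Instance ae_mu_weak : Filter (almost_everywhere mu) :=
  ae_filter_ringOfSetsType mu.

Let H := L2_hilbert mu.

Lemma anglesE x : angles kappa x = (0 < x < kappa).
Proof. by rewrite /angles /= in_itv /=. Qed.

Lemma open_angles : open (angles kappa). Proof. exact: interval_open. Qed.

Lemma measurable_angles : measurable An. Proof. exact: measurable_itv. Qed.

Let HA := L2on_hilbert mu measurable_angles.

Lemma rho_gt0 x : angles kappa x -> 0 < rho kappa x.
Proof. by rewrite anglesE => /andP[h1 h2]; rewrite /rho lt_min h1 subr_gt0. Qed.

Lemma rho_continuous : continuous (rho kappa).
Proof.
move=> x; have cB : {for x, continuous (fun y => kappa - y)}.
  by apply: cvgB; [exact: cvg_cst|exact: cvg_id].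
exact: (@continuous_min R R (id : R -> R) (fun y => kappa - y) x (@cvg_id _ _) cB).
Qed.

(** The square root of the weight [rho ^ s]. *)
Definition Wa s x : R := rho kappa x `^ (s / 2).

Lemma Wa_gt0 s x : angles kappa x -> 0 < Wa s x.
Proof. by move=> /rho_gt0 h; rewrite powR_gt0. Qed.

Lemma Wa_continuous s x : angles kappa x -> {for x, continuous (Wa s)}.
Proof.
move=> /rho_gt0 h; apply: (@continuous_comp _ _ _ (rho kappa) (fun r => r `^ (s / 2))).
  exact: rho_continuous.
exact: powR_continuous.
Qed.

Lemma measurable_Wa s : measurable_fun An (Wa s).
Proof.
apply: open_continuous_measurable_fun; first exact: open_angles.
by move=> x; rewrite inE; exact: Wa_continuous.
Qed.

Lemma Wa_sq s x : angles kappa x -> Wa s x ^+ 2 = rho kappa x `^ s.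
Proof. by move=> h; rewrite /Wa -powR_mulrn ?powR_ge0 // -powRrM divfK. Qed.

Lemma WaN s x : angles kappa x -> Wa s x * Wa (- s) x = 1.
Proof.
move=> /rho_gt0 h; rewrite /Wa -powRD ?(gt_eqF h) ?implybT //.
by rewrite mulNr subrr powRr0.
Qed.

Lemma compact_angles (K : set R) : compact K -> K `<=` angles kappa ->
  exists e : R, 0 < e /\ K `<=` `[e, kappa - e]%classic.
Proof.
move=> cK KA; have cI : compact ((fun x => (rho kappa x)^-1) @` K).
  apply: continuous_compact => //; apply: continuous_in_subspaceT => x /set_mem /KA xA.
  by apply: cvgV; [rewrite gt_eqF // rho_gt0|exact: rho_continuous].
have [M [_ hM]] := compact_bounded cI.
have MM : M < `|M| + 1 by rewrite (le_lt_trans (ler_norm M)) // ltrDl.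
have M0 : 0 < `|M| + 1 by rewrite ltr_wpDl.
exists (`|M| + 1)^-1; split; first by rewrite invr_gt0.
move=> x Kx; have r0 := rho_gt0 (KA _ Kx).
have : `|(rho kappa x)^-1| <= `|M| + 1 by apply: (hM _ MM); exists x.
rewrite ger0_norm ?invr_ge0 ?(ltW r0) // => h.
have : (`|M| + 1)^-1 <= rho kappa x by rewrite -[leRHS]invrK lef_pV2 ?posrE // invr_gt0.
rewrite /rho le_min /= in_itv /= => /andP[-> h2] /=; lra.
Qed.

Lemma sub_angles (e : R) : 0 < e -> `[e, kappa - e]%classic `<=` angles kappa.
Proof.
by move=> e0 x; rewrite anglesE /= in_itv /= => /andP[h1 h2]; apply/andP; split; lra.
Qed.

Notation tf := (test_function (angles kappa : set R)).

Lemma test_derive1 (D : set R) eta : test_function D eta -> test_function D (eta^`()%classic).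
Proof.
move=> [se [K [cK KD h0]]]; split; first exact: smooth_derive1.
exists K; split => // x nK.
have oK : open (~` K) by rewrite openC; apply: compact_closed => //; exact: Rhausdorff.
rewrite derive1E; have nb' : \forall y \near x, eta y = (cst 0 : R -> R) y.
  have : nbhs x (~` K) by exact: open_nbhs_nbhs.
  by apply: filterS => y nKy; rewrite h0.
by rewrite (near_eq_derive _ nb') derive_cst.
Qed.

Lemma test_derive1n (D : set R) n eta : test_function D eta -> test_function D (derive1n n eta).
Proof. by move=> te; elim: n => //= n IH; exact: test_derive1. Qed.

Lemma testD (D : set R) f g : test_function D f -> test_function D g -> test_function D (f + g).
Proof.
move=> [sh [K [cK KR h0]]] [sg [K' [cK' KR' g0]]]; split; first exact: smoothD.
exists (K `|` K'); split; [exact: compactU|by move=> x [/KR|/KR']|].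
by move=> x nK; rewrite fctE h0 ?g0 ?addr0 // => ?; apply: nK; [right|left].
Qed.

Lemma testZ (D : set R) s f : test_function D f -> test_function D (s *: f).
Proof.
move=> [sh [K [cK KR h0]]]; split; first exact: smoothZ.
by exists K; split => // x /h0 hx; rewrite fctE /GRing.scale /= hx mulr0.
Qed.

Lemma derive1nD n f g : smooth f -> smooth g -> derive1n n (f + g) = derive1n n f + derive1n n g.
Proof.
move=> sf sg; elim: n => //= n ->; apply/funext => x.
rewrite [RHS](_ : _ = (derive1n n f)^`()%classic x + (derive1n n g)^`()%classic x) // !derive1E.
apply: deriveD.
- by apply: diff_derivable; apply: smooth_differentiable; exact: smooth_derive1n.
- by apply: diff_derivable; apply: smooth_differentiable; exact: smooth_derive1n.
Qed.

Lemma derive1nZ n s f : smooth f -> derive1n n (s *: f) = s *: derive1n n f.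
Proof.
move=> sf; elim: n => //= n ->; apply/funext => x.
rewrite [RHS](_ : _ = s *: (derive1n n f)^`()%classic x) // !derive1E.
apply: deriveZ.
by apply: diff_derivable; apply: smooth_differentiable; exact: smooth_derive1n.
Qed.

Definition ta s eta : R -> R := cut (angles kappa) (fun x => Wa s x * eta x).

Lemma ta_cc s eta : tf eta -> cc (angles kappa) (ta s eta).
Proof.
move=> te; have -> : ta s eta = fun x => Wa s x * eta x.
  apply/funext => x; rewrite /ta /cut; case: ifPn => //.
  rewrite notin_setE => nx; have [_ [K [_ KD h0]]] := te.
  by rewrite h0 ?mulr0 // => /KD.
by apply: cc_weight; [exact: open_angles|exact: Wa_continuous|exact: test_cc].
Qed.

Lemma ta_L2on s eta : tf eta -> L2on mu (angles kappa) (ta s eta).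
Proof. by move=> /(ta_cc s)/cc_L2on. Qed.

Lemma taD s f g : ta s (f + g) = ta s f + ta s g.
Proof.
apply/funext => x; rewrite /ta /cut.
have -> : (f + g) x = f x + g x by [].
by rewrite [RHS]/GRing.add /=; case: ifP => _; rewrite ?addr0 // mulrDr.
Qed.

Lemma taZ s k f : ta s (k *: f) = k *: ta s f.
Proof.
apply/funext => x; rewrite /ta /cut.
transitivity (k * cut (angles kappa) (fun x => Wa s x * f x) x); last by [].
have -> : (k *: f) x = k * f x by [].
by rewrite /cut; case: ifP => _; rewrite ?mulr0 // mulrCA.
Qed.

Lemma angles_nonempty : angles kappa !=set0.
Proof.
exists (kappa / 2); rewrite anglesE divr_gt0 //= ltr_pdivrMr //.
by rewrite mulr_natr mulr2n ltrDl.
Qed.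

(** An orthonormal basis, used only for separability. *)
Let ob : nat -> (R -> R) := gram_schmidt (ip mu) (fun n => cut (angles kappa) (fun x => cst 1 x * bump_seq (angles kappa) n x)).

Let tb n : tf (bump_seq (angles kappa) n).
Proof. exact: bump_seq_test angles_nonempty. Qed.

Let obS n : L2on mu (angles kappa) (cut (angles kappa) (fun x => cst 1 x * bump_seq (angles kappa) n x)).
Proof.
have := cc_L2on (test_cc (tb n)); set b := bump_seq _ _ => Lb.
rewrite (_ : cut _ _ = b) //; apply/funext => x; rewrite /cut; case: ifPn => [_|].
  by rewrite mul1r.
by rewrite notin_setE => nx; rewrite Lb.2.
Qed.

Let ob_on : orthonormal (L2on mu (angles kappa)) (ip mu) ob.
Proof. exact: (gs_orthonormal HA obS). Qed.

Let ob_total : total (L2on mu (angles kappa)) (ip mu) ob.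
Proof.
move=> f Sf fe; have h := gs_total HA obS Sf fe.
apply: (bump_null (W := cst 1) open_angles Sf) => //.
by move=> x _; exact: cvg_cst.
Qed.

Section fixed_order.
Variables (s0 : R) (a : nat).
Let s : R := s0 + a.*2%:R.

Lemma graph_dense : exists2 x : nat -> R -> R, forall n, tf (x n) &
  forall eta, tf eta -> forall e : R, 0 < e -> exists n,
    ip mu (ta (- s) eta - ta (- s) (x n)) (ta (- s) eta - ta (- s) (x n)) < e /\
    ip mu (ta (- s0) (derive1n a eta) - ta (- s0) (derive1n a (x n)))
          (ta (- s0) (derive1n a eta) - ta (- s0) (derive1n a (x n))) < e.
Proof.
have t0 : tf (cst 0 : R -> R) := test0 angles_nonempty.
have [x tx hx] := separable_graph HA (X := [the choiceType of R -> R]) (D := tf) (A := ta (- s)) (B := fun eta => ta (- s0) (derive1n a eta))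
  ob_on ob_total t0 (fun eta te => ta_L2on (- s) te)
  (fun eta te => ta_L2on (- s0) (test_derive1n a te)).
by exists x.
Qed.

Lemma ae0_continuous h : continuous h -> {ae mu, forall x, h x = 0} -> forall x, h x = 0.
Proof.
move=> ch [N [mN N0 hN]] x; apply/eqP; apply: contraT => hx.
have : \forall y \near x, h y != 0 := cvgr_neq0 (h x) (ch x) hx.
move=> [e /= e0 he].
have sub : `]x - e, x + e[%classic `<=` N.
  move=> y /=; rewrite in_itv /= => /andP[h1 h2]; apply: hN => /= hy.
  have : h y != 0.
    by apply: he => /=; rewrite ltr_norml; apply/andP; split; lra.
  by rewrite hy eqxx.
have : mu (`]x - e, x + e[%classic : set (measurableTypeR R)) = 0%E.
  by apply: (subset_measure0 _ mN _ N0) => //; exact: measurable_itv.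
rewrite lebesgue_measure_itv /= lte_fin; case: ifP => [_|/negP]; last by case; lra.
by rewrite -EFinB => -[]; lra.
Qed.

Definition form (c : R) (g v eta : R -> R) : R :=
  ip mu g (ta (- s) eta) - c * ip mu v (ta (- s0) (derive1n a eta)).

Lemma formD c g v eta zeta : L2 mu g -> L2 mu v -> tf eta -> tf zeta ->
  form c g v (eta + zeta) = form c g v eta + form c g v zeta.
Proof.
move=> Lg Lv te tz; rewrite /form taD (derive1nD a te.1 tz.1) taD.
have [L1 _] := ta_L2on (- s) te; have [L2' _] := ta_L2on (- s) tz.
have [L3 _] := ta_L2on (- s0) (test_derive1n a te).
have [L4 _] := ta_L2on (- s0) (test_derive1n a tz).
rewrite (hipDr H L1 L2' Lg) (hipDr H L3 L4 Lv).
move: (ip mu g _) (ip mu g _) (ip mu v _) (ip mu v _) => p q r t; ring.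
Qed.

Lemma formZ c g v k eta : L2 mu g -> L2 mu v -> tf eta ->
  form c g v (k *: eta) = k * form c g v eta.
Proof.
move=> Lg Lv te; rewrite /form taZ (derive1nZ a k te.1) taZ.
have [L1 _] := ta_L2on (- s) te.
have [L3 _] := ta_L2on (- s0) (test_derive1n a te).
rewrite (hipZr H k L1 Lg) (hipZr H k L3 Lv).
move: (ip mu g _) (ip mu v _) => p q; ring.
Qed.

(** The family of weighted test functions together with their weighted
    derivatives is separable, so countably many test functions are dense for
    the graph norm. Orthonormalising them gives one system that is total for
    the target weight and also detects the weak derivative of order [a]: an
    identity [form c g v (e m) = 0] for all [m] extends to every test function. *)
Lemma test_system : exists e : nat -> R -> R, [/\ forall m, tf (e m),
  orthonormal (L2on mu (angles kappa)) (ip mu) (fun m => ta (- s) (e m)),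
  total (L2on mu (angles kappa)) (ip mu) (fun m => ta (- s) (e m)) &
  forall c g v, L2 mu g -> L2 mu v -> (forall m, form c g v (e m) = 0) ->
    forall eta, tf eta -> form c g v eta = 0].
Proof.
have [x tx hx] := graph_dense.
pose d n := ta (- s) (x n).
have Sd n : L2on mu (angles kappa) (d n) := ta_L2on (- s) (tx n).
have ex m : exists e, tf e /\ gram_schmidt (ip mu) d m = ta (- s) e.
  have := gs_closed (P := fun u => exists e, tf e /\ u = ta (- s) e) (ip mu) (d := d).
  move=> /(_ _ _ _ _ m) [].
  - exists (cst 0); split; first exact: test0 angles_nonempty.
    by apply/funext => y; rewrite /ta /cut mulr0 if_same.
  - move=> u w [f [tf0 ->]] [g [tg ->]]; exists (f + g); split; first exact: testD.
    by rewrite taD.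
  - move=> k u [f [tf0 ->]]; exists (k *: f); split; first exact: testZ.
    by rewrite taZ.
  - by move=> n; exists (x n).
  - by [].
pose e m := projT1 (cid (ex m)).
have te m : tf (e m) by have [] := projT2 (cid (ex m)).
have Ee m : gram_schmidt (ip mu) d m = ta (- s) (e m) by have [] := projT2 (cid (ex m)).
have Ef : (fun m => ta (- s) (e m)) = gram_schmidt (ip mu) d by apply/funext => m; rewrite Ee.
have on := gs_orthonormal HA Sd.
have Lt eta : tf eta -> L2 mu (ta (- s) eta) by move=> t; case: (ta_L2on (- s) t).
have Lt0 eta : tf eta -> L2 mu (ta (- s0) (derive1n a eta)).
  by move=> t; case: (ta_L2on (- s0) (test_derive1n a t)).
exists e; split=> //; first by rewrite Ef.
- rewrite Ef => f Sf fe; have h := gs_total HA Sd Sf fe.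
  have hall eta : tf eta -> ip mu f (ta (- s) eta) = 0.
    move=> t; apply/eqP; rewrite -sqrf_eq0 eq_le sqr_ge0 andbT; apply/ler_addgt0Pr => eps eps0.
    rewrite add0r; have N1 : 0 < ip mu f f + 1 by rewrite ltr_wpDl // (hge0 H).
    have [n [hn _]] := hx eta t _ (divr_gt0 eps0 N1).
    have Lf := Sf.1; have Le := Lt _ t; have Lx := Lt _ (tx n).
    have -> : ip mu f (ta (- s) eta) = ip mu f (ta (- s) eta - ta (- s) (x n)).
      by rewrite (hipBr H Le Lx Lf) h subr0.
    apply: le_trans (hCS H Lf (hSB H Le Lx)) _.
    have := hn; rewrite ltr_pdivlMr // => hn'.
    have := hge0 H (ta (- s) eta - ta (- s) (x n)); have := hge0 H f; nra.
  apply: (bump_null (W := Wa (- s)) open_angles Sf).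
  + exact: Wa_continuous.
  + exact: Wa_gt0.
  + by move=> k; exact: hall (tb k).
move=> c g v Lg Lv he eta t.
have Fx n : form c g v (x n) = 0.
  have [k /= E] := gs_span HA d n.
  pose z := x n + \sum_(i < n.+1) (- k i) *: e i.
  have tsum m : tf (\sum_(i < m) (- k i) *: e i).
    elim: m => [|m IH]; first by rewrite big_ord0; exact: test0 angles_nonempty.
    by rewrite big_ord_recr /=; apply: testD => //; exact: testZ.
  have tz : tf z by apply: testD.
  have Ez : ta (- s) z = d n - \sum_(i < n.+1) k i *: gram_schmidt (ip mu) d i.
    rewrite /z taD -/(d n); congr (_ + _).
    have aux (u : nat -> R -> R) m : (forall i, u i = ta (- s) (e i)) ->
        ta (- s) (\sum_(i < m) (- k i) *: e i) = - \sum_(i < m) k i *: u i.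
      move=> hu; elim: m => [|m IH].
        by rewrite !big_ord0 oppr0; apply/funext => y; rewrite /ta /cut mulr0 if_same.
      by rewrite !big_ord_recr /= taD IH taZ hu [RHS]opprD scaleNr.
    exact: aux.
  have Nz : ip mu (ta (- s) z) (ta (- s) z) = 0.
    rewrite Ez E; case: ifP => [/eqP //|_]; exact: (hip0 HA (hS0 HA)).
  have z0 y : ta (- s) z y = 0.
    by apply: ae0_continuous; [case: (ta_cc (- s) tz)|exact: L2_norm0_ae (Lt _ tz) Nz].
  have zz : z = cst 0.
    apply/funext => y; have [yA|yA] := pselect (angles kappa y).
      have := z0 y; rewrite /ta /cut mem_set // => /eqP; rewrite mulf_eq0.
      by rewrite (gt_eqF (Wa_gt0 _ yA)) => /eqP.
    have [_ [K [_ KD h0]]] := tz; by rewrite h0 // => /KD.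
  have Fsum m : form c g v (\sum_(i < m) (- k i) *: e i) = 0.
    elim: m => [|m IH].
      rewrite big_ord0; have -> : (0 : R -> R) = 0 *: e 0%N by rewrite scale0r.
      by rewrite (formZ c 0 Lg Lv (te 0%N)) mul0r.
    rewrite big_ord_recr /= (formD c Lg Lv (tsum m) (testZ _ (te m))) IH add0r.
    by rewrite (formZ c _ Lg Lv (te m)) he mulr0.
  have : form c g v z = 0.
    rewrite zz; have -> : (cst 0 : R -> R) = 0 *: e 0%N by rewrite scale0r.
    by rewrite (formZ c 0 Lg Lv (te 0%N)) mul0r.
  by rewrite /z (formD c Lg Lv (tx n) (tsum n.+1)) Fsum addr0.
apply/eqP; rewrite -sqrf_eq0 eq_le sqr_ge0 andbT; apply/ler_addgt0Pr => eps eps0.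
rewrite add0r; pose M := 2 * ip mu g g + 2 * c ^+ 2 * ip mu v v + 1.
have G0 := hge0 H g; have V0 := hge0 H v.
have M0 : 0 < M by rewrite ltr_wpDl // addr_ge0 // mulr_ge0 // mulr_ge0 // sqr_ge0.
have [n [h1 h2]] := hx eta t _ (divr_gt0 eps0 M0).
have Le := Lt _ t; have Lx := Lt _ (tx n); have Le0 := Lt0 _ t; have Lx0 := Lt0 _ (tx n).
have -> : form c g v eta = ip mu g (ta (- s) eta - ta (- s) (x n)) -
    c * ip mu v (ta (- s0) (derive1n a eta) - ta (- s0) (derive1n a (x n))).
  rewrite (hipBr H Le Lx Lg) (hipBr H Le0 Lx0 Lv) -[LHS]subr0 -[X in _ - X](Fx n) /form.
  move: (ip mu g _) (ip mu g _) (ip mu v _) (ip mu v _) => p q r t0; ring.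
have CS1 := hCS H Lg (hSB H Le Lx); have CS2 := hCS H Lv (hSB H Le0 Lx0).
have P1 := hge0 H (ta (- s) eta - ta (- s) (x n)).
have P2 := hge0 H (ta (- s0) (derive1n a eta) - ta (- s0) (derive1n a (x n))).
move: h1 h2 CS1 CS2 P1 P2.
move: (ip mu g (_ - _)) (ip mu v (_ - _)) (ip mu (_ - _) _) (ip mu (_ - _) _).
move: (ip mu g g) (ip mu v v) G0 V0 @M M0 => G V G0 V0 M M0 p q A B hA hB hp hq A0 B0.
set del := eps / M in hA hB; have Ed : del * M = eps by rewrite /del divfK // gt_eqF.
have d0 : 0 <= del by rewrite divr_ge0 ?ltW.
have c0 := sqr_ge0 c.
have b1 : (p - c * q) ^+ 2 <= 2 * p ^+ 2 + 2 * (c ^+ 2 * q ^+ 2).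
  by rewrite -exprMn; have := sqr_ge0 (p + c * q); move: (c * q) => cq; rewrite !expr2; lra.
have b2 : p ^+ 2 <= G * del by apply: (le_trans hp); rewrite ler_wpM2l // ltW.
have b3 : c ^+ 2 * q ^+ 2 <= c ^+ 2 * (V * del).
  by apply: ler_wpM2l => //; apply: (le_trans hq); rewrite ler_wpM2l // ltW.
apply: (le_trans b1); rewrite -Ed /M.
move: (c ^+ 2) (p ^+ 2) (q ^+ 2) b2 b3 => cc pp qq b2 b3; lra.
Qed.

End fixed_order.

End weak_derivative.

(** * The weighted norm of weak derivatives through coefficients *)

Section slice_norm.
Context {R : realType}.
Notation mu := (@lebesgue_measure R).
Variables (kappa : R) (kappa_gt0 : 0 < kappa).
Notation An := (angles kappa : set (measurableTypeR R)).
Notation tf := (test_function (angles kappa : set R)).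
Notation ta := (ta kappa).
Notation Wa := (Wa kappa).
Implicit Types (f g h eta : R -> R) (v w : R -> R[i]) (s x y t : R) (a n m : nat).

#[local] Instance ae_mu_slice : Filter (almost_everywhere mu) :=
  ae_filter_ringOfSetsType mu.

Let H := L2_hilbert mu.
Let mA : measurable An := measurable_angles kappa.
Let HA := L2on_hilbert mu mA.

Definition em (s0 : R) a : nat -> R -> R := projT1 (cid (test_system kappa_gt0 s0 a)).
Definition Ea (s0 : R) a m := ta (- (s0 + a.*2%:R)) (em s0 a m).
Definition Za (s0 : R) a m := ta (- s0) (derive1n a (em s0 a m)).

Section fixed_order.
Variables (s0 : R) (a : nat).
Let s : R := s0 + a.*2%:R.

Lemma em_test m : tf (em s0 a m).
Proof. by have [te _ _ _] := projT2 (cid (test_system kappa_gt0 s0 a)); exact: te. Qed.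

Lemma Ea_on : orthonormal (L2on mu (angles kappa)) (ip mu) (Ea s0 a).
Proof. by have [] := projT2 (cid (test_system kappa_gt0 s0 a)). Qed.

Lemma Ea_total : total (L2on mu (angles kappa)) (ip mu) (Ea s0 a).
Proof. by have [] := projT2 (cid (test_system kappa_gt0 s0 a)). Qed.

Lemma Ea_form c g f : L2 mu g -> L2 mu f ->
  (forall m, ip mu g (Ea s0 a m) = c * ip mu f (Za s0 a m)) ->
  forall eta, tf eta -> ip mu g (ta (- s) eta) = c * ip mu f (ta (- s0) (derive1n a eta)).
Proof.
move=> Lg Lf h eta te; apply/eqP; rewrite -subr_eq0; apply/eqP.
have [_ _ _ F] := projT2 (cid (test_system kappa_gt0 s0 a)).
apply: (F c g f Lg Lf) => // m; apply/eqP; rewrite subr_eq0; apply/eqP; exact: h.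
Qed.

Lemma Za_L2on m : L2on mu (angles kappa) (Za s0 a m).
Proof. by apply: ta_L2on; apply: test_derive1n; exact: em_test. Qed.

Lemma Ea0_Za0 m : Ea s0 a m = 0 -> Za s0 a m = 0.
Proof.
move=> E0; have te := em_test m; have e0 : em s0 a m = cst 0.
  apply/funext => x; have [xA|nA] := pselect (angles kappa x).
    have : Ea s0 a m x = 0 by rewrite E0.
    rewrite /Ea /ta /cut mem_set // => /eqP; rewrite mulf_eq0.
    by rewrite (gt_eqF (Wa_gt0 _ xA)) => /eqP.
  by have [_ [K [_ KD h0]]] := te; rewrite h0 // => /KD.
rewrite /Za; have -> : em s0 a m = 0 *: em s0 a m by rewrite scale0r e0.
by rewrite (derive1nZ a 0 te.1) scale0r; apply/funext => x; rewrite /ta /cut mulr0 if_same.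
Qed.

Lemma ip_ta (r : R) f h : ip mu (ta r f) (ta (- r) h) = \int[mu]_(x in An) (f x * h x).
Proof.
rewrite /ip [RHS]Rintegral_mkcond; apply: eq_Rintegral => x _.
rewrite patchE /ta /cut; case: ifPn => [/set_mem xA|_]; last by rewrite mul0r.
by rewrite mulrACA WaN // mul1r.
Qed.

Lemma locally_integrable_ta (r : R) f : L2 mu (ta r f) ->
  locally_integrable_on (angles kappa) f.
Proof.
move=> Lf p q pq.
have := locally_integrable_weight Lf (@Wa_continuous R kappa (- r)) pq.
apply: eq_integrable; first exact: measurable_itv.
move=> x /set_mem /pq xA /=; rewrite /ta /cut mem_set //.
by rewrite mulrAC (WaN _ xA) mul1r.
Qed.

Lemma normc_le (z : R[i]) : Normc.normc z <= `|complex.Re z| + `|complex.Im z|.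
Proof.
rewrite -(@ler_pXn2r _ 2) ?nnegrE ?addr_ge0 //; last by case: z => p q; exact: sqrtr_ge0.
rewrite normc_sq -[complex.Re z ^+ 2]real_normK ?num_real // -[complex.Im z ^+ 2]real_normK ?num_real //.
by have := normr_ge0 (complex.Re z); have := normr_ge0 (complex.Im z); nra.
Qed.

Lemma L1loc_of_L2 (r : R) v : cmeasurable An v -> pairS (L2on mu (angles kappa)) (tld An (Wa r) v) ->
  L1loc1 (angles kappa) v.
Proof.
move=> mv [[L1 _] [L2' _]]; split => // K cK KA.
have [e [e0 KI]] := compact_angles cK KA.
pose I : set (measurableTypeR R) := `[e, kappa - e]%classic.
have IA : I `<=` angles kappa := sub_angles e0.
have i1 := integrable_normR (locally_integrable_ta L1 IA).
have i2 := integrable_normR (locally_integrable_ta L2' IA).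
have mI : measurable I := measurable_itv _.
have i12 : mu.-integrable I (EFin \o (fun x => `|complex.Re (v x)| + `|complex.Im (v x)|)).
  exact: (integrableD mI i1 i2).
have [_] := integrableP _ _ _ i12.
have n0 z : 0 <= Normc.normc z by case: z => p q; exact: sqrtr_ge0.
have st1 : (\int[mu1]_(x in (K : set (measurableTypeR R))) (Normc.normc (v x))%:E <= \int[mu]_(x in I) (Normc.normc (v x))%:E)%E.
  rewrite [leLHS]integral_mkcond [leRHS]integral_mkcond.
  apply: le_ge0_integral => x _; rewrite patchE; case: ifPn => xK //.
  - by rewrite lee_fin n0.
  - by rewrite patchE mem_set //; exact: KI (set_mem xK).
  - by rewrite patchE; case: ifP => // _; rewrite lee_fin n0.
apply: le_lt_trans; apply: (le_trans st1).
apply: le_ge0_integral => x _; first by rewrite lee_fin n0.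
by rewrite /= lee_fin ger0_norm ?addr_ge0 //; exact: normc_le.
Qed.

Let Re_mul (u : R -> R[i]) (k : R -> R) :
  Rintegral mu1 An (fun x => complex.Re (u x * (k x)%:C%C)) = \int[mu]_(x in An) (complex.Re (u x) * k x).
Proof. by apply: eq_Rintegral => x _; case: (u x) => p q /=; ring. Qed.

Let Im_mul (u : R -> R[i]) (k : R -> R) :
  Rintegral mu1 An (fun x => complex.Im (u x * (k x)%:C%C)) = \int[mu]_(x in An) (complex.Im (u x) * k x).
Proof. by apply: eq_Rintegral => x _; case: (u x) => p q /=; ring. Qed.

Let sgn_mul (p q : R) : (-1) ^+ a * Complex p q = Complex ((-1) ^+ a * p) ((-1) ^+ a * q).
Proof.
have -> : (-1) ^+ a = ((-1) ^+ a)%:C%C :> R[i] by rewrite rmorphXn rmorphN1.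
by apply/eqP; rewrite eq_complex /= !mul0r subr0 addr0 !eqxx.
Qed.

Lemma wderiv_coef v w : is_wderiv kappa a v w -> forall eta, tf eta ->
  \int[mu]_(x in An) (complex.Re (w x) * eta x) =
    (-1) ^+ a * \int[mu]_(x in An) (complex.Re (v x) * derive1n a eta x) /\
  \int[mu]_(x in An) (complex.Im (w x) * eta x) =
    (-1) ^+ a * \int[mu]_(x in An) (complex.Im (v x) * derive1n a eta x).
Proof.
move=> [_ _ h] eta te; have := h _ te; rewrite /cintegral sgn_mul => -[].
by rewrite !Re_mul !Im_mul.
Qed.

Lemma wderiv_of_int v w : L1loc1 (angles kappa) v -> L1loc1 (angles kappa) w ->
  (forall eta, tf eta ->
  \int[mu]_(x in An) (complex.Re (w x) * eta x) =
    (-1) ^+ a * \int[mu]_(x in An) (complex.Re (v x) * derive1n a eta x) /\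
  \int[mu]_(x in An) (complex.Im (w x) * eta x) =
    (-1) ^+ a * \int[mu]_(x in An) (complex.Im (v x) * derive1n a eta x)) ->
  is_wderiv kappa a v w.
Proof.
move=> lv lw h; split => // eta te; have [h1 h2] := h _ te.
by rewrite /cintegral sgn_mul !Re_mul !Im_mul h1 h2.
Qed.

(** Both sides of the defining identity are continuous for the graph norm in the
    test function, so that the countable system decides. *)
Lemma wderiv_of_coef v w : cmeasurable An v -> cmeasurable An w ->
  pairS (L2on mu (angles kappa)) (tld An (Wa s0) v) ->
  pairS (L2on mu (angles kappa)) (tld An (Wa s) w) ->
  (forall m, ip mu (tld An (Wa s) w).1 (Ea s0 a m) = (-1) ^+ a * ip mu (tld An (Wa s0) v).1 (Za s0 a m)) ->
  (forall m, ip mu (tld An (Wa s) w).2 (Ea s0 a m) = (-1) ^+ a * ip mu (tld An (Wa s0) v).2 (Za s0 a m)) ->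
  is_wderiv kappa a v w.
Proof.
move=> mv mw Lv Lw h1 h2.
apply: wderiv_of_int (L1loc_of_L2 mv Lv) (L1loc_of_L2 mw Lw) _ => eta te.
have := Ea_form Lw.1.1 Lv.1.1 h1 te; have := Ea_form Lw.2.1 Lv.2.1 h2 te.
by rewrite /tld /= -!/(ta _ _) !ip_ta => -> ->.
Qed.

Lemma L1loc_locally v : L1loc1 (angles kappa) v ->
  locally_integrable_on (angles kappa) (fun x => complex.Re (v x)) /\
  locally_integrable_on (angles kappa) (fun x => complex.Im (v x)).
Proof.
move=> [[m1 m2] h]; split=> p q pq.
- apply/integrableP; split.
    by apply/measurable_EFinP; apply: measurable_funS m1 => //; exact: measurable_angles.
  apply: le_lt_trans (h _ (@segment_compact R p q) pq); apply: le_ge0_integral => x _ //.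
  by rewrite lee_fin; case: (v x) => u w /=; rewrite -sqrtr_sqr ler_wsqrtr // lerDl sqr_ge0.
- apply/integrableP; split.
    by apply/measurable_EFinP; apply: measurable_funS m2 => //; exact: measurable_angles.
  apply: le_lt_trans (h _ (@segment_compact R p q) pq); apply: le_ge0_integral => x _ //.
  by rewrite lee_fin; case: (v x) => u w /=; rewrite -sqrtr_sqr ler_wsqrtr // lerDr sqr_ge0.
Qed.

Lemma ae_eq_of_tests f g : locally_integrable_on (angles kappa) f ->
  locally_integrable_on (angles kappa) g ->
  (forall eta, tf eta -> \int[mu]_(x in An) (f x * eta x) = \int[mu]_(x in An) (g x * eta x)) ->
  {ae mu, forall x, angles kappa x -> f x = g x}.
Proof.
move=> lf lg h.
suff : {ae mu, forall x, angles kappa x -> f x - g x = 0}.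
  by apply: filterS => x hx /hx /subr0_eq.
apply: bump_separates; first exact: open_angles.
  move=> p q pq; have mI : measurable (`[p, q]%classic : set (measurableTypeR R)) := measurable_itv _.
  exact: (integrableB mI (lf _ _ pq) (lg _ _ pq)).
move=> k; have tb := bump_seq_test k (angles_nonempty kappa_gt0).
have il (u : R -> R) : locally_integrable_on (angles kappa) u ->
    mu.-integrable An (EFin \o (fun x => u x * bump_seq (angles kappa) k x)).
  move=> lu; set b := bump_seq _ _ in tb *; have [sb [K [cK KA b0]]] := tb.
  have [e [e0 KI]] := compact_angles cK KA.
  pose I : set (measurableTypeR R) := `[e, kappa - e]%classic.
  have IA : I `<=` angles kappa := sub_angles e0.
  have mI : measurable I := measurable_itv _.
  have [M hM] := cc_bounded (test_cc tb).
  have iI := lu _ _ IA.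
  have i1 : mu.-integrable I (EFin \o (fun x => u x * b x)).
    apply: (@le_integrable _ _ _ mu _ _ _ _ _ _ (integrableZl mI M iI)) => //.
      apply/measurable_EFinP/measurable_funM; first exact: integrable_measurable iI.
      by apply: measurable_funTS; apply: continuous_measurable; exact: smooth_continuous.
    move=> x _; rewrite /= lee_fin !normrM mulrC; apply: ler_wpM2r => //.
    by apply: le_trans (hM x) _; exact: ler_norm.
  apply: (integrable_mkcond _ mA).2.
  have := (integrable_mkcond _ mI).1 i1; apply: eq_integrable => // x _.
  rewrite !patchE; case: ifPn => xI; case: ifPn => xA //.
  - by move: xA; rewrite notin_setE => /(_ (IA _ (set_mem xI))).
  - by rewrite /= b0 ?mulr0 // => /KI; move: xI; rewrite notin_setE.
under eq_Rintegral do rewrite mulrBl.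
by rewrite (RintegralB mA (il _ lf) (il _ lg)) (h _ tb) subrr.
Qed.

Lemma wderiv_unique v w w' : is_wderiv kappa a v w -> is_wderiv kappa a v w' ->
  {ae mu, forall x, angles kappa x -> w x = w' x}.
Proof.
move=> h h'; have [_ lw _] := h; have [_ lw' _] := h'.
have [l1 l2] := L1loc_locally lw; have [l1' l2'] := L1loc_locally lw'.
have e1 : {ae mu, forall x, angles kappa x -> complex.Re (w x) = complex.Re (w' x)}.
  by apply: ae_eq_of_tests => // eta te; have [-> _] := wderiv_coef h te; have [-> _] := wderiv_coef h' te.
have e2 : {ae mu, forall x, angles kappa x -> complex.Im (w x) = complex.Im (w' x)}.
  by apply: ae_eq_of_tests => // eta te; have [_ ->] := wderiv_coef h te; have [_ ->] := wderiv_coef h' te.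
apply: filterS2 e1 e2 => x h1 h2 xA; have := h1 xA; have := h2 xA.
by case: (w x) (w' x) => p q [p' q'] /= -> ->.
Qed.

(** The squared norm of the derivative of order [a] of [v], if that derivative
    exists and is square integrable, and [+oo] otherwise: its coefficients in
    the system [Ea] are those of [v] in [Za], up to sign. Unlike the derivative,
    this expression makes sense for every [v] and is visibly measurable in
    parameters. *)
Definition energy (V : (R -> R) * (R -> R)) : \bar R :=
  (\sum_(0 <= m <oo) (ip mu V.1 (Za s0 a m) ^+ 2 + ip mu V.2 (Za s0 a m) ^+ 2)%:E)%E.

Lemma energy_wderiv_L2 v w : cmeasurable An v -> is_wderiv kappa a v w ->
  pairS (L2on mu (angles kappa)) (tld An (Wa s0) v) ->
  pairS (L2on mu (angles kappa)) (tld An (Wa s) w) ->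
  (\int[mu]_(x in An) (Normc.normc (w x) ^+ 2 * Wa s x ^+ 2)%:E = energy (tld An (Wa s0) v))%E.
Proof.
move=> mv hw Lv Lw; have [_ [mw _] _] := hw.
rewrite (tld_ipE mA (@measurable_Wa R kappa s) mw Lw) /pairip EFinD.
rewrite -(parseval HA Ea_on Ea_total Lw.1) -(parseval HA Ea_on Ea_total Lw.2).
rewrite -nneseriesD; [|by move=> m _ _; rewrite lee_fin sqr_ge0..].
apply: eq_eseriesr => m _; rewrite -EFinD; congr (_%:E).
have [h1 h2] := wderiv_coef hw (em_test m).
have E1 : ip mu (tld An (Wa s) w).1 (Ea s0 a m) = (-1) ^+ a * ip mu (tld An (Wa s0) v).1 (Za s0 a m).
  by rewrite /tld /= -!/(ta _ _) /Ea /Za !ip_ta.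
have E2 : ip mu (tld An (Wa s) w).2 (Ea s0 a m) = (-1) ^+ a * ip mu (tld An (Wa s0) v).2 (Za s0 a m).
  by rewrite /tld /= -!/(ta _ _) /Ea /Za !ip_ta.
by rewrite E1 E2 !exprMn sqrr_sign !mul1r.
Qed.

(** Finite energy means square summable coefficients, which Riesz--Fischer turns
    into a function. *)
Lemma wderiv_of_energy v : cmeasurable An v ->
  pairS (L2on mu (angles kappa)) (tld An (Wa s0) v) ->
  (energy (tld An (Wa s0) v) < +oo)%E ->
  exists w, [/\ is_wderiv kappa a v w, cmeasurable An w &
    pairS (L2on mu (angles kappa)) (tld An (Wa s) w)].
Proof.
move=> mv Lv fin; set V := tld An (Wa s0) v in Lv fin *.
have [B hB] : exists B : R, forall n, \sum_(m < n) (ip mu V.1 (Za s0 a m) ^+ 2 + ip mu V.2 (Za s0 a m) ^+ 2) <= B.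
  exists (fine (energy V)) => n.
  have e0 : (0 <= energy V)%E by apply: nneseries_ge0 => m _ _; rewrite lee_fin addr_ge0 ?sqr_ge0.
  rewrite -lee_fin fineK ?ge0_fin_numE // -sumEFin.
  rewrite -(big_mkord xpredT (fun m => (ip mu V.1 (Za s0 a m) ^+ 2 + ip mu V.2 (Za s0 a m) ^+ 2)%:E)).
  by apply: nneseries_lim_ge => m _ _; rewrite lee_fin addr_ge0 ?sqr_ge0.
have rf (f : R -> R) : (forall n, \sum_(m < n) (ip mu f (Za s0 a m)) ^+ 2 <= B) ->
    exists2 g, L2on mu (angles kappa) g & forall m, ip mu g (Ea s0 a m) = (-1) ^+ a * ip mu f (Za s0 a m).
  move=> hf; have [_ _ ne] := Ea_on.
  have N m : ip mu (Ea s0 a m) (Ea s0 a m) * ((-1) ^+ a * ip mu f (Za s0 a m)) = (-1) ^+ a * ip mu f (Za s0 a m).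
    have [->|E0] := ne m; first by rewrite mul1r.
    rewrite (Ea0_Za0 E0) E0; have -> : ip mu f 0 = 0.
      by rewrite /ip; under eq_Rintegral do rewrite mulr0; rewrite Rintegral_cst // mul0r.
    by rewrite !mulr0.
  have hf' n : \sum_(m < n) ((-1) ^+ a * ip mu f (Za s0 a m)) ^+ 2 <= B.
    by apply: le_trans (hf n); apply: ler_sum => m _; rewrite exprMn sqrr_sign mul1r.
  by have [g Sg [_ hg]] := riesz_fischer HA Ea_on N hf'; exists g.
have [g1 S1 h1] : exists2 g, L2on mu (angles kappa) g & forall m, ip mu g (Ea s0 a m) = (-1) ^+ a * ip mu V.1 (Za s0 a m).
  by apply: rf => n; apply: le_trans (hB n); apply: ler_sum => m _; rewrite lerDl sqr_ge0.
have [g2 S2 h2] : exists2 g, L2on mu (angles kappa) g & forall m, ip mu g (Ea s0 a m) = (-1) ^+ a * ip mu V.2 (Za s0 a m).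
  by apply: rf => n; apply: le_trans (hB n); apply: ler_sum => m _; rewrite lerDr sqr_ge0.
pose w := untld (Wa s) (g1, g2).
have Ew : tld An (Wa s) w = (g1, g2).
  by apply: untldK; [move=> x; exact: Wa_gt0|exact: S1.2|exact: S2.2].
have mw : cmeasurable An w.
  have mV : measurable_fun An (fun x => (Wa s x)^-1).
    apply: (eq_measurable_fun (Wa (- s))); last exact: measurable_Wa.
    move=> x /set_mem xA; apply: (mulfI (lt0r_neq0 (Wa_gt0 s xA))).
    by rewrite WaN // divff // lt0r_neq0 // Wa_gt0.
  exact: (untld_measurable (c := (g1, g2)) mV S1.1.1 S2.1.1).
have Lw : pairS (L2on mu (angles kappa)) (tld An (Wa s) w) by rewrite Ew.
by exists w; split => //; apply: wderiv_of_coef => //; rewrite Ew.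
Qed.

Lemma energy_wderiv v w : cmeasurable An v -> is_wderiv kappa a v w ->
  pairS (L2on mu (angles kappa)) (tld An (Wa s0) v) ->
  (\int[mu]_(x in An) (Normc.normc (w x) ^+ 2 * Wa s x ^+ 2)%:E = energy (tld An (Wa s0) v))%E.
Proof.
move=> mv hw Lv; have [_ [mw _] _] := hw.
have [fin|inf] := ltP (\int[mu]_(x in An) (Normc.normc (w x) ^+ 2 * Wa s x ^+ 2)%:E)%E +oo%E.
  by apply: energy_wderiv_L2 => //; exact: (tld_on mA (@measurable_Wa R kappa s) mw fin).
have [efin|einf] := ltP (energy (tld An (Wa s0) v)) +oo%E; last first.
  by apply/eqP; rewrite eq_le (le_trans _ inf) ?leey // (le_trans _ einf) ?leey.
have [w' [hw' mw' Lw']] := wderiv_of_energy mv Lv efin.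
rewrite -(energy_wderiv_L2 mv hw' Lv Lw'); apply: ae_eq_ge0_integral => //.
- by move=> x _; rewrite lee_fin mulr_ge0 ?sqr_ge0.
- by move=> x _; rewrite lee_fin mulr_ge0 ?sqr_ge0.
- by apply: filterS (wderiv_unique hw hw') => x hx xA; rewrite hx.
Qed.

End fixed_order.
End slice_norm.

Section Hnorm_energy.
Context {R : realType}.
Notation mu := (@lebesgue_measure R).
Variables (kappa : R) (kappa_gt0 : 0 < kappa).
Notation An := (angles kappa : set (measurableTypeR R)).
Notation Wa := (Wa kappa).
Implicit Types (v w : R -> R[i]) (s x : R) (a k : nat).

#[local] Instance ae_mu_Hnorm : Filter (almost_everywhere mu) :=
  ae_filter_ringOfSetsType mu.

Lemma sq_pinfty : ((+oo : \bar R) ^+ 2 = +oo)%E.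
Proof. by rewrite (_ : (+oo ^+ 2)%E = (+oo * +oo)%E) ?mulyy. Qed.

Lemma poweR_half_sq (x : \bar R) : (0 <= x)%E -> ((x `^ 2^-1) ^+ 2 = x)%E.
Proof.
case: x => [x| |] //; last by rewrite poweRyr ?invr_eq0 // sq_pinfty.
rewrite lee_fin => x0; rewrite poweR_EFin powR12_sqrt // -EFin_expe.
by rewrite sqr_sqrtr.
Qed.

Lemma weight_sq (s : R) a x (z : R[i]) : angles kappa x ->
  (rho kappa x ^+ a * Normc.normc z) ^+ 2 * rho kappa x `^ s =
  Normc.normc z ^+ 2 * Wa (s + a.*2%:R) x ^+ 2.
Proof.
move=> xA; have r0 := rho_gt0 xA.
rewrite (Wa_sq _ xA) powRD ?(gt_eqF r0) ?implybT // powR_mulrn ?ltW //.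
rewrite exprMn -exprM -muln2; ring.
Qed.

(** The infinite value assigned to the norm when a derivative is missing agrees
    with the value of the energy. *)
Lemma Hnorm_energy k (Theta : R) v : cmeasurable An v ->
  pairS (L2on mu (angles kappa)) (tld An (Wa (Theta - 1)) v) ->
  (Hnorm kappa k Theta v ^+ 2 =
   \sum_(a < k.+1) energy kappa_gt0 (Theta - 1) a (tld An (Wa (Theta - 1)) v))%E.
Proof.
move=> mv Lv; rewrite /Hnorm.
have e0 a : (0 <= energy kappa_gt0 (Theta - 1) a (tld An (Wa (Theta - 1)) v))%E.
  by apply: nneseries_ge0 => m _ _; rewrite lee_fin addr_ge0 ?sqr_ge0.
case: asboolP => [h|nh].
  rewrite poweR_half_sq; last first.
    by apply: sume_ge0 => a _; apply: integral_ge0 => x _; rewrite lee_fin mulr_ge0 ?sqr_ge0 ?powR_ge0.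
  apply: eq_bigr => a _; have [w hw] := h a (ltn_ord a).
  have hwd : is_wderiv kappa a v (wderiv kappa a v).
    by apply: (xgetPex (P := [set w | is_wderiv kappa a v w]) (fun=> 0)); exists w.
  rewrite -(energy_wderiv kappa_gt0 mv hwd Lv); apply: eq_integral => x /set_mem xA.
  by rewrite weight_sq.
have [a ak na] : exists2 a, (a <= k)%N & ~ exists w, is_wderiv kappa a v w.
  apply: contrapT => hn; apply: nh => a ak; apply: contrapT => na; apply: hn.
  by exists a.
have ea : energy kappa_gt0 (Theta - 1) a (tld An (Wa (Theta - 1)) v) = +oo%E.
  apply/eqP; rewrite -leye_eq leNgt; apply/negP => fin.
  by have [w [hw _ _]] := wderiv_of_energy mv Lv fin; apply: na; exists w.
have ak' : (a < k.+1)%N by [].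
rewrite (bigD1 (Ordinal ak')) //= ea addye ?sq_pinfty //.
by rewrite gt_eqF // (@lt_le_trans _ _ 0%E) // sume_ge0.
Qed.

Lemma Hnorm_ge k (Theta : R) v :
  (\int[mu]_(x in An) (Normc.normc (v x) ^+ 2 * Wa (Theta - 1) x ^+ 2)%:E <= Hnorm kappa k Theta v ^+ 2)%E.
Proof.
rewrite /Hnorm; case: asboolP => [h|_]; last by rewrite sq_pinfty leey.
rewrite poweR_half_sq; last first.
  by apply: sume_ge0 => a _; apply: integral_ge0 => x _; rewrite lee_fin mulr_ge0 ?sqr_ge0 ?powR_ge0.
have [w hw] := h 0%N (leq0n k).
have hwd : is_wderiv kappa 0 v (wderiv kappa 0 v).
  by apply: (xgetPex (P := [set w | is_wderiv kappa 0 v w]) (fun=> 0)); exists w.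
have hv : is_wderiv kappa 0 v v.
  by have [lv _ _] := hwd; split => // eta _; rewrite expr0 mul1r.
rewrite big_ord_recl /=.
apply: (@le_trans _ _ (\int[mu1]_(x in angles kappa)
   ((rho kappa x ^+ 0 * Normc.normc (wderiv kappa 0 v x)) ^+ 2 * rho kappa x `^ (Theta - 1))%:E)%E).
  rewrite le_eqVlt; apply/orP; left; apply/eqP; apply: ae_eq_ge0_integral.
  - by move=> x _; rewrite lee_fin mulr_ge0 ?sqr_ge0.
  - by move=> x _; rewrite lee_fin mulr_ge0 ?sqr_ge0 ?powR_ge0.
  - apply: filterS (wderiv_unique kappa_gt0 hv hwd) => x hx xA.
    by rewrite weight_sq // addr0 (hx xA).
rewrite leeDl // sume_ge0 // => a _; apply: integral_ge0 => x _.
by rewrite lee_fin mulr_ge0 ?sqr_ge0 ?powR_ge0.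
Qed.

End Hnorm_energy.

(** * Mellin pairs with a parameter *)

Section parametrised.
Context {R : realType}.
Notation mu := (@lebesgue_measure R).
Notation muq := (@lebesgue_measure R \x @lebesgue_measure R)%E.
Notation V := ((R -> R) * (R -> R))%type.
Notation W := ((R * R -> R) * (R * R -> R))%type.
Notation Rp := (Rpos : set (measurableTypeR R)).
Implicit Types (F : R * R -> R) (A B : W) (x y r t : R).

#[local] Instance ae_mu_param : Filter (almost_everywhere mu) :=
  ae_filter_ringOfSetsType mu.

Let H := L2_hilbert mu.
Let HL := pair_hilbert (L2_hilbert mu).
Let HQ := pair_hilbert (L2_hilbert muq).

Definition col A y : V := (fun x => A.1 (x, y), fun x => A.2 (x, y)).
Definition cpart A (q : R -> R) : V := (part mu A.1 q, part mu A.2 q).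
Definition ccol A (e : V) y : R := ipc mu (col A y) e.

Lemma L2_swap F : L2 muq F -> L2 muq (fun z => F (z.2, z.1)).
Proof.
move=> [mF fin]; have ms : measurable_fun setT (fun z : R * R => F (z.2, z.1)).
  exact: (measurableT_comp mF (@measurable_swap _ _ (measurableTypeR R) (measurableTypeR R))).
by split => //; rewrite L2_tonelli //= -(L2_tonelli2 mu mu mF).
Qed.

Lemma ccolE A e : ccol A e = part2 mu A.1 e.1 + part2 mu A.2 e.2.
Proof. by []. Qed.

Lemma L2_ccol A e : L2c muq A -> L2c mu e -> L2 mu (ccol A e).
Proof.
by move=> [A1 A2] [e1 e2]; rewrite ccolE; exact: (hSD H (L2_part2 A1 e1) (L2_part2 A2 e2)).
Qed.

Lemma ae_col A : L2c muq A -> {ae mu, forall y, L2c mu (col A y)}.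
Proof. by move=> [A1 A2]; apply: filterS2 (L2_slice2 A1) (L2_slice2 A2) => y h1 h2. Qed.

Let sqE_ge0 (a : R) : (0 <= (a ^+ 2)%:E)%E. Proof. by rewrite lee_fin sqr_ge0. Qed.

Lemma ipc_col A : L2c muq A ->
  (\int[mu]_y (ipc mu (col A y) (col A y))%:E = (ipc muq A A)%:E)%E.
Proof.
move=> [A1 A2]; have [m1 _] := A1; have [m2 _] := A2.
rewrite /pairip EFinD -(L2_ipE A1) -(L2_ipE A2) (L2_tonelli2 _ _ m1) (L2_tonelli2 _ _ m2).
rewrite -ge0_integralD //; last 4 first.
- by move=> y _; apply: integral_ge0 => x _; rewrite lee_fin sqr_ge0.
- by have := measurable_fun_fubini_tonelli_G (m1 := mu) _ (measurable_sqE m1) (fun z => sqE_ge0 (A.1 z)).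
- by move=> y _; apply: integral_ge0 => x _; rewrite lee_fin sqr_ge0.
- by have := measurable_fun_fubini_tonelli_G (m1 := mu) _ (measurable_sqE m2) (fun z => sqE_ge0 (A.2 z)).
apply: ae_eq_ge0_integral.
- by move=> y _; rewrite lee_fin; exact: (hge0 HL).
- by move=> y _; apply: adde_ge0; apply: integral_ge0 => x _; rewrite lee_fin sqr_ge0.
apply: filterS (ae_col (conj A1 A2)) => y [h1 h2] _.
by rewrite (L2_ipE h1) (L2_ipE h2).
Qed.

(** The function [B] is assembled by Riesz--Fischer with parameters from the
    coefficients of the columns of [A]; Bessel's inequality gives the bound. *)
Lemma param_transfer (D D' E : set R) (e e' : nat -> V) A :
  measurable (D' : set (measurableTypeR R)) -> measurable (E : set (measurableTypeR R)) ->
  orthonormal (pairS (L2on mu D)) (ipc mu) e -> orthonormal (pairS (L2on mu D')) (ipc mu) e' ->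
  (forall k, ipc mu (e k) (e k) = ipc mu (e' k) (e' k)) ->
  L2c muq A -> (forall x y, ~ E y -> A.1 (x, y) = 0 /\ A.2 (x, y) = 0) ->
  exists B, [/\ L2c muq B,
    forall x y, ~ (D' x /\ E y) -> B.1 (x, y) = 0 /\ B.2 (x, y) = 0 &
    {ae mu, forall y, pairS (L2on mu D') (col B y) /\
      forall k, ipc mu (col B y) (e' k) = ipc mu (col A y) (e k)}].
Proof.
move=> mD mE on on' ee LA A0.
have [Se oe ne] := on; have [Se' oe' ne'] := on'.
have one : orthonormal (L2c mu) (ipc mu) e by split => // k; exact: L2on_L2c (Se k).
have one' : orthonormal (L2c mu) (ipc mu) e' by split => // k; exact: L2on_L2c (Se' k).
pose c k := ccol A (e k).
have Lc k : L2 mu (c k) := L2_ccol LA (L2on_L2c (Se k)).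
have nc k y : ipc mu (e' k) (e' k) * c k y = c k y.
  rewrite -ee; have [->|E0] := ne k; first by rewrite mul1r.
  have z (f : R -> R) : ip mu f 0 = 0.
    by rewrite /ip; under eq_Rintegral do rewrite mulr0; rewrite Rintegral_cst // mul0r.
  by rewrite /c /ccol E0 /pairip /= !z addr0 mulr0.
have cB n : \sum_(k < n) ip mu (c k) (c k) <= ipc muq A A.
  rewrite -lee_fin -(ipc_col LA) -sumEFin.
  under eq_bigr do rewrite -(L2_ipE (Lc _)).
  have mc (k : 'I_n) : measurable_fun setT (fun y => (c k y ^+ 2)%:E).
    by apply: measurable_sqE; case: (Lc k).
  rewrite -(ge0_integral_sum mu measurableT mc (fun k y _ => sqE_ge0 (c k y))).
  apply: ae_le_integral.
  - by move=> y _; apply: sume_ge0 => k _; rewrite lee_fin sqr_ge0.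
  - by move=> y _; rewrite lee_fin; exact: (hge0 HL).
  apply: filterS (ae_col LA) => y Ly _; rewrite sumEFin lee_fin.
  exact: (bessel HL n one Ly).
have [G [G1 G2] hG] := riesz_fischer_param one' Lc nc cB.
pose B : W := (fun z => if (z.1 \in D') && (z.2 \in E) then G.1 (z.2, z.1) else 0,
               fun z => if (z.1 \in D') && (z.2 \in E) then G.2 (z.2, z.1) else 0).
have LB (F : R * R -> R) : L2 muq F ->
    L2 muq (fun z => if (z.1 \in D') && (z.2 \in E) then F (z.2, z.1) else 0).
  move=> LF; have mX : measurable (D' `*` E : set (measurableTypeR R * measurableTypeR R)).
    exact: measurableX.
  have [h _] := L2_cut mX (L2_swap LF).
  rewrite (_ : (fun z => _) = cut (D' `*` E) (fun z => F (z.2, z.1))) //.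
  apply/funext => -[x y]; rewrite /cut /=.
  have -> // : ((x, y) \in D' `*` E) = (x \in D') && (y \in E).
  by apply/idP/andP => [/set_mem[h1 h2]|[/set_mem h1 /set_mem h2]]; [split; exact/mem_set|exact/mem_set].
exists B; split.
- by split; exact: LB.
- move=> x y nxy; rewrite /B /=.
  have -> // : (x \in D') && (y \in E) = false.
  by apply/negbTE/negP => /andP[/set_mem h1 /set_mem h2]; apply: nxy.
apply: filterS hG => y [[h1 h2] hk].
have cutE (F : R * R -> R) : y \in E ->
    (fun x => if (x \in D') && (y \in E) then F (y, x) else 0) = cut D' (fun x => F (y, x)).
  by move=> yE; apply/funext => x; rewrite /cut yE andbT.
have [yE|nE] := boolP (y \in E); last first.
  have z : col B y = 0.
    by rewrite /col /B /=; congr (_, _); apply/funext => x; rewrite (negbTE nE) andbF.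
  have zA : col A y = 0.
    have nEy : ~ E y by move: nE; rewrite notin_setE.
    by rewrite /col; congr (_, _); apply/funext => x; have [a1 a2] := A0 x y nEy; rewrite ?a1 ?a2.
  rewrite z zA; split; first exact: (hS0 (pair_hilbert (L2on_hilbert mu mD))).
  by move=> k; rewrite (hip0 HL (L2on_L2c (Se' k))) (hip0 HL (L2on_L2c (Se k))).
split.
  by rewrite /col /B /= !cutE //; split; exact: L2_cut.
move=> k; rewrite -[RHS](hk k) /col /B /= !cutE // /pairip /=.
have cut_ip (f g : R -> R) : L2on mu D' g -> ip mu (cut D' f) g = ip mu f g.
  move=> [_ g0]; apply: eq_Rintegral => x _; rewrite /cut; case: ifPn => //.
  by rewrite notin_setE => /g0 ->; rewrite !mulr0.
by have [s1 s2] := Se' k; rewrite !cut_ip.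
Qed.

Variable beta : R.
Notation MP := (MP beta).

(** Square integrable functions on the plane have slices only for almost every
    angle; the support conditions fix representatives off the domains. *)
Definition REL (E : set R) A B := [/\ L2c muq A, L2c muq B,
  forall x y, ~ (Rpos x /\ E y) -> A.1 (x, y) = 0 /\ A.2 (x, y) = 0,
  forall x y, ~ E y -> B.1 (x, y) = 0 /\ B.2 (x, y) = 0 &
  {ae mu, forall y, MP (col A y) (col B y)}].

Lemma col_on (E : set R) A y : L2c mu (col A y) ->
  (forall x y, ~ (Rpos x /\ E y) -> A.1 (x, y) = 0 /\ A.2 (x, y) = 0) ->
  pairS (L2on mu Rpos) (col A y).
Proof.
move=> [h1 h2] A0; split; split=> //= x nx.
- by have [|-> _] := A0 x y => // -[].
- by have [|_ ->] := A0 x y => // -[].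
Qed.

Let mbT : orthonormal (pairS (L2on mu setT)) (ipc mu) (mbh beta).
Proof.
have [S o n] := mbh_on beta; split => // k; have [S1 S2] := S k.
by split; split => // x nx; case: nx.
Qed.

Let nmb k : ipc mu (mb beta k) (mb beta k) = ipc mu (mbh beta k) (mbh beta k).
Proof. by rewrite /mbh (Mt_ip (mb_ccc _ k) (mb_ccc _ k)). Qed.

Lemma REL_right (E : set R) A : measurable (E : set (measurableTypeR R)) -> L2c muq A ->
  (forall x y, ~ (Rpos x /\ E y) -> A.1 (x, y) = 0 /\ A.2 (x, y) = 0) ->
  exists B, REL E A B.
Proof.
move=> mE LA A0.
have A0' x y : ~ E y -> A.1 (x, y) = 0 /\ A.2 (x, y) = 0 by move=> nE; apply: A0 => -[].
have mT : measurable (setT : set (measurableTypeR R)) := measurableT.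
have [B [LB B0 hB]] := param_transfer mT mE (mb_on beta) mbT nmb LA A0'.
exists B; split => //; first by move=> x y nE; apply: B0 => -[].
apply: filterS2 hB (ae_col LA) => y [h1 h2] h3.
apply: MP_of_basis; [exact: col_on h3 A0|exact: L2on_L2c h1|by move=> k; rewrite h2].
Qed.

Lemma REL_left (E : set R) B : measurable (E : set (measurableTypeR R)) -> L2c muq B ->
  (forall x y, ~ E y -> B.1 (x, y) = 0 /\ B.2 (x, y) = 0) ->
  exists A, REL E A B.
Proof.
move=> mE LB B0.
have [A [LA A0 hA]] := param_transfer (@measurable_Rp R) mE mbT (mb_on beta) (fun k => esym (nmb k)) LB B0.
exists A; split => //.
apply: filterS2 hA (ae_col LB) => y [h1 h2] h3.
by apply: MP_of_basis.
Qed.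

Lemma part0 F (q : R -> R) x : (forall y, F (x, y) = 0) -> part mu F q x = 0.
Proof.
move=> F0; rewrite /part /ip; under eq_Rintegral do rewrite F0 mul0r.
by rewrite Rintegral_cst // mul0r.
Qed.

Lemma ip_cpart A (e : V) q : L2c muq A -> L2c mu e -> L2 mu q ->
  ipc mu (cpart A q) e = ip mu (ccol A e) q.
Proof.
move=> [A1 A2] [e1 e2] Lq; rewrite ccolE (hipD H (L2_part2 A1 e1) (L2_part2 A2 e2) Lq).
by rewrite /pairip /= (ip_part A1 e1 Lq) (ip_part A2 e2 Lq) (ip_part2 A1 e1 Lq) (ip_part2 A2 e2 Lq).
Qed.

(** Membership is decided by coefficients, and pairing in both variables may be
    done in either order. *)
Lemma REL_cpart (E : set R) A B q : REL E A B -> L2 mu q -> MP (cpart A q) (cpart B q).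
Proof.
move=> [LA LB A0 B0 h] Lq; have [A1 A2] := LA; have [B1 B2] := LB.
apply: MP_of_basis.
- split; split; [exact: L2_part|move=> x nx|exact: L2_part|move=> x nx].
  + by apply: part0 => y; have [|-> _] := A0 x y => // -[].
  + by apply: part0 => y; have [|_ ->] := A0 x y => // -[].
- by split; exact: L2_part.
move=> k; have [Se _ _] := mb_on beta; have [Seh _ _] := mbh_on beta.
rewrite (ip_cpart LA (L2on_L2c (Se k)) Lq) (ip_cpart LB (Seh k) Lq).
apply: (ip_ae (L2_ccol LA (L2on_L2c (Se k))) (L2_ccol LB (Seh k)) Lq Lq).
  by apply: filterS h => y hy; rewrite /ccol (MP_basis k hy).
exact: aeW.
Qed.

Lemma REL_norm (E : set R) A B : REL E A B -> ipc muq A A = ipc muq B B.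
Proof.
move=> [LA LB _ _ h]; apply: EFin_inj; rewrite -(ipc_col LA) -(ipc_col LB).
apply: ae_eq_ge0_integral.
- by move=> y _; rewrite lee_fin; exact: (hge0 HL).
- by move=> y _; rewrite lee_fin; exact: (hge0 HL).
by apply: filterS h => y hy _; rewrite (MP_norm hy).
Qed.

Lemma RELD (E : set R) A A' B B' : REL E A B -> REL E A' B' -> REL E (A + A') (B + B').
Proof.
move=> [LA LB A0 B0 h] [LA' LB' A0' B0' h']; split.
- exact: (hSD HQ LA LA').
- exact: (hSD HQ LB LB').
- move=> x y n; have [a1 a2] := A0 x y n; have [b1 b2] := A0' x y n.
  have -> : (A + A').1 (x, y) = A.1 (x, y) + A'.1 (x, y) by [].
  have -> : (A + A').2 (x, y) = A.2 (x, y) + A'.2 (x, y) by [].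
  by rewrite a1 a2 b1 b2 addr0.
- move=> x y n; have [a1 a2] := B0 x y n; have [b1 b2] := B0' x y n.
  have -> : (B + B').1 (x, y) = B.1 (x, y) + B'.1 (x, y) by [].
  have -> : (B + B').2 (x, y) = B.2 (x, y) + B'.2 (x, y) by [].
  by rewrite a1 a2 b1 b2 addr0.
by apply: filterS2 h h' => y h h'; exact: (MPD h h').
Qed.

Lemma RELZ (E : set R) (s : R) A B : REL E A B -> REL E (s *: A) (s *: B).
Proof.
move=> [LA LB A0 B0 h]; split.
- exact: (hSZ HQ s LA).
- exact: (hSZ HQ s LB).
- by move=> x y n; have [a1 a2] := A0 x y n; split; [rewrite (_ : (s *: A).1 (x, y) = s * A.1 (x, y)) // a1 mulr0|rewrite (_ : (s *: A).2 (x, y) = s * A.2 (x, y)) // a2 mulr0].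
- by move=> x y n; have [a1 a2] := B0 x y n; split; [rewrite (_ : (s *: B).1 (x, y) = s * B.1 (x, y)) // a1 mulr0|rewrite (_ : (s *: B).2 (x, y) = s * B.2 (x, y)) // a2 mulr0].
by apply: filterS h => y h; exact: (MPZ s h).
Qed.

Definition Jq A : W := (- A.2, A.1).

Lemma REL_Jq (E : set R) A B : REL E A B -> REL E (Jq A) (Jq B).
Proof.
move=> [[A1 A2] [B1 B2] A0 B0 h]; have Hq := L2_hilbert muq; split.
- exact: (conj (hSN Hq A2) A1).
- exact: (conj (hSN Hq B2) B1).
- by move=> x y n; have [a1 a2] := A0 x y n; rewrite /Jq /= fctE a1 a2 oppr0.
- by move=> x y n; have [a1 a2] := B0 x y n; rewrite /Jq /= fctE a1 a2 oppr0.
by apply: filterS h => y h; exact: (MP_Jc h).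
Qed.

End parametrised.

(** * Energies of functions on a product set *)

Section rows.
Context {R : realType}.
Notation mu := (@lebesgue_measure R).
Notation muq := (@lebesgue_measure R \x @lebesgue_measure R)%E.
Variables (kappa : R) (kappa_gt0 : 0 < kappa).
Notation An := (angles kappa : set (measurableTypeR R)).
Notation Wa := (Wa kappa).
Notation Za := (Za kappa_gt0).
Notation energy := (energy kappa_gt0).
Notation V := ((R -> R) * (R -> R))%type.
Notation W := ((R * R -> R) * (R * R -> R))%type.
Implicit Types (A B : W) (s x y r t : R) (a k m : nat).

#[local] Instance ae_mu_rows : Filter (almost_everywhere mu) :=
  ae_filter_ringOfSetsType mu.

Let H := L2_hilbert mu.
Let mA : measurable An := measurable_angles kappa.

Definition strip (D : set R) : set (R * R) := D `*` angles kappa.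

Lemma measurable_strip (D : set R) : measurable (D : set (measurableTypeR R)) ->
  measurable (strip D : set (measurableTypeR R * measurableTypeR R)).
Proof. by move=> mD; exact: measurableX. Qed.

Definition pw (c : R -> R) s (p : R * R) : R := c p.1 * Wa s p.2.

Lemma measurable_pw (D : set R) (c : R -> R) s : measurable (D : set (measurableTypeR R)) ->
  measurable_fun (D : set (measurableTypeR R)) c ->
  measurable_fun (strip D : set (measurableTypeR R * measurableTypeR R)) (pw c s).
Proof.
move=> mD mc; apply: measurable_funM.
- apply: (measurable_comp mD _ mc) => /=; last exact: measurable_funTS.
  by move=> x [p [h _] <-].
- apply: (measurable_comp mA _ (@measurable_Wa R kappa s)) => /=; last exact: measurable_funTS.
  by move=> x [p [_ h] <-].
Qed.

Lemma cmeasurable_row (D : set R) (w : R * R -> R[i]) x : measurable (D : set (measurableTypeR R)) ->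
  cmeasurable (strip D : set (measurableTypeR R * measurableTypeR R)) w -> D x ->
  cmeasurable An (fun y => w (x, y)).
Proof.
move=> mD [m1 m2] Dx; have mS := measurable_strip mD.
have mp : measurable_fun An (fun y : measurableTypeR R => (x : measurableTypeR R, y)).
  by apply: measurable_funTS; exact: pair1_measurable.
by split; [apply: (measurable_comp mS _ m1 mp)|apply: (measurable_comp mS _ m2 mp)];
  move=> p [y yA <-].
Qed.

Lemma row_tld (D : set R) (c : R -> R) s (w : R * R -> R[i]) x : D x ->
  slice1 (tld (strip D) (pw c s) w) x = c x *: tld An (Wa s) (fun y => w (x, y)).
Proof.
move=> Dx; have e y : ((x, y) \in strip D) = (y \in An).
  by apply/idP/idP => /set_mem h; apply/mem_set; [case: h|split].
rewrite /slice1 /tld /cut; congr (_, _); apply/funext => y; rewrite /GRing.scale /= e /pw /=.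
- by case: ifP => _; [rewrite -mulrA|rewrite [RHS]mulr0].
- by case: ifP => _; [rewrite -mulrA|rewrite [RHS]mulr0].
Qed.

Lemma energy_ge0 s a (v : V) : (0 <= energy s a v)%E.
Proof. by apply: nneseries_ge0 => m _ _; rewrite lee_fin addr_ge0 ?sqr_ge0. Qed.

Lemma energyZ s a c (v : V) : L2c mu v -> energy s a (c *: v) = ((c ^+ 2)%:E * energy s a v)%E.
Proof.
move=> [v1 v2]; rewrite /energy -nneseriesZl; last by move=> m _; rewrite lee_fin addr_ge0 ?sqr_ge0.
apply: eq_eseriesr => m _; have [LZ _] := Za_L2on kappa_gt0 s a m.
by rewrite /= (hipZ H c v1 LZ) (hipZ H c v2 LZ) -EFinM; congr (_%:E); ring.
Qed.

(** The energy of order [a] in the second variable, integrated over the first. *)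
Definition tenergy s a A : \bar R :=
  (\sum_(0 <= m <oo) (ipc mu (cpart A (Za s a m)) (cpart A (Za s a m)))%:E)%E.

Lemma measurable_energy_row s a A : L2c muq A ->
  measurable_fun setT (fun x => energy s a (slice1 A x)).
Proof.
move=> [[m1 _] [m2 _]]; apply: ge0_emeasurable_sum => m.
  by move=> x _ _; rewrite lee_fin addr_ge0 ?sqr_ge0.
move=> _; have [[mZ _] _] := Za_L2on kappa_gt0 s a m.
apply/measurable_EFinP; apply: measurable_funD; apply: measurable_funX.
- exact: (measurable_part mu m1 mZ).
- exact: (measurable_part mu m2 mZ).
Qed.

Lemma tenergy_rows s a A : L2c muq A ->
  (\int[mu]_x energy s a (slice1 A x) = tenergy s a A)%E.
Proof.
move=> [L1 L2']; have [m1 _] := L1; have [m2 _] := L2'.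
have mZ m : measurable_fun setT (Za s a m) by have [[]] := Za_L2on kappa_gt0 s a m.
have mp1 m := measurable_part mu m1 (mZ m).
have mp2 m := measurable_part mu m2 (mZ m).
rewrite integral_nneseries //; last 2 first.
- by move=> m; apply/measurable_EFinP; apply: measurable_funD; apply: measurable_funX; [exact: mp1|exact: mp2].
- by move=> m x _; rewrite lee_fin addr_ge0 ?sqr_ge0.
apply: eq_eseriesr => m _; have [LZ _] := Za_L2on kappa_gt0 s a m.
rewrite /pairip EFinD -(L2_ipE (L2_part L1 LZ)) -(L2_ipE (L2_part L2' LZ)) -ge0_integralD //.
- by move=> x _; rewrite lee_fin sqr_ge0.
- by apply/measurable_EFinP/measurable_funX; exact: mp1.
- by move=> x _; rewrite lee_fin sqr_ge0.
- by apply/measurable_EFinP/measurable_funX; exact: mp2.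
Qed.

Lemma tenergy_ge0 s a A : (0 <= tenergy s a A)%E.
Proof. by apply: nneseries_ge0 => m _ _; rewrite lee_fin; exact: (hge0 (pair_hilbert H)). Qed.

(** Mellin pairs have the same energies, since the derivatives and the Mellin
    transform act on different variables. *)
Lemma tenergy_REL beta (E : set R) s a A B : REL beta E A B -> tenergy s a A = tenergy s a B.
Proof.
move=> h; apply: eq_eseriesr => m _; have [LZ _] := Za_L2on kappa_gt0 s a m.
by rewrite (MP_norm (REL_cpart h LZ)).
Qed.

Lemma ae_row A : L2c muq A -> {ae mu, forall x, L2c mu (slice1 A x)}.
Proof. by move=> [A1 A2]; apply: filterS2 (L2_slice A1) (L2_slice A2) => y h1 h2. Qed.

Lemma row_on (c : R -> R) s (D : set R) (w : R * R -> R[i]) x :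
  (forall x, D x -> 0 < c x) -> D x -> L2c mu (slice1 (tld (strip D) (pw c s) w) x) ->
  pairS (L2on mu (angles kappa)) (tld An (Wa s) (fun y => w (x, y))).
Proof.
move=> c0 Dx; rewrite (row_tld _ _ _ Dx) => h.
have := hSZ (pair_hilbert H) (c x)^-1 h.
rewrite scalerA mulVf ?scale1r ?(gt_eqF (c0 _ Dx)) // => -[h1 h2].
have out (f : R -> R) y : ~ An y -> cut An f y = 0 by move=> nA; rewrite /cut memNset.
by split; split => //; exact: out.
Qed.

Lemma Hnorm_row k (Theta : R) (c : R -> R) (D : set R) (w : R * R -> R[i]) :
  measurable (D : set (measurableTypeR R)) -> (forall x, D x -> 0 < c x) ->
  cmeasurable (strip D : set (measurableTypeR R * measurableTypeR R)) w ->
  L2c muq (tld (strip D) (pw c (Theta - 1)) w) ->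
  {ae mu, forall x, D x ->
    ((c x ^+ 2)%:E * Hnorm kappa k Theta (fun y => w (x, y)) ^+ 2 =
     \sum_(a < k.+1) energy (Theta - 1) a (slice1 (tld (strip D) (pw c (Theta - 1)) w) x))%E}.
Proof.
move=> mD c0 mw LA; apply: filterS (ae_row LA) => x Lx Dx.
have Lv := row_on c0 Dx Lx.
rewrite (Hnorm_energy kappa_gt0 k (cmeasurable_row mD mw Dx) Lv).
rewrite ge0_sume_distrr; last by move=> a _; exact: energy_ge0.
apply: eq_bigr => a _; rewrite (row_tld _ _ _ Dx) energyZ //.
exact: L2on_L2c Lv.
Qed.

Lemma energy_row_out s a (D : set R) (c : R -> R) (w : R * R -> R[i]) s' x : ~ D x ->
  energy s' a (slice1 (tld (strip D) (pw c s) w) x) = 0%E.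
Proof.
move=> nD; have z0 f : f = (fun=> 0 : R) -> forall m, ip mu f (Za s' a m) = 0.
  move=> -> m; rewrite /ip; under eq_Rintegral do rewrite mul0r.
  by rewrite Rintegral_cst // mul0r.
have z1 : forall y, ((x, y) \in strip D) = false.
  by move=> y; apply/negbTE; rewrite notin_setE => -[].
rewrite /energy eseries0 // => m _ _; rewrite !z0 ?expr0n ?addr0 //;
  by apply/funext => y; rewrite /slice1 /tld /cut /= z1.
Qed.

End rows.

(** * The transform side *)

Section complex_measurable.
Context d (T : measurableType d) (R : realType).
Implicit Types (D : set T) (f g : T -> R[i]).

Lemma cmeasurableM D f g : cmeasurable D f -> cmeasurable D g -> cmeasurable D (fun x => f x * g x).
Proof.
move=> [f1 f2] [g1 g2]; split.
- apply: eq_measurable_fun (measurable_funB (measurable_funM f1 g1) (measurable_funM f2 g2)) => x _.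
  by rewrite /=; case: (f x) => a b; case: (g x).
- apply: eq_measurable_fun (measurable_funD (measurable_funM f1 g2) (measurable_funM f2 g1)) => x _.
  by rewrite /=; case: (f x) => a b; case: (g x).
Qed.

Lemma cmeasurableD D f g : cmeasurable D f -> cmeasurable D g -> cmeasurable D (fun x => f x + g x).
Proof.
move=> [f1 f2] [g1 g2]; split.
- apply: eq_measurable_fun (measurable_funD f1 g1) => x _.
  by rewrite /=; case: (f x) => a b; case: (g x).
- apply: eq_measurable_fun (measurable_funD f2 g2) => x _.
  by rewrite /=; case: (f x) => a b; case: (g x).
Qed.

Lemma cmeasurable_cst D (z : R[i]) : cmeasurable D (fun=> z).
Proof. by split; exact: measurable_cst. Qed.

Lemma cmeasurableZ D (z : R[i]) f : cmeasurable D f -> cmeasurable D (fun x => z * f x).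
Proof. by apply: cmeasurableM; exact: cmeasurable_cst. Qed.

Lemma cmeasurableX D f n : cmeasurable D f -> cmeasurable D (fun x => f x ^+ n).
Proof.
move=> mf; elim: n => [|n IH]; first exact: cmeasurable_cst.
have -> : (fun x => f x ^+ n.+1) = (fun x => f x * f x ^+ n) by apply/funext => x; rewrite exprS.
exact: cmeasurableM.
Qed.

End complex_measurable.

Definition cmulp (R : realType) (U : Type) (z : R[i]) (A : (U -> R) * (U -> R)) : (U -> R) * (U -> R) :=
  (complex.Re z *: A.1 - complex.Im z *: A.2, complex.Im z *: A.1 + complex.Re z *: A.2).

Lemma cmulp_L2c d (T : measurableType d) (R : realType) (m : {measure set T -> \bar R}) z A :
  L2c m A -> L2c m (cmulp z A).
Proof.
move=> [A1 A2]; have H := L2_hilbert m; split.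
- exact: (hSB H (hSZ H _ A1) (hSZ H _ A2)).
- exact: (hSD H (hSZ H _ A1) (hSZ H _ A2)).
Qed.

Lemma cmulp_on d (T : measurableType d) (R : realType) (m : {measure set T -> \bar R}) (D : set T) z A :
  measurable D -> pairS (L2on m D) A -> pairS (L2on m D) (cmulp z A).
Proof.
move=> mD [A1 A2]; have H := L2on_hilbert m mD; split.
- exact: (hSB H (hSZ H _ A1) (hSZ H _ A2)).
- exact: (hSD H (hSZ H _ A1) (hSZ H _ A2)).
Qed.

Section transform_side.
Context {R : realType}.
Notation mu := (@lebesgue_measure R).
Notation muq := (@lebesgue_measure R \x @lebesgue_measure R)%E.
Variables (kappa : R) (kappa_gt0 : 0 < kappa).
Notation An := (angles kappa : set (measurableTypeR R)).
Notation Wa := (Wa kappa).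
Notation Za := (Za kappa_gt0).
Notation Ea := (Ea kappa_gt0).
Notation energy := (energy kappa_gt0).
Notation tenergy := (tenergy kappa_gt0).
Notation V := ((R -> R) * (R -> R))%type.
Notation W := ((R * R -> R) * (R * R -> R))%type.
Implicit Types (A B : W) (v w : R -> R[i]) (s x y r t : R) (a k m j : nat) (z : R[i]).

#[local] Instance ae_mu_transform : Filter (almost_everywhere mu) :=
  ae_filter_ringOfSetsType mu.

Let H := L2_hilbert mu.
Let mA : measurable An := measurable_angles kappa.
Let mT : measurable ([set: R] : set (measurableTypeR R)) := measurableT.

Lemma normcX (z : R[i]) n : Normc.normc (z ^+ n) = Normc.normc z ^+ n.
Proof.
elim: n => [|n IH]; first by rewrite !expr0 /= expr0n /= expr1n addr0 sqrtr1.
by rewrite !exprS Normc.normcM IH.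
Qed.

Lemma ip_cmulp z (v : V) f : L2c mu v -> L2 mu f ->
  ip mu (cmulp z v).1 f = complex.Re z * ip mu v.1 f - complex.Im z * ip mu v.2 f /\
  ip mu (cmulp z v).2 f = complex.Im z * ip mu v.1 f + complex.Re z * ip mu v.2 f.
Proof.
move=> [v1 v2] Lf; split.
- by rewrite (hipB H (hSZ H _ v1) (hSZ H _ v2) Lf) (hipZ H _ v1 Lf) (hipZ H _ v2 Lf).
- by rewrite (hipD H (hSZ H _ v1) (hSZ H _ v2) Lf) (hipZ H _ v1 Lf) (hipZ H _ v2 Lf).
Qed.

Lemma energy_cmulp s a z (v : V) : L2c mu v ->
  energy s a (cmulp z v) = ((Normc.normc z ^+ 2)%:E * energy s a v)%E.
Proof.
move=> Lv; rewrite /energy -nneseriesZl; last by move=> m _; rewrite lee_fin addr_ge0 ?sqr_ge0.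
apply: eq_eseriesr => m _; have [LZ _] := Za_L2on kappa_gt0 s a m.
have [-> ->] := ip_cmulp z Lv LZ; rewrite -EFinM normc_sq; congr (_%:E); ring.
Qed.

Lemma energyD_le s a (v w : V) : L2c mu v -> L2c mu w ->
  (energy s a (v + w)%R <= 2%:E * energy s a v + 2%:E * energy s a w)%E.
Proof.
move=> [v1 v2] [w1 w2]; rewrite /energy.
have p0 (f g : V) m : (0 <= (ip mu f.1 (Za s a m) ^+ 2 + ip mu f.2 (Za s a m) ^+ 2)%:E :> \bar R)%E.
  by rewrite lee_fin addr_ge0 ?sqr_ge0.
rewrite -!nneseriesZl; try by move=> m _; exact: p0.
rewrite -nneseriesD; try by move=> m _ _; rewrite mule_ge0 ?p0.
apply: lee_nneseries => [m *|m *]; first exact: p0.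
have [LZ _] := Za_L2on kappa_gt0 s a m.
have -> : (v + w).1 = v.1 + w.1 by []. have -> : (v + w).2 = v.2 + w.2 by [].
rewrite (hipD H v1 w1 LZ) (hipD H v2 w2 LZ) -!EFinM -EFinD lee_fin.
have := sqr_ge0 (ip mu v.1 (Za s a m) - ip mu w.1 (Za s a m)).
have := sqr_ge0 (ip mu v.2 (Za s a m) - ip mu w.2 (Za s a m)).
move: (ip mu v.1 _) (ip mu v.2 _) (ip mu w.1 _) (ip mu w.2 _) => p q r t; nra.
Qed.

Lemma tenergy_le (A B : W) s a (c : R) : 0 <= c -> L2c muq A -> L2c muq B ->
  (forall x, L2c mu (slice1 A x) -> (energy s a (slice1 B x) <= c%:E * energy s a (slice1 A x))%E) ->
  (tenergy s a B <= c%:E * tenergy s a A)%E.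
Proof.
move=> c0 LA LB h; rewrite -(tenergy_rows kappa_gt0 s a LA) -(tenergy_rows kappa_gt0 s a LB).
rewrite -ge0_integralZl //; last 2 first.
- exact: measurable_energy_row.
- by move=> x _; exact: energy_ge0.
apply: ae_le_integral => [x _|x _|]; [exact: energy_ge0|by rewrite mule_ge0 ?energy_ge0|].
by apply: filterS (ae_row LA) => x Lx _; exact: h.
Qed.

Lemma tenergy_cmulp_fin s a z A : L2c muq A -> (tenergy s a A < +oo)%E ->
  (tenergy s a (cmulp z A) < +oo)%E.
Proof.
move=> LA fin; apply: (@le_lt_trans _ _ ((Normc.normc z ^+ 2)%:E * tenergy s a A)%E); last first.
  by rewrite lte_mul_pinfty ?lee_fin ?sqr_ge0.
apply: tenergy_le => //; [exact: sqr_ge0|exact: cmulp_L2c|].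
by move=> x Lx; rewrite -(energy_cmulp s a z Lx).
Qed.

Lemma integral_le_twice (f g h : R -> \bar R) :
  measurable_fun (setT : set (measurableTypeR R)) f -> measurable_fun (setT : set (measurableTypeR R)) g ->
  (forall x, 0 <= f x)%E -> (forall x, 0 <= g x)%E -> (forall x, 0 <= h x)%E ->
  {ae mu, forall x, (h x <= 2%:E * f x + 2%:E * g x)%E} ->
  (\int[mu]_x h x <= 2%:E * \int[mu]_x f x + 2%:E * \int[mu]_x g x)%E.
Proof.
move=> mf mg f0 g0 h0 hfg; rewrite -ge0_integralZl // -ge0_integralZl // -ge0_integralD //; last 4 first.
- by move=> x _; rewrite mule_ge0.
- exact: measurable_funeM.
- by move=> x _; rewrite mule_ge0.
- exact: measurable_funeM.
apply: ae_le_integral => [x _|x _|]; [exact: h0|by rewrite adde_ge0 ?mule_ge0|].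
by apply: filterS hfg => x hx _.
Qed.

(** Finiteness is checked row by row, where coefficients are additive. *)
Lemma tenergyD_fin s a A B : L2c muq A -> L2c muq B -> (tenergy s a A < +oo)%E ->
  (tenergy s a B < +oo)%E -> (tenergy s a (A + B)%R < +oo)%E.
Proof.
move=> LA LB fA fB; have LAB := hSD (pair_hilbert (L2_hilbert muq)) LA LB.
rewrite -(tenergy_rows kappa_gt0 s a LA) in fA; rewrite -(tenergy_rows kappa_gt0 s a LB) in fB.
rewrite -(tenergy_rows kappa_gt0 s a LAB).
have e0 := @energy_ge0 R kappa kappa_gt0 s a.
have h : {ae mu, forall x, (energy s a (slice1 (A + B)%R x) <=
    2%:E * energy s a (slice1 A x) + 2%:E * energy s a (slice1 B x))%E}.
  by apply: filterS2 (ae_row LA) (ae_row LB) => x Lx Lx'; exact: (energyD_le s a Lx Lx').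
apply: le_lt_trans (integral_le_twice (measurable_energy_row kappa_gt0 s a LA)
  (measurable_energy_row kappa_gt0 s a LB) (fun x => e0 _) (fun x => e0 _) (fun x => e0 _) h) _.
have tw (p : \bar R) : (p < +oo -> 2%:E * p < +oo)%E by move=> p0; rewrite lte_mul_pinfty.
exact: (lte_add_pinfty (tw _ fA) (tw _ fB)).
Qed.

(** The inner integrals bound the squares of both components, and Tonelli's
    theorem applies. *)
Lemma L2c_tld (D : set R) (c : R -> R) s (w : R * R -> R[i]) :
  measurable (D : set (measurableTypeR R)) -> measurable_fun (D : set (measurableTypeR R)) c ->
  cmeasurable (strip kappa D : set (measurableTypeR R * measurableTypeR R)) w ->
  (\int[mu]_(x in D) ((c x ^+ 2)%:E *
     \int[mu]_(y in An) (Normc.normc (w (x, y)) ^+ 2 * Wa s y ^+ 2)%:E) < +oo)%E ->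
  L2c muq (tld (strip kappa D) (pw kappa c s) w).
Proof.
move=> mD mc mw fin; have mS := measurable_strip kappa mD.
have [m1 m2] := tld_measurable mS (measurable_pw s mD mc) mw.
have key (F : R * R -> R) : measurable_fun setT F ->
    (forall x y, ~ strip kappa D (x, y) -> F (x, y) = 0) ->
    (forall x y, D x -> An y -> F (x, y) ^+ 2 <= c x ^+ 2 * (Normc.normc (w (x, y)) ^+ 2 * Wa s y ^+ 2)) ->
    L2 muq F.
  move=> mF F0 Fle; split => //; rewrite L2_tonelli //; apply: le_lt_trans fin.
  rewrite [leRHS]integral_mkcond; apply: le_ge0_integral => x _.
    by apply: integral_ge0 => y _; rewrite lee_fin sqr_ge0.
  rewrite patchE; case: ifPn => [/set_mem Dx|]; last first.
    rewrite notin_setE => nD; rewrite integral0_eq // => y _.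
    by rewrite F0 ?expr0n // => -[].
  rewrite -ge0_integralZl //; last 3 first.
  - have [w1 w2] := cmeasurable_row mD mw Dx.
    apply/measurable_EFinP; apply: measurable_funM; last first.
      by apply: measurable_funX; exact: (@measurable_Wa R kappa s).
    apply: eq_measurable_fun (measurable_funD (measurable_funX 2 w1) (measurable_funX 2 w2)) => y _.
    by rewrite normc_sq.
  - by move=> y _; rewrite lee_fin mulr_ge0 ?sqr_ge0.
  - by rewrite lee_fin sqr_ge0.
  rewrite [leRHS]integral_mkcond; apply: le_ge0_integral => y _; first by rewrite lee_fin sqr_ge0.
  rewrite patchE; case: ifPn => [/set_mem yA|]; first by rewrite -EFinM lee_fin; exact: Fle.
  by rewrite notin_setE => nA; rewrite F0 ?expr0n // => -[].
have out f x y : ~ strip kappa D (x, y) -> cut (strip kappa D) f (x, y) = 0 :> R.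
  by move=> n; rewrite /cut memNset.
have inn f x y : D x -> An y -> cut (strip kappa D) f (x, y) = f (x, y) :> R.
  by move=> Dx Ay; rewrite /cut mem_set.
by split; apply: key => // [x y|x y Dx Ay]; [exact: out|rewrite /= inn // /pw /= normc_sq; nra|
  exact: out|rewrite /= inn // /pw /= normc_sq; nra].
Qed.

End transform_side.

Section Y_spaces.
Context {R : realType}.
Notation mu := (@lebesgue_measure R).
Notation muq := (@lebesgue_measure R \x @lebesgue_measure R)%E.
Variables (kappa : R) (kappa_gt0 : 0 < kappa) (Theta theta : R).
Notation An := (angles kappa : set (measurableTypeR R)).
Notation ST := (strip kappa (setT : set R) : set (measurableTypeR R * measurableTypeR R)).
Notation Wa := (Wa kappa).
Notation Za := (Za kappa_gt0).
Notation Ea := (Ea kappa_gt0).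
Notation energy := (energy kappa_gt0).
Notation tenergy := (tenergy kappa_gt0).
Notation V := ((R -> R) * (R -> R))%type.
Notation W := ((R * R -> R) * (R * R -> R))%type.
Implicit Types (A B : W) (v w : R -> R[i]) (s x y r t : R) (a k m j : nat) (z : R[i]) (U : R[i] * R -> R[i]).

#[local] Instance ae_mu_Y : Filter (almost_everywhere mu) :=
  ae_filter_ringOfSetsType mu.

Let H := L2_hilbert mu.
Let mA : measurable An := measurable_angles kappa.
Let mT : measurable (setT : set (measurableTypeR R)) := measurableT.

Lemma Hnorm0 (Th : R) v : L1loc1 (angles kappa) v ->
  (Hnorm kappa 0 Th v ^+ 2 = \int[mu]_(x in An) (Normc.normc (v x) ^+ 2 * Wa (Th - 1) x ^+ 2)%:E)%E.
Proof.
move=> lv; have hv : is_wderiv kappa 0 v v by split => // eta _; rewrite expr0 mul1r.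
rewrite /Hnorm; case: asboolP => [h|]; last first.
  by move=> nh; exfalso; apply: nh => a; rewrite leqn0 => /eqP ->; exists v.
rewrite poweR_half_sq; last first.
  by apply: sume_ge0 => a _; apply: integral_ge0 => x _; rewrite lee_fin mulr_ge0 ?sqr_ge0 ?powR_ge0.
have hwd : is_wderiv kappa 0 v (wderiv kappa 0 v).
  by apply: (xgetPex (P := [set w | is_wderiv kappa 0 v w]) (fun=> 0)); exists v.
rewrite big_ord_recl big_ord0 adde0 /=; apply: ae_eq_ge0_integral.
- by move=> x _; rewrite lee_fin mulr_ge0 ?sqr_ge0 ?powR_ge0.
- by move=> x _; rewrite lee_fin mulr_ge0 ?sqr_ge0.
- apply: filterS (wderiv_unique kappa_gt0 hv hwd) => x hx xA.
  by rewrite weight_sq // addr0 (hx xA).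
Qed.

Definition kk : R := (Num.sqrt (2 * pi))^-1.

Lemma kk_gt0 : 0 < kk. Proof. by rewrite invr_gt0 sqrt2pi_gt0. Qed.

Lemma kk_sq : kk ^+ 2 = (2 * pi)^-1. Proof. by rewrite exprVn sqrt2pi_sq. Qed.

Lemma kk_sq_le1 : kk ^+ 2 <= 1.
Proof.
have := @pi_ge2 R => p2; rewrite kk_sq invf_le1; last by rewrite mulr_gt0 // pi_gt0.
by lra.
Qed.

Definition lam t : R[i] := vline (- (theta / 2)) t.
Definition onl U (p : R * R) : R[i] := U (vline (- (theta / 2)) p.1, p.2).
Definition Uj j U (p : R * R) : R[i] := lam p.1 ^+ j * onl U p.
Definition sj j : R := Theta - 1 + j.*2%:R - 1.
Definition tlY j U : W := tld ST (pw kappa (fun=> kk) (sj j)) (Uj j U).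

Lemma mST : measurable ST. Proof. exact: measurable_strip. Qed.

Lemma cmeasurable_lam : cmeasurable ST (fun p => lam p.1).
Proof. by split; [exact: measurable_cst|apply: measurable_funTS; exact: measurable_fst]. Qed.

Lemma cmeasurable_lamX (w : R * R -> R[i]) j : cmeasurable ST w -> cmeasurable ST (fun p => lam p.1 ^+ j * w p).
Proof. by move=> mU; apply: cmeasurableM => //; apply: cmeasurableX; exact: cmeasurable_lam. Qed.

Lemma ae_lam0 : {ae mu, forall t, lam t != 0}.
Proof.
exists [set 0]; split; [exact: measurable_set1|exact: lebesgue_measure_set1|].
by move=> t /= /negP; rewrite negbK => /eqP[_ ->].
Qed.

Section line_rows.
Variables (j : nat) (U : R[i] * R -> R[i]).
Hypotheses (mU : cmeasurable ST (onl U)) (LU : L2c muq (tlY j U)).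

Lemma row_Uj t : L2c mu (slice1 (tlY j U) t) -> lam t != 0 ->
  pairS (L2on mu (angles kappa)) (tld An (Wa (sj j)) (fun y => onl U (t, y))).
Proof.
move=> Lt t0; have h := row_on (fun x _ => kk_gt0) (I : setT t) Lt.
have -> : (fun y => onl U (t, y)) = (fun y => (lam t ^+ j)^-1 * Uj j U (t, y)).
  by apply/funext => y; rewrite /Uj /= mulrA mulVf ?mul1r // expf_neq0.
rewrite tldZ; exact: (cmulp_on _ mA h).
Qed.

Lemma energy_Uj s' a t : L2c mu (slice1 (tlY j U) t) -> lam t != 0 ->
  energy s' a (slice1 (tlY j U) t) =
  ((kk ^+ 2)%:E * ((Normc.normc (lam t) ^+ j.*2)%:E *
    energy s' a (tld An (Wa (sj j)) (fun y => onl U (t, y)))))%E.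
Proof.
move=> Lt t0; have h := row_on (fun x _ => kk_gt0) (I : setT t) Lt.
rewrite /tlY (row_tld kappa _ _ _ (I : setT t)) (energyZ kappa_gt0 s' a _ (L2on_L2c h)).
have -> : (fun y => Uj j U (t, y)) = (fun y => lam t ^+ j * onl U (t, y)) by [].
rewrite tldZ (energy_cmulp kappa_gt0 s' a _ (L2on_L2c (row_Uj Lt t0))) normcX.
by rewrite -exprM muln2.
Qed.

Lemma energy_Uj_wderiv a t w : L2c mu (slice1 (tlY j U) t) -> lam t != 0 ->
  is_wderiv kappa a (fun y => onl U (t, y)) w ->
  (\int[mu]_(y in An) (Normc.normc (lam t ^+ j * w y)%R ^+ 2 * Wa (sj j + a.*2%:R) y ^+ 2)%:E =
   (2 * pi)%:E * energy (sj j) a (slice1 (tlY j U) t))%E.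
Proof.
move=> Lt t0 hw; have [_ [mw _] _] := hw.
rewrite (energy_Uj _ _ Lt t0) muleA -EFinM kk_sq divff ?gt_eqF ?mulr_gt0 ?pi_gt0 // mul1e.
have mv : cmeasurable An (fun y => onl U (t, y)) by have [_ _ _] := hw; have [[]] := hw.
rewrite -(energy_wderiv kappa_gt0 mv hw (row_Uj Lt t0)) -ge0_integralZl //.
- apply: eq_integral => y _; rewrite -EFinM; congr EFin.
  by rewrite Normc.normcM normcX exprMn -exprM muln2 -!mulrA.
- have [w1 w2] := mw; apply/measurable_EFinP; apply: measurable_funM; last first.
    by apply: measurable_funX; exact: (@measurable_Wa R kappa (sj j + a.*2%:R)).
  apply: eq_measurable_fun (measurable_funD (measurable_funX 2 w1) (measurable_funX 2 w2)) => y _.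
  by rewrite normc_sq.
- by move=> y _; rewrite lee_fin mulr_ge0 ?sqr_ge0.
- by rewrite lee_fin exprn_ge0 //; case: (lam t) => p q; exact: sqrtr_ge0.
Qed.

(** For [lam t != 0] the factor [lam t ^ j] can be moved in and out of the norm;
    a single value of [t] is excluded. *)
Lemma Hnorm_line k t : L2c mu (slice1 (tlY j U) t) -> lam t != 0 ->
  ((Normc.normc (lam t) ^+ j.*2)%:E *
    Hnorm kappa k (Theta - 1 + j.*2%:R) (fun y => onl U (t, y)) ^+ 2 =
   (2 * pi)%:E * \sum_(a < k.+1) energy (sj j) a (slice1 (tlY j U) t))%E.
Proof.
move=> Lt t0; have mv := cmeasurable_row mT mU (I : setT t).
rewrite (Hnorm_energy kappa_gt0 k mv (row_Uj Lt t0)) !ge0_sume_distrr; last 2 first.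
- by move=> a _; exact: energy_ge0.
- by move=> a _; exact: energy_ge0.
apply: eq_bigr => a _; rewrite (energy_Uj _ _ Lt t0) [RHS]muleA -EFinM kk_sq divff ?mul1e //.
by rewrite gt_eqF ?mulr_gt0 ?pi_gt0.
Qed.

End line_rows.

(** Membership in the image space, expressed through square integrability and
    energies. In this form it is stable under linear combinations and can be
    compared with the other side of the isomorphism. *)
Definition Ygood (gamma : nat) U := cmeasurable ST (onl U) /\
  forall j, (j <= gamma)%N -> L2c muq (tlY j U) /\
    forall a, (a <= gamma - j)%N -> (tenergy (sj j) a (tlY j U) < +oo)%E.

Lemma Ynorm_energy gamma U : cmeasurable ST (onl U) ->
  (forall j, (j <= gamma)%N -> L2c muq (tlY j U)) ->
  Ynorm kappa gamma Theta theta U =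
  ((\sum_(j < gamma.+1) \sum_(a < (gamma - j).+1) tenergy (sj j) a (tlY j U)) `^ 2^-1)%E.
Proof.
move=> mU LU; rewrite /Ynorm; congr (_ `^ _)%E.
have p0 : 0 < 2 * pi :> R by rewrite mulr_gt0 // pi_gt0.
rewrite ge0_sume_distrr; last first.
  move=> j _; apply: integral_ge0 => t _; rewrite mule_ge0 ?sqre_ge0 // lee_fin exprn_ge0 //.
  exact: sqrtr_ge0.
apply: eq_bigr => j _; have Lj := LU j (ltn_ord j).
have mE a := measurable_energy_row kappa_gt0 (sj j) a Lj.
pose S t := (\sum_(a < (gamma - j).+1) energy (sj j) a (slice1 (tlY j U) t))%E.
have mS : measurable_fun (setT : set (measurableTypeR R)) S by apply: emeasurable_sum => a; exact: mE.
have S0 t : (0 <= S t)%E by apply: sume_ge0 => a _; exact: energy_ge0.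
rewrite (@ae_eq_ge0_integral _ _ _ mu setT _ (fun t => (2 * pi)%:E * S t)%E).
- rewrite ge0_integralZl // ?lee_fin ?ltW // muleA -EFinM mulVf ?gt_eqF // mul1e.
  rewrite (ge0_integral_sum mu mT (fun a : 'I_(gamma - j).+1 => mE a)); last by move=> a t _; exact: energy_ge0.
  by apply: eq_bigr => a _; exact: tenergy_rows.
- by move=> t _; apply: mule_ge0; [rewrite lee_fin exprn_ge0 //; exact: sqrtr_ge0|exact: sqre_ge0].
- by move=> t _; rewrite mule_ge0 // lee_fin ltW.
- apply: filterS2 (ae_row Lj) ae_lam0 => t Lt t0 _; exact: (Hnorm_line mU (gamma - j) Lt t0).
Qed.

Lemma Ygood_lin gamma z U U' : Ygood gamma U -> Ygood gamma U' ->
  Ygood gamma (fun p => z * U p + U' p).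
Proof.
have HQ := pair_hilbert (L2_hilbert muq).
move=> [mU hU] [mU' hU']; split.
  by apply: cmeasurableD mU'; apply: cmeasurableZ.
move=> j hj; have [L h] := hU j hj; have [L' h'] := hU' j hj.
have -> : tlY j (fun p => z * U p + U' p) = cmulp z (tlY j U) + tlY j U'.
  rewrite /tlY -[cmulp z _]tldZ -tldD; congr (tld _ _ _); apply/funext => p.
  by rewrite /Uj /onl; ring.
have Lz := cmulp_L2c z L; split; first exact: (hSD HQ Lz L').
by move=> a ha; apply: tenergyD_fin => //; [exact: tenergy_cmulp_fin (h a ha)|exact: h'].
Qed.

Lemma Y0norm_lty (Th : R) U : (Y0norm kappa Th theta U < +oo)%E <->
  (\int[mu]_t Hnorm kappa 0 (Th - 1) (fun phi => onl U (t, phi)) ^+ 2 < +oo)%E.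
Proof.
have p0 : 0 < (2 * pi)^-1 :> R by rewrite invr_gt0 mulr_gt0 // pi_gt0.
rewrite /Y0norm -/mu; set I := (\int[_]_t _)%E; split => [|fin]; last first.
  by apply: poweR_lty; rewrite lte_mul_pinfty // lee_fin ltW.
move/lty_poweRy => /(_ _); rewrite invr_eq0 pnatr_eq0 => /(_ isT) h.
rewrite ltey; apply/negP => /eqP Ioo; move: h.
by rewrite Ioo gt0_muley // lte_fin.
Qed.

Lemma sjE j a : Theta + j.*2%:R + a.*2%:R - 1 - 1 = sj j + a.*2%:R.
Proof. by rewrite /sj; ring. Qed.

Lemma ae_lines U : cmeasurable ST (onl U) -> forall j, L2c muq (tlY j U) ->
  {ae mu, forall t, L2c mu (slice1 (tlY j U) t) /\ lam t != 0}.
Proof. by move=> mU j Lj; apply: filterS2 (ae_row Lj) ae_lam0 => t h1 h2. Qed.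

Lemma Yspace_good gamma U : Yspace kappa gamma Theta theta U -> Ygood gamma U.
Proof.
move=> [mU hU]; split => // j hj.
have Lj : L2c muq (tlY j U).
  have [w hw [_ /Y0norm_lty fin]] := hU j 0%N hj (leq0n _).
  apply: L2c_tld => //; first exact: cmeasurable_lamX.
  apply: le_lt_trans fin; apply: ae_le_integral.
  - by move=> t _; rewrite mule_ge0 ?lee_fin ?sqr_ge0 //; apply: integral_ge0 => y _; rewrite lee_fin mulr_ge0 ?sqr_ge0.
  - by move=> t _; exact: sqre_ge0.
  apply: filterS hw => t ht _; have [lv _ _] := ht.
  have hv : is_wderiv kappa 0 (fun y => onl U (t, y)) (fun y => onl U (t, y)).
    by split => // eta _; rewrite expr0 mul1r.
  have uw := wderiv_unique kappa_gt0 hv ht.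
  apply: le_trans (Hnorm_ge kappa_gt0 _ _ _).
  have -> : (\int[mu]_(y in An) (Normc.normc (Uj j U (t, y)) ^+ 2 * Wa (sj j) y ^+ 2)%:E =
    \int[mu]_(x in An) (Normc.normc (lam t ^+ j * w (vline (- (theta / 2)) t, x))%R ^+ 2 *
      Wa (Theta + j.*2%:R + 0.*2%:R - 1 - 1) x ^+ 2)%:E)%E.
    rewrite sjE addr0; apply: ae_eq_ge0_integral.
    - by move=> y _; rewrite lee_fin mulr_ge0 ?sqr_ge0.
    - by move=> y _; rewrite lee_fin mulr_ge0 ?sqr_ge0.
    - by apply: filterS uw => y hy yA; rewrite /Uj /= (hy yA).
  set I := (\int[_]_(_ in _) _)%E; rewrite -[leRHS]mul1e; apply: lee_wpmul2r.
    by apply: integral_ge0 => y _; rewrite lee_fin mulr_ge0 ?sqr_ge0.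
  by rewrite lee_fin kk_sq_le1.
split => // a ha; have [w hw [_ /Y0norm_lty fin]] := hU j a hj ha.
rewrite -(tenergy_rows kappa_gt0 (sj j) a Lj); apply: le_lt_trans fin; apply: ae_le_integral.
- by move=> t _; exact: energy_ge0.
- by move=> t _; exact: sqre_ge0.
apply: filterS2 (ae_lines mU Lj) hw => t [Lt t0] ht _.
apply: le_trans (Hnorm_ge kappa_gt0 _ _ _).
rewrite sjE (energy_Uj_wderiv Lt t0 ht) -[leLHS]mul1e; apply: lee_wpmul2r; first exact: energy_ge0.
by rewrite lee_fin; have := @pi_ge2 R; lra.
Qed.

(** Riesz--Fischer with parameters provides derivatives of all rows at once, and
    jointly measurable. *)
Lemma wderiv_family s0 a (w : R * R -> R[i]) : cmeasurable ST w ->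
  L2c muq (tld ST (pw kappa (fun=> kk) s0) w) ->
  (tenergy s0 a (tld ST (pw kappa (fun=> kk) s0) w) < +oo)%E ->
  exists2 X : R * R -> R[i], cmeasurable ST X &
    {ae mu, forall t, is_wderiv kappa a (fun y => w (t, y)) (fun y => X (t, y)) /\
      pairS (L2on mu (angles kappa)) (tld An (Wa (s0 + a.*2%:R)) (fun y => X (t, y)))}.
Proof.
set B := tld _ _ _ => mw LB fin; have [B1 B2] := LB.
have HL := pair_hilbert H; have z0 := hS0 H.
have ip0l f : L2 mu f -> ip mu 0 f = 0 := fun Lf => hip0 H Lf.
have ip0 f : L2 mu f -> ip mu f 0 = 0 by move=> Lf; rewrite (hipC H) ip0l.
have [Se oe ne] := Ea_on kappa_gt0 s0 a.
pose e m : V := (Ea s0 a m, 0).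
have Lz m : L2 mu (Za s0 a m) by case: (Za_L2on kappa_gt0 s0 a m).
have one : orthonormal (L2c mu) (ipc mu) e.
  split.
  - by move=> m; split => //=; have [] := Se m.
  - by move=> m n mn; rewrite /pairip /= oe // ip0 // addr0.
  - by move=> m; have [h|h] := ne m; [left; rewrite /pairip /= (ip0 _ z0) addr0|right; rewrite /e h].
pose c (F : R * R -> R) m := (-1) ^+ a *: part mu F (Za s0 a m).
have Lc F : L2 muq F -> forall m, L2 mu (c F m).
  by move=> LF m; apply: (hSZ H); exact: L2_part.
have nc F m x : ipc mu (e m) (e m) * c F m x = c F m x.
  have [h|h] := ne m.
    by rewrite (_ : ipc mu (e m) (e m) = 1) ?mul1r // /pairip /= (ip0 _ z0) addr0 h.
  have Z0 := Ea0_Za0 h.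
  by rewrite /c !fctE /GRing.scale /= /part Z0 /ip; under eq_Rintegral do rewrite mulr0;
    rewrite Rintegral_cst // mul0r !mulr0.
have ipcc F m : L2 muq F -> ip mu (c F m) (c F m) = ip mu (part mu F (Za s0 a m)) (part mu F (Za s0 a m)).
  move=> LF; have Lp := L2_part LF (Lz m).
  rewrite /c (hipZ H _ Lp (hSZ H _ Lp)) (hipZr H _ Lp Lp) mulrA -exprMn.
  by rewrite mulrNN mulr1 expr1n mul1r.
have bnd n : \sum_(m < n) ipc mu (cpart B (Za s0 a m)) (cpart B (Za s0 a m)) <= fine (tenergy s0 a B).
  rewrite -lee_fin fineK; last by rewrite ge0_fin_numE // tenergy_ge0.
  rewrite -sumEFin -(big_mkord xpredT (fun m => (ipc mu (cpart B (Za s0 a m)) (cpart B (Za s0 a m)))%:E)).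
  by apply: nneseries_lim_ge => m _ _; rewrite lee_fin; exact: (hge0 HL).
have cB1 n : \sum_(m < n) ip mu (c B.1 m) (c B.1 m) <= fine (tenergy s0 a B).
  apply: le_trans (bnd n); apply: ler_sum => m _; rewrite ipcc // /pairip lerDl.
  exact: (hge0 H).
have cB2 n : \sum_(m < n) ip mu (c B.2 m) (c B.2 m) <= fine (tenergy s0 a B).
  apply: le_trans (bnd n); apply: ler_sum => m _; rewrite ipcc // /pairip lerDr.
  exact: (hge0 H).
have [G1 [G1a _] h1] := riesz_fischer_param one (Lc _ B1) (nc B.1) cB1.
have [G2 [G2a _] h2] := riesz_fischer_param one (Lc _ B2) (nc B.2) cB2.
pose s1 := s0 + a.*2%:R.
pose T : W := (cut ST G1.1, cut ST G2.1).
have [LT1 T1o] := L2_cut mST G1a; have [LT2 T2o] := L2_cut mST G2a.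
pose X := untld (pw kappa (fun=> kk) s1) T.
have pw0 p : ST p -> 0 < pw kappa (fun=> kk) s1 p.
  by move=> [_ pA]; rewrite mulr_gt0 ?kk_gt0 ?Wa_gt0.
have mpV : measurable_fun ST (fun p => (pw kappa (fun=> kk) s1 p)^-1).
  have mp : measurable_fun ST (pw kappa (fun=> kk^-1) (- s1)) by exact: measurable_pw.
  apply: eq_measurable_fun mp => p /set_mem[_ pA].
  rewrite /pw invfM; congr (_ * _); apply: (mulfI (lt0r_neq0 (Wa_gt0 s1 pA))).
  by rewrite WaN // divff // gt_eqF // Wa_gt0.
have mX : cmeasurable ST X.
  by apply: (untld_measurable (c := T) mpV); [case: LT1|case: LT2].
have XT : tld ST (pw kappa (fun=> kk) s1) X = T.
  by rewrite /X untldK.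
exists X => //.
have LT : L2c muq T by [].
apply: filterS2 (filterI (ae_row LB) (ae_row LT)) (filterI h1 h2) => t [Lt LTt] [[[_ g1] k1] [[_ g2] k2]].
have oX : pairS (L2on mu (angles kappa)) (tld An (Wa s1) (fun y => X (t, y))).
  have hX : L2c mu (slice1 (tld ST (pw kappa (fun=> kk) s1) X) t) by rewrite XT.
  exact: (row_on (fun x _ => kk_gt0) (I : setT t) hX).
have oW : pairS (L2on mu (angles kappa)) (tld An (Wa s0) (fun y => w (t, y))).
  exact: (row_on (fun x _ => kk_gt0) (I : setT t) Lt).
split => //.
have rX : slice1 T t = kk *: tld An (Wa s1) (fun y => X (t, y)).
  by rewrite -XT (row_tld kappa _ _ _ (I : setT t)).
have rW : slice1 B t = kk *: tld An (Wa s0) (fun y => w (t, y)).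
  by rewrite /B (row_tld kappa _ _ _ (I : setT t)).
have cutE (F : R * R -> R) m : ip mu (fun y => cut ST F (t, y)) (Ea s0 a m) = ip mu (fun y => F (t, y)) (Ea s0 a m).
  apply: eq_Rintegral => y _; have [_ E0] := Se m; have [yA|nA] := pselect (angles kappa y).
    by rewrite /cut mem_set //; split.
  by rewrite E0 // !mulr0.
have k0 : kk != 0 by rewrite gt_eqF // kk_gt0.
apply: (wderiv_of_coef (kappa_gt0 := kappa_gt0) (cmeasurable_row mT mw (I : setT t)) (cmeasurable_row mT mX (I : setT t)) oW oX) => m.
- apply: (mulfI k0); rewrite mulrCA -(hipZ H kk (L2on_L2c oW).1 (Lz m)).
  rewrite -(hipZ H kk (L2on_L2c oX).1 (Se m).1).
  have -> : kk *: (tld An (Wa s1) (fun y => X (t, y))).1 = (slice1 T t).1 by rewrite rX.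
  have -> : kk *: (tld An (Wa s0) (fun y => w (t, y))).1 = (slice1 B t).1 by rewrite rW.
  have := k1 m; rewrite /pairip /= (ip0 _ g1) addr0.
  by rewrite cutE => ->.
- apply: (mulfI k0); rewrite mulrCA -(hipZ H kk (L2on_L2c oW).2 (Lz m)).
  rewrite -(hipZ H kk (L2on_L2c oX).2 (Se m).1).
  have -> : kk *: (tld An (Wa s1) (fun y => X (t, y))).2 = (slice1 T t).2 by rewrite rX.
  have -> : kk *: (tld An (Wa s0) (fun y => w (t, y))).2 = (slice1 B t).2 by rewrite rW.
  have := k2 m; rewrite /pairip /= (ip0 _ g2) addr0.
  by rewrite cutE => ->.
Qed.

Lemma good_Yspace gamma U : Ygood gamma U -> Yspace kappa gamma Theta theta U.
Proof.
move=> [mU hU]; split => // j a hj ha.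
have aj : (a <= gamma - 0)%N by rewrite subn0 (leq_trans ha) // leq_subr.
have [L0 /(_ a aj) f0] := hU 0%N (leq0n _).
have U0 : Uj 0 U = onl U by apply/funext => p; rewrite /Uj expr0 mul1r.
have [X mX hX] : exists2 X : R * R -> R[i], cmeasurable ST X &
    {ae mu, forall t, is_wderiv kappa a (fun y => onl U (t, y)) (fun y => X (t, y)) /\
      pairS (L2on mu (angles kappa)) (tld An (Wa (sj 0 + a.*2%:R)) (fun y => X (t, y)))}.
  by have := wderiv_family (a := a) mU; rewrite -U0; exact.
exists (fun p => X (complex.Im p.1, p.2)); first by apply: filterS hX => t [].
split.
  have := cmeasurable_lamX j mX.
  have -> : (fun p : R * R => lam p.1 ^+ j * X p) = (fun p => lam p.1 ^+ j * X (p.1, p.2)).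
    by apply/funext => -[t y].
  exact.
apply/Y0norm_lty; have [Lj /(_ a ha) fj] := hU j hj.
have p0 : 0 < 2 * pi :> R by rewrite mulr_gt0 // pi_gt0.
apply: (@le_lt_trans _ _ (\int[mu]_t ((2 * pi)%:E * energy (sj j) a (slice1 (tlY j U) t)))%E); last first.
  rewrite ge0_integralZl //; last 3 first.
  - exact: measurable_energy_row.
  - by move=> t _; exact: energy_ge0.
  - by rewrite lee_fin ltW.
  rewrite tenergy_rows //; move: fj; set I := tenergy _ _ _ => fj.
  by rewrite lte_mul_pinfty // lee_fin ltW.
apply: ae_le_integral.
- by move=> t _; exact: sqre_ge0.
- by move=> t _; rewrite mule_ge0 ?energy_ge0 // lee_fin ltW.
apply: filterS2 (ae_lines mU Lj) hX => t [Lt t0] [ht oX] _.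
have mXt := cmeasurable_row mT mX (I : setT t).
rewrite (Hnorm0 _ (v := fun y => lam t ^+ j * X (t, y))); last first.
  apply: (L1loc_of_L2 (r := sj 0 + a.*2%:R)); first exact: cmeasurableZ.
  by rewrite tldZ; exact: (cmulp_on _ mA oX).
by rewrite sjE (energy_Uj_wderiv Lt t0 ht).
Qed.

End Y_spaces.

(** * Test functions on the wedge *)

Section plane.
Context {R : realType}.
Notation mu := (@lebesgue_measure R).
Notation muq := (@lebesgue_measure R \x @lebesgue_measure R)%E.
Notation T2 := (measurableTypeR R * measurableTypeR R)%type.
Implicit Types (f : R * R -> R) (x y r t : R).

#[local] Instance ae_mu_plane : Filter (almost_everywhere mu) :=
  ae_filter_ringOfSetsType mu.

(** A continuous function is the limit of functions that depend on the first
    variable through a step function. The sigma-algebra of the plane is the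
    product one, so that openness of preimages does not suffice. *)
Lemma continuous_measurable2 f : continuous f -> measurable_fun (setT : set T2) f.
Proof.
move=> cf; pose c (n : nat) : R := n.+1%:R.
have c0 n : 0 < c n by rewrite ltr0n.
pose g n (x : R) : R := (Num.Def.floor (c n * x))%:~R / c n.
have gx x n : x - harmonic n <= g n x <= x.
  have /andP[h1 h2] := floor_itv (c n * x).
  rewrite intrD in h2; rewrite /g /harmonic /=; apply/andP; split.
    rewrite ler_pdivlMr // mulrBl mulVf ?gt_eqF // -/(c n); lra.
  by rewrite ler_pdivrMr // [x * _]mulrC.
apply: (@measurable_fun_cvg _ _ _ _ (fun n (p : T2) => f (g n p.1, p.2))).
  move=> n; pose E i : set T2 := if (unpickle i : option int) is Some k then
    ((fun x : measurableTypeR R => c n * x) @^-1` `[k%:~R, (k + 1)%:~R[) `*` setT else set0.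
  have mE i : measurable (E i).
    rewrite /E; case: (unpickle i) => [k|]; last exact: measurable0.
    apply: measurableX => //; rewrite -[X in measurable X]setTI.
    by apply: (mulrl_measurable (c n) measurableT); exact: measurable_itv.
  have ET : \bigcup_i E i = (setT : set T2).
    apply/seteqP; split => // p _; pose k := Num.Def.floor (c n * p.1).
    exists (pickle k); first exact: I.
    rewrite /E pickleK; split; last exact: I.
    by rewrite /= in_itv /=; exact: floor_itv.
  apply: (eq_ind _ (fun D : set T2 => measurable_fun D _) _ _ ET).
  apply/(measurable_fun_bigcup _ mE) => i.
  case ui : (unpickle i : option int) => [k|]; last first.
    by rewrite /E ui; exact: measurable_fun_set0.
  have mk : measurable_fun (setT : set T2) (fun p : T2 => f (k%:~R / c n, p.2)).
    apply: (measurableT_comp (f := fun y : R => f (k%:~R / c n, y))) measurable_snd.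
    apply: continuous_measurable => y.
    exact: (cvg_comp (fun y => (k%:~R / c n, y)) f (cvg_pair (@cvg_cst _ (k%:~R / c n) _ (nbhs y) _) (@cvg_id _ (nbhs y))) (@cf (k%:~R / c n, y))).
  apply: eq_measurable_fun (measurable_funS measurableT (@subsetT _ _) mk) => p.
  rewrite /E ui => /set_mem[/=]; rewrite in_itv /= => kp _.
  by rewrite /g (floor_def kp).
move=> [x y] _ /=.
have gc : g n x @[n --> \oo] --> x.
  apply: (squeeze_cvgr (f := fun n => x - harmonic n) (h := fun=> x)).
  - by near=> n; exact: gx.
  - have := cvgB (@cvg_cst _ x _ (\oo : set_system nat) _) (@cvg_harmonic R).
    by rewrite subr0; apply.
  - exact: cvg_cst.
exact: (cvg_comp (fun n => (g n x, y)) f (cvg_pair gc (@cvg_cst _ y _ (\oo : set_system nat) _)) (@cf (x, y))).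
Unshelve. all: by end_near. Qed.

Definition slice f y : R -> R := fun r => f (r, y).

Lemma slice_quotient f y v r :
  (fun h : R => h^-1 *: ((slice f y \o shift r) (h *: v) - slice f y r)) =
  (fun h : R => h^-1 *: ((f \o shift (r, y)) (h *: (v, 0) : R * R) - f (r, y))).
Proof.
apply/funext => h; rewrite /slice /= /shift /=; congr (_ *: (f _ - _)).
transitivity (h *: v + r, h *: (0 : R) + y); last by [].
by rewrite scaler0 add0r.
Qed.

Lemma derive_slice f y v r : 'D_v (slice f y) r = 'D_((v, 0) : R * R) f (r, y).
Proof. by rewrite /derive slice_quotient. Qed.

Lemma differentiable_slice f y r : differentiable f (r, y) -> differentiable (slice f y) r.
Proof.
move=> df; apply/derivable1_diffP; rewrite /derivable slice_quotient.
have := @diff_derivable _ _ _ f (r, y) ((1, 0) : R * R) df; rewrite /derivable; exact.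
Qed.

Lemma smooth_slice f y : smooth f -> smooth (slice f y).
Proof.
move=> sf; apply/smoothP => n; elim: n f sf => [//|n IH] f sf /=.
split; first by move=> x; apply: differentiable_slice; exact: smooth_differentiable.
move=> v; have -> : 'D_v (slice f y) = slice ('D_((v, 0) : R * R) f) y.
  by apply/funext => r; rewrite derive_slice.
by apply: IH; exact: smooth_derive.
Qed.

Lemma Dr_r_slice f x y : smooth f ->
  Dr_r f (x, y) = f (x, y) + x * (slice f y)^`()%classic x.
Proof.
move=> sf; rewrite /Dr_r -derive_slice -derive1E.
have ds : is_derive x 1 (slice f y) ((slice f y)^`()%classic x).
  by apply: smooth_is_derive; exact: smooth_slice.
have -> : slice (fun p : R * R => p.1 * f p) y = id * slice f y by [].
have := is_deriveM (is_derive_id x 1) ds => h; rewrite derive1E derive_val.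
by rewrite /slice /GRing.scale /= mulr1 addrC.
Qed.

Lemma Dr_r_test (D : set (R * R)) f : test_function D f -> test_function D (Dr_r f).
Proof.
move=> [sf [K [cK KD f0]]]; split.
  by apply: smooth_derive; exact: (smoothM smooth_fst sf).
exists K; split => // -[x y] nK; have oK : open (~` K).
  by rewrite openC; apply: compact_closed => //; exact: norm_hausdorff.
rewrite /Dr_r; have nb : \forall p \near (x, y), p.1 * f p = (cst 0 : R * R -> R) p.
  have : nbhs (x, y) (~` K) by exact: open_nbhs_nbhs.
  by apply: filterS => p nKp; rewrite f0 // mulr0.
by rewrite (near_eq_derive _ nb) derive_cst.
Qed.

Lemma iter_Dr_r_test (D : set (R * R)) j f : test_function D f -> test_function D (iter j Dr_r f).
Proof. by move=> tf; elim: j => //= j IH; exact: Dr_r_test. Qed.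

Definition tensor (chi zeta : R -> R) (p : R * R) : R := chi p.1 * zeta p.2.

Lemma tensor_test (D E : set R) chi zeta : test_function D chi -> test_function E zeta ->
  test_function (D `*` E) (tensor chi zeta).
Proof.
move=> [sc [K [cK KD c0]]] [sz [L [cL LE z0]]]; split.
  exact: (smoothM (smooth_comp sc smooth_fst) (smooth_comp sz smooth_snd)).
exists (K `*` L); split; first exact: compact_setX.
  by move=> [x y] [/KD ? /LE ?].
move=> [x y] n; rewrite /tensor /=; have [xK|/c0 ->] := pselect (K x); last by rewrite mul0r.
by rewrite z0 ?mulr0 // => yL; apply: n.
Qed.

Lemma Dr_r_tensor chi zeta : smooth chi -> smooth zeta ->
  Dr_r (tensor chi zeta) = tensor (fun r => chi r + euler chi r) zeta.
Proof.
move=> sc sz; apply/funext => -[x y].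
rewrite Dr_r_slice; last exact: (smoothM (smooth_comp sc smooth_fst) (smooth_comp sz smooth_snd)).
have -> : slice (tensor chi zeta) y = zeta y *: chi.
  by apply/funext => r; rewrite /slice /tensor /= mulrC.
rewrite /tensor /euler /= derive1E deriveZ; last first.
  by apply: diff_derivable_fun => z; exact: smooth_differentiable.
by rewrite -derive1E /GRing.scale /=; ring.
Qed.

End plane.

Lemma integrable_rows d1 d2 (T1 : measurableType d1) (T2 : measurableType d2)
  (R : realType) (m1 : {sigma_finite_measure set T1 -> \bar R})
  (m2 : {sigma_finite_measure set T2 -> \bar R}) (F : T1 * T2 -> R) :
  (m1 \x m2)%E.-integrable setT (EFin \o F) ->
  {ae m1, forall x, m2.-integrable setT (EFin \o (fun y => F (x, y)))}.
Proof.
move=> IF; have mF := integrable_measurable IF.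
have mN : measurable_fun setT (fun z => (`|F z|)%:E).
  by apply/measurable_EFinP; exact: measurableT_comp.
have N0 z : (0 <= (`|F z|)%:E)%E by rewrite lee_fin.
have mI := measurable_fun_fubini_tonelli_F (m2 := m2) _ mN N0.
have fin : (\int[m1]_x (fubini_F m2 (fun z => (`|F z|)%:E) x) < +oo)%E.
  by rewrite -fubini_tonelli1 //; have /integrableP[_] := IF.
have := integral_lty_ae measurableT mI _ fin.
have I0 x : setT x -> (0 <= fubini_F m2 (fun z => (`|F z|)%:E) x)%E.
  by move=> _; apply: integral_ge0 => y _; exact: N0.
move=> /(_ I0); have Fl := ae_filter_ringOfSetsType m1.
apply: filterS => x /(_ Logic.I) hx; apply/integrableP; split; last exact: hx.
by apply/measurable_EFinP; exact: measurable_fun_pair2.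
Qed.

Section iterated_null.
Context {R : realType}.
Notation mu := (@lebesgue_measure R).
Notation muq := (@lebesgue_measure R \x @lebesgue_measure R)%E.
Notation T2 := (measurableTypeR R * measurableTypeR R)%type.
Implicit Types (f D : R * R -> R) (x y r t : R).

#[local] Instance ae_mu_iter : Filter (almost_everywhere mu) :=
  ae_filter_ringOfSetsType mu.
#[local] Instance ae_muq_iter : Filter (almost_everywhere (muq : set T2 -> \bar R)) :=
  ae_filter_ringOfSetsType muq.

(** The integral of the square does not depend on the order of integration. *)
Lemma rows_null D : measurable_fun setT D -> {ae mu, forall x, {ae mu, forall y, D (x, y) = 0}} ->
  L2 muq D /\ ip muq D D = 0.
Proof.
move=> mD h; have D0 : (\int[muq]_z (D z ^+ 2)%:E = 0)%E.
  rewrite L2_tonelli // (@ae_eq_ge0_integral _ _ _ mu _ _ (cst 0%E)) //.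
  - by rewrite integral_cst // mul0e.
  - by move=> x _; apply: integral_ge0 => y _; rewrite lee_fin sqr_ge0.
  apply: filterS h => x hx _; rewrite (@ae_eq_ge0_integral _ _ _ mu _ _ (cst 0%E)) //.
  - by rewrite integral_cst // mul0e.
  - by move=> y _; rewrite lee_fin sqr_ge0.
  - by apply: filterS hx => y -> _; rewrite expr0n.
have LD : L2 muq D by split => //; rewrite D0.
by split => //; apply: EFin_inj; rewrite -(L2_ipE LD) D0.
Qed.

Lemma null_cols D : L2 muq D -> ip muq D D = 0 -> {ae mu, forall y, {ae mu, forall x, D (x, y) = 0}}.
Proof.
move=> LD D0; have [mD _] := LD.
have h : (\int[mu]_y \int[mu]_x (D (x, y) ^+ 2)%:E = 0)%E.
  by rewrite -(L2_tonelli2 mu mu mD) L2_ipE // D0.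
have sq0 (z : R * R) : (0 <= (D z ^+ 2)%:E)%E by rewrite lee_fin sqr_ge0.
have mI := measurable_fun_fubini_tonelli_G (m1 := mu) _ (measurable_sqE mD) sq0.
have [/(_ _)] := ae_eq_integral_abs mu measurableT mI.
have -> : (\int[mu]_x `|fubini_G mu (fun z => (D z ^+ 2)%:E) x| = 0)%E.
  rewrite -[RHS]h; apply: eq_integral => y _; rewrite gee0_abs //.
  by apply: integral_ge0 => x _; exact: sq0.
move=> /(_ erefl) e _; apply: filterS2 e (L2_slice2 LD) => y hy Ly.
apply: (L2_norm0_ae Ly); apply: EFin_inj; rewrite -(L2_ipE Ly); exact: hy.
Qed.

(** Pairing with a bump of the second variable gives an integrable function of
    the first one, to which separation by bumps applies; countably many bumps
    leave a common null set. *)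
Lemma box_separates (J1 J2 : set R) f : open J1 -> open J2 ->
  muq.-integrable setT (EFin \o f) ->
  (forall k l, \int[muq]_z (f z * tensor (bump_seq J1 k) (bump_seq J2 l) z) = 0) ->
  {ae mu, forall x, J1 x -> {ae mu, forall y, J2 y -> f (x, y) = 0}}.
Proof.
move=> oJ1 oJ2 If f0; have mf := integrable_measurable If.
have b01 (J : set R) k x : 0 <= bump_seq J k x <= 1.
  rewrite /bump_seq; case: unpickle => [[[p q] n]|]; last by rewrite lexx ler01.
  by case: asboolP => _; rewrite ?lexx ?ler01 // bump_ge0 bump_le1.
have bout (J : set R) k x : ~ J x -> bump_seq J k x = 0.
  move=> nJ; rewrite /bump_seq; case: unpickle => [[[p q] n]|] //.
  case: asboolP => // h; apply: bump_out => xpq; apply: nJ; apply: h.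
  by move: xpq; rewrite /= !in_itv /= => /andP[/ltW -> /ltW ->].
have mb (J : set R) k : measurable_fun setT (bump_seq J k).
  have [J0|/set0P/negP] := pselect (J !=set0).
    by apply: continuous_measurable; apply: smooth_continuous; case: (bump_seq_test k J0).
  rewrite negbK => /eqP J0; rewrite (_ : bump_seq J k = cst 0); first exact: measurable_cst.
  by apply/funext => x; rewrite bout // J0.
have absb (J : set R) k x (a : R) : `|a * bump_seq J k x| <= `|a|.
  have /andP[b0 b1] := b01 J k x; rewrite normrM -[leRHS]mulr1 ler_wpM2l //.
  by rewrite ger0_norm.
pose H l (z : R * R) := f z * bump_seq J2 l z.2.
have mH l : measurable_fun setT (H l).
  by apply: measurable_funM => //; exact: (measurableT_comp (mb J2 l) measurable_snd).
have IH l : muq.-integrable setT (EFin \o H l).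
  apply: (@le_integrable _ _ _ muq setT measurableT (EFin \o H l) (EFin \o f) _ _ If).
  - by apply/measurable_EFinP; exact: mH.
  - by move=> z _; rewrite /= lee_fin; exact: absb.
pose h l := fubini_F mu (EFin \o H l); have Ih l := integrable_fubini_F (IH l).
pose g l x := fine (h l x).
have Ig l : mu.-integrable setT (EFin \o g l).
  apply: (@le_integrable _ _ _ mu setT measurableT (EFin \o g l) (h l) _ _ (Ih l)).
  - apply/measurable_EFinP; apply: (measurableT_comp (fine_measurable measurableT)).
    exact: (measurable_int mu (Ih l)).
  - by move=> x _; rewrite /g /=; case: (h l x) => [?| |] //=; exact: leey.
have rowsH F : muq.-integrable setT (EFin \o F) ->
    {ae mu, forall x, mu.-integrable setT (EFin \o (fun y => F (x, y)))} := @integrable_rows _ _ _ _ _ mu mu F.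
have g0 l : {ae mu, forall x, J1 x -> g l x = 0}.
  apply: bump_separates oJ1 _ _.
    by move=> p q _; apply: integrableS (Ig l) => //; exact: measurable_itv.
  move=> k; rewrite Rintegral_mkcond -[RHS](f0 k l) /Rintegral; congr fine.
  have It : muq.-integrable setT (EFin \o (fun z => H l z * bump_seq J1 k z.1)).
    apply: (@le_integrable _ _ _ muq setT measurableT _ (EFin \o H l) _ _ (IH l)).
    - apply/measurable_EFinP; apply: measurable_funM; first exact: mH.
      exact: (measurableT_comp (mb J1 k) measurable_fst).
    - by move=> z _; rewrite /= lee_fin; exact: absb.
  transitivity (\int[muq]_z (H l z * bump_seq J1 k z.1)%:E)%E; last first.
    by apply: eq_integral => z _; rewrite /H /tensor; congr EFin; ring.
  rewrite -(integral12_prod_meas1 It).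
  apply: ae_eq_integral => //.
  - apply/measurable_EFinP.
    rewrite (_ : patch _ _ _ = (fun x => g l x * bump_seq J1 k x)).
      exact: (measurable_funM (integrable_measurable (Ig l)) (mb J1 k)).
    apply/funext => x; rewrite patchE; case: ifPn => //; rewrite notin_setE => nJ.
    by rewrite bout ?mulr0.
  - exact: (measurable_int mu (integrable_fubini_F It)).
  apply: filterS (rowsH _ (IH l)) => x Ix _.
  rewrite /fubini_F /=.
  transitivity ((bump_seq J1 k x)%:E * h l x)%E.
    have -> : h l x = (g l x)%:E by rewrite /g fineK //; exact: (integrable_fin_num _ Ix).
    rewrite patchE; case: ifPn => [_|]; first by rewrite -EFinM mulrC.
    by rewrite notin_setE => nJ; rewrite bout // mul0e.
  rewrite /h /fubini_F -(integralZl measurableT Ix); apply: eq_integral => y _.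
  by rewrite /= -EFinM mulrC.
apply: filterS2 (rowsH f If) (ae_foralln g0) => x Ix gx J1x.
apply: bump_separates oJ2 _ _.
  by move=> p q _; apply: integrableS Ix => //; exact: measurable_itv.
move=> l; rewrite -[RHS](gx l J1x) Rintegral_mkcond /g /h /fubini_F /Rintegral; congr fine.
apply: eq_integral => y _; congr EFin; rewrite patchE /H /=; case: ifPn => //.
by rewrite notin_setE => nJ; rewrite bout ?mulr0.
Qed.

End iterated_null.

(** * Distributions on the wedge *)

Section wedge_distributions.
Context {R : realType}.
Notation mu := (@lebesgue_measure R).
Notation muq := (@lebesgue_measure R \x @lebesgue_measure R)%E.
Notation T2 := (measurableTypeR R * measurableTypeR R)%type.
Variables (kappa : R) (kappa_gt0 : 0 < kappa).
Notation An := (angles kappa : set (measurableTypeR R)).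
Notation Wd := (wedge kappa : set T2).
Notation Rp := (Rpos : set (measurableTypeR R)).
Notation Wa := (Wa kappa).
Notation W := ((R * R -> R) * (R * R -> R))%type.
Implicit Types (eta : R * R -> R) (u w : R * R -> R[i]) (x y r t s : R) (j : nat).

#[local] Instance ae_mu_wedge : Filter (almost_everywhere mu) :=
  ae_filter_ringOfSetsType mu.
#[local] Instance ae_muq_wedge : Filter (almost_everywhere (muq : set T2 -> \bar R)) :=
  ae_filter_ringOfSetsType muq.

Let mW : measurable Wd := measurable_strip kappa (@measurable_Rp R).

Definition box (a b c d : R) : set (R * R) := `[a, b]%classic `*` `[c, d]%classic.

Lemma measurable_box a b c d : measurable (box a b c d : set T2).
Proof. by apply: measurableX; exact: measurable_itv. Qed.

Lemma compact_wedge (K : set (R * R)) : compact K -> K `<=` wedge kappa ->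
  exists a b c d, [/\ `[a, b]%classic `<=` (Rpos : set R), `[c, d]%classic `<=` angles kappa &
    K `<=` box a b c d].
Proof.
move=> cK KW; have c1 : compact (fst @` K).
  by apply: continuous_compact => //; apply: continuous_subspaceT => p; exact: cvg_fst.
have c2 : compact (snd @` K).
  by apply: continuous_compact => //; apply: continuous_subspaceT => p; exact: cvg_snd.
have K1 : fst @` K `<=` (Rpos : set R) by move=> _ [p /KW[h _] <-].
have K2 : snd @` K `<=` angles kappa by move=> _ [p /KW[_ h] <-].
have [B hB] := compact_bounded_Rpos c1 K1; have [e [e0 he]] := compact_angles c2 K2.
exists (expR (- B)), (expR B), e, (kappa - e); split.
- by move=> x /=; rewrite in_itv /= RposE => /andP[h _]; exact: lt_le_trans (expR_gt0 _) h.
- exact: sub_angles.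
move=> p Kp; split; last by apply: he; exists p.
have p1 : Rpos p.1 by apply: K1; exists p.
have := hB p.1 (ex_intro2 _ _ p Kp erefl); rewrite ler_norml => /andP[h1 h2].
have /lnK e1 : p.1 \is Num.pos by rewrite posrE -RposE.
by rewrite /= in_itv /= -e1 !ler_expR h1.
Qed.

Lemma bounded_on_segment (g : R -> R) (D : set R) a b : (forall x, D x -> {for x, continuous g}) ->
  `[a, b]%classic `<=` D -> exists2 M, 0 <= M & forall x, `[a, b]%classic x -> `|g x| <= M.
Proof.
move=> cg abD; have cI : compact (g @` `[a, b]).
  apply: continuous_compact; last exact: segment_compact.
  by apply: continuous_in_subspaceT => x /set_mem /abD; exact: cg.
have [M [_ hM]] := compact_bounded cI.
have MM : M < `|M| + 1 by rewrite (le_lt_trans (ler_norm M)) // ltrDl.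
exists (`|M| + 1); first by rewrite addr_ge0.
by move=> x xab; apply: (hM _ MM); exists x.
Qed.

Lemma L2_box (f : R * R -> R) a b c d C : measurable_fun (setT : set T2) f ->
  (forall p, box a b c d p -> `|f p| <= C) -> (forall p, ~ box a b c d p -> f p = 0) ->
  L2 muq f.
Proof.
move=> mf fC f0.
have L1 (p q : R) : L2 mu (\1_(`[p, q]%classic : set (measurableTypeR R)) : R -> R).
  split; first by apply: measurable_indic; exact: measurable_itv.
  have -> : (fun x => (\1_(`[p, q]%classic) x ^+ 2)%:E : \bar R) = (fun x => (\1_(`[p, q]%classic) x)%:E).
    by apply/funext => x; rewrite indicE; case: (_ \in _); rewrite ?expr1n ?expr0n.
  rewrite integral_indic // setIT.
  by rewrite /= lebesgue_measure_itv /=; case: ifP => _; rewrite // -EFinD ltry.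
have Lg := hSZ (L2_hilbert muq) C (L2_tensor (L1 a b) (L1 c d)); apply: (L2_le mf Lg) => p.
have -> : (C *: (fun z : R * R => \1_(`[a, b]%classic) z.1 * \1_(`[c, d]%classic) z.2)) p =
  C * (\1_(`[a, b]%classic) p.1 * \1_(`[c, d]%classic) p.2) by [].
have [[p1 p2]|n] := pselect (box a b c d p); last by rewrite f0 // normr0.
rewrite !indicE !mem_set // !mulr1 (le_trans _ (ler_norm C)) //; exact: fC.
Qed.

Section weighted.
Variables (beta s : R).
Notation P := (pw kappa (Wr beta) s).

Lemma pw_gt0 p : wedge kappa p -> 0 < P p.
Proof. by move=> [p1 p2]; exact: (mulr_gt0 (Wr_gt0 beta p1) (Wa_gt0 s p2)). Qed.

Lemma pwV p : wedge kappa p -> (P p)^-1 = pw kappa (Wr (1 - beta)) (- s) p.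
Proof.
move=> [p1 p2]; rewrite /pw invfM; congr (_ * _).
- by rewrite /Wr -powRN; congr (_ `^ _); field.
- apply: (mulfI (lt0r_neq0 (Wa_gt0 s p2))); rewrite WaN // divff // gt_eqF //.
  exact: Wa_gt0.
Qed.

Lemma measurable_pwb : measurable_fun Wd P.
Proof. by apply: measurable_pw; [exact: measurable_Rp|exact: measurable_Wr]. Qed.

Lemma measurable_pwV : measurable_fun Wd (fun p => (P p)^-1).
Proof.
have mp : measurable_fun Wd (pw kappa (Wr (1 - beta)) (- s)).
  by apply: measurable_pw; [exact: measurable_Rp|exact: measurable_Wr].
by apply: eq_measurable_fun mp => p /set_mem pW; rewrite pwV.
Qed.

Lemma pwV_bounded a b c d : `[a, b]%classic `<=` (Rpos : set R) -> `[c, d]%classic `<=` angles kappa ->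
  exists2 M, 0 <= M & forall p, box a b c d p -> `|(P p)^-1| <= M.
Proof.
move=> abR cdA; have [M1 M10 h1] := bounded_on_segment (@Wr_continuous R (1 - beta)) abR.
have [M2 M20 h2] := bounded_on_segment (@Wa_continuous R kappa (- s)) cdA.
exists (M1 * M2); first exact: mulr_ge0.
move=> p [p1 p2]; rewrite pwV; last by split; [exact: abR|exact: cdA].
by rewrite normrM ler_pM // ?h1 ?h2.
Qed.

(** The factor that turns pairing with a test function into a scalar product
    of unweighted functions. *)
Definition Qw eta : R * R -> R := cut Wd (fun p => (P p)^-1 * eta p).

Lemma test_bounded eta : test_function (wedge kappa) eta -> exists a b c d M,
  [/\ `[a, b]%classic `<=` (Rpos : set R), `[c, d]%classic `<=` angles kappa,
    0 <= M, forall p, `|eta p| <= M & forall p, ~ box a b c d p -> eta p = 0].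
Proof.
move=> [se [K [cK KW e0]]]; have [a [b [c [d [abR cdA Kb]]]]] := compact_wedge cK KW.
have cI : compact (eta @` K).
  by apply: continuous_compact => //; apply: continuous_subspaceT; exact: smooth_continuous.
have [M [_ hM]] := compact_bounded cI.
have MM : M < `|M| + 1 by rewrite (le_lt_trans (ler_norm M)) // ltrDl.
have M0 : 0 <= `|M| + 1 by rewrite addr_ge0.
exists a, b, c, d, (`|M| + 1); split => //.
- move=> p; have [Kp|/e0 ->] := pselect (K p); last by rewrite normr0.
  by apply: (hM _ MM); exists p.
- by move=> p n; apply: e0 => /Kb.
Qed.

Lemma measurable_test eta : test_function (wedge kappa) eta -> measurable_fun (setT : set T2) eta.
Proof. by move=> [se _]; apply: continuous_measurable2; exact: smooth_continuous. Qed.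

Lemma Qw_L2 eta : test_function (wedge kappa) eta -> L2 muq (Qw eta).
Proof.
move=> te; have [a [b [c [d [M [abR cdA M0 hM e0]]]]]] := test_bounded te.
have [N N0 hN] := pwV_bounded abR cdA.
apply: (@L2_box _ a b c d (N * M)).
- apply: (measurable_cut mW); apply: measurable_funM; first exact: measurable_pwV.
  by apply: measurable_funTS; exact: measurable_test.
- move=> p bp; rewrite /Qw /cut; case: ifP => _; last by rewrite normr0 mulr_ge0.
  by rewrite normrM ler_pM // hN.
- by move=> p n; rewrite /Qw /cut e0 // mulr0 if_same.
Qed.

Lemma ip_Qw w eta :
  ip muq (tld Wd P w).1 (Qw eta) = \int[muq]_(p in Wd) (complex.Re (w p) * eta p) /\
  ip muq (tld Wd P w).2 (Qw eta) = \int[muq]_(p in Wd) (complex.Im (w p) * eta p).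
Proof.
split; rewrite /ip [RHS]Rintegral_mkcond; apply: eq_Rintegral => p _;
  rewrite patchE /Qw /tld /cut /=; case: ifPn => [/set_mem pW|_]; rewrite ?mul0r //;
  by rewrite mulrACA divff ?mul1r // gt_eqF // pw_gt0.
Qed.

Lemma L1loc2_of_L2 w : cmeasurable Wd w -> L2c muq (tld Wd P w) -> L1loc2 (wedge kappa) w.
Proof.
move=> mw [L1 L2']; split => // K cK KW.
have [a [b [c [d [abR cdA Kb]]]]] := compact_wedge cK KW.
have [N N0 hN] := pwV_bounded abR cdA.
have bW p : box a b c d p -> Wd p by move=> [/abR ? /cdA ?].
pose q : R * R -> R := cut (box a b c d : set T2) (fun=> N).
have Lq : L2 muq q.
  apply: (@L2_box _ a b c d N).
  - by apply: measurable_cut; [exact: measurable_box|exact: measurable_cst].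
  - by move=> p bp; rewrite /q /cut mem_set // ger0_norm.
  - by move=> p n; rewrite /q /cut memNset.
have fin (f : R * R -> R) : L2 muq f -> (\int[muq]_p (`|f p| * q p)%:E < +oo)%E.
  move=> Lf; have /integrableP[_] := L2_mul_integrable Lf Lq; apply: le_lt_trans.
  apply: le_ge0_integral => p _; first by rewrite lee_fin mulr_ge0 // /q /cut; case: ifP.
  by rewrite /= lee_fin normrM ler_wpM2l // ler_norm.
have m0 (f : R * R -> R) p : 0 <= `|f p| * q p by rewrite mulr_ge0 // /q /cut; case: ifP.
have mf (f : R * R -> R) : L2 muq f -> measurable_fun setT (fun p => (`|f p| * q p)%:E).
  move=> [mf _]; apply/measurable_EFinP; apply: measurable_funM; last by case: Lq.
  exact: measurableT_comp.
have := lte_add_pinfty (fin _ L1) (fin _ L2'); rewrite -ge0_integralD //; last 4 first.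
- by move=> p _; rewrite lee_fin.
- exact: mf.
- by move=> p _; rewrite lee_fin.
- exact: mf.
apply: le_lt_trans; rewrite [leLHS]integral_mkcond.
apply: (@le_ge0_integral _ _ _ muq) => p _.
  by rewrite patchE; case: ifP => // _; rewrite lee_fin; case: (w p) => u v; exact: sqrtr_ge0.
rewrite patchE; case: ifPn => [/set_mem Kp|_]; last by rewrite -EFinD lee_fin addr_ge0.
have bp := Kb p Kp; have pW := bW p bp; have pp := pw_gt0 pW.
rewrite -EFinD lee_fin /q /tld /cut /= !mem_set //.
have n z : `|P p * z| = P p * `|z| by rewrite normrM (gtr0_norm pp).
apply: (le_trans (normc_le _)); rewrite -mulrDl !n -mulrDr.
rewrite mulrAC -[leLHS]mul1r ler_wpM2r ?addr_ge0 //.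
have := hN p bp; rewrite normfV (gtr0_norm pp) => h.
by rewrite -(divff (lt0r_neq0 pp)) ler_wpM2l // ltW.
Qed.

End weighted.

Let Re_mul2 w eta : Rintegral (@mu2 R) Wd (fun p => complex.Re (w p * (eta p)%:C%C)) =
  \int[muq]_(p in Wd) (complex.Re (w p) * eta p).
Proof. by apply: eq_Rintegral => p _; case: (w p) => a b /=; ring. Qed.

Let Im_mul2 w eta : Rintegral (@mu2 R) Wd (fun p => complex.Im (w p * (eta p)%:C%C)) =
  \int[muq]_(p in Wd) (complex.Im (w p) * eta p).
Proof. by apply: eq_Rintegral => p _; case: (w p) => a b /=; ring. Qed.

Let sgn_mul2 j (p q : R) : (-1) ^+ j * Complex p q = Complex ((-1) ^+ j * p) ((-1) ^+ j * q).
Proof.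
have -> : (-1) ^+ j = ((-1) ^+ j)%:C%C :> R[i] by rewrite rmorphXn rmorphN1.
by apply/eqP; rewrite eq_complex /= !mul0r subr0 addr0 !eqxx.
Qed.

Lemma rDr_coef j u w : is_rDr kappa j u w -> forall eta, test_function (wedge kappa) eta ->
  \int[muq]_(p in Wd) (complex.Re (w p) * eta p) =
    (-1) ^+ j * \int[muq]_(p in Wd) (complex.Re (u p) * iter j Dr_r eta p) /\
  \int[muq]_(p in Wd) (complex.Im (w p) * eta p) =
    (-1) ^+ j * \int[muq]_(p in Wd) (complex.Im (u p) * iter j Dr_r eta p).
Proof.
move=> [_ _ h] eta te; have := h _ te; rewrite /cintegral sgn_mul2 => -[].
by rewrite !Re_mul2 !Im_mul2.
Qed.

Lemma rDr_of_int j u w : L1loc2 (wedge kappa) u -> L1loc2 (wedge kappa) w ->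
  (forall eta, test_function (wedge kappa) eta ->
  \int[muq]_(p in Wd) (complex.Re (w p) * eta p) =
    (-1) ^+ j * \int[muq]_(p in Wd) (complex.Re (u p) * iter j Dr_r eta p) /\
  \int[muq]_(p in Wd) (complex.Im (w p) * eta p) =
    (-1) ^+ j * \int[muq]_(p in Wd) (complex.Im (u p) * iter j Dr_r eta p)) ->
  is_rDr kappa j u w.
Proof.
move=> lu lw h; split => // eta te; have [h1 h2] := h _ te.
by rewrite /cintegral sgn_mul2 !Re_mul2 !Im_mul2 h1 h2.
Qed.

Lemma rDr0 u : L1loc2 (wedge kappa) u -> is_rDr kappa 0 u u.
Proof. by move=> lu; split => // eta _; rewrite expr0 mul1r. Qed.

Lemma L1loc2_box u a b c d : L1loc2 (wedge kappa) u -> `[a, b]%classic `<=` (Rpos : set R) ->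
  `[c, d]%classic `<=` angles kappa ->
  muq.-integrable (box a b c d : set T2) (EFin \o (fun p => complex.Re (u p))) /\
  muq.-integrable (box a b c d : set T2) (EFin \o (fun p => complex.Im (u p))).
Proof.
move=> [[m1 m2] fin] abR cdA; have cb : compact (box a b c d).
  by apply: compact_setX; exact: segment_compact.
have bW : box a b c d `<=` wedge kappa by move=> p [/abR ? /cdA ?].
have := fin _ cb bW => fb; have mb := measurable_box a b c d.
split; apply/integrableP; split.
- by apply/measurable_EFinP; exact: (measurable_funS mW bW m1).
- apply: le_lt_trans fb; apply: le_ge0_integral => p _ //=; rewrite lee_fin.
  by case: (u p) => q r /=; rewrite -sqrtr_sqr ler_wsqrtr // lerDl sqr_ge0.
- by apply/measurable_EFinP; exact: (measurable_funS mW bW m2).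
- apply: le_lt_trans fb; apply: le_ge0_integral => p _ //=; rewrite lee_fin.
  by case: (u p) => q r /=; rewrite -sqrtr_sqr ler_wsqrtr // lerDr sqr_ge0.
Qed.

End wedge_distributions.

Section wedge_unique.
Context {R : realType}.
Notation mu := (@lebesgue_measure R).
Notation muq := (@lebesgue_measure R \x @lebesgue_measure R)%E.
Notation T2 := (measurableTypeR R * measurableTypeR R)%type.
Variables (kappa : R) (kappa_gt0 : 0 < kappa).
Notation An := (angles kappa : set (measurableTypeR R)).
Notation Wd := (wedge kappa : set T2).
Notation Rp := (Rpos : set (measurableTypeR R)).
Notation Wa := (Wa kappa).
Implicit Types (eta f g : R * R -> R) (u w : R * R -> R[i]) (x y r t s : R) (j : nat).

#[local] Instance ae_mu_wunique : Filter (almost_everywhere mu) :=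
  ae_filter_ringOfSetsType mu.

Lemma test_sub (D E : set R) h : D `<=` E -> test_function D h -> test_function E h.
Proof. by move=> DE [sh [K [cK KD h0]]]; split => //; exists K; split => // x /KD /DE. Qed.

(** The wedge is a countable union of boxes, each of which lies in the interior of
    a compact subset. *)
Lemma wedge_separates f g :
  (forall a b c d, `[a, b]%classic `<=` (Rpos : set R) -> `[c, d]%classic `<=` angles kappa ->
     muq.-integrable (box a b c d : set T2) (EFin \o f) /\
     muq.-integrable (box a b c d : set T2) (EFin \o g)) ->
  (forall eta, test_function (wedge kappa) eta ->
     \int[muq]_(p in Wd) (f p * eta p) = \int[muq]_(p in Wd) (g p * eta p)) ->
  {ae mu, forall x, Rpos x -> {ae mu, forall y, angles kappa y -> f (x, y) = g (x, y)}}.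
Proof.
move=> Ifg fg.
pose a n : R := n.+2%:R^-1; pose b n : R := n.+2%:R.
pose c n : R := kappa * n.+3%:R^-1; pose d n : R := kappa - c n.
have a0 n : 0 < a n by rewrite invr_gt0 ltr0n.
have c0 n : 0 < c n by rewrite mulr_gt0 // invr_gt0 ltr0n.
have abR n : `[a n, b n]%classic `<=` (Rpos : set R).
  by move=> x; rewrite RposE /= in_itv /= => /andP[h _]; exact: lt_le_trans (a0 n) h.
have cdA n : `[c n, d n]%classic `<=` angles kappa by exact: sub_angles.
pose J1 n : set R := `]a n, b n[%classic; pose J2 n : set R := `]c n, d n[%classic.
have J1R n : J1 n `<=` (Rpos : set R).
  by move=> x h; apply: (abR n); move: h; rewrite /J1 /= !in_itv /= => /andP[/ltW -> /ltW ->].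
have J2A n : J2 n `<=` angles kappa.
  by move=> x h; apply: (cdA n); move: h; rewrite /J2 /= !in_itv /= => /andP[/ltW -> /ltW ->].
have J10 n : J1 n !=set0.
  exists 1; rewrite /J1 /= in_itv /= /a /b invf_lt1 ?ltr0n // !ltr1n //.
have J20 n : J2 n !=set0.
  exists (kappa / 2); rewrite /J2 /d /c /= in_itv /=.
  have h : n.+3%:R^-1 < 2^-1 :> R by rewrite ltf_pV2 ?posrE ?ltr0n // ltr_nat.
  have h' : kappa * n.+3%:R^-1 < kappa * 2^-1 by rewrite ltr_pM2l.
  by move: h'; rewrite /=; set q := kappa * _ => h'; apply/andP; split; lra.
have main n : {ae mu, forall x, J1 n x -> {ae mu, forall y, J2 n y -> f (x, y) = g (x, y)}}.
  pose B := box (a n) (b n) (c n) (d n) : set T2.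
  have mB : measurable B := measurable_box _ _ _ _.
  have [If Ig] := Ifg _ _ _ _ (abR n) (@cdA n).
  have cutI (h : R * R -> R) : muq.-integrable B (EFin \o h) -> muq.-integrable setT (EFin \o cut B h).
    move=> /(integrable_mkcond _ mB); apply: eq_integrable => // z _.
    by rewrite patchE /cut /=; case: ifP.
  have If' := cutI _ If; have Ig' := cutI _ Ig.
  have Ifg' : muq.-integrable setT (EFin \o (fun z => cut B f z - cut B g z)).
    by have := integrableB measurableT If' Ig'; apply: eq_integrable.
  have := box_separates (itv_open (a n) (b n)) (itv_open (c n) (d n)) Ifg' _.
  have cE (h : R * R -> R) x y : J1 n x -> J2 n y -> cut B h (x, y) = h (x, y).
    move=> h1 h2; rewrite /cut mem_set //; split; move: h1 h2; rewrite /J1 /J2 /= !in_itv /=.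
    - by move=> /andP[/ltW -> /ltW ->].
    - by move=> _ /andP[/ltW -> /ltW ->].
  move=> H; have {H} := H _; have hz k l :
      \int[muq]_z ((cut B f z - cut B g z) * tensor (bump_seq (J1 n) k) (bump_seq (J2 n) l) z) = 0.
    have t1 := bump_seq_test k (J10 n); have t2 := bump_seq_test l (J20 n).
    set T := tensor _ _.
    have tT : test_function (wedge kappa) T.
      exact: (tensor_test (test_sub (@J1R n) t1) (test_sub (@J2A n) t2)).
    have T0 z : ~ (J1 n `*` J2 n) z -> T z = 0.
      by have [_ [K [_ KJ h0]]] := tensor_test t1 t2; move=> nz; apply: h0 => /KJ.
    have [_ [_ [_ [_ [M [_ _ M0 hM _]]]]]] := test_bounded tT.
    have IT (h : R * R -> R) : muq.-integrable setT (EFin \o cut B h) ->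
        muq.-integrable setT (EFin \o (fun z => cut B h z * T z)).
      move=> Ih; apply: (@le_integrable _ _ _ muq setT measurableT _ _ _ _ (integrableZl measurableT M Ih)).
      - apply/measurable_EFinP; apply: measurable_funM; first exact: integrable_measurable Ih.
        exact: measurable_test tT.
      - move=> z _; rewrite /= lee_fin normrM [X in _ <= X]normrM mulrC ler_wpM2r //.
        by rewrite (le_trans (hM z)) // ler_norm.
    have eT (h : R * R -> R) : \int[muq]_z (cut B h z * T z) = \int[muq]_(z in Wd) (h z * T z).
      rewrite [RHS]Rintegral_mkcond; apply: eq_Rintegral => -[x y] _; rewrite patchE.
      have [[h1 h2]|nJ] := pselect ((J1 n `*` J2 n) (x, y)); last first.
        by rewrite T0 // !mulr0 if_same.
      by rewrite cE // mem_set //; split; [exact: (J1R n x h1)|exact: (J2A n y h2)].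
    under eq_Rintegral do rewrite mulrBl.
    by rewrite (RintegralB measurableT (IT f If') (IT g Ig')) !eT (fg _ tT) subrr.
  move=> /(_ hz); apply: filterS => x hx Jx; apply: filterS (hx Jx) => y hy Jy.
  by have := hy Jy; rewrite !cE // => /subr0_eq.
apply: filterS (ae_foralln main) => x hx xR.
have x0 : 0 < x by move: xR; rewrite RposE.
have xV0 : 0 < x^-1 by rewrite invr_gt0.
have [n0 xn0] : exists n0, forall n, J1 (n0 + n)%N x.
  exists (Num.bound (x + x^-1)) => n.
  have xb : x + x^-1 < (Num.bound (x + x^-1) + n).+2%:R.
    apply: (lt_le_trans (archi_boundP (addr_ge0 (ltW x0) (ltW xV0)))).
    by rewrite ler_nat -addn2 -addnA leq_addr.
  rewrite /J1 /= in_itv /= /a /b; apply/andP; split; last by lra.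
  by rewrite invf_plt ?posrE ?ltr0n //; lra.
apply: filterS (ae_foralln (fun n => hx (n0 + n)%N (xn0 n))) => y hy yA.
have y0 : 0 < y < kappa by move: yA; rewrite anglesE.
have /andP[y1 y2] := y0; have y3 : 0 < kappa - y by rewrite subr_gt0.
have q1 : 0 < kappa / y by rewrite divr_gt0.
have q2 : 0 < kappa / (kappa - y) by rewrite divr_gt0.
apply: (hy (Num.bound (kappa / y + kappa / (kappa - y)))).
set m := (n0 + _)%N; have mb : kappa / y + kappa / (kappa - y) < m.+3%:R.
  apply: (lt_le_trans (archi_boundP (addr_ge0 (ltW q1) (ltW q2)))).
  by rewrite ler_nat /m -addn3 addnAC leq_addl.
have m0 : 0 < m.+3%:R :> R by rewrite ltr0n.
have c1 : c m < y by rewrite /c ltr_pdivrMr // mulrC -ltr_pdivrMr //; lra.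
have c2 : c m < kappa - y by rewrite /c ltr_pdivrMr // mulrC -ltr_pdivrMr //; lra.
by rewrite /J2 /= in_itv /= c1 /d; lra.
Qed.

Lemma rDr_unique j u w w' : is_rDr kappa j u w -> is_rDr kappa j u w' ->
  {ae mu, forall x, Rpos x -> {ae mu, forall y, angles kappa y -> w (x, y) = w' (x, y)}}.
Proof.
move=> h h'; have [_ lw _] := h; have [_ lw' _] := h'.
have e1 := wedge_separates (f := fun p => complex.Re (w p)) (g := fun p => complex.Re (w' p))
  (fun a b c d ab cd => conj (L1loc2_box lw ab cd).1 (L1loc2_box lw' ab cd).1)
  (fun eta te => etrans (rDr_coef h te).1 (esym (rDr_coef h' te).1)).
have e2 := wedge_separates (f := fun p => complex.Im (w p)) (g := fun p => complex.Im (w' p))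
  (fun a b c d ab cd => conj (L1loc2_box lw ab cd).2 (L1loc2_box lw' ab cd).2)
  (fun eta te => etrans (rDr_coef h te).2 (esym (rDr_coef h' te).2)).
apply: filterS2 e1 e2 => x h1 h2 xR; apply: filterS2 (h1 xR) (h2 xR) => y k1 k2 yA.
by apply/eqP; rewrite eq_complex k1 // k2 // !eqxx.
Qed.

Lemma rDr_step j u w w' : is_rDr kappa j u w -> is_rDr kappa j.+1 u w' ->
  forall eta, test_function (wedge kappa) eta ->
  \int[muq]_(p in Wd) (complex.Re (w' p) * eta p) = - (\int[muq]_(p in Wd) (complex.Re (w p) * Dr_r eta p)) /\
  \int[muq]_(p in Wd) (complex.Im (w' p) * eta p) = - \int[muq]_(p in Wd) (complex.Im (w p) * Dr_r eta p).
Proof.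
move=> h h' eta te; have [-> ->] := rDr_coef h' te; have [-> ->] := rDr_coef h (Dr_r_test te).
by rewrite -!iterSr !exprS !mulN1r !mulNr.
Qed.

End wedge_unique.

Section wedge_euler.
Context {R : realType}.
Notation mu := (@lebesgue_measure R).
Notation muq := (@lebesgue_measure R \x @lebesgue_measure R)%E.
Notation T2 := (measurableTypeR R * measurableTypeR R)%type.
Variables (kappa : R) (kappa_gt0 : 0 < kappa) (beta : R).
Notation An := (angles kappa : set (measurableTypeR R)).
Notation Wd := (wedge kappa : set T2).
Notation Wa := (Wa kappa).
Notation Wr := (Wr beta).
Notation tr := (tr beta).
Notation W := ((R * R -> R) * (R * R -> R))%type.
Implicit Types (A B : W) (eta : R * R -> R) (zeta h : R -> R) (u w : R * R -> R[i]) (x y r t s : R) (j : nat).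

#[local] Instance ae_mu_weuler : Filter (almost_everywhere mu) :=
  ae_filter_ringOfSetsType mu.

Let H := L2_hilbert mu.

Definition chi h r : R := r `^ (2 * beta - 1) * h r.

Lemma WrV r : 0 < r -> (Wr r)^-1 * r `^ (2 * beta - 1) = Wr r.
Proof.
move=> r0; rewrite -(Wr_sq beta r0) expr2 mulrA mulVf ?mul1r // gt_eqF //.
by apply: Wr_gt0; rewrite RposE.
Qed.

Lemma tensor_Qw s h zeta :
  (fun z => cut Rpos (fun r => Wr r * h r) z.1 * ta kappa (- s) zeta z.2) =
  Qw kappa beta s (tensor (chi h) zeta).
Proof.
apply/funext => -[r y]; rewrite /ta /Qw /cut /=.
have [rR|nR] := boolP (r \in Rpos); last first.
  have -> : ((r, y) \in wedge kappa) = false.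
    by apply/negbTE; move: nR; rewrite !notin_setE => nR [].
  by rewrite mul0r.
have [yA|nA] := boolP (y \in angles kappa); last first.
  have -> : ((r, y) \in wedge kappa) = false.
    by apply/negbTE; move: nA; rewrite !notin_setE => nA [].
  by rewrite mulr0.
have Rr := set_mem rR; have Ay := set_mem yA.
have r0 : 0 < r by move: Rr; rewrite RposE.
rewrite (mem_set (conj Rr Ay : wedge kappa (r, y))) /pw /tensor /chi /= invfM.
have -> : (Wa s y)^-1 = Wa (- s) y.
  apply: (mulfI (lt0r_neq0 (Wa_gt0 s Ay))); rewrite WaN // divff // gt_eqF //.
  exact: Wa_gt0.
by rewrite -{1}(WrV r0); ring.
Qed.

Lemma chi_euler h r : test_function (Rpos : set R) h -> 0 < r ->
  chi h r + euler (chi h) r = - chi (fun r => - (2 * beta) * h r - euler h r) r.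
Proof.
move=> [sh _] r0; rewrite /euler.
have := is_deriveM (is_derive1_powR (2 * beta - 1) r0) (smooth_is_derive sh r) => d.
rewrite derive1E (_ : chi h = ((@powR R)^~ (2 * beta - 1)) * h) // (@derive_val _ _ _ _ _ _ _ d).
have e : r `^ (2 * beta - 1 - 1) = r `^ (2 * beta - 1) / r.
  by rewrite (@powRB _ r (2 * beta - 1) 1) ?(gt_eqF r0) ?implybT // powRr1 ?ltW.
have -> : ((@powR R)^~ (2 * beta - 1) * h) r = r `^ (2 * beta - 1) * h r by [].
rewrite e /GRing.scale /chi /=; move: (r `^ (2 * beta - 1)) (h^`()%classic r) (h r) => p q k.
by field; rewrite gt_eqF.
Qed.

Lemma Lop_comp f r : complex.Re (Lop beta f r) = - (2 * beta) * complex.Re (f r) - euler (fun r => complex.Re (f r)) r /\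
  complex.Im (Lop beta f r) = - (2 * beta) * complex.Im (f r) - euler (fun r => complex.Im (f r)) r.
Proof. by rewrite /Lop /eulerc; case: (f r) => a b /=; split; ring. Qed.

Lemma part_test s zeta h w : test_function (angles kappa : set R) zeta ->
  test_function (Rpos : set R) h -> L2c muq (tld Wd (pw kappa Wr s) w) ->
  ip mu (part mu (tld Wd (pw kappa Wr s) w).1 (ta kappa (- s) zeta)) (cut Rpos (fun r => Wr r * h r)) =
    \int[muq]_(p in Wd) (complex.Re (w p) * tensor (chi h) zeta p) /\
  ip mu (part mu (tld Wd (pw kappa Wr s) w).2 (ta kappa (- s) zeta)) (cut Rpos (fun r => Wr r * h r)) =
    \int[muq]_(p in Wd) (complex.Im (w p) * tensor (chi h) zeta p).
Proof.
move=> tz th [A1 A2]; have [Lz _] := ta_L2on (- s) tz.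
have [Lh _] := L2on_L2c (tr_L2on beta (Cc_of_test th th)).
have [q1 q2] := ip_Qw kappa beta s w (tensor (chi h) zeta).
split.
- apply: etrans (ip_part A1 Lh Lz) _; apply: etrans q1.
  by congr (ip _ _ _); exact: tensor_Qw.
- apply: etrans (ip_part A2 Lh Lz) _; apply: etrans q2.
  by congr (ip _ _ _); exact: tensor_Qw.
Qed.

Lemma Dr_r_chi (g : R * R -> R) zeta h l : test_function (angles kappa : set R) zeta ->
  test_function (Rpos : set R) h -> (forall r, l r = - (2 * beta) * h r - euler h r) ->
  - (\int[muq]_(p in Wd) (g p * Dr_r (tensor (chi h) zeta) p)) =
  \int[muq]_(p in Wd) (g p * tensor (chi l) zeta p).
Proof.
move=> [sz _] th hl; have [sc _] := test_powR (2 * beta - 1) th.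
rewrite [X in - X]Rintegral_mkcond [RHS]Rintegral_mkcond -Rintegral_opp; apply: eq_Rintegral => -[r y] _; rewrite !patchE.
case: ifPn => [/set_mem[rR _]|_]; last by rewrite oppr0.
have r0 : 0 < r by move: rR; rewrite RposE.
rewrite (Dr_r_tensor sc sz) /tensor /= -/(chi h) (chi_euler th r0).
have -> : chi (fun r => - (2 * beta) * h r - euler h r) r = chi l r by rewrite /chi hl.
by ring.
Qed.

(** Products of test functions are test functions on the wedge, which turns the
    distributional relation on the wedge into a relation between functions of
    the radius alone. *)
Lemma cpart_euler j u w w' s s' zeta f :
  is_rDr kappa j u w -> is_rDr kappa j.+1 u w' ->
  L2c muq (tld Wd (pw kappa Wr s) w) -> L2c muq (tld Wd (pw kappa Wr s') w') ->
  test_function (angles kappa : set R) zeta -> Cc_infty_Rpos f ->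
  ipc mu (cpart (tld Wd (pw kappa Wr s') w') (ta kappa (- s') zeta)) (tr f) =
  ipc mu (cpart (tld Wd (pw kappa Wr s) w) (ta kappa (- s) zeta)) (tr (Lop beta f)).
Proof.
move=> hw hw' [A1 A2] [A1' A2'] tz Cf.
have CL := Cc_Lop beta Cf; have [tf1 tf2] := Cc_test Cf; have [tl1 tl2] := Cc_test CL.
have tt h : test_function (Rpos : set R) h -> test_function (wedge kappa) (tensor (chi h) zeta).
  by move=> th; exact: (tensor_test (test_powR _ th) tz).
have e1 := etrans (part_test tz tf1 (conj A1' A2')).1 (etrans (rDr_step hw hw' (tt _ tf1)).1
  (Dr_r_chi (fun p => complex.Re (w p)) tz tf1 (fun r => (Lop_comp f r).1))).
have e2 := etrans (part_test tz tf2 (conj A1' A2')).2 (etrans (rDr_step hw hw' (tt _ tf2)).2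
  (Dr_r_chi (fun p => complex.Im (w p)) tz tf2 (fun r => (Lop_comp f r).2))).
exact: (f_equal2 +%R (etrans e1 (esym (part_test tz tl1 (conj A1 A2)).1))
  (etrans e2 (esym (part_test tz tl2 (conj A1 A2)).2))).
Qed.

End wedge_euler.

(** * The isomorphism *)

Section mellin_transport.
Context {R : realType}.
Notation mu := (@lebesgue_measure R).
Notation muq := (@lebesgue_measure R \x @lebesgue_measure R)%E.
Notation T2 := (measurableTypeR R * measurableTypeR R)%type.
Variables (kappa : R) (kappa_gt0 : 0 < kappa).
Notation An := (angles kappa : set (measurableTypeR R)).
Notation Wd := (wedge kappa : set T2).
Notation Rp := (Rpos : set (measurableTypeR R)).
Notation Wa := (Wa kappa).
Notation V := ((R -> R) * (R -> R))%type.
Notation W := ((R * R -> R) * (R * R -> R))%type.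
Implicit Types (A B : W) (a b : V) (x y r t s : R) (j : nat).

#[local] Instance ae_mu_transport : Filter (almost_everywhere mu) :=
  ae_filter_ringOfSetsType mu.

Let H := L2_hilbert mu.
Let HQ := L2_hilbert muq.
Let mA : measurable An := measurable_angles kappa.

Variable beta : R.
Notation MP := (MP beta).
Notation tr := (tr beta).
Notation REL := (REL beta (angles kappa)).

Lemma MP_ae_right a b b' : MP a b -> L2c mu b' ->
  {ae mu, forall t, b'.1 t = b.1 t /\ b'.2 t = b.2 t} -> MP a b'.
Proof.
move=> [Sa [b1 b2] h] [c1 c2] e; split => // f Cf; rewrite (h _ Cf).
have [m1 m2] := Mt_L2c (tr_ccc beta Cf); congr (_ + _).
- by apply: (ip_ae b1 c1 m1 m1); [apply: filterS e => t [->]|exact: aeW].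
- by apply: (ip_ae b2 c2 m2 m2); [apply: filterS e => t [_ ->]|exact: aeW].
Qed.

Lemma MP_ae_left a a' b : MP a b -> pairS (L2on mu Rpos) a' ->
  {ae mu, forall r, a'.1 r = a.1 r /\ a'.2 r = a.2 r} -> MP a' b.
Proof.
move=> [Sa Sb h] Sa' e; split => // f Cf; rewrite -(h _ Cf).
have [m1 m2] := L2on_L2c (tr_L2on beta Cf); have [a1 a2] := L2on_L2c Sa.
have [c1 c2] := L2on_L2c Sa'; congr (_ + _).
- by apply: (ip_ae c1 a1 m1 m1); [apply: filterS e => t [->]|exact: aeW].
- by apply: (ip_ae c2 a2 m2 m2); [apply: filterS e => t [_ ->]|exact: aeW].
Qed.

Lemma rows_cols (F G : R * R -> R) : measurable_fun (setT : set T2) F -> L2 muq G ->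
  {ae mu, forall x, {ae mu, forall y, F (x, y) = G (x, y)}} ->
  L2 muq F /\ {ae mu, forall y, {ae mu, forall x, F (x, y) = G (x, y)}}.
Proof.
move=> mF LG h; have mD : measurable_fun (setT : set T2) (F - G).
  by apply: measurable_funB => //; case: LG.
have h' : {ae mu, forall x, {ae mu, forall y, (F - G) (x, y) = 0}}.
  apply: filterS h => x hx; apply: filterS hx => y e.
  by rewrite (_ : (F - G) (x, y) = F (x, y) - G (x, y)) // e subrr.
have [LD D0] := rows_null mD h'; split.
  by have := hSD HQ LD LG; rewrite subrK.
apply: filterS (null_cols LD D0) => y hy; apply: filterS hy => x.
by rewrite (_ : (F - G) (x, y) = F (x, y) - G (x, y)) // => /subr0_eq.
Qed.

Definition rows_eq A B := {ae mu, forall x, {ae mu, forall y, A.1 (x, y) = B.1 (x, y) /\ A.2 (x, y) = B.2 (x, y)}}.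
Definition cmeas A := measurable_fun (setT : set T2) A.1 /\ measurable_fun (setT : set T2) A.2.

Lemma rows_cols2 A B : cmeas A -> L2c muq B -> rows_eq A B -> L2c muq A /\
  {ae mu, forall y, {ae mu, forall x, A.1 (x, y) = B.1 (x, y) /\ A.2 (x, y) = B.2 (x, y)}}.
Proof.
move=> [m1 m2] [B1 B2] h.
have h1 : {ae mu, forall x, {ae mu, forall y, A.1 (x, y) = B.1 (x, y)}}.
  by apply: filterS h => x hx; apply: filterS hx => y [].
have h2 : {ae mu, forall x, {ae mu, forall y, A.2 (x, y) = B.2 (x, y)}}.
  by apply: filterS h => x hx; apply: filterS hx => y [].
have [A1 e1] := rows_cols m1 B1 h1; have [A2 e2] := rows_cols m2 B2 h2.
by split => //; apply: filterS2 e1 e2 => y k1 k2; apply: filterS2 k1 k2 => x.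
Qed.

Lemma REL_ae_right A B B' : REL A B -> cmeas B' -> rows_eq B' B ->
  (forall x y, ~ angles kappa y -> B'.1 (x, y) = 0 /\ B'.2 (x, y) = 0) -> REL A B'.
Proof.
move=> [LA LB A0 B0 h] mB' e B'0; have [LB' e'] := rows_cols2 mB' LB e; split => //.
apply: filterS3 h e' (ae_col LB') => y hy ey Ly.
by apply: (MP_ae_right hy Ly); apply: filterS ey => x.
Qed.

Lemma REL_ae_left A A' B : REL A B -> cmeas A' -> rows_eq A' A ->
  (forall x y, ~ (Rpos x /\ angles kappa y) -> A'.1 (x, y) = 0 /\ A'.2 (x, y) = 0) -> REL A' B.
Proof.
move=> [LA LB A0 B0 h] mA' e A'0; have [LA' e'] := rows_cols2 mA' LA e; split => //.
apply: filterS3 h e' (ae_col LA') => y hy ey Ly.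
by apply: (MP_ae_left hy (col_on Ly A'0)); apply: filterS ey => x.
Qed.

Lemma WaD2 s y : angles kappa y -> Wa (s + 2) y = Wa s y * Wa 2 y.
Proof.
move=> /rho_gt0 h; rewrite /Wa -powRD ?(gt_eqF h) ?implybT //.
by congr (_ `^ _); field.
Qed.

Lemma L2_Wa2 (f : R -> R) : L2on mu (angles kappa) f -> L2on mu (angles kappa) (cut An (fun y => Wa 2 y * f y)).
Proof.
move=> [Lf f0]; split; last by move=> y nA; rewrite /cut memNset.
have [mf _] := Lf.
apply: (L2_le _ (hSZ H kappa Lf)).
  apply: (measurable_cut mA); apply: measurable_funM; first exact: (@measurable_Wa R kappa 2).
  exact: measurable_funTS.
move=> y; rewrite /cut; case: ifPn => [/set_mem yA|_]; last by rewrite normr0.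
have /rho_gt0 r0 := yA; have -> : Wa 2 y = rho kappa y by rewrite /Wa divff // powRr1 // ltW.
rewrite (_ : (kappa *: f) y = kappa * f y) // !normrM ler_wpM2r //.
rewrite !gtr0_norm // /rho ge_min; move: yA; rewrite anglesE => /andP[h1 h2].
by rewrite (ltW h2).
Qed.

(** For each member [zeta] of a total system of the second variable, the strong
    Euler relation gives a relation between coefficients of rows; totality turns
    it into a pointwise relation. The factor [Wa 2] accounts for the difference
    between the weights of [A] and [A']. *)
Lemma euler_rows s A A' B B' : REL A B -> REL A' B' ->
  (forall zeta f, test_function (angles kappa : set R) zeta -> Cc_infty_Rpos f ->
    ipc mu (cpart A' (ta kappa (- (s + 2)) zeta)) (tr f) =
    ipc mu (cpart A (ta kappa (- s) zeta)) (tr (Lop beta f))) ->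
  {ae mu, forall t, {ae mu, forall y,
    B'.1 (t, y) = Wa 2 y * (- beta * B.1 (t, y) - t * B.2 (t, y)) /\
    B'.2 (t, y) = Wa 2 y * (t * B.1 (t, y) - beta * B.2 (t, y))}}.
Proof.
move=> h h' e; have [_ LB _ B0 _] := h; have [_ LB' _ B0' _] := h'.
have EaE m : Ea kappa_gt0 (s + 2) 0 m = ta kappa (- (s + 2)) (em kappa_gt0 (s + 2) 0 m).
  by rewrite /Ea addr0.
pose q m := ta kappa (- s) (em kappa_gt0 (s + 2) 0 m).
have te m := em_test kappa_gt0 (s + 2) 0 m.
have Lq m : L2on mu (angles kappa) (q m) := ta_L2on (- s) (te m).
have [Se oe ne] := Ea_on kappa_gt0 (s + 2) 0.
have key m : {ae mu, forall t,
   part mu B'.1 (Ea kappa_gt0 (s + 2) 0 m) t = - beta * part mu B.1 (q m) t - t * part mu B.2 (q m) t /\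
   part mu B'.2 (Ea kappa_gt0 (s + 2) 0 m) t = t * part mu B.1 (q m) t - beta * part mu B.2 (q m) t}.
  have h1 := REL_cpart h (Lq m).1; have h2 := REL_cpart h' (Se m).1.
  apply: (euler_strong h1 h2) => f Cf; rewrite EaE; exact: (e _ f (te m) Cf).
have qE m y : angles kappa y -> Wa 2 y * Ea kappa_gt0 (s + 2) 0 m y = q m y.
  move=> yA; rewrite EaE /q /ta /cut mem_set // mulrA; congr (_ * _).
  have w0 := lt0r_neq0 (Wa_gt0 (s + 2) yA).
  apply: (mulfI w0); rewrite mulrCA WaN // mulr1 WaD2 // mulrAC WaN // mul1r //.
apply: filterS3 (ae_foralln key) (ae_row LB) (ae_row LB') => t kt [b1 b2] [b1' b2'].
have on (F : R * R -> R) : L2 mu (fun y => F (t, y)) -> (forall y, ~ angles kappa y -> F (t, y) = 0) ->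
  L2on mu (angles kappa) (fun y => F (t, y)) by [].
have c1 : L2on mu (angles kappa) (fun y => B.1 (t, y)) by apply: on => // y /(B0 t)[].
have c2 : L2on mu (angles kappa) (fun y => B.2 (t, y)) by apply: on => // y /(B0 t)[].
have c1' : L2on mu (angles kappa) (fun y => B'.1 (t, y)) by apply: on => // y /(B0' t)[].
have c2' : L2on mu (angles kappa) (fun y => B'.2 (t, y)) by apply: on => // y /(B0' t)[].
have HA := L2on_hilbert mu mA.
have main (f g k : R -> R) (p1 p2 : R) : L2on mu (angles kappa) f -> L2on mu (angles kappa) g -> L2on mu (angles kappa) k ->
    (forall m, ip mu f (Ea kappa_gt0 (s + 2) 0 m) = p1 * ip mu g (q m) + p2 * ip mu k (q m)) ->
    {ae mu, forall y, f y = Wa 2 y * (p1 * g y + p2 * k y)}.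
  move=> Lf Lg Lk E; pose l := p1 *: g + p2 *: k.
  have Ll : L2on mu (angles kappa) l := hSD HA (hSZ HA _ Lg) (hSZ HA _ Lk).
  have Lv := L2_Wa2 Ll; pose v := cut An (fun y => Wa 2 y * l y).
  have LD : L2on mu (angles kappa) (f - v) := hSB HA Lf Lv.
  have D0 m : ip mu (f - v) (Ea kappa_gt0 (s + 2) 0 m) = 0.
    rewrite (hipB HA Lf Lv (Se m)) E; apply/eqP; rewrite subr_eq0; apply/eqP.
    transitivity (ip mu l (q m)).
      by rewrite (hipD HA (hSZ HA _ Lg) (hSZ HA _ Lk) (Lq m)) (hipZ HA _ Lg (Lq m)) (hipZ HA _ Lk (Lq m)).
    apply: eq_Rintegral => y _; rewrite /v /cut; case: ifPn => [/set_mem yA|].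
      by rewrite -(qE m y yA); ring.
    by rewrite notin_setE => nA; rewrite (Lq m).2 // mulr0 mul0r.
  have := L2_norm0_ae LD.1 (Ea_total LD D0); apply: filterS => y.
  rewrite (_ : (f - v) y = f y - v y) // => /subr0_eq ->; rewrite /v /cut; case: ifPn => //.
  by rewrite notin_setE => nA; rewrite Lg.2 // Lk.2 // !mulr0 addr0 mulr0.
have r1 := main _ _ _ (- beta) (- t) c1' c1 c2 (fun m => etrans (kt m).1 (congr1 (fun z => _ + z) (esym (mulNr _ _)))).
have r2 := main _ _ _ t (- beta) c2' c1 c2 (fun m => etrans (kt m).2 (congr1 (fun z => _ + z) (esym (mulNr _ _)))).
by apply: filterS2 r1 r2 => y -> ->; split; ring.
Qed.

End mellin_transport.

Section isomorphism.
Context {R : realType}.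
Notation mu := (@lebesgue_measure R).
Notation muq := (@lebesgue_measure R \x @lebesgue_measure R)%E.
Notation T2 := (measurableTypeR R * measurableTypeR R)%type.
Variables (kappa : R) (kappa_gt0 : 0 < kappa) (gamma : nat) (Theta theta : R).
Notation beta := (theta / 2).
Notation An := (angles kappa : set (measurableTypeR R)).
Notation Wd := (strip kappa (Rpos : set R) : set T2).
Notation ST := (strip kappa (setT : set R) : set T2).
Notation Rp := (Rpos : set (measurableTypeR R)).
Notation Wa := (Wa kappa).
Notation W := ((R * R -> R) * (R * R -> R))%type.
Notation sj := (sj Theta).
Notation tlY := (tlY kappa Theta theta).
Notation tenergy := (tenergy kappa_gt0).
Notation REL := (REL beta (angles kappa)).
Notation Ygood := (Ygood kappa_gt0 Theta theta gamma).
Implicit Types (A B : W) (u w : R * R -> R[i]) (U : R[i] * R -> R[i]) (x y r t s : R) (j : nat).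

#[local] Instance ae_mu_iso : Filter (almost_everywhere mu) :=
  ae_filter_ringOfSetsType mu.

Let mA : measurable An := measurable_angles kappa.
Let mW : measurable Wd := measurable_strip kappa (@measurable_Rp R).
Let mRp : measurable Rp := @measurable_Rp R.

Definition tlP s u : W := tld Wd (pw kappa (Wr beta) s) u.

Lemma tlP_out s u x y : ~ (Rpos x /\ angles kappa y) -> (tlP s u).1 (x, y) = 0 /\ (tlP s u).2 (x, y) = 0.
Proof. by move=> n; rewrite /tlP /tld /cut /= memNset. Qed.

Lemma tlY_out j U x y : ~ angles kappa y -> (tlY j U).1 (x, y) = 0 /\ (tlY j U).2 (x, y) = 0.
Proof. by move=> n; rewrite /tlY /tld /cut /= memNset // => -[]. Qed.

Lemma tlP_meas s u : cmeasurable Wd u -> cmeas (tlP s u).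
Proof. by move=> mu'; exact: (tld_measurable mW (@measurable_pwb R kappa beta s) mu'). Qed.

Lemma tlP_eq s u u' : {ae mu, forall x, Rpos x -> {ae mu, forall y, angles kappa y -> u (x, y) = u' (x, y)}} ->
  rows_eq (tlP s u) (tlP s u').
Proof.
move=> h; apply: filterS h => x hx; have [xR|nR] := pselect (Rpos x).
  apply: filterS (hx xR) => y e; rewrite /tlP /tld /cut /=.
  by case: ifPn => // /set_mem[_ yA]; rewrite e.
by apply: aeW => y; rewrite /tlP /tld /cut /= memNset // => -[].
Qed.

Lemma Wr_theta r : 0 < r -> r `^ (theta - 1) = Wr beta r ^+ 2.
Proof. by move=> r0; rewrite Wr_sq //; congr (_ `^ _); field. Qed.

Definition has_rDr u := forall j, (j <= gamma)%N -> is_rDr kappa j u (rDr kappa j u).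

Lemma has_rDrP u : (forall j, (j <= gamma)%N -> exists w, is_rDr kappa j u w) -> has_rDr u.
Proof.
by move=> h j hj; apply: (xgetPex (P := [set w | is_rDr kappa j u w]) (fun=> 0)); exact: h.
Qed.

Lemma is_rDr_meas j u w : is_rDr kappa j u w -> cmeasurable Wd w.
Proof. by case=> _ []. Qed.

Lemma Pnorm_energy u : has_rDr u -> (forall j, (j <= gamma)%N -> L2c muq (tlP (sj j) (rDr kappa j u))) ->
  Pnorm kappa gamma Theta theta u =
  ((\sum_(j < gamma.+1) \sum_(a < (gamma - j).+1) tenergy (sj j) a (tlP (sj j) (rDr kappa j u))) `^ 2^-1)%E.
Proof.
move=> hu Lu; rewrite /Pnorm; case: asboolP => [_|n]; last first.
  by exfalso; apply: n => j hj; exists (rDr kappa j u); exact: hu.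
congr (_ `^ _)%E.
pose F (j : 'I_gamma.+1) r := ((Wr beta r ^+ 2)%:E *
  Hnorm kappa (gamma - j) (Theta - 1 + j.*2%:R) (fun phi => rDr kappa j u (r, phi)) ^+ 2)%E.
pose S (j : 'I_gamma.+1) r := (\sum_(a < (gamma - j).+1)
  energy kappa_gt0 (sj j) a (slice1 (tlP (sj j) (rDr kappa j u)) r))%E.
have S0 (j : 'I_gamma.+1) r : (0 <= S j r)%E by apply: sume_ge0 => a _; exact: energy_ge0.
have mE (j : 'I_gamma.+1) a := measurable_energy_row kappa_gt0 (sj j) a (Lu j (ltn_ord j)).
have mS (j : 'I_gamma.+1) : measurable_fun (setT : set (measurableTypeR R)) (S j) by apply: emeasurable_sum => a; exact: mE.
have FS (j : 'I_gamma.+1) : {ae mu, forall r, Rpos r -> F j r = S j r}.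
  exact: (Hnorm_row kappa_gt0 (gamma - j) mRp (@Wr_gt0 R beta) (is_rDr_meas (hu j (ltn_ord j))) (Lu j (ltn_ord j))).
have FSn : {ae mu, forall r, forall n, forall h : (n < gamma.+1)%N, Rpos r -> F (Ordinal h) r = S (Ordinal h) r}.
  apply: ae_foralln => n; have [h|h] := pselect (n < gamma.+1)%N.
    by apply: filterS (FS (Ordinal h)) => r e h' /e; rewrite (bool_irrelevance h' h).
  by apply: aeW => r h'; case: h.
rewrite (@ae_eq_ge0_integral _ _ _ mu Rp _ (fun r => \sum_(j < gamma.+1) S j r)%E).
- rewrite integral_mkcond (_ : _ \_ _ = (fun r => \sum_(j < gamma.+1) S j r)%E).
    rewrite (ge0_integral_sum mu measurableT mS); last by move=> j r _; exact: S0.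
    apply: eq_bigr => j _; have Lj := Lu j (ltn_ord j).
    rewrite (ge0_integral_sum mu measurableT (fun a : 'I_(gamma - j).+1 => mE j a)).
      by apply: eq_bigr => a _; exact: tenergy_rows.
    by move=> a r _; exact: energy_ge0.
  apply/funext => r; rewrite patchE; case: ifPn => //; rewrite notin_setE => nR.
  by rewrite big1 // => j _; rewrite /S big1 // => a _; exact: energy_row_out.
- by move=> r _; rewrite mule_ge0 ?lee_fin ?powR_ge0 // sume_ge0 // => j _; exact: sqre_ge0.
- by move=> r _; apply: sume_ge0 => j _; exact: S0.
apply: filterS FSn => r e rR; have r0 : 0 < r by move: rR; rewrite RposE.
rewrite ge0_sume_distrr; last by move=> j _; exact: sqre_ge0.
apply: eq_bigr => -[j h] _; rewrite -(e j h rR) /F; congr (_ * _)%E; congr EFin.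
exact: Wr_theta.
Qed.

Lemma P_data u : Pspace kappa gamma Theta theta u -> has_rDr u /\
  forall j, (j <= gamma)%N -> L2c muq (tlP (sj j) (rDr kappa j u)).
Proof.
move=> [lu]; rewrite /Pnorm; case: asboolP => // ex fin; have hu := has_rDrP ex; split => // j hj.
have {}fin : (\int[mu]_(r in Rp) ((r `^ (theta - 1))%:E * \sum_(j < gamma.+1)
    Hnorm kappa (gamma - j) (Theta - 1 + j.*2%:R) (fun phi => rDr kappa j u (r, phi)) ^+ 2) < +oo)%E.
  by apply: lty_poweRy fin; rewrite invr_eq0 pnatr_eq0.
apply: (L2c_tld mRp (@measurable_Wr R beta) (is_rDr_meas (hu j hj))).
apply: le_lt_trans fin; apply: le_ge0_integral => r rR.
  rewrite mule_ge0 ?lee_fin ?sqr_ge0 // integral_ge0 // => y _.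
  by rewrite lee_fin mulr_ge0 ?sqr_ge0.
have r0 : 0 < r by move: rR; rewrite RposE.
rewrite (Wr_theta r0); apply: lee_wpmul2l; first by rewrite lee_fin sqr_ge0.
apply: (le_trans (Hnorm_ge kappa_gt0 (gamma - j) (Theta - 1 + j.*2%:R) _)).
have jg : (j < gamma.+1)%N by [].
rewrite (bigD1 (Ordinal jg)) //= leeDl // sume_ge0 // => i _; exact: sqre_ge0.
Qed.

(** Two functions correspond to each other when their weighted versions form
    Mellin pairs for almost every angle. *)
Definition Rel u U := REL (tlP (sj 0) u) (tlY 0 U).

Lemma sjS j : sj j.+1 = sj j + 2.
Proof. by rewrite /sj doubleS -addn2 natrD; ring. Qed.

Lemma tlYS j U t y : (tlY j.+1 U).1 (t, y) = Wa 2 y * (- beta * (tlY j U).1 (t, y) - t * (tlY j U).2 (t, y)) /\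
  (tlY j.+1 U).2 (t, y) = Wa 2 y * (t * (tlY j U).1 (t, y) - beta * (tlY j U).2 (t, y)).
Proof.
have [yA|nA] := pselect (angles kappa y); last first.
  have [-> ->] := tlY_out j.+1 U t nA; have [-> ->] := tlY_out j U t nA.
  by rewrite !mulr0 subrr mulr0.
rewrite /tlY /tld /cut /= mem_set; last by split.
have -> : Uj theta j.+1 U (t, y) = lam theta t * Uj theta j U (t, y).
  by rewrite /Uj /= exprS mulrA.
rewrite /pw /= sjS (WaD2 _ yA) /lam /vline; case: (Uj theta j U (t, y)) => p q /=; split; ring.
Qed.

Lemma REL_tenergy A B s a : REL A B -> tenergy s a A = tenergy s a B.
Proof. exact: tenergy_REL. Qed.

Lemma norms_eq u U : has_rDr u -> cmeasurable ST (onl theta U) ->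
  (forall j, (j <= gamma)%N -> REL (tlP (sj j) (rDr kappa j u)) (tlY j U)) ->
  Pnorm kappa gamma Theta theta u = Ynorm kappa gamma Theta theta U.
Proof.
move=> hu mU h.
have LP j : (j <= gamma)%N -> L2c muq (tlP (sj j) (rDr kappa j u)) by move=> /h[].
have LY j : (j <= gamma)%N -> L2c muq (tlY j U) by move=> /h[].
apply: etrans (Pnorm_energy hu LP) _; apply: etrans (esym (Ynorm_energy kappa_gt0 mU LY)).
apply: (congr1 (fun z => poweR z 2^-1)); apply: eq_bigr => j _; apply: eq_bigr => a _.
exact: (REL_tenergy (sj j) a (h j (ltn_ord j))).
Qed.

(** The transforms [B j] of the Euler derivatives of [u] are constructed
    independently of each other. They are then recognised as [lambda ^ j] times
    the first one by repeated use of the strong Euler relation. *)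
Lemma P_to_Y u : Pspace kappa gamma Theta theta u ->
  exists U, [/\ Ygood U, Ynorm kappa gamma Theta theta U = Pnorm kappa gamma Theta theta u & Rel u U].
Proof.
move=> Pu; have [lu _] := Pu; have [hu Lu] := P_data Pu.
pose A j := tlP (sj j) (rDr kappa j u).
have exB j : exists B, (j <= gamma)%N -> REL (A j) B.
  have [hj|n] := boolP (j <= gamma)%N; last by exists 0 => h; case/negP: n.
  have [B hB] := REL_right beta mA (Lu j hj) (@tlP_out (sj j) (rDr kappa j u)).
  by exists B.
have [B hB] := choice exB.
have [_ [[mB1 _] [mB2 _]] _ B00 _] := hB 0%N (leq0n _).
pose G := untld (pw kappa (fun=> kk) (sj 0)) (B 0%N).
pose U (z : R[i] * R) : R[i] := G (complex.Im z.1, z.2).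
have mG : cmeasurable ST G.
  apply: (untld_measurable (c := B 0%N) _ mB1 mB2).
  have mp : measurable_fun ST (pw kappa (fun=> kk^-1) (- sj 0)) by exact: measurable_pw.
  apply: eq_measurable_fun mp => p /set_mem[_ pA].
  rewrite /pw invfM; congr (_ * _); apply: (mulfI (lt0r_neq0 (Wa_gt0 (sj 0) pA))).
  by rewrite WaN // divff // gt_eqF // Wa_gt0.
have UG : onl theta U = G by apply/funext => -[t y].
have mU : cmeasurable ST (onl theta U) by rewrite UG.
have Y0 : tlY 0 U = B 0%N.
  rewrite /tlY (_ : Uj theta 0 U = G); last by apply/funext => p; rewrite /Uj expr0 mul1r UG.
  apply: untldK => /=.
  - by move=> p [_ pA]; rewrite mulr_gt0 ?kk_gt0 ?Wa_gt0.
  - by move=> [t y] n; have [] := B00 t y; [move=> yA; apply: n; split|].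
  - by move=> [t y] n; have [] := B00 t y; [move=> yA; apply: n; split|].
have mY j : cmeas (tlY j U).
  have mk : measurable_fun ST (pw kappa (fun=> kk) (sj j)) by exact: measurable_pw.
  have mv : cmeasurable ST (Uj theta j U) := cmeasurable_lamX theta j mU.
  exact: (tld_measurable (mST kappa) mk mv).
have step j : (j < gamma)%N -> rows_eq (tlY j U) (B j) -> rows_eq (tlY j.+1 U) (B j.+1).
  move=> hj; have hj' := ltnW hj.
  have hE (zeta : R -> R) (f : R -> R[i]) : test_function (angles kappa : set R) zeta -> Cc_infty_Rpos f ->
      ipc mu (cpart (A j.+1) (ta kappa (- (sj j + 2)) zeta)) (tr beta f) =
      ipc mu (cpart (A j) (ta kappa (- sj j) zeta)) (tr beta (Lop beta f)).
    move=> tz Cf; rewrite -sjS.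
    exact: (cpart_euler (hu j hj') (hu j.+1 hj) (Lu j hj') (Lu j.+1 hj) tz Cf).
  have := euler_rows kappa_gt0 (hB j hj') (hB j.+1 hj) hE => e1 e2.
  apply: filterS2 e1 e2 => t h1 h2; apply: filterS2 h1 h2 => y [k1 k2] [l1 l2].
  by have [-> ->] := tlYS j U t y; rewrite k1 k2 l1 l2.
have YB j : (j <= gamma)%N -> rows_eq (tlY j U) (B j).
  elim: j => [_|j IH hj]; last by apply: step => //; apply: IH; exact: ltnW.
  by rewrite Y0; apply: aeW => t; apply: aeW => y.
have RY j : (j <= gamma)%N -> REL (A j) (tlY j U).
  by move=> hj; apply: (REL_ae_right (hB j hj) (mY j) (YB j hj)) => x y; exact: tlY_out.
have NE := norms_eq hu mU RY.
exists U; split; last 2 first.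
- by rewrite NE.
- apply: (REL_ae_left (RY 0%N (leq0n _)) (tlP_meas _ lu.1)).
    apply: tlP_eq; exact: (rDr_unique kappa_gt0 (rDr0 lu) (hu 0%N (leq0n _))).
  exact: tlP_out.
split => // j hj; have RYj := RY j hj; have [_ LY _ _ _] := RYj; split => // a ha.
have [_ fin] := Pu; have S := Pnorm_energy hu Lu; rewrite S in fin.
have {}fin := lty_poweRy _ fin; have {fin} := fin _; rewrite invr_eq0 pnatr_eq0 => /(_ isT).
have jg : (j < gamma.+1)%N by []. have ag : (a < (gamma - j).+1)%N by [].
apply: le_lt_trans; rewrite -(REL_tenergy (sj j) a RYj) (bigD1 (Ordinal jg)) //= (bigD1 (Ordinal ag)) //=.
have t0 i b : (0 <= tenergy (sj i) b (tlP (sj i) (rDr kappa i u)))%E by exact: tenergy_ge0.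
rewrite -addeA leeDl // adde_ge0 // sume_ge0 // => i _; rewrite ?t0 //.
by apply: sume_ge0 => b _; exact: t0.
Qed.

End isomorphism.

Section fibrewise_euler.
Context {R : realType}.
Notation mu := (@lebesgue_measure R).
Notation muq := (@lebesgue_measure R \x @lebesgue_measure R)%E.
Notation T2 := (measurableTypeR R * measurableTypeR R)%type.
Variables (kappa : R) (kappa_gt0 : 0 < kappa) (beta : R).
Notation An := (angles kappa : set (measurableTypeR R)).
Notation Wd := (wedge kappa : set T2).
Notation Wa := (Wa kappa).
Notation Wr := (Wr beta).
Notation tr := (tr beta).
Notation MP := (MP beta).
Notation V := ((R -> R) * (R -> R))%type.
Notation W := ((R * R -> R) * (R * R -> R))%type.
Implicit Types (A B : W) (v : V) (eta F G : R * R -> R) (h l : R -> R) (w : R * R -> R[i]) (x y r t s : R) (j : nat).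

#[local] Instance ae_mu_fibre : Filter (almost_everywhere mu) :=
  ae_filter_ringOfSetsType mu.

Let H := L2_hilbert mu.

Lemma ip_cols F G : L2 muq F -> L2 muq G ->
  measurable_fun (setT : set (measurableTypeR R)) (fun y => ip mu (fun x => F (x, y)) (fun x => G (x, y))) /\
  ip muq F G = \int[mu]_y ip mu (fun x => F (x, y)) (fun x => G (x, y)).
Proof.
move=> LF LG; have I0 := L2_mul_integrable LF LG.
have mI := measurable_fubini_G I0.
have mf : measurable_fun (setT : set (measurableTypeR R)) (fun y => fine (fubini_G mu (EFin \o (fun z => F z * G z)) y)).
  exact: (measurableT_comp (fine_measurable measurableT) mI).
split; first exact: mf.
rewrite /ip /Rintegral; congr fine; apply: etrans (esym (integral21_prod_meas1 I0)) _.
apply: ae_eq_integral => //; first by apply/measurable_EFinP; exact: mf.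
apply: filterS2 (L2_slice2 LF) (L2_slice2 LG) => y Fy Gy _.
rewrite /fubini_G /= fineK //; exact: (integrable_fin_num measurableT (L2_mul_integrable Fy Gy)).
Qed.

Lemma ip_cols_eq F G F' G' : L2 muq F -> L2 muq G -> L2 muq F' -> L2 muq G' ->
  {ae mu, forall y, ip mu (fun x => F (x, y)) (fun x => G (x, y)) =
    - ip mu (fun x => F' (x, y)) (fun x => G' (x, y))} -> ip muq F G = - ip muq F' G'.
Proof.
move=> LF LG LF' LG' e; have [m1 ->] := ip_cols LF LG; have [m2 ->] := ip_cols LF' LG'.
rewrite -Rintegral_opp /Rintegral; congr fine; apply: ae_eq_integral => //.
- by apply/measurable_EFinP; exact: m1.
- have mo : measurable_fun setT (fun z : R => - z) by apply: continuous_measurable; exact: opp_continuous.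
  by apply/measurable_EFinP; exact: (measurableT_comp mo m2).
by apply: filterS e => y -> _.
Qed.

Lemma slice_test eta y : test_function (wedge kappa) eta -> test_function (Rpos : set R) (slice eta y).
Proof.
move=> [se [K [cK KW e0]]]; split; first exact: smooth_slice.
exists (fst @` K); split.
- by apply: continuous_compact => //; apply: continuous_subspaceT => p; exact: cvg_fst.
- by move=> _ [p /KW[h _] <-].
by move=> r n; apply: e0 => k; apply: n; exists (r, y).
Qed.

Lemma Qw_slice s (eta : R * R -> R) h y : angles kappa y ->
  (forall r, 0 < r -> chi beta h r = eta (r, y)) ->
  (fun r => Qw kappa beta s eta (r, y)) = Wa (- s) y *: cut Rpos (fun r => Wr r * h r).
Proof.
move=> yA e; apply/funext => r; rewrite /Qw /cut /=.
have -> : (Wa (- s) y *: (fun x => if x \in Rpos then Wr x * h x else 0)) r =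
  Wa (- s) y * (if r \in Rpos then Wr r * h r else 0) by [].
have [rR|nR] := boolP (r \in Rpos); last first.
  have -> : ((r, y) \in wedge kappa) = false.
    by apply/negbTE; move: nR; rewrite !notin_setE => nR [].
  by rewrite mulr0.
have Rr := set_mem rR; have r0 : 0 < r by move: Rr; rewrite RposE.
rewrite (mem_set (conj Rr yA : wedge kappa (r, y))) /pw /= invfM -(e r r0) /chi.
have -> : (Wa s y)^-1 = Wa (- s) y.
  apply: (mulfI (lt0r_neq0 (Wa_gt0 s yA))); rewrite WaN // divff // gt_eqF //.
  exact: Wa_gt0.
by rewrite -{2}(WrV beta r0); ring.
Qed.

Lemma Qw_slice_out s (eta : R * R -> R) y : ~ angles kappa y -> (fun r => Qw kappa beta s eta (r, y)) = 0.
Proof. by move=> nA; apply/funext => r; rewrite /Qw /cut memNset // => -[]. Qed.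

Lemma weak_components v v' h : pairS (L2on mu Rpos) v -> pairS (L2on mu Rpos) v' ->
  (forall f, Cc_infty_Rpos f -> ipc mu v' (tr f) = ipc mu v (tr (Lop beta f))) ->
  test_function (Rpos : set R) h ->
  let l r := - (2 * beta) * h r - euler h r in
  ip mu v'.1 (cut Rpos (fun r => Wr r * h r)) = ip mu v.1 (cut Rpos (fun r => Wr r * l r)) /\
  ip mu v'.2 (cut Rpos (fun r => Wr r * h r)) = ip mu v.2 (cut Rpos (fun r => Wr r * l r)).
Proof.
move=> [[v1 _] [v2 _]] [[v1' _] [v2' _]] e th l.
have ip0 f : L2 mu f -> ip mu f 0 = 0 by move=> Lf; rewrite (hipC H); exact: (hip0 H Lf).
have z : cut (Rpos : set R) (fun r => Wr r * 0) = 0.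
  by apply/funext => r; rewrite /cut mulr0 if_same.
have t0 : test_function (Rpos : set R) (fun=> 0 : R).
  by apply: (@test0 R R); exists 1; rewrite RposE.
have eu0 r : euler (fun=> 0 : R) r = 0 by rewrite /euler derive1_cst mulr0.
pose f1 r : R[i] := Complex (h r) 0; pose f2 r : R[i] := Complex 0 (h r).
have C1 : Cc_infty_Rpos f1 := Cc_of_test th t0.
have C2 : Cc_infty_Rpos f2 := Cc_of_test t0 th.
have L1 : tr (Lop beta f1) = (cut Rpos (fun r => Wr r * l r), 0).
  rewrite /tr /tld -z; congr (_, _); congr (cut _ _); apply/funext => r.
  - by have [-> _] := Lop_comp beta f1 r.
  - by have [_ ->] := Lop_comp beta f1 r; rewrite /f1 /= eu0 mulr0 subrr.
have L2' : tr (Lop beta f2) = (0, cut Rpos (fun r => Wr r * l r)).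
  rewrite /tr /tld -z; congr (_, _); congr (cut _ _); apply/funext => r.
  - by have [-> _] := Lop_comp beta f2 r; rewrite /f2 /= eu0 mulr0 subrr.
  - by have [_ ->] := Lop_comp beta f2 r.
have T1 : tr f1 = (cut Rpos (fun r => Wr r * h r), 0) by rewrite /tr /tld -z.
have T2 : tr f2 = (0, cut Rpos (fun r => Wr r * h r)) by rewrite /tr /tld -z.
have := e _ C1; have := e _ C2; rewrite L1 L2' T1 T2 /pairip /=.
by rewrite (ip0 _ v1) (ip0 _ v2) (ip0 _ v1') (ip0 _ v2') !addr0 !add0r.
Qed.

(** Every test function on the wedge restricts to a test function on each ray, so
    the weak Euler relation may be applied ray by ray and integrated over the
    angle; no density of products is involved. *)
Lemma euler_cols s w w' B B' : cmeasurable Wd w -> cmeasurable Wd w' ->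
  REL beta (angles kappa) (tld Wd (pw kappa Wr s) w) B ->
  REL beta (angles kappa) (tld Wd (pw kappa Wr (s + 2)) w') B' ->
  (forall t y, B'.1 (t, y) = Wa 2 y * (- beta * B.1 (t, y) - t * B.2 (t, y)) /\
    B'.2 (t, y) = Wa 2 y * (t * B.1 (t, y) - beta * B.2 (t, y))) ->
  forall eta, test_function (wedge kappa) eta ->
  \int[muq]_(p in Wd) (complex.Re (w' p) * eta p) = - (\int[muq]_(p in Wd) (complex.Re (w p) * Dr_r eta p)) /\
  \int[muq]_(p in Wd) (complex.Im (w' p) * eta p) = - (\int[muq]_(p in Wd) (complex.Im (w p) * Dr_r eta p)).
Proof.
pose A := tld Wd (pw kappa Wr s) w; pose A' := tld Wd (pw kappa Wr (s + 2)) w'; move=> mw mw' hR hR' e eta te.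
have [[A1 A2] _ A0 _ hA] := hR; have [[A1' A2'] _ A0' _ hA'] := hR'.
have [i1 i2] := ip_Qw kappa beta (s + 2) w' eta.
have [k1 k2] := ip_Qw kappa beta s w (Dr_r eta).
have LQ := Qw_L2 beta (s + 2) te; have LQ' := Qw_L2 beta s (Dr_r_test te).
have [se _] := te.
have main : {ae mu, forall y,
   ip mu (fun x => A'.1 (x, y)) (fun x => Qw kappa beta (s + 2) eta (x, y)) =
     - ip mu (fun x => A.1 (x, y)) (fun x => Qw kappa beta s (Dr_r eta) (x, y)) /\
   ip mu (fun x => A'.2 (x, y)) (fun x => Qw kappa beta (s + 2) eta (x, y)) =
     - ip mu (fun x => A.2 (x, y)) (fun x => Qw kappa beta s (Dr_r eta) (x, y))}.
  apply: filterS2 hA hA' => y my my'.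
  have [[[a1 a1o] [a2 a2o]] _ _] := my; have [[[a1' a1o'] [a2' a2o']] _ _] := my'.
  have ip0 f : L2 mu f -> ip mu f 0 = 0 by move=> Lf; rewrite (hipC H); exact: (hip0 H Lf).
  have [yA|nA] := pselect (angles kappa y); last first.
    rewrite !Qw_slice_out //; have a1z := ip0 _ a1; have a2z := ip0 _ a2.
    have a1z' := ip0 _ a1'; have a2z' := ip0 _ a2'.
    by split; [rewrite a1z' a1z oppr0|rewrite a2z' a2z oppr0].
  have ts := slice_test y te; pose h r := r `^ (1 - 2 * beta) * slice eta y r.
  have th : test_function (Rpos : set R) h := test_powR _ ts.
  pose l r := - (2 * beta) * h r - euler h r.
  have cE r : 0 < r -> chi beta h r = eta (r, y).
    move=> r0; rewrite /chi /h mulrA -powRD ?(gt_eqF r0) ?implybT //.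
    by rewrite (_ : 2 * beta - 1 + (1 - 2 * beta) = 0) ?powRr0 ?mul1r //; ring.
  have mv := MPZ (Wa 2 y) my.
  have W2 : {ae mu, forall t, (col B' y).1 t = (lamc beta (Wa 2 y *: col B y)).1 t /\
      (col B' y).2 t = (lamc beta (Wa 2 y *: col B y)).2 t}.
    apply: aeW => t; have [e1 e2] := e t y.
    have E1 : (lamc beta (Wa 2 y *: col B y)).1 t =
      - beta * (Wa 2 y * B.1 (t, y)) - t * (Wa 2 y * B.2 (t, y)) by [].
    have E2 : (lamc beta (Wa 2 y *: col B y)).2 t =
      t * (Wa 2 y * B.1 (t, y)) - beta * (Wa 2 y * B.2 (t, y)) by [].
    by rewrite E1 E2; split; [apply: etrans e1 _|apply: etrans e2 _]; ring.
  have we := euler_weak mv my' W2.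
  have [Sv _ _] := mv; have [Sv' _ _] := my'.
  have [c1 c2] := weak_components Sv Sv' we th.
  have Q1 := Qw_slice (s + 2) yA cE.
  have Q2 : (fun r => Qw kappa beta s (Dr_r eta) (r, y)) = Wa (- s) y *: cut Rpos (fun r => Wr r * (- l r)).
    apply: Qw_slice => // r r0; rewrite (Dr_r_slice _ _ se) -(cE r r0).
    have -> : (slice eta y)^`()%classic r = (chi beta h)^`()%classic r.
      rewrite !derive1E; apply: near_eq_derive.
      have nR : nbhs r (Rpos : set R).
        by apply: open_nbhs_nbhs; split; [exact: open_Rpos|rewrite RposE].
      by apply: filterS nR => x; rewrite RposE => x0; rewrite cE.
    rewrite -/(euler (chi beta h) r) (chi_euler beta th r0) /chi -/(l r); ring.
  have Ll : L2 mu (cut Rpos (fun r => Wr r * l r)).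
    have tl : test_function (Rpos : set R) l.
      have := testD (testZ (- (2 * beta)) th) (testZ (-1) (test_euler th)).
      rewrite (_ : _ + _ = l) //; apply/funext => r.
      have -> : ((- (2 * beta)) *: h + (-1 : R) *: euler h) r = - (2 * beta) * h r + -1 * euler h r by [].
      by rewrite /l mulN1r.
    by have [[]] := tr_L2on beta (Cc_of_test tl tl).
  have Lh : L2 mu (cut Rpos (fun r => Wr r * h r)) by have [[]] := tr_L2on beta (Cc_of_test th th).
  have Q2' : cut Rpos (fun r => Wr r * (- l r)) = (-1) *: cut Rpos (fun r => Wr r * l r).
    apply/funext => r; rewrite /cut.
    have -> : ((-1 : R) *: (fun x => if x \in Rpos then Wr x * l x else 0)) r =
      -1 * (if r \in Rpos then Wr r * l r else 0) by [].
    by case: ifP => _; ring.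
  have W3 : Wa (- (s + 2)) y * Wa 2 y = Wa (- s) y.
    apply: (mulfI (lt0r_neq0 (Wa_gt0 (s + 2) yA))).
    by rewrite mulrA WaN // mul1r WaD2 // mulrAC WaN // mul1r.
  rewrite Q1 Q2 Q2' scalerA.
  have fin (a a' : R -> R) : L2 mu a -> L2 mu a' ->
     ip mu a' (cut Rpos (fun r => Wr r * h r)) = ip mu (Wa 2 y *: a) (cut Rpos (fun r => Wr r * l r)) ->
     ip mu a' (Wa (- (s + 2)) y *: cut Rpos (fun r => Wr r * h r)) =
     - ip mu a ((Wa (- s) y * -1) *: cut Rpos (fun r => Wr r * l r)).
    move=> La La' E; rewrite (hipZr H _ Lh La') (hipZr H _ Ll La) E (hipZ H _ La Ll) -W3.
    by move: (ip mu _ _) => q; ring.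
  by split; [exact: fin a1 a1' c1|exact: fin a2 a2' c2].
rewrite -i1 -i2 -k1 -k2; split.
- by apply: (ip_cols_eq A1' LQ A1 LQ'); apply: filterS main => y [].
- by apply: (ip_cols_eq A2' LQ A2 LQ'); apply: filterS main => y [].
Qed.

End fibrewise_euler.

Section inverse_direction.
Context {R : realType}.
Notation mu := (@lebesgue_measure R).
Notation muq := (@lebesgue_measure R \x @lebesgue_measure R)%E.
Notation T2 := (measurableTypeR R * measurableTypeR R)%type.
Variables (kappa : R) (kappa_gt0 : 0 < kappa) (gamma : nat) (Theta theta : R).
Notation beta := (theta / 2).
Notation An := (angles kappa : set (measurableTypeR R)).
Notation Wd := (strip kappa (Rpos : set R) : set T2).
Notation ST := (strip kappa (setT : set R) : set T2).
Notation Wa := (Wa kappa).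
Notation W := ((R * R -> R) * (R * R -> R))%type.
Notation sj := (sj Theta).
Notation tlY := (tlY kappa Theta theta).
Notation tlP := (tlP kappa theta).
Notation tenergy := (tenergy kappa_gt0).
Notation REL := (REL beta (angles kappa)).
Notation Ygood := (Ygood kappa_gt0 Theta theta gamma).
Notation Rel := (Rel kappa Theta theta).
Notation Pspace := (Pspace kappa gamma Theta theta).
Notation Yspace := (Yspace kappa gamma Theta theta).
Notation Pnorm := (Pnorm kappa gamma Theta theta).
Notation Ynorm := (Ynorm kappa gamma Theta theta).
Implicit Types (A B : W) (u v w : R * R -> R[i]) (U : R[i] * R -> R[i]) (x y r t s : R) (j : nat) (z : R[i]).

#[local] Instance ae_mu_inv : Filter (almost_everywhere mu) :=
  ae_filter_ringOfSetsType mu.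
#[local] Instance ae_muq_inv : Filter (almost_everywhere (muq : set T2 -> \bar R)) :=
  ae_filter_ringOfSetsType muq.

Let mA : measurable An := measurable_angles kappa.
Let mW : measurable Wd := measurable_strip kappa (@measurable_Rp R).
Let HQ := L2_hilbert muq.

(** The inverse transforms [w j] of [lambda ^ j * U] are constructed independently
    of each other; the weak Euler relation shows that they are the Euler
    derivatives of [w 0]. *)
Lemma Y_to_P U : Ygood U -> exists u, [/\ Pspace u, Pnorm u = Ynorm U & Rel u U].
Proof.
move=> [mU hU].
have exA j : exists A, (j <= gamma)%N -> REL A (tlY j U).
  have [hj|n] := boolP (j <= gamma)%N; last by exists 0 => h; case/negP: n.
  have [A hA] := REL_left beta mA (hU j hj).1 (fun x y => @tlY_out R kappa Theta theta j U x y).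
  by exists A.
have [A hA] := choice exA.
pose w j := untld (pw kappa (Wr beta) (sj j)) (A j).
have mw j : (j <= gamma)%N -> cmeasurable Wd (w j).
  move=> hj; have [[[m1 _] [m2 _]] _ _ _ _] := hA j hj.
  exact: (untld_measurable (c := A j) (@measurable_pwV R kappa beta (sj j)) m1 m2).
have Aw j : (j <= gamma)%N -> tlP (sj j) (w j) = A j.
  move=> hj; have [_ _ A0 _ _] := hA j hj; apply: untldK => /=.
  - by move=> p; exact: pw_gt0.
  - by move=> [x y] n; have [] := A0 x y n.
  - by move=> [x y] n; have [] := A0 x y n.
have hw j : (j <= gamma)%N -> REL (tlP (sj j) (w j)) (tlY j U) by move=> hj; rewrite Aw //; exact: hA.
have lw j : (j <= gamma)%N -> L1loc2 (wedge kappa) (w j).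
  by move=> hj; have [L _ _ _ _] := hw j hj; exact: (L1loc2_of_L2 (mw j hj) L).
have hD j : (j <= gamma)%N -> is_rDr kappa j (w 0%N) (w j).
  elim: j => [_|j IH hj]; first by apply: rDr0; exact: lw.
  have hj' := ltnW hj; have hDj := IH hj'.
  have hs : REL (tld Wd (pw kappa (Wr beta) (sj j + 2)) (w j.+1)) (tlY j.+1 U).
    by rewrite -sjS; exact: (hw j.+1 hj).
  have ec := euler_cols (mw j hj') (mw j.+1 hj) (hw j hj') hs (fun t y => tlYS kappa Theta theta j U t y).
  apply: rDr_of_int => [||eta te]; [exact: lw|exact: lw|].
  have [e1 e2] := ec eta te; have [d1 d2] := rDr_coef hDj (Dr_r_test te).
  by rewrite e1 e2 d1 d2 -!iterSr !exprS !mulN1r !mulNr.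
pose u := w 0%N; have lu : L1loc2 (wedge kappa) u := lw 0%N (leq0n _).
have hu : has_rDr kappa gamma u by apply: has_rDrP => j hj; exists (w j); exact: hD.
have RY j : (j <= gamma)%N -> REL (tlP (sj j) (rDr kappa j u)) (tlY j U).
  move=> hj; apply: (REL_ae_left (hw j hj) (tlP_meas theta (sj j) (is_rDr_meas (hu j hj)))).
    by apply: tlP_eq; exact: (rDr_unique kappa_gt0 (hu j hj) (hD j hj)).
  by move=> x y; exact: tlP_out.
have NE := norms_eq kappa_gt0 hu mU RY.
exists u; split => //; last exact: (hw 0%N (leq0n _)).
split => //; rewrite NE (Ynorm_energy kappa_gt0 mU (fun j hj => (hU j hj).1)).
apply: poweR_lty; apply: lte_sum_pinfty => j _; apply: lte_sum_pinfty => a _.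
by apply: (hU j (ltn_ord j)).2; rewrite -ltnS.
Qed.

Lemma L2_ip0 d (T : measurableType d) (m : {measure set T -> \bar R}) (f : T -> R) : L2 m f ->
  {ae m, forall p, f p = 0} -> ip m f f = 0.
Proof.
move=> Lf f0; apply: EFin_inj; rewrite -(L2_ipE Lf) (@ae_eq_ge0_integral _ _ _ m _ _ (cst 0%E)) //.
- by rewrite integral_cst // mul0e.
- by move=> p _; rewrite lee_fin sqr_ge0.
- have Fl := ae_filter_ringOfSetsType m.
  by apply: filterS f0 => p -> _; rewrite expr0n.
Qed.

Lemma tld_null d (T : measurableType d) (m : {measure set T -> \bar R}) (D : set T) (w : T -> R)
  (u v : T -> R[i]) : measurable D -> (forall p, D p -> 0 < w p) ->
  L2c m (tld D w u) -> L2c m (tld D w v) ->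
  ipc m (tld D w u - tld D w v) (tld D w u - tld D w v) = 0 <-> {ae m, forall p, D p -> u p = v p}.
Proof.
move=> mD w0 [u1 u2] [v1 v2]; have Hm := L2_hilbert m; have Fl := ae_filter_ringOfSetsType m.
have d1 := hSB Hm u1 v1; have d2 := hSB Hm u2 v2; split=> [e|e].
- have g1 := hge0 Hm ((tld D w u).1 - (tld D w v).1); have g2 := hge0 Hm ((tld D w u).2 - (tld D w v).2).
  have e' : ip m ((tld D w u).1 - (tld D w v).1) ((tld D w u).1 - (tld D w v).1) +
    ip m ((tld D w u).2 - (tld D w v).2) ((tld D w u).2 - (tld D w v).2) = 0 by exact: e.
  have z1 : ip m ((tld D w u).1 - (tld D w v).1) ((tld D w u).1 - (tld D w v).1) = 0 by lra.
  have z2 : ip m ((tld D w u).2 - (tld D w v).2) ((tld D w u).2 - (tld D w v).2) = 0 by lra.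
  apply: filterS2 (L2_norm0_ae d1 z1) (L2_norm0_ae d2 z2) => p.
  have -> : ((tld D w u).1 - (tld D w v).1) p = (tld D w u).1 p - (tld D w v).1 p by [].
  have -> : ((tld D w u).2 - (tld D w v).2) p = (tld D w u).2 p - (tld D w v).2 p by [].
  move=> h1 h2 Dp; move: h1 h2; rewrite /tld /cut /= mem_set // => /subr0_eq h1 /subr0_eq h2.
  have nz := lt0r_neq0 (w0 p Dp).
  by apply/eqP; rewrite eq_complex (mulfI nz h1) (mulfI nz h2) !eqxx.
have z1 : {ae m, forall p, ((tld D w u).1 - (tld D w v).1) p = 0}.
  apply: filterS e => p h; rewrite (_ : _ p = (tld D w u).1 p - (tld D w v).1 p) //.
  by rewrite /tld /cut /=; case: ifP => [/set_mem/h ->|_]; rewrite subrr.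
have z2 : {ae m, forall p, ((tld D w u).2 - (tld D w v).2) p = 0}.
  apply: filterS e => p h; rewrite (_ : _ p = (tld D w u).2 p - (tld D w v).2 p) //.
  by rewrite /tld /cut /=; case: ifP => [/set_mem/h ->|_]; rewrite subrr.
have i1 := L2_ip0 d1 z1; have i2 := L2_ip0 d2 z2.
exact: (etrans (f_equal2 +%R i1 i2) (addr0 0)).
Qed.

Lemma Rel_diff u v U U' : Rel u U -> Rel v U' ->
  ipc muq (tlP (sj 0) u - tlP (sj 0) v) (tlP (sj 0) u - tlP (sj 0) v) =
  ipc muq (tlY 0 U - tlY 0 U') (tlY 0 U - tlY 0 U').
Proof. by move=> h h'; have := REL_norm (RELD h (RELZ (-1) h')); rewrite !scaleN1r. Qed.

Lemma Peq_null u v U U' : Rel u U -> Rel v U' ->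
  ipc muq (tlP (sj 0) u - tlP (sj 0) v) (tlP (sj 0) u - tlP (sj 0) v) = 0 <-> Peq kappa u v.
Proof.
by move=> [Lu _ _ _ _] [Lv _ _ _ _]; apply: (tld_null mW _ Lu Lv) => p; exact: pw_gt0.
Qed.

Lemma Yeq_null u v U U' : Rel u U -> Rel v U' ->
  ipc muq (tlY 0 U - tlY 0 U') (tlY 0 U - tlY 0 U') = 0 <-> Yeq kappa theta U U'.
Proof.
move=> [_ LU _ _ _] [_ LU' _ _ _].
have w0 p : ST p -> 0 < pw kappa (fun=> kk) (sj 0) p by move=> [_ pA]; rewrite mulr_gt0 ?kk_gt0 ?Wa_gt0.
apply: (iff_trans (tld_null (mST kappa) w0 LU LU')).
split; apply: filterS => p h pA.
- by have := h (conj I pA); rewrite /Uj !expr0 !mul1r.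
- by case: pA => _ pA; rewrite /Uj !expr0 !mul1r; exact: h.
Qed.

Lemma Rel_Y_unique u v U U' : Rel u U -> Rel v U' -> Peq kappa u v -> Yeq kappa theta U U'.
Proof.
by move=> h h' e; apply/(Yeq_null h h'); rewrite -(Rel_diff h h'); apply/(Peq_null h h').
Qed.

Lemma Rel_P_unique u v U U' : Rel u U -> Rel v U' -> Yeq kappa theta U U' -> Peq kappa u v.
Proof.
by move=> h h' e; apply/(Peq_null h h'); rewrite (Rel_diff h h'); apply/(Yeq_null h h').
Qed.

Lemma cmulpE z A : cmulp z A = complex.Re z *: A + complex.Im z *: Jq A.
Proof.
rewrite /cmulp /Jq; congr (_, _); first by rewrite /= scalerN.
by rewrite addrC.
Qed.

Lemma Rel_lin z u v U U' : Rel u U -> Rel v U' ->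
  Rel (fun p => z * u p + v p) (fun p => z * U p + U' p).
Proof.
move=> h h'; rewrite /Rel.
have -> : tlP (sj 0) (fun p => z * u p + v p) = cmulp z (tlP (sj 0) u) + tlP (sj 0) v.
  by rewrite -[cmulp z _]tldZ -tldD.
have -> : tlY 0 (fun p => z * U p + U' p) = cmulp z (tlY 0 U) + tlY 0 U'.
  rewrite /tlY -[cmulp z _]tldZ -tldD; congr (tld _ _ _); apply/funext => p.
  by rewrite /Uj /onl !expr0 !mul1r.
rewrite !cmulpE; apply: RELD => //; apply: RELD; first exact: RELZ.
by apply: RELZ; exact: REL_Jq.
Qed.

Lemma is_rDr_eq j u v w : Peq kappa u v -> L1loc2 (wedge kappa) v ->
  is_rDr kappa j u w -> is_rDr kappa j v w.
Proof.
move=> e lv h; have [lu lw _] := h; apply: rDr_of_int => // eta te.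
have [-> ->] := rDr_coef h te; have tj := iter_Dr_r_test j te.
have mt : measurable_fun Wd (iter j Dr_r eta) by apply: measurable_funTS; exact: measurable_test tj.
have [[u1 u2] _] := lu; have [[v1 v2] _] := lv.
split; congr (_ * fine _); apply: ae_eq_integral => //.
- by apply/measurable_EFinP; exact: (measurable_funM u1 mt).
- by apply/measurable_EFinP; exact: (measurable_funM v1 mt).
- by apply: filterS e => p hp pW; rewrite /= hp.
- by apply/measurable_EFinP; exact: (measurable_funM u2 mt).
- by apply/measurable_EFinP; exact: (measurable_funM v2 mt).
- by apply: filterS e => p hp pW; rewrite /= hp.
Qed.

Lemma Pspace_eq u v : Peq kappa u v -> L1loc2 (wedge kappa) v -> Pspace u -> Pspace v.
Proof.
move=> e lv [lu fin]; split; first exact: lv.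
have e' : Peq kappa v u by apply: filterS e => p h /h.
have E : (fun j => is_rDr kappa j u) = (fun j => is_rDr kappa j v).
  apply/funext => j; apply/funext => w; apply/propext.
  by split; [exact: (is_rDr_eq e lv)|exact: (is_rDr_eq e' lu)].
pose X (P : nat -> (R * R -> R[i]) -> Prop) j : R * R -> R[i] := xget (fun=> 0) [set w | P j w].
pose G (P : nat -> (R * R -> R[i]) -> Prop) : \bar R :=
  if `[< forall j, (j <= gamma)%N -> exists w, P j w >] then
    ((\int[mu1]_(r in Rpos)
       ((r `^ (theta - 1))%:E *
        \sum_(j < gamma.+1)
          Hnorm kappa (gamma - j) (Theta - 1 + j.*2%:R)
            (fun phi => X P j (r, phi)) ^+ 2)) `^ 2^-1)%E
  else +oo%E.
change (G (fun j => is_rDr kappa j v) < +oo)%E.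
by apply: (eq_ind _ (fun P => (G P < +oo)%E) fin _ E).
Qed.

(** The norm of a sum is not estimated directly: the sum coincides almost
    everywhere with the preimage of the sum of the transforms. *)
Lemma Pspace_lin z u v U U' : Pspace u -> Pspace v -> Ygood U -> Ygood U' -> Rel u U -> Rel v U' ->
  Pspace (fun p => z * u p + v p).
Proof.
move=> [[mu_ _] _] [[mv _] _] gU gU' h h'.
have [u' [Pu' _ hu']] := Y_to_P (Ygood_lin z gU gU').
have hl := Rel_lin z h h'; have [Ll _ _ _ _] := hl.
apply: Pspace_eq Pu'; first by apply: (Rel_P_unique hu' hl); exact: aeW.
by apply: (L1loc2_of_L2 _ Ll); apply: cmeasurableD => //; exact: cmeasurableZ.
Qed.

Lemma cmeasurable_col u y : cmeasurable Wd u -> angles kappa y ->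
  cmeasurable (Rpos : set (measurableTypeR R)) (fun r => u (r, y)).
Proof.
move=> [m1 m2] yA.
have mp : measurable_fun (Rpos : set (measurableTypeR R)) (fun r : measurableTypeR R => (r, y : measurableTypeR R)).
  by apply: measurable_funTS; exact: pair2_measurable.
by split; [apply: (measurable_comp mW _ m1 mp)|apply: (measurable_comp mW _ m2 mp)];
  move=> p [r rR <-].
Qed.

Lemma Rel_fiberwise u U : cmeasurable Wd u -> Rel u U -> is_fiberwise_mellin kappa theta u U.
Proof.
move=> mu_ [_ _ _ _ h]; apply: filterS h => y hy yA.
apply: (mellin_extension (cmeasurable_col mu_ yA)).
have w0 := lt0r_neq0 (Wa_gt0 (sj 0) yA).
have e1 : col (tlP (sj 0) u) y = Wa (sj 0) y *: tr beta (fun r => u (r, y)).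
  have e x : ((x, y) \in Wd) = (x \in (Rpos : set R)).
    by apply/idP/idP => /set_mem k; apply/mem_set; [case: k|split].
  rewrite /col /tlP /tr /tld /cut; congr (_, _); apply/funext => x; rewrite /GRing.scale /= e /pw /=.
  - by case: ifP => _; [rewrite mulrAC mulrC|rewrite [RHS]mulr0].
  - by case: ifP => _; [rewrite mulrAC mulrC|rewrite [RHS]mulr0].
have e2 : col (tlY 0 U) y = Wa (sj 0) y *: tw beta (fun l => U (l, y)).
  have e x : ((x, y) \in ST) by apply/mem_set.
  rewrite /col /tlY /tw /tld /cut; congr (_, _); apply/funext => x; rewrite /GRing.scale /= e /pw /Uj /onl /= expr0 mul1r.
  - by rewrite mulrAC mulrC.
  - by rewrite mulrAC mulrC.
move: hy; rewrite e1 e2 => hy; have := MPZ (Wa (sj 0) y)^-1 hy.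
by rewrite !scalerA mulVf // !scale1r.
Qed.

End inverse_direction.

Theorem theorem3p31 (R : realType) (kappa : R) (gamma : nat) (Theta theta : R)
    (kappa_gt0 : 0 < kappa) (kappa_lt2pi : kappa < 2 * pi) :
  exists M : (R * R -> R[i]) -> (R[i] * R -> R[i]),
    [/\ forall u, Pspace kappa gamma Theta theta u ->
          is_fiberwise_mellin kappa theta u (M u),
        bounded_linear_operator (Pgamma kappa gamma Theta theta)
          (Ygamma kappa gamma Theta theta) M,
        exists Minv : (R[i] * R -> R[i]) -> (R * R -> R[i]),
          [/\ bounded_linear_operator (Ygamma kappa gamma Theta theta)
                (Pgamma kappa gamma Theta theta) Minv,
              is_left_inverse (Pgamma kappa gamma Theta theta) M Minv &
              is_left_inverse (Ygamma kappa gamma Theta theta) Minv M] &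
        exists c1 c2 : R, [/\ 0 < c1, 0 < c2 &
          forall u, Pspace kappa gamma Theta theta u ->
            (c1%:E * Pnorm kappa gamma Theta theta u <=
               Ynorm kappa gamma Theta theta (M u))%E /\
            (Ynorm kappa gamma Theta theta (M u) <=
               c2%:E * Pnorm kappa gamma Theta theta u)%E]].
Proof.
pose Ps := Pspace kappa gamma Theta theta; pose Ys := Yspace kappa gamma Theta theta.
pose PY (u : R * R -> R[i]) (U : R[i] * R -> R[i]) :=
  [/\ Ygood kappa_gt0 Theta theta gamma U,
    Ynorm kappa gamma Theta theta U = Pnorm kappa gamma Theta theta u & Rel kappa Theta theta u U].
pose M (u : R * R -> R[i]) : R[i] * R -> R[i] := xget (fun=> 0) [set U | PY u U].
pose N (U : R[i] * R -> R[i]) : R * R -> R[i] := xget (fun=> 0) [set u | Ps u /\ PY u U].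
have hM u : Ps u -> PY u (M u).
  move=> /(P_to_Y kappa_gt0)[U hU].
  by apply: (xgetPex (P := [set U | PY u U]) (fun=> 0)); exists U.
have hN U : Ys U -> Ps (N U) /\ PY (N U) U.
  move=> /(Yspace_good kappa_gt0) gU; have [u [Pu nu hu]] := Y_to_P gU.
  apply: (xgetPex (P := [set u | Ps u /\ PY u U]) (fun=> 0)); exists u.
  exact: (conj Pu (And3 gU (esym nu) hu)).
have goodY U : Ygood kappa_gt0 Theta theta gamma U -> Ys U := @good_Yspace _ _ _ _ _ _ _.
have Prefl (u : R * R -> R[i]) : Peq kappa u u by apply: aeW.
have Yrefl (U : R[i] * R -> R[i]) : Yeq kappa theta U U by apply: aeW.
have linP z u v : Ps u -> Ps v -> Ps (fun p => z * u p + v p).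
  move=> Pu Pv; have [gu _ ru] := hM u Pu; have [gv _ rv] := hM v Pv.
  exact: (Pspace_lin z Pu Pv gu gv ru rv).
have linY z U V : Ys U -> Ys V -> Ys (fun p => z * U p + V p).
  move=> /hN[_ [gU _ _]] /hN[_ [gV _ _]]; apply: goodY; exact: Ygood_lin.
exists M; split.
- move=> u Pu; have [_ _ ru] := hM u Pu; have [[mu_ _] _] := Pu.
  exact: Rel_fiberwise mu_ ru.
- split=> /=.
  + by move=> u Pu; have [gu _ _] := hM u Pu; exact: goodY.
  + move=> u v Pu Pv e; have [_ _ ru] := hM u Pu; have [_ _ rv] := hM v Pv.
    exact: (Rel_Y_unique ru rv e).
  + move=> z u v Pu Pv; split; first exact: (linP z u v Pu Pv).
    have [_ _ ru] := hM u Pu; have [_ _ rv] := hM v Pv; have [_ _ rl] := hM _ (linP z u v Pu Pv).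
    exact: (Rel_Y_unique rl (Rel_lin z ru rv) (Prefl _)).
  + exists 1 => // u Pu; have [_ -> _] := hM u Pu; by rewrite mul1e.
- exists N; split.
  + split=> /=.
    * by move=> U /hN[].
    * move=> U V YU YV e; have [_ [_ _ rU]] := hN U YU; have [_ [_ _ rV]] := hN V YV.
      exact: (Rel_P_unique rU rV e).
    * move=> z U V YU YV; split; first exact: (linY z U V YU YV).
      have [_ [_ _ rU]] := hN U YU; have [_ [_ _ rV]] := hN V YV.
      have [_ [_ _ rl]] := hN _ (linY z U V YU YV).
      exact: (Rel_P_unique rl (Rel_lin z rU rV) (Yrefl _)).
    * exists 1 => // U YU; have [_ [_ -> _]] := hN U YU; by rewrite mul1e.
  + move=> u Pu; have [gu _ ru] := hM u Pu; have [_ [_ _ rn]] := hN (M u) (goodY _ gu).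
    exact: (Rel_P_unique rn ru (Yrefl _)).
  + move=> U YU; have [Pn [_ _ rn]] := hN U YU; have [_ _ rm] := hM (N U) Pn.
    exact: (Rel_Y_unique rm rn (Prefl _)).
- exists 1, 1; split => // u Pu; have [_ -> _] := hM u Pu; by rewrite mul1e.
Qed.
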